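(* Let $P,q\in\mathbb C(z)$ be rational functions with $P$ non-constant of degree $n$ and $q\not\equiv0$, and let $\gamma\subset\mathbb C$ be a curve containing no poles of $P$ or $q$. Let $f_{s,i}\in\mathbb Z$ ($1\le s\le k$, $1\le i\le n$) be the integers attached to $P$ and $\gamma$ as described in the context, and for $1\le s\le k$ put $$\phi_s(z)=\sum_{i=1}^n f_{s,i}\left(\frac{q}{P'}\right)\bigl(P_i^{-1}(z)\bigr),\qquad z\in U.$$ Then the function $I_\infty(t)$ is rational if and only if $\phi_s(z)\equiv0$ for all $s$, $1\le s\le k$.
   Context: A curve is an oriented piecewise-smooth curve in $\mathbb C$ (closed or not) having only transversal self-intersections. $U_\infty$ is the connected component of $\mathbb{CP}^1\setminus P(\gamma)$ containing $\infty$, and $I_\infty(t)=\frac{1}{2\pi\sqrt{-1}}\int_\gamma\frac{q(z)\,dz}{P(z)-t}$ for $t\in U_\infty$; it is called rational if it equals a rational function on $U_\infty$. Construction of $f_{s,i}$. Let $c_1,\dots,c_k$ be all finite branch points of $P^{-1}$; if $\gamma$ is non-closed with end points $a,b$, the points $P(a)$ and $P(b)$ are added to this list if they are not already in it. Let $c\in\mathbb C$ be a point different from $c_1,\dots,c_k$ (and not a branch point), and let $S$ be a ''star'': the union of oriented arcs $\gamma_1,\dots,\gamma_k$ in $\mathbb C$, $\gamma_s$ going from $c$ to $c_s$, which do not intersect each other except at $c$. Let $U\subset\mathbb C$ be a simply connected domain containing no branch points of $P^{-1}$, with $\infty\in\partial U$ and $S\setminus\{c_1,\dots,c_k\}\subset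 U$, and let $P_1^{-1},\dots,P_n^{-1}$ be the single-valued branches of $P^{-1}$ in $U$. Let $\lambda_P=P^{-1}(S)\subset\mathbb{CP}^1$, viewed as an embedded graph whose vertices are the preimages of $c,c_1,\dots,c_k$ and whose edges are the preimages of the arcs $\gamma_s$. The graph $\lambda_P$ is connected, and each connected component of $\mathbb{CP}^1\setminus\lambda_P$ is a disc containing exactly one pole of $P$. For $1\le i\le n$ let $S_i$ be the closure of $P_i^{-1}(S\setminus\{c_1,\dots,c_k\})$; its center is $P_i^{-1}(c)$, and it contains, for each $s$, exactly one edge (the lift of $\gamma_s$) joining its center to a preimage $c_{s,i}$ of $c_s$. Choose a path $\tilde\gamma$ contained in $\lambda_P$ and homologous to $\gamma$ in $\mathbb{CP}^1\setminus P^{-1}\{\infty\}$ (with the same end points $a,b$ if $\gamma$ is non-closed; i.e. $\gamma-\tilde\gamma$ is a cycle homologous to zero in $\mathbb{CP}^1\setminus P^{-1}\{\infty\}$). Then $f_{s,i}$ is the signed number of times $\tilde\gamma$ traverses the edge of $S_i$ joining its center to $c_{s,i}$: a passage from the center of $S_i$ to $c_{s,i}$ counts $+1$, and a passage from $c_{s,i}$ to the center of $S_i$ counts $-1$. *)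

(* Defs.v *)
From mathcomp Require Import all_boot all_order all_algebra.
From mathcomp Require Import complex.
From mathcomp Require Import all_classical all_reals all_analysis.
Import numFieldNormedType.Exports.

Set Implicit Arguments.
Unset Strict Implicit.
Unset Printing Implicit Defensive.

Import Order.TTheory GRing.Theory Num.Theory.
Local Open Scope classical_set_scope.
Local Open Scope ring_scope.
Local Open Scope complex_scope.

(* The alias [^o] is what carries the topology of the modulus on R[i]. *)
Notation Cplx R := (R[i]^o).
Notation CP1 R := (one_point_compactification (Cplx R)).
Notation ratfun R := {fraction {poly R[i]}}.

(** * Rational functions on the Riemann sphere *)

Section RationalFunctions.
Variable R : realType.
Implicit Types (r P q : ratfun R).
Local Notation "p %:F" := (@FracField.tofrac _ p).

(* Lowest terms; the pair is determined by r up to a common nonzero constant,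
   and nothing below depends on that constant. *)
Definition rnum r : {poly R[i]} :=
  let x := frac (repr r) in x.1 %/ gcdp x.1 x.2.
Definition rden r : {poly R[i]} :=
  let x := frac (repr r) in x.2 %/ gcdp x.1 x.2.

Definition rdeg r : nat := maxn (size (rnum r)).-1 (size (rden r)).-1.

(* The value at a point that is not a pole. *)
Definition rval r (w : Cplx R) : Cplx R := (rnum r).[w] / (rden r).[w].

Definition reval r (w : CP1 R) : CP1 R :=
  match w with
  | Some z => if (rden r).[z] == 0 then None else Some (rval r z)
  | None => if (size (rden r) < size (rnum r))%N then None
            else Some ((rnum r)`_(size (rden r)).-1 / lead_coef (rden r))
  end.

Definition rderiv r : ratfun R :=
  ((rnum r)^`() * rden r - rnum r * (rden r)^`())%:F / (rden r ^+ 2)%:F.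

(* The multiplicity of w as a solution of r(w) = t, for r nonconstant of degree
   n: the finite solutions are the roots of num - t den, and infinity accounts
   for the n - deg (num - t den) missing ones. *)
Definition rmult r (t : Cplx R) (w : CP1 R) : nat :=
  let p := rnum r - t *: rden r in
  match w with
  | Some z => mup z p
  | None => rdeg r - (size p).-1
  end.

(* The finite branch points of the algebraic function P^-1. *)
Definition branch_point P (t : Cplx R) : Prop :=
  exists w : CP1 R, (1 < rmult P t w)%N.

Definition poles P : set (CP1 R) := [set w | reval P w = None].

End RationalFunctions.

(** * Curves and contour integrals *)

Section Curves.
Variable R : realType.
Implicit Types (g : R -> Cplx R).

Definition cderive g (u : R) : Cplx R :=
  derive1 (fun v => complex.Re (g v)) u +i* derive1 (fun v => complex.Im (g v)) u.

Definition continuously_differentiable (f : R -> R) : Prop :=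
  (forall u, derivable f u 1) /\ continuous (derive1 f : R -> R).

(* Being C^1 up to the end points of [a, b] is expressed by the existence of a
   C^1 extension to the line. *)
Definition smooth_on g (a b : R) : Prop :=
  exists h : R -> Cplx R,
    [/\ continuously_differentiable (fun u => complex.Re (h u)),
        continuously_differentiable (fun u => complex.Im (h u)),
        {in `[a, b], g =1 h} &
        {in `[a, b], forall u, cderive h u != 0}].

Definition piecewise_smooth g : Prop :=
  exists s : seq R,
    [/\ path <%R 0 s, last 0 s = 1 &
        forall j, (j < size s)%N -> smooth_on g (nth 0 (0 :: s) j) (nth 0 s j)].

(* v is one of the (one or two) one-sided tangent vectors at the parameter u. *)
Definition tangent g (u : R) (v : Cplx R) : Prop :=
  (0 <= u < 1 /\ (h^-1)%:C * (g (u + h) - g u) @[h --> 0^'+] --> v) \/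
  (0 < u <= 1 /\ (h^-1)%:C * (g (u + h) - g u) @[h --> 0^'-] --> v).

(* Two complex numbers are R-linearly independent iff Im (conj v1 * v2) <> 0.
   The parameters 0 and 1 of a closed curve are one and the same point of it. *)
Definition transversal_self_intersections g : Prop :=
  forall u1 u2 : R, 0 <= u1 -> u1 < u2 -> u2 <= 1 -> ~ (u1 = 0 /\ u2 = 1) ->
    g u1 = g u2 ->
    forall v1 v2, tangent g u1 v1 -> tangent g u2 v2 ->
      complex.Im (conjc v1 * v2) != 0.

(* Curves are parametrized by [0, 1]; such a curve is closed iff g 0 = g 1. *)
Definition is_curve g : Prop :=
  piecewise_smooth g /\ transversal_self_intersections g.

Definition contour_integral g (f : Cplx R -> Cplx R) : Cplx R :=
  (\int[lebesgue_measure]_(u in `[0, 1]) complex.Re (f (g u) * cderive g u)) +i*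
  (\int[lebesgue_measure]_(u in `[0, 1]) complex.Im (f (g u) * cderive g u)).

End Curves.

(** * The function I_infty *)

Section IInfty.
Variables (R : realType) (P q : ratfun R) (g : R -> Cplx R).

Definition U_infty : set (CP1 R) :=
  connected_component
    (~` [set reval P (Some (g u)) | u in `[0, 1]]) None.

Definition I_infty (t : Cplx R) : Cplx R :=
  (0 +i* (2 * pi))^-1 *
  contour_integral g (fun z => rval q z / (rval P z - t)).

(* In particular r has no pole in U_infty; the value at infinity need not be
   mentioned, both sides being continuous there. *)
Definition I_infty_rational : Prop :=
  exists r : ratfun R,
    forall t : Cplx R, U_infty (Some t) -> reval r (Some t) = Some (I_infty t).

End IInfty.

(** * Singular 1-chains with integer coefficients *)

Section Homology.
Variables (R : realType) (T : topologicalType).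

(* A formal sum of paths is represented by its coefficient function. A singular
   1-simplex is a function on R of which only the restriction to [0, 1] matters,
   so coefficients are constant on classes of functions agreeing on [0, 1]. *)
Definition chain := (R -> T) -> int.

Definition simplex_chain (f : R -> T) : chain :=
  fun h => `[< {in `[0, 1], f =1 h} >]%:Z.

Definition std_triangle : set (R * R) :=
  [set p | [/\ 0 <= p.1, 0 <= p.2 & p.1 + p.2 <= 1]].

(* The 2-simplex has vertices (0,0), (1,0), (0,1), in this order. *)
Definition simplex_boundary (sigma : R * R -> T) : chain :=
  simplex_chain (fun u => sigma (1 - u, u))
  - simplex_chain (fun u => sigma (0, u))
  + simplex_chain (fun u => sigma (u, 0)).

Definition homologous_to_zero (X : set T) (z : chain) : Prop :=
  exists (m : nat) (a : 'I_m -> int) (sigma : 'I_m -> R * R -> T),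
    (forall j, {within std_triangle, continuous (sigma j)} /\
               sigma j @` std_triangle `<=` X) /\
    z = \sum_(j < m) simplex_boundary (sigma j) *~ a j.

End Homology.

(** * Domains *)

Section Domains.
Variable R : realType.

Definition boundary (T : topologicalType) (A : set T) : set T :=
  closure A `\` interior A.

Definition loops_contractible (U : set (Cplx R)) : Prop :=
  forall h : R -> Cplx R,
    {within `[0, 1], continuous h} -> h @` `[0, 1] `<=` U -> h 0 = h 1 ->
    exists H : R * R -> Cplx R,
      [/\ {within `[0, 1] `*` `[0, 1], continuous H},
          H @` (`[0, 1] `*` `[0, 1]) `<=` U &
          forall u, u \in `[0, 1] ->
            [/\ H (0, u) = h u, H (1, u) = h 0, H (u, 0) = h 0
              & H (u, 1) = h 0]].

Definition simply_connected_domain (U : set (Cplx R)) : Prop :=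
  [/\ open U, U !=set0, connected U & loops_contractible U].

End Domains.

(** * The star, the graph over it, and the numbers f_(s,i) *)

Section Graph.
Variables (R : realType) (P q : ratfun R) (n k : nat).

(* cs lists, without repetition, the finite branch points of P^-1, together with
   the images of the end points of g when g is not closed. *)
Definition marked_points (g : R -> Cplx R) (cs : 'I_k -> Cplx R) : Prop :=
  injective cs /\
  range cs = [set t | branch_point P t] `|`
             [set t | g 0 <> g 1 /\ (t = rval P (g 0) \/ t = rval P (g 1))].

Definition is_star (cs : 'I_k -> Cplx R) (c : Cplx R)
    (arc : 'I_k -> R -> Cplx R) : Prop :=
  [/\ ~ range cs c,
      forall s, {within `[0, 1], continuous (arc s)} /\
                {in `[0, 1] &, injective (arc s)},
      forall s, arc s 0 = c /\ arc s 1 = cs s &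
      forall s s', s != s' ->
        arc s @` `[0, 1] `&` arc s' @` `[0, 1] = [set c]].

Definition star (c : Cplx R) (arc : 'I_k -> R -> Cplx R) : set (Cplx R) :=
  [set c] `|` \bigcup_s (arc s @` `[0, 1]).

Definition is_branch (U : set (Cplx R)) (f : Cplx R -> CP1 R) : Prop :=
  {within U, continuous f} /\ forall z, U z -> reval P (f z) = Some z.

(* For n the degree of P, n pairwise distinct branches are all of them. *)
Definition branches (U : set (Cplx R)) (br : 'I_n -> Cplx R -> CP1 R) : Prop :=
  (forall i, is_branch U (br i)) /\
  (forall i j, {in U, br i =1 br j} -> i = j).

Variables (c : Cplx R) (arc : 'I_k -> R -> Cplx R) (br : 'I_n -> Cplx R -> CP1 R).

(* The edge of S_i over the arc of index s: the lift of the arc by the branch of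
   index i, completed by its limit c_(s,i). It runs from the center of S_i. *)
Definition edge (s : 'I_k) (i : 'I_n) (u : R) : CP1 R :=
  if u < 1 then br i (arc s u) else lim (br i (arc s v) @[v --> 1^'-]).

(* An oriented edge; the boolean is true for the orientation from the center. *)
Definition oedge : Type := 'I_k * 'I_n * bool.

Definition oedge_source (e : oedge) : CP1 R :=
  if e.2 then br e.1.2 c else edge e.1.1 e.1.2 1.
Definition oedge_target (e : oedge) : CP1 R :=
  if e.2 then edge e.1.1 e.1.2 1 else br e.1.2 c.
Definition oedge_sign (e : oedge) : int := if e.2 then 1 else -1.

(* w is an edge path in the graph lambda_P = P^-1(S) from x to y. *)
Fixpoint graph_path (x : CP1 R) (w : seq oedge) (y : CP1 R) : Prop :=
  match w with
  | [::] => x = y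
  | e :: w' => x = oedge_source e /\ graph_path (oedge_target e) w' y
  end.

(* A concatenation of paths is homologous to the sum of its pieces, and a
   reversed path to the opposite of the path. *)
Definition graph_path_chain (w : seq oedge) : chain R (CP1 R) :=
  \sum_(e <- w) simplex_chain (edge e.1.1 e.1.2) *~ oedge_sign e.

Definition represents (g : R -> Cplx R) (w : seq oedge) : Prop :=
  [/\ g 0 <> g 1 -> graph_path (Some (g 0)) w (Some (g 1)),
      g 0 = g 1 -> exists x, graph_path x w x &
      homologous_to_zero (~` poles P)
        (simplex_chain (fun u => Some (g u) : CP1 R) - graph_path_chain w)].

Definition edge_number (w : seq oedge) (s : 'I_k) (i : 'I_n) : int :=
  \sum_(e <- w | e.1 == (s, i)) oedge_sign e.

Definition finite_part (x : CP1 R) : Cplx R := if x is Some z then z else 0.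

Definition phi (f : 'I_k -> 'I_n -> int) (s : 'I_k) (z : Cplx R) : Cplx R :=
  \sum_(i < n) (f s i)%:~R * finite_part (reval (q / rderiv P) (br i z)).

(* phi is meromorphic in U: it vanishes identically iff it vanishes at the
   points where none of its terms has a pole. *)
Definition phi_identically_zero (U : set (Cplx R)) (f : 'I_k -> 'I_n -> int)
    (s : 'I_k) : Prop :=
  forall z, U z -> (forall i, reval (q / rderiv P) (br i z) <> None) ->
    phi f s z = 0.

End Graph.

(* Main.v *)
(** After a Moebius change of coordinate, P = N / D with deg D < deg N, and multiplying q dz by
    A(P) for a suitable polynomial A <> 0 turns it into a form K / D^a dx which is holomorphic
    away from the poles of P.

    (1) I_infty is rational iff, for some A <> 0, all the moments of A(P) P^m q along gamma
    vanish: A(t) I_infty(t) is then a polynomial, the Cauchy transform of a functional with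
    vanishing moments being zero near infinity, hence on U_infty by a clopen argument.

    (2) The form A(P) P^m q dz has a primitive S + sum_j rho_j log(x - e_j), whose increment along
    paths vanishes on boundaries in the complement of the poles. So the m-th moment equals
    sum_(s,i) f_(s,i) J_m(edge (s,i)), with J_m the increment along the edge.

    (3) These sums vanish for all m iff sum_i f_(s,i) g(branch_i) = 0 on U for all s, where g dz
    is the form expressed in the variable z = P. If the sums of branches vanish, the increments
    are constant along each arc. Conversely, replace a piece of the s-th arc by a chord lying in
    U: the moments of a functional supported on the modified star vanish; as the complement of a
    star is connected, its Cauchy transform vanishes on both sides of the chord; its jump across
    the chord is the sum of the branches, which thus vanishes on the chord and, by the
    identity theorem, on U. *)

(* The arcs of the star, hence the edges of the graph, are merely continuous, so nothing can be
   integrated over them. What survives is the increment of a primitive, and from it a linear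
   functional on continuous functions, bounded by a sup norm near the arc; this is enough to study
   Cauchy transforms. The jump formula, however, wants a density on a smooth piece, which is why a
   chord is put into the arc. An arbitrary chord could cross the star elsewhere, so its ends are the
   extreme parameters at which the arc meets a small disc.

   The change of coordinate moves a pole of P to infinity: the poles are then infinity and the roots
   of D, and the fibres of P over a bounded set are bounded, so the lifts of the arcs converge at
   their ends. The factor A(P) removes the poles of q dz over finite values of P, because a homology
   in the complement of the poles of P may sweep across them.

   Analyticity enters only through explicit bounds C B^j j! on iterated derivatives of the branches,
   and geometric series only through the identity 1 / (1 - u) = 1 + u / (1 - u). *)
Require Import Defs.
From mathcomp Require Import all_boot all_order all_algebra.
From mathcomp Require Import complex ring lra zify.
From mathcomp Require Import all_classical all_reals all_analysis.
From mathcomp Require Import measurable_realfun.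
Import numFieldNormedType.Exports.
Import Order.TTheory GRing.Theory Num.Theory.
Local Open Scope classical_set_scope.
Local Open Scope ring_scope.
Local Open Scope complex_scope.
Set Implicit Arguments.
Unset Strict Implicit.
Unset Printing Implicit Defensive.

(** * Continuity at a point and the modulus *)

(* A record, as opposed to a definition: [done] and [apply:] reduce the
   filter-theoretic statement at great cost. *)
Record cts_at (T V : topologicalType) (f : T -> V) (x : T) : Prop :=
  CtsAt { cts_atP : f @ x --> f x }.

Lemma cts_id (T : topologicalType) (x : T) : cts_at (fun y : T => y) x.
Proof. by split; exact: cvg_id. Qed.

Lemma cts_comp (T V W : topologicalType) (f : T -> V) (g : V -> W) x :
  cts_at f x -> cts_at g (f x) -> cts_at (fun y : T => g (f y)) x.
Proof. by move=> [cf] [cg]; split; exact: (@continuous_comp _ _ _ f g x). Qed.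

Lemma ctsT (T V : topologicalType) (f : T -> V) x : continuous f -> cts_at f x.
Proof. by move=> cf; split; exact: cf. Qed.

Lemma cts_continuous (T V : topologicalType) (f : T -> V) :
  (forall x, cts_at f x) -> continuous f.
Proof. by move=> cf x; case: (cf x). Qed.

Lemma near_all (T : topologicalType) (x : T) (P : T -> Prop) :
  (forall y, P y) -> \forall y \near x, P y.
Proof. by move=> h; apply: (@filterE _ (nbhs x) (nbhs_filter x)). Qed.

Lemma cts_near (T V : topologicalType) (f g : T -> V) x :
  (\forall y \near x, f y = g y) -> cts_at f x -> cts_at g x.
Proof.
move=> fg [cf]; split; rewrite -(nbhs_singleton fg).
by apply: cvg_trans cf; apply: near_eq_cvg; apply: filterS fg => y ->.
Qed.

Section Modulus.
Variable R : realType.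
Implicit Types (z w : Cplx R) (e : R).

(** The norm of [R[i]] takes its values in [R[i]]; its real part lives in the ordered field R, where
    real inequalities can be handled. *)
Definition cabs z : R := complex.Re (`|z| : R[i]).

Lemma cabsE z : `|z| = (cabs z)%:C :> R[i].
Proof. by rewrite /cabs normc_def. Qed.

Lemma cabs_sqrt z : cabs z = Num.sqrt (complex.Re z ^+ 2 + complex.Im z ^+ 2).
Proof. by rewrite /cabs normc_def. Qed.

Lemma cabs_ge0 z : 0 <= cabs z.
Proof. by rewrite cabs_sqrt sqrtr_ge0. Qed.

Lemma cabsM z w : cabs (z * w) = cabs z * cabs w.
Proof. by rewrite {1}/cabs normrM !cabsE -rmorphM. Qed.

Lemma cabs_eq0 z : (cabs z == 0) = (z == 0).
Proof.
have <- : (`|z : R[i]| == 0) = (z == 0) by rewrite normr_eq0.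
by rewrite cabsE -(inj_eq (@complexI R)).
Qed.

Lemma cabs0 : cabs 0 = 0.
Proof. by apply/eqP; rewrite cabs_eq0. Qed.

Lemma cabs1 : cabs 1 = 1.
Proof. by rewrite {1}/cabs normr1. Qed.

Lemma cabs_gt0 z : (0 < cabs z) = (z != 0).
Proof. by rewrite lt_def cabs_ge0 andbT cabs_eq0. Qed.

Lemma cabsN z : cabs (- z) = cabs z.
Proof. by rewrite {1}/cabs normrN. Qed.

Lemma cabsB z w : cabs (z - w) = cabs (w - z).
Proof. by rewrite -cabsN opprB. Qed.

Lemma cabsV z : cabs z^-1 = (cabs z)^-1.
Proof. by rewrite {1}/cabs normfV cabsE -fmorphV. Qed.

Lemma cabsX z n : cabs (z ^+ n) = cabs z ^+ n.
Proof. by elim: n => [|n IH]; rewrite ?expr0 ?cabs1// !exprS cabsM IH. Qed.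

Lemma cabsD z w : cabs (z + w) <= cabs z + cabs w.
Proof. by rewrite -lecR rmorphD /= -!cabsE ler_normD. Qed.

Lemma cabs_real x : cabs x%:C = `|x|.
Proof. by rewrite cabs_sqrt /= expr0n addr0 sqrtr_sqr. Qed.

Lemma cabs_Re z : `|complex.Re z| <= cabs z.
Proof.
by rewrite cabs_sqrt -sqrtr_sqr ler_wsqrtr// lerDl sqr_ge0.
Qed.

Lemma cabs_Im z : `|complex.Im z| <= cabs z.
Proof.
by rewrite cabs_sqrt -sqrtr_sqr ler_wsqrtr// lerDr sqr_ge0.
Qed.

Lemma cabs_le_ReIm z : cabs z <= `|complex.Re z| + `|complex.Im z|.
Proof.
case: z => a b /=; rewrite [_ +i* _](_ : _ = a%:C + 'i * b%:C); last first.
  by apply/eqP; rewrite eq_complex /= !(mul0r, mulr0, mul1r, subr0, addr0, add0r) !eqxx.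
apply: le_trans (cabsD _ _) _; rewrite cabsM !cabs_real [cabs 'i]cabs_sqrt /=.
by rewrite expr0n expr1n add0r sqrtr1 mul1r.
Qed.

Lemma cabs_sum (I : Type) (s : seq I) (F : I -> Cplx R) :
  cabs (\sum_(i <- s) F i) <= \sum_(i <- s) cabs (F i).
Proof.
elim: s => [|i s IH]; first by rewrite !big_nil cabs0.
by rewrite !big_cons; apply: le_trans (cabsD _ _) _; rewrite lerD2l.
Qed.

Lemma cabs_distC z w : cabs z - cabs w <= cabs (z - w).
Proof. by rewrite lerBlDr; have := cabsD (z - w) w; rewrite subrK. Qed.

Lemma nbhs_cabs z (A : set (Cplx R)) :
  nbhs z A <-> exists2 e : R, 0 < e & forall w, cabs (z - w) < e -> A w.
Proof.
split.
  move=> /nbhs_ballP[e /= e0 eA]; exists (complex.Re e).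
    by move: e0; rewrite ltcE => /andP[_].
  move=> w zw; apply: eA; rewrite -ball_normE /= cabsE; move: e0 zw.
  by case: e => a b; rewrite !ltcE /= => /andP[/eqP -> _]; rewrite eqxx.
move=> [e e0 eA]; apply/nbhs_ballP; exists e%:C; first by rewrite /= ltcR.
by move=> w; rewrite -ball_normE /= cabsE ltcR => /eA.
Qed.

Lemma cvg_cabs (T : Type) (F : set_system T) {FF : Filter F} (f : T -> Cplx R) l :
  f @ F --> l <-> forall e, 0 < e -> \forall x \near F, cabs (l - f x) < e.
Proof.
split=> [fl e e0|fl A].
  by apply: (fl [set w | cabs (l - w) < e]); apply/nbhs_cabs; exists e.
move=> /nbhs_cabs[e e0 eA]; rewrite /nbhs /=; have := fl _ e0.
by apply: filterS => x /eA.
Qed.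

Lemma cvg_Re (T : Type) (F : set_system T) {FF : Filter F} (f : T -> Cplx R) (l : Cplx R) :
  f @ F --> l -> complex.Re (f x) @[x --> F] --> complex.Re l.
Proof.
move=> /cvg_cabs fl; apply/cvgrPdist_lt => e e0; near=> x.
rewrite -raddfB; apply: le_lt_trans (cabs_Re _) _.
by near: x; exact: fl.
Unshelve. all: by end_near. Qed.

Lemma cvg_Im (T : Type) (F : set_system T) {FF : Filter F} (f : T -> Cplx R) (l : Cplx R) :
  f @ F --> l -> complex.Im (f x) @[x --> F] --> complex.Im l.
Proof.
move=> /cvg_cabs fl; apply/cvgrPdist_lt => e e0; near=> x.
rewrite -raddfB; apply: le_lt_trans (cabs_Im _) _.
by near: x; exact: fl.
Unshelve. all: by end_near. Qed.

Lemma cvg_ReIm (T : Type) (F : set_system T) {FF : Filter F} (f g : T -> R) a b :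
  f @ F --> a -> g @ F --> b -> (f x +i* g x : Cplx R) @[x --> F] --> (a +i* b : Cplx R).
Proof.
move=> /cvgrPdist_lt fa /cvgrPdist_lt gb; apply/cvg_cabs => e e0; near=> x.
apply: le_lt_trans (cabs_le_ReIm _) _ => /=; rewrite [e]splitr; apply: ltrD.
  by near: x; apply: fa; rewrite divr_gt0.
by near: x; apply: gb; rewrite divr_gt0.
Unshelve. all: by end_near. Qed.

Lemma cvg_real (T : Type) (F : set_system T) {FF : Filter F} (f : T -> R) (a : R) :
  f @ F --> a -> ((f x)%:C : Cplx R) @[x --> F] --> (a%:C : Cplx R).
Proof. by move=> fa; apply: cvg_ReIm => //; exact: cvg_cst. Qed.

Lemma cvg_cabs_comp (T : Type) (F : set_system T) {FF : Filter F} (f : T -> Cplx R) (l : Cplx R) :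
  f @ F --> l -> cabs (f x) @[x --> F] --> cabs l.
Proof.
move=> /cvg_cabs fl; apply/cvgrPdist_lt => e e0; near=> x.
apply: (@le_lt_trans _ _ (cabs (l - f x))).
  by rewrite ler_norml cabs_distC lerNl opprB cabsB cabs_distC.
by near: x; exact: fl.
Unshelve. all: by end_near. Qed.

Lemma continuous_ReIm (T : topologicalType) (f g : T -> R) :
  continuous f -> continuous g -> continuous (fun x : T => f x +i* g x : Cplx R).
Proof. by move=> cf cg x; apply: cvg_ReIm; [exact: cf|exact: cg]. Qed.

Section Limits.
Context {T : Type} {F : set_system T} {FF : Filter F}.
Implicit Types (f g : T -> Cplx R) (a b : Cplx R).

Lemma cvgC_D f g a b : f @ F --> a -> g @ F --> b -> f x + g x @[x --> F] --> a + b.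
Proof. exact: cvgD. Qed.

Lemma cvgC_N f a : f @ F --> a -> - f x @[x --> F] --> - a.
Proof. exact: cvgN. Qed.

Lemma cvgC_B f g a b : f @ F --> a -> g @ F --> b -> f x - g x @[x --> F] --> a - b.
Proof. exact: cvgB. Qed.

Lemma cvgC_M f g a b : f @ F --> a -> g @ F --> b -> f x * g x @[x --> F] --> a * b.
Proof. exact: cvgM. Qed.

Lemma cvgC_V f a : a != 0 -> f @ F --> a -> (f x)^-1 @[x --> F] --> a^-1.
Proof. exact: cvgV. Qed.

Lemma cvgC_X f a n : f @ F --> a -> f x ^+ n @[x --> F] --> a ^+ n.
Proof.
move=> fa; elim: n => [|n IH].
  by under eq_fun do rewrite expr0; rewrite expr0; exact: cvg_cst.
by under eq_fun do rewrite exprS; rewrite exprS; exact: cvgC_M.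
Qed.

Lemma cvgC_sum (I : Type) (s : seq I) (f : I -> T -> Cplx R) (a : I -> Cplx R) :
  (forall i, f i @ F --> a i) -> \sum_(i <- s) f i x @[x --> F] --> \sum_(i <- s) a i.
Proof.
move=> h; elim: s => [|i s IH].
  by under eq_fun do rewrite big_nil; rewrite big_nil; exact: cvg_cst.
rewrite big_cons (_ : (fun x : T => _) = fun x : T => f i x + \sum_(j <- s) f j x); last first.
  by apply/funext => x; rewrite big_cons.
exact: (cvgC_D (h i) IH).
Qed.

Lemma cvgC_horner (p : {poly R[i]}) f a : f @ F --> a -> (p.[f x] : Cplx R) @[x --> F] --> (p.[a] : Cplx R).
Proof.
move=> fa; under eq_fun do rewrite horner_coef; rewrite horner_coef.
apply: cvgC_sum => i; apply: cvgC_M; first exact: cvg_cst.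
exact: cvgC_X.
Qed.

End Limits.

Section ContinuityAt.
Variable T : topologicalType.
Implicit Types (f g : T -> Cplx R) (x : T).

Lemma cts_cst (a : Cplx R) x : cts_at (fun _ : T => a) x.
Proof. by split; exact: cvg_cst. Qed.

Lemma ctsD f g x : cts_at f x -> cts_at g x -> cts_at (fun y => f y + g y) x.
Proof. by move=> [cf] [cg]; split; exact: (cvgC_D cf cg). Qed.

Lemma ctsB f g x : cts_at f x -> cts_at g x -> cts_at (fun y => f y - g y) x.
Proof. by move=> [cf] [cg]; split; exact: (cvgC_B cf cg). Qed.

Lemma ctsN f x : cts_at f x -> cts_at (fun y => - f y) x.
Proof. by move=> [cf]; split; exact: (cvgC_N cf). Qed.

Lemma ctsM f g x : cts_at f x -> cts_at g x -> cts_at (fun y => f y * g y) x.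
Proof. by move=> [cf] [cg]; split; exact: (cvgC_M cf cg). Qed.

Lemma ctsV f x : f x != 0 -> cts_at f x -> cts_at (fun y => (f y)^-1) x.
Proof. by move=> f0 [cf]; split; exact: (cvgC_V f0 cf). Qed.

Lemma ctsX f x n : cts_at f x -> cts_at (fun y => f y ^+ n) x.
Proof. by move=> [cf]; split; exact: (cvgC_X (n := n) cf). Qed.

Lemma cts_horner (p : {poly R[i]}) f x : cts_at f x ->
  cts_at (fun y => p.[f y] : Cplx R) x.
Proof. by move=> [cf]; split; exact: (cvgC_horner (p := p) cf). Qed.

Lemma cts_sum (I : Type) (s : seq I) (f : I -> T -> Cplx R) x :
  (forall i, cts_at (f i) x) -> cts_at (fun y => \sum_(i <- s) f i y) x.
Proof. by move=> h; split; apply: cvgC_sum => i; case: (h i). Qed.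

Lemma cts_ReIm (f g : T -> R) x : cts_at f x -> cts_at g x ->
  cts_at (fun y => f y +i* g y : Cplx R) x.
Proof. by move=> [cf] [cg]; split; exact: (cvg_ReIm cf cg). Qed.

Lemma cts_Re f x : cts_at f x -> cts_at (fun y => complex.Re (f y)) x.
Proof. by move=> [cf]; split; exact: (cvg_Re cf). Qed.

Lemma cts_Im f x : cts_at f x -> cts_at (fun y => complex.Im (f y)) x.
Proof. by move=> [cf]; split; exact: (cvg_Im cf). Qed.

Lemma cts_realf (f : T -> R) x : cts_at f x -> cts_at (fun y => (f y)%:C : Cplx R) x.
Proof. by move=> [cf]; split; exact: (cvg_real cf). Qed.

Lemma cts_neq0 f x : cts_at f x -> f x != 0 -> \forall y \near x, f y != 0.
Proof.
move=> [cf]; rewrite -cabs_gt0 => f0; near=> y; rewrite -cabs_gt0; near: y.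
by apply: (cvgr_gt (cabs (f x))) => //; exact: (cvg_cabs_comp cf).
Unshelve. all: by end_near. Qed.

Lemma cts_cabs f x : cts_at f x ->
  forall e : R, 0 < e -> \forall y \near x, cabs (f x - f y) < e.
Proof. by move=> [/cvg_cabs]. Qed.

Lemma cts_atE f x : (forall e : R, 0 < e -> \forall y \near x, cabs (f x - f y) < e) -> cts_at f x.
Proof. by move=> h; split; apply/cvg_cabs. Qed.

End ContinuityAt.

Lemma Cplx_hausdorff : hausdorff_space (Cplx R).
Proof. exact: norm_hausdorff. Qed.

End Modulus.

(** * Exponential and continuous logarithms *)

Section ExpLog.
Variable R : realType.
Implicit Types (z : Cplx R).

(** Replaces the subdivision of [a, b] into small pieces: the supremum of the points reachable from
    a is itself reachable, and the local hypothesis there leads beyond it unless it is b. *)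
Lemma interval_ind (a b : R) (Rel : R -> R -> Prop) : a <= b ->
  (forall u v w, a <= u -> u <= v -> v <= w -> w <= b ->
     Rel u v -> Rel v w -> Rel u w) ->
  (forall u0, a <= u0 <= b -> exists2 e, 0 < e &
     forall u v, a <= u -> u <= v -> v <= b -> `|u - u0| < e -> `|v - u0| < e ->
       Rel u v) ->
  Rel a b.
Proof.
move=> ab tr loc; pose A := [set v | a <= v <= b /\ Rel a v].
have Aa : A a.
  have [|e e0 H] := loc a; first by rewrite lexx ab.
  by split; [rewrite lexx ab|apply: H; rewrite ?subrr ?normr0].
have Aub : ubound A b by move=> v [/andP[]].
have hA : has_sup A by split; [exists a|exists b].
have aS : a <= sup A by apply: ub_le_sup => //; exists b.
have Sb : sup A <= b by apply: ge_sup => //; exists a.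
have [|e e0 H] := loc (sup A); first by rewrite aS Sb.
have [v [/andP[av vb] Rv] vS] := sup_adherent e0 hA.
have vS' : v <= sup A by apply: ub_le_sup => //; [exists b|split => //; rewrite av vb].
have RS : Rel a (sup A).
  apply: (tr a v) => //; apply: H => //; last by rewrite subrr normr0.
  by rewrite ler0_norm ?subr_le0// opprB ltrBlDl -ltrBlDr.
have [Sb'|Sb'] := eqVneq (sup A) b; first by rewrite -Sb'.
pose w := Num.min b (sup A + e / 2).
have Sw : sup A < w by rewrite lt_min lt_neqAle Sb' Sb ltrDl divr_gt0.
have : A w.
  split; first by rewrite (le_trans aS (ltW Sw)) ge_min lexx.
  apply: (tr a (sup A)) => //; rewrite ?(ltW Sw) ?ge_min ?lexx//.
  apply: H; rewrite ?(ltW Sw) ?ge_min ?lexx ?subrr ?normr0//.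
  rewrite gtr0_norm ?subr_gt0// ltrBlDl gt_min; apply/orP; right.
  by rewrite ltrD2l ltr_pdivrMr// ltr_pMr// ltrDl ltr01.
by move=> /(ub_le_sup (ex_intro _ b Aub)); rewrite leNgt Sw.
Qed.

(** Tube lemma. *)
Lemma compact_forall_near (T I : topologicalType) (K : set T) (t0 : I) (P : I -> T -> Prop) :
  compact K -> (forall x, K x -> \forall p \near ((x, t0) : T * I), P p.2 p.1) ->
  \forall t \near t0, forall x, K x -> P t x.
Proof.
move=> /compact_near_coveringP cK H.
exact: (cK I (nbhs t0) P (nbhs_filter t0) H).
Qed.

Lemma cvg_map (T : Type) (V W : topologicalType) (F : set_system T) {FF : Filter F}
  (f : T -> V) (h : V -> W) (a : V) :
  {for a, continuous h} -> f @ F --> a -> h (f x) @[x --> F] --> h a.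
Proof. by move=> ch fa; exact: (continuous_cvg FF ch fa). Qed.

Lemma cvg_pt_pair (T : Type) (V W : topologicalType) (F : set_system T) {FF : Filter F}
  (f : T -> V) (g : T -> W) (a : V) (b : W) :
  f @ F --> a -> g @ F --> b -> (f x, g x) @[x --> F] --> ((a, b) : V * W).
Proof. by move=> fa gb; exact: (cvg_pair fa gb). Qed.

Definition cexp z : Cplx R :=
  (expR (complex.Re z))%:C * (cos (complex.Im z) +i* sin (complex.Im z)).

Lemma cexpD z (w : Cplx R) : cexp (z + w) = cexp z * cexp w.
Proof.
rewrite /cexp !raddfD /= expRD cosD sinD; apply/eqP.
by rewrite eq_complex /=; apply/andP; split; apply/eqP; ring.
Qed.

Lemma cexp0 : cexp 0 = 1.
Proof. by rewrite /cexp /= expR0 cos0 sin0 mul1r. Qed.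

Lemma cexpN_mul z : cexp (- z) * cexp z = 1.
Proof. by rewrite -cexpD addNr cexp0. Qed.

Lemma cexp_neq0 z : cexp z != 0.
Proof.
apply/eqP => z0; have /eqP := cexpN_mul z; rewrite z0 mulr0 eq_sym.
by rewrite oner_eq0.
Qed.

Lemma cexpN z : cexp (- z) = (cexp z)^-1.
Proof. by apply: (mulIf (cexp_neq0 z)); rewrite cexpN_mul mulVf// cexp_neq0. Qed.

Lemma cexpB z (w : Cplx R) : cexp (z - w) = cexp z / cexp w.
Proof. by rewrite cexpD cexpN. Qed.

Lemma cabs_cexp z : cabs (cexp z) = expR (complex.Re z).
Proof.
rewrite /cexp cabsM cabs_real ger0_norm ?expR_ge0// cabs_sqrt /=.
by rewrite cos2Dsin2 sqrtr1 mulr1.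
Qed.

Lemma cvg_cexp (T : Type) (F : set_system T) {FF : Filter F} (f : T -> Cplx R) (l : Cplx R) :
  f @ F --> l -> cexp (f x) @[x --> F] --> cexp l.
Proof.
move=> fl; apply: cvgM.
  apply: cvg_real; apply: (cvg_comp _ _ (cvg_Re fl)); exact: continuous_expR.
apply: cvg_ReIm; apply: (cvg_comp _ _ (cvg_Im fl)).
  exact: continuous_cos.
exact: continuous_sin.
Qed.

(** Correct on the half plane Re z > 0 only, where atan (y / x) is the argument of x + i y. *)
Definition Clog z : Cplx R := ln (cabs z) +i* atan (complex.Im z / complex.Re z).

Lemma cexp_Clog z : 0 < complex.Re z -> cexp (Clog z) = z.
Proof.
move=> z0; have cz : 0 < cabs z.
  by rewrite cabs_gt0; apply: contraTneq z0 => ->; rewrite ltxx.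
rewrite /cexp /Clog /= lnK ?posrE//.
set t := _ / _.
have ct : 0 < cos (atan t) by rewrite cos_gt0_pihalf// atan_gtNpi2 atan_ltpi2.
have E : cabs z * cos (atan t) = complex.Re z.
  rewrite cos_atan cabs_sqrt.
  have -> : complex.Re z ^+ 2 + complex.Im z ^+ 2 = complex.Re z ^+2 * (1 + t ^+ 2).
    by rewrite /t; field; rewrite gt_eqF.
  rewrite sqrtrM ?sqr_ge0// sqrtr_sqr gtr0_norm// mulfK// gt_eqF// sqrtr_gt0.
  by rewrite ltr_pwDl// sqr_ge0.
have tE : t * complex.Re z = complex.Im z by rewrite /t mulfVK// gt_eqF.
have S : sin (atan t) = t * cos (atan t).
  by rewrite -{2}[t]atanK /tan mulfVK// gt_eqF.
clearbody t; case: z z0 cz ct E S tE => a b /= z0 cz ct E S tE.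
by apply/eqP; rewrite eq_complex /= !mul0r subr0 addr0 S mulrCA E tE !eqxx.
Qed.

Lemma Re_near1 z : cabs (1 - z) < 1 -> 0 < complex.Re z.
Proof.
move=> h; have := le_lt_trans (cabs_Re _) h; rewrite raddfB /= => /ltr_normlP[_].
by rewrite ltrBlDl ltrDr.
Qed.

Lemma cvg_Clog (T : Type) (F : set_system T) {FF : Filter F} (f : T -> Cplx R) (l : Cplx R) :
  0 < complex.Re l -> f @ F --> l -> Clog (f x) @[x --> F] --> Clog l.
Proof.
move=> l0 fl; have cz : 0 < cabs l.
  by rewrite cabs_gt0; apply: contraTneq l0 => ->; rewrite ltxx.
apply: cvg_ReIm.
  by apply: (cvg_comp _ _ (cvg_cabs_comp fl)); exact: continuous_ln.
apply: (cvg_map (h := @atan R)); first exact: continuous_atan.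
apply: cvgM; first exact: cvg_Im.
by apply: cvgV; [rewrite gt_eqF|exact: cvg_Re].
Qed.

Lemma cexp_surj z : z != 0 -> exists w, cexp w = z.
Proof.
have pos v : 0 < complex.Re v -> exists w, cexp w = v.
  by move=> v0; exists (Clog v); rewrite cexp_Clog.
have nz v : complex.Re v != 0 -> exists w, cexp w = v.
  have [v0 _|v0 _|//] := ltgtP (complex.Re v) 0; last exact: pos.
  have [|w wE] := pos (- v); first by rewrite raddfN /= oppr_gt0.
  exists (w + (0 +i* pi)); rewrite cexpD wE /cexp /= expR0 cospi sinpi mul1r.
  by apply/eqP; case: (v) => a b; rewrite eq_complex /=; apply/andP; split; apply/eqP; ring.
move=> z0; have [zr|/nz//] := eqVneq (complex.Re z) 0.
(* Multiplication by 1 + i moves the imaginary axis off itself, and 1 + i is itself an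
   exponential. *)
have [|w wE] := nz (z * (1 +i* 1)).
  case: z z0 zr => a b z0 /= a0; rewrite a0 mul0r sub0r mulr1 oppr_eq0.
  by apply: contra z0 => /eqP ->; rewrite a0.
have [|v vE] := nz (1 +i* 1); first by rewrite /= oner_eq0.
exists (w - v); rewrite cexpB wE vE mulfK//.
by rewrite eq_complex /= oner_eq0.
Qed.

Lemma cos_eq1_small (x : R) : `|x| < pi -> cos x = 1 -> x = 0.
Proof.
move=> xpi cx; apply/eqP; rewrite -normr_eq0; apply/eqP.
have cx' : cos `|x| = 1 by case: (ger0P x) => //; rewrite cosN.
have := @cosK R `|x|; rewrite cx' acos1 => -> //.
by rewrite in_itv /= normr_ge0 ltW.
Qed.

Lemma cexp_eq1_small z : `|complex.Im z| < pi -> cexp z = 1 -> z = 0.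
Proof.
move=> zpi z1; have r0 : complex.Re z = 0.
  by apply: (@expR_inj R); rewrite expR0 -cabs_cexp z1 cabs1.
move: z1; rewrite /cexp r0 expR0 mul1r => /eqP; rewrite eq_complex /= => /andP[/eqP c1 _].
have := cos_eq1_small zpi c1; case: (z) r0 => a b /= -> -> //.
Qed.

(** The difference of two logarithms of one function lies in the kernel of exp, whose only element
    with imaginary part below pi in modulus is 0. Continuity therefore makes the difference locally
    constant. *)
Lemma cexp_eq_path (a b : R) (l m : R -> Cplx R) : a <= b ->
  (forall u, a <= u <= b -> {for u, continuous l}) ->
  (forall u, a <= u <= b -> {for u, continuous m}) ->
  (forall u, a <= u <= b -> cexp (l u) = cexp (m u)) ->
  l b - l a = m b - m a.
Proof.
move=> ab cl cm E; pose d u := l u - m u.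
suff h : d a = d b.
  apply/eqP; rewrite -subr_eq0 -[X in X == _](_ : d b - d a = _).
    by rewrite h subrr.
  by rewrite /d; ring.
apply: (@interval_ind a b (fun u v => d u = d v)) => // [u v w _ _ _ _ -> //|u0 u0ab].
have /cvg_Im /cvgrPdist_lt : d u @[u --> u0] --> d u0 by apply: cvgC_B; [exact: cl|exact: cm].
have pi2 : 0 < pi / 2 :> R by rewrite divr_gt0 ?pi_gt0.
move=> /(_ _ pi2) /nbhs_ballP[e /= e0 H]; exists e => // u v au uv vb ue ve.
apply/eqP; rewrite -subr_eq0; apply/eqP/cexp_eq1_small.
  have := H u; have := H v; rewrite /ball /= distrC => /(_ ve) h1.
  rewrite distrC => /(_ ue) h2; rewrite raddfB /=.
  rewrite (_ : _ - _ = (complex.Im (d u0) - complex.Im (d v)) - (complex.Im (d u0) - complex.Im (d u))); last by ring.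
  by rewrite (le_lt_trans (ler_normB _ _))// [pi]splitr ltrD.
rewrite /d !cexpB !E ?(divff (cexp_neq0 _)) ?invr1 ?mulr1//.
  by rewrite (le_trans au uv).
by rewrite au (le_trans uv vb).
Qed.

Definition clamp (x : R) : R := Num.max (-1) (Num.min 1 x).

Lemma clamp_id (x : R) : -1 <= x <= 1 -> clamp x = x.
Proof. by move=> /andP[a b]; rewrite /clamp min_r// max_r. Qed.

Lemma clampP (x : R) : -1 <= clamp x <= 1.
Proof. by rewrite /clamp le_max lexx /= ge_max ge_min lexx /= andbT; lra. Qed.

Lemma clamp_continuous : continuous clamp.
Proof.
move=> x; have : {for x, continuous ((cst (-1) : R -> R^o) \max (((cst 1) : R -> R^o) \min id))}.
  apply: continuous_max; first exact: cvg_cst.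
  by apply: continuous_min; [exact: cvg_cst|exact: cvg_id].
exact.
Qed.

Lemma square_compact : compact (`[-1, 1] `*` `[-1, 1] : set (R * R)).
Proof. by apply: compact_setX; exact: segment_compact. Qed.

(** Homotopy lifting: the square is contracted to its centre, where the function is constant, and a
    logarithm is carried along from t = 0 to t = 1. A short step in t changes the function by a
    factor close to 1, uniformly by compactness, and [Clog] of this factor corrects the
    logarithm. *)
Lemma log_lift (g : R * R -> Cplx R) : continuous g -> (forall p, g p != 0) ->
  exists l : R * R -> Cplx R, continuous l /\
    forall x y, -1 <= x <= 1 -> -1 <= y <= 1 -> cexp (l (x, y)) = g (x, y).
Proof.
move=> cg g0; pose sc (t : R) (p : R * R) : R * R := (t * clamp p.1, t * clamp p.2).
have csc : continuous (fun q : R * (R * R) => sc q.1 q.2).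
  move=> [t p]; apply: cvg_pt_pair; apply: cvgM; try exact: cvg_fst.
    apply: (cvg_map (h := clamp)); first exact: clamp_continuous.
    by apply: cvg_comp; [exact: cvg_snd|exact: cvg_fst].
  apply: (cvg_map (h := clamp)); first exact: clamp_continuous.
  by apply: cvg_comp; [exact: cvg_snd|exact: cvg_snd].
have cgs : continuous (fun q : R * (R * R) => g (sc q.1 q.2)).
  by move=> q; apply: (cvg_map (h := g)); [exact: cg|exact: csc].
have cgt t : continuous (fun p => g (sc t p)).
  move=> p; apply: (cvg_map (f := fun p => (t, p)) (h := fun q : R * (R * R) => g (sc q.1 q.2)) (a := (t, p))).
    exact: cgs.
  by apply: cvg_pt_pair; [exact: cvg_cst|exact: cvg_id].
pose Good t := exists l : R * R -> Cplx R, continuous l /\ forall p, cexp (l p) = g (sc t p).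
suff : Good 1.
  move=> [l [cl lE]]; exists l; split => // x y hx hy; rewrite lE /sc /= !mul1r !clamp_id//.
have : Good 0.
  have [w wE] := cexp_surj (g0 (0, 0)); exists (fun=> w); split.
    by move=> p; exact: cvg_cst.
  by move=> p; rewrite wE /sc !mul0r.
apply: (@interval_ind 0 1 (fun u v => Good u -> Good v)) => //.
  by move=> u v w _ _ _ _ h1 h2 /h1.
move=> t0 _.
have step : \forall t \near t0, forall p, (`[-1, 1] `*` `[-1, 1]) p ->
    cabs (1 - g (sc t p) / g (sc t0 p)) < 1 / 2 .
  apply: (compact_forall_near (P := fun t p => cabs (1 - g (sc t p) / g (sc t0 p)) < 1 / 2) square_compact).
  move=> p _.
  have : (fun q : (R * R) * R => g (sc q.2 q.1) / g (sc t0 q.1)) @ (p, t0) --> (1 : Cplx R).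
    rewrite -[X in _ --> X](divff (g0 (sc t0 p))); apply: cvgM.
      apply: (cvg_map (f := fun q : (R * R) * R => (q.2, q.1)) (h := fun q : R * (R * R) => g (sc q.1 q.2)) (a := (t0, p))); first exact: cgs.
      by apply: cvg_pt_pair; [exact: cvg_snd|exact: cvg_fst].
    apply: cvgV => //; apply: (cvg_map (f := fun q : (R * R) * R => q.1) (h := fun p => g (sc t0 p)) (a := p)); first exact: cgt.
    exact: cvg_fst.
  move=> /cvg_cabs; apply.
  by rewrite divr_gt0.
(* [sc t] factors through the square, so a bound on the compact square holds on the whole plane. *)
have scE t p : sc t p = sc t (clamp p.1, clamp p.2).
  by rewrite /sc /= !(clamp_id (clampP _)).
have step' : \forall t \near t0, forall p, cabs (1 - g (sc t p) / g (sc t0 p)) < 1 / 2.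
  apply: filterS step => t h p; rewrite (scE t) (scE t0); apply: h.
  by split; rewrite /= in_itv /= clampP.
have half : 1 / 2 < 1 :> R by lra.
have fwd t : (forall p, cabs (1 - g (sc t p) / g (sc t0 p)) < 1 / 2) -> Good t0 -> Good t.
  move=> h [l [cl lE]]; exists (fun p => l p + Clog (g (sc t p) / g (sc t0 p))).
  have re p : 0 < complex.Re (g (sc t p) / g (sc t0 p)).
    by apply: Re_near1; apply: lt_trans (h p) half.
  split.
    move=> p; apply: cvgD; first exact: cl.
    by apply: cvg_Clog => //; apply: cvgM; [exact: cgt|apply: cvgV => //; exact: cgt].
  by move=> p; rewrite cexpD cexp_Clog// lE mulrC mulfVK.
(* [interval_ind] asks for a step from u to v on either side of t0: logarithms are moved from u back
   to t0, and from there to v. *)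
have bwd t : (forall p, cabs (1 - g (sc t p) / g (sc t0 p)) < 1 / 2) -> Good t -> Good t0.
  move=> h [l [cl lE]]; exists (fun p => l p - Clog (g (sc t p) / g (sc t0 p))).
  have re p : 0 < complex.Re (g (sc t p) / g (sc t0 p)).
    by apply: Re_near1; apply: lt_trans (h p) half.
  split.
    move=> p; apply: cvgC_B; first exact: cl.
    by apply: cvg_Clog => //; apply: cvgM; [exact: cgt|apply: cvgV => //; exact: cgt].
  by move=> p; rewrite cexpB cexp_Clog// lE invf_div mulrC mulfVK.
move: step' => /nbhs_ballP[e /= e0 H]; exists e => // u v _ _ _ ue ve /bwd h.
by apply: fwd; [apply: H; rewrite /ball /= distrC|apply: h; apply: H; rewrite /ball /= distrC].
Qed.

Lemma log_path (f : R -> Cplx R) : continuous f -> (forall u, f u != 0) ->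
  exists l : R -> Cplx R, continuous l /\ forall u, 0 <= u <= 1 -> cexp (l u) = f u.
Proof.
move=> cf f0; have [|//|l [cl lE]] := @log_lift (fun p => f p.1).
  by move=> p; apply: continuous_comp; [exact: cvg_fst|exact: cf].
exists (fun u => l (u, 0)); split.
  move=> u; apply: (cvg_map (f := fun u => (u, 0 : R)) (h := l)); first exact: cl.
  by apply: cvg_pt_pair; [exact: cvg_id|exact: cvg_cst].
by move=> u /andP[u0 u1]; rewrite lE//; [rewrite (le_trans _ u0)|]; rewrite ?lerN10 ?ler01.
Qed.

End ExpLog.

(** * Derivatives *)

Section Caratheodory.
Variables (R : realType) (T : topologicalType) (i : T -> Cplx R).
Implicit Types (f g : T -> Cplx R) (x : T) (d : Cplx R).

(* Caratheodory's form of differentiability along the map [i], which is the identity of the plane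
   for complex derivatives and the embedding of the line for derivatives of paths. *)
Definition cder f x d := exists phi : T -> Cplx R,
  [/\ cts_at phi x, phi x = d &
      \forall y \near x, f y - f x = phi y * (i y - i x)].

Lemma cder_near f g x d : (\forall y \near x, f y = g y) -> cder f x d -> cder g x d.
Proof.
move=> fg [phi [cphi phix E]]; exists phi; split => //; near=> y.
rewrite -(near fg y) // -(nbhs_singleton fg) //; by near: y.
Unshelve. all: by end_near. Qed.

Lemma cder_cst (a : Cplx R) x : cder (fun=> a) x 0.
Proof.
exists (fun=> 0); split => //; first exact: cts_cst.
by near=> y; rewrite subrr mul0r.
Unshelve. all: by end_near. Qed.

Lemma cder_id x : cder i x 1.
Proof.
exists (fun=> 1); split => //; first exact: cts_cst.
by near=> y; rewrite mul1r.
Unshelve. all: by end_near. Qed.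

Lemma cderD f g x d e : cder f x d -> cder g x e -> cder (fun y => f y + g y) x (d + e).
Proof.
move=> [phi [cphi phix E]] [psi [cpsi psix E']]; exists (fun y => phi y + psi y).
split; [exact: ctsD|by rewrite phix psix|near=> y].
rewrite mulrDl -(near E y) // -(near E' y) //; ring.
Unshelve. all: by end_near. Qed.

Lemma cderM f g x d e : cts_at f x -> cder f x d -> cder g x e ->
  cder (fun y => f y * g y) x (d * g x + f x * e).
Proof.
move=> cf [phi [cphi phix E]] [psi [cpsi psix E']].
exists (fun y => phi y * g x + f y * psi y); split; last first.
- near=> y; rewrite mulrDl.
  rewrite -(mulrA (f y)) -(near E' y) // mulrAC -(near E y) //; ring.
- by rewrite phix psix.
by apply: ctsD; apply: ctsM => //; exact: cts_cst.
Unshelve. all: by end_near. Qed.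

Lemma cderZ (a : Cplx R) f x d : cder f x d -> cder (fun y => a * f y) x (a * d).
Proof.
move=> df; have := cderM (@cts_cst _ _ a x) (cder_cst a x) df.
by rewrite mul0r add0r.
Qed.

Lemma cderB f g x d e : cder f x d -> cder g x e -> cder (fun y => f y - g y) x (d - e).
Proof.
move=> df dg; have := cderD df (cderZ (-1) dg).
by rewrite mulN1r; under eq_fun do rewrite mulN1r.
Qed.

Lemma cderV g x e : cts_at g x -> g x != 0 -> cder g x e ->
  cder (fun y => (g y)^-1) x (- e / g x ^+ 2).
Proof.
move=> cg g0 [psi [cpsi psix E']].
exists (fun y => - psi y / (g x * g y)); split; last first.
- near=> y.
  have gy : g y != 0 by near: y; exact: cts_neq0.
  have E : psi y * (i y - i x) = g y - g x by rewrite (near E' y).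
  rewrite mulrAC mulNr E; field; by rewrite gy g0.
- by rewrite psix expr2.
apply: ctsM; first exact: ctsN.
apply: ctsV; first by rewrite mulf_neq0.
by apply: ctsM => //; exact: cts_cst.
Unshelve. all: by end_near. Qed.

Lemma cder_sum (I : Type) (s : seq I) (f : I -> T -> Cplx R) x (d : I -> Cplx R) :
  (forall j, cder (f j) x (d j)) ->
  cder (fun y => \sum_(j <- s) f j y) x (\sum_(j <- s) d j).
Proof.
move=> h; elim: s => [|j s IH].
  by rewrite big_nil; under eq_fun do rewrite big_nil; exact: cder_cst.
rewrite big_cons (_ : (fun y : T => _) = fun y : T => f j y + \sum_(j <- s) f j y).
  exact: (cderD (h j) IH).
by apply/funext => y; rewrite big_cons.
Qed.

Hypothesis ci : continuous i.

Lemma cder_continuous f x d : cder f x d -> cts_at f x.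
Proof.
move=> [phi [cphi phix E]].
split; have : (fun y => f x + phi y * (i y - i x)) @ x --> f x.
  rewrite -[X in _ --> X](_ : f x + phi x * (i x - i x) = f x); last by rewrite subrr mulr0 addr0.
  have h : cts_at (fun y => f x + phi y * (i y - i x)) x.
    apply: ctsD; first exact: cts_cst.
    by apply: ctsM => //; apply: ctsB; [exact: ctsT|exact: cts_cst].
  by case: h.
apply: cvg_trans; apply: near_eq_cvg; near=> y.
by rewrite -(near E y) // addrC subrK.
Unshelve. all: by end_near. Qed.

End Caratheodory.

Notation cdiff := (cder id).
Definition rc (R : realType) (u : R) : Cplx R := u%:C.
Notation rdiff := (cder (@rc _)).

Section Rules.
Variables (R : realType).
Implicit Types (T : topologicalType).

Lemma rc_continuous : continuous (@rc R).
Proof. by move=> x; apply: cvg_real; exact: cvg_id. Qed.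

Lemma cder_comp T (i : T -> Cplx R) (f : T -> Cplx R) (g : Cplx R -> Cplx R) x d e :
  cts_at f x -> cder i f x d -> cdiff g (f x) e ->
  cder i (fun y => g (f y)) x (e * d).
Proof.
move=> cf [phi [cphi phix E]] [psi [cpsi psix E']].
exists (fun y => psi (f y) * phi y); split; last first.
- near=> y; have -> : g (f y) - g (f x) = psi (f y) * (f y - f x).
    by near: y; case: cf => cf; exact: (cf _ E').
  by rewrite (near E y) // mulrA.
- by rewrite phix psix.
by apply: ctsM => //; exact: (cts_comp cf cpsi).
Unshelve. all: by end_near. Qed.

(** The slope of [E] at [l x] does not vanish near [l x], so one can divide by it, and continuity of
    [l] is upgraded to differentiability. This yields the derivatives of logarithms and of the
    branches of the inverse of P. *)
Lemma cder_implicit T (i : T -> Cplx R) (l G : T -> Cplx R) (E : Cplx R -> Cplx R) x d e :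
  cts_at l x -> cdiff E (l x) e -> e != 0 ->
  (\forall y \near x, E (l y) = G y) -> cder i G x d -> cder i l x (d / e).
Proof.
move=> cl [phi [cphi phix H]] e0 EG [psi [cpsi psix H']].
have cpl : cts_at (fun y => phi (l y)) x by exact: (cts_comp cl cphi).
have p0 : phi (l x) != 0 by rewrite phix.
exists (fun y => psi y / phi (l y)); split; last first.
- near=> y.
  have py : phi (l y) != 0 by near: y; exact: (cts_neq0 cpl p0).
  have h : E (l y) - E (l x) = phi (l y) * (l y - l x) by near: y; case: cl => cl; exact: (cl _ H).
  rewrite mulrAC -(near H' y) // -(near EG y) // -(nbhs_singleton EG) h.
  by rewrite mulrAC divff// mul1r.
- by rewrite phix psix.
by apply: ctsM => //; exact: (ctsV p0 cpl).
Unshelve. all: by end_near. Qed.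

Lemma cdiff_horner (p : {poly R[i]}) (z : Cplx R) : cdiff (fun w : Cplx R => p.[w] : Cplx R) z p^`().[z].
Proof.
have /factor_theorem[q qE] : root (p - p.[z]%:P) z by rewrite /root hornerD hornerN hornerC subrr.
exists (fun w => q.[w]); split.
- by apply: cts_horner; exact: cts_id.
- have -> : p^`() = (q * ('X - z%:P))^`() by rewrite -qE derivB derivC subr0.
  by rewrite derivM derivB derivX derivC subr0 mulr1 hornerD hornerM hornerXsubC subrr mulr0 add0r.
near=> w; have := congr1 (fun p => p.[w]) qE.
by rewrite hornerM hornerXsubC hornerD hornerN hornerC.
Unshelve. all: by end_near. Qed.

(** Passage from [is_derive] to Caratheodory's form; [is_derive_of_quot] goes back. *)
Lemma is_derive_quot (f : R -> R) (x d : R) : is_derive x 1 f d ->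
  exists phi : R -> R, [/\ cts_at phi x, phi x = d &
    forall y, f y - f x = phi y * (y - x)].
Proof.
move=> df; pose phi y := if y == x then d else (f y - f x) / (y - x).
exists phi; split; rewrite /phi ?eqxx//; last first.
  by move=> y; case: eqVneq => [->|yx]; rewrite ?subrr ?mulr0// mulfVK// subr_eq0.
have /cvgrPdist_lt := @ex_derive _ _ _ _ _ _ _ df.
rewrite -/(derive f x 1) derive_val => H.
have cE : (if x == x then d else (f x - f x) / (x - x)) = d by rewrite eqxx.
split; rewrite cE; apply/cvgrPdist_lt => e e0; have /nbhs_ballP[r /= r0 {}H] := H _ e0.
apply/nbhs_ballP; exists r => // y; rewrite /ball /= => xy.
case: eqVneq => [_|yx]; first by rewrite subrr normr0.
have yx0 : y - x != 0 by rewrite subr_eq0.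
have := H (y - x); rewrite /ball /= sub0r normrN distrC => /(_ xy yx0).
by rewrite /GRing.scale /= mulr1 subrK mulrC.
Qed.

Lemma cdiff_cexp (z : Cplx R) : cdiff (@cexp R) z (cexp z).
Proof.
have [al [cal al0 alE]] := is_derive_quot (is_derive_expR (0 : R)).
have [be [cbe be0 beE]] := is_derive_quot (is_derive_cos (0 : R)).
have [ga [cga ga0 gaE]] := is_derive_quot (is_derive_sin (0 : R)).
rewrite expR0 in al0; rewrite sin0 oppr0 in be0; rewrite cos0 in ga0.
pose cis (y : R) : Cplx R := cos y +i* sin y.
pose rest (h : Cplx R) : Cplx R := (al (complex.Re h))%:C * cis (complex.Im h) - 1.
pose rest2 (h : Cplx R) : Cplx R := (be (complex.Im h) +i* ga (complex.Im h)) - (0 +i* 1).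
have cRe : cts_at (fun h : Cplx R => complex.Re h) 0 by apply: cts_Re; exact: cts_id.
have cIm : cts_at (fun h : Cplx R => complex.Im h) 0 by apply: cts_Im; exact: cts_id.
have crest : cts_at rest 0.
  apply: ctsB; last exact: cts_cst.
  apply: ctsM; first by apply: cts_realf; apply: (cts_comp cRe).
  apply: cts_ReIm; apply: (cts_comp cIm); apply: ctsT.
    exact: continuous_cos.
  exact: continuous_sin.
have rest0 : rest 0 = 0 by rewrite /rest /= al0 /cis cos0 sin0 mul1r subrr.
have crest2 : cts_at rest2 0.
  apply: ctsB; last exact: cts_cst.
  by apply: cts_ReIm; [exact: (cts_comp cIm cbe)|exact: (cts_comp cIm cga)].
have rest20 : rest2 0 = 0 by rewrite /rest2 /= be0 ga0 subrr.
pose phi (w : Cplx R) : Cplx R := if w == z then cexp z else (cexp w - cexp z) / (w - z).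
exists phi; split; rewrite /phi ?eqxx//; last first.
  by near=> w; case: eqVneq => [->|yx]; rewrite ?subrr ?mulr0// mulfVK// subr_eq0.
have cE : (if z == z then cexp z else (cexp z - cexp z) / (z - z)) = cexp z by rewrite eqxx.
apply: cts_atE; rewrite cE => e e0.
(* There are two remainders, and both are multiplied by |exp z|. *)
pose e' := e / (1 + cabs (cexp z)) / 2.
have e'0 : 0 < e' by rewrite !divr_gt0// ltr_pwDl// cabs_ge0.
have /nbhs_cabs[r1 r10 H1] := cts_cabs crest e'0.
have /nbhs_cabs[r2 r20 H2] := cts_cabs crest2 e'0.
near=> w; case: eqVneq => [_|wz]; first by rewrite subrr cabs0.
have wz0 : w - z != 0 by rewrite subr_eq0.
pose h : Cplx R := w - z.
have hr1 : cabs (0 - h) < r1.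
  by rewrite sub0r cabsN /h cabsB; near: w; apply/nbhs_cabs; exists r1.
have hr2 : cabs (0 - h) < r2.
  by rewrite sub0r cabsN /h cabsB; near: w; apply/nbhs_cabs; exists r2.
(* With the slopes [al], [be], [ga] of exp, cos and sin at 0, exp (x + i y) = (1 + al x) cis y and
   cis y = 1 + y (be + i ga). Both remainders tend to 0 with h. *)
have key : cexp h - 1 - h = (complex.Re h)%:C * rest h + (complex.Im h)%:C * rest2 h.
  rewrite /rest /rest2 /cis /cexp.
  case: (h) => x y /=.
  have := alE x; have := beE y; have := gaE y.
  rewrite !subr0 sin0 cos0 expR0 subr0 => -> E2 E1.
  have {E2}-> : cos y = 1 + be y * y by rewrite -E2; ring.
  have {E1}-> : expR x = 1 + al x * x by rewrite -E1; ring.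
  by apply/eqP; rewrite eq_complex /=; apply/andP; split; apply/eqP; ring.
have -> : cexp z - (cexp w - cexp z) / (w - z) = - (cexp z * ((cexp h - 1 - h) / h)).
  by rewrite /h cexpB; field; rewrite wz0 cexp_neq0.
rewrite cabsN cabsM cabsM cabsV key.
have := H1 _ hr1; have := H2 _ hr2; rewrite rest0 rest20 !sub0r !cabsN => h2 h1.
have B : cabs ((complex.Re h)%:C * rest h + (complex.Im h)%:C * rest2 h) <= cabs h * (e' + e').
  apply: le_trans (cabsD _ _) _; rewrite [in leRHS]mulrDr !cabsM !cabs_real.
  by apply: lerD; apply: ler_pM => //; rewrite ?cabs_ge0 ?cabs_Re ?cabs_Im// ltW.
have ch : 0 < cabs h by rewrite cabs_gt0.
apply: (@le_lt_trans _ _ (cabs (cexp z) * (e' + e'))).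
  by rewrite ler_wpM2l ?cabs_ge0// ler_pdivrMr// [leRHS]mulrC.
rewrite /e' -splitr mulrA ltr_pdivrMr ?ltr_pwDl ?cabs_ge0// mulrC ltr_pM2l//.
by rewrite ltrDr.
Unshelve. all: by end_near. Qed.

Lemma cder_log T (i : T -> Cplx R) (l g : T -> Cplx R) x d :
  cts_at l x -> (\forall y \near x, cexp (l y) = g y) ->
  cder i g x d -> cder i l x (d / g x).
Proof.
move=> cl E dg; rewrite -(nbhs_singleton E).
exact: (cder_implicit cl (cdiff_cexp (l x)) (cexp_neq0 _) E dg).
Qed.

Lemma is_derive_of_quot (f phi : R -> R) (x : R) : cts_at phi x ->
  (\forall y \near x, f y - f x = phi y * (y - x)) -> is_derive x 1 f (phi x).
Proof.
move=> [cphi] E.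
have H : (fun h => h^-1 *: ((f \o shift x) h%:A - f x)) @ (0 : R)^' --> phi x.
  have : (fun h : R => phi (h + x)) @ (0 : R)^' --> phi x.
    apply: (cvg_within_filter (F := nbhs (0 : R))).
    have c : (fun h : R => h + x) @ (0 : R) --> x.
      by rewrite -[X in _ --> X]add0r; apply: cvgD; [exact: cvg_id|exact: cvg_cst].
    exact: (cvg_comp _ _ c cphi).
  apply: cvg_trans; apply: near_eq_cvg.
  move: E => /nbhs_ballP[r /= r0 E]; apply/nbhs_ballP; exists r => // h.
  rewrite /ball /= sub0r normrN => hr h0.
  rewrite /GRing.scale /= mulr1 E; last by rewrite /ball /= opprD addrA addrAC subrr sub0r normrN.
  by rewrite addrK mulrC mulfK.
split; first by apply: cvgP H.
exact: cvg_lim H.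
Qed.

Lemma rdiff_Re (f : R -> Cplx R) (x : R) (d : Cplx R) : rdiff f x d ->
  is_derive x 1 (fun y : R => complex.Re (f y)) (complex.Re d).
Proof.
move=> [phi [cphi <- E]].
apply: (is_derive_of_quot (phi := fun y => complex.Re (phi y))); first exact: cts_Re.
apply: filterS E => y E; rewrite -raddfB E /rc.
by case: (phi y) => a b /=; rewrite !subr0 mulr0 subr0.
Qed.

Lemma rdiff_Im (f : R -> Cplx R) (x : R) (d : Cplx R) : rdiff f x d ->
  is_derive x 1 (fun y : R => complex.Im (f y)) (complex.Im d).
Proof.
move=> [phi [cphi <- E]].
apply: (is_derive_of_quot (phi := fun y => complex.Im (phi y))); first exact: cts_Im.
apply: filterS E => y E; rewrite -raddfB E /rc.
by case: (phi y) => a b /=; rewrite !subr0 mulr0 add0r.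
Qed.

Lemma rdiff_ReIm (f g : R -> R) (x a b : R) : is_derive x 1 f a -> is_derive x 1 g b ->
  rdiff (fun y => f y +i* g y : Cplx R) x (a +i* b).
Proof.
move=> /is_derive_quot[p [cp p0 pE]] /is_derive_quot[q [cq q0 qE]].
exists (fun y => p y +i* q y); split; first exact: cts_ReIm.
  by rewrite p0 q0.
apply: near_all => y; have := pE y; have := qE y => E1 E2.
by apply/eqP; rewrite eq_complex /= E1 E2 !subr0 !mulr0 subr0 add0r !eqxx.
Qed.

Lemma seg_rdiff (z w : Cplx R) (x : R) : rdiff (fun u => z + rc u * (w - z)) x (w - z).
Proof.
exists (fun=> w - z); split => //; first exact: cts_cst.
by apply: near_all => y; ring.
Qed.

Lemma rc_cts (x : R) : cts_at (@rc R) x.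
Proof. exact: ctsT rc_continuous. Qed.

Lemma rdiff_cts (f : R -> Cplx R) (x : R) (d : Cplx R) : rdiff f x d -> cts_at f x.
Proof. exact: (cder_continuous rc_continuous). Qed.

Lemma cdiff_cts (f : Cplx R -> Cplx R) (x : Cplx R) (d : Cplx R) : cdiff f x d -> cts_at f x.
Proof. by apply: cder_continuous => z; exact: cvg_id. Qed.

Lemma seg_cts (z w : Cplx R) (x : R) : cts_at (fun u => z + rc u * (w - z)) x.
Proof. exact: rdiff_cts (seg_rdiff z w x). Qed.

(** The derivative of M x^(m+1) / (m+1) + e g is nonnegative for e = 1 and for e = -1, so the mean
    value theorem bounds g from both sides. Iterating the estimate gives [taylor_vanishing]. *)
Lemma monoton_pow (g dg : R -> R) (M : R) (m : nat) : 0 <= M ->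
  (forall x : R, 0 <= x <= 1 -> is_derive x 1 g (dg x)) ->
  (forall x : R, 0 <= x <= 1 -> `|dg x| <= M * x ^+ m) ->
  forall x : R, 0 <= x <= 1 -> `|g x - g 0| <= M * x ^+ m.+1 / m.+1%:R.
Proof.
move=> M0 gd dgb x /andP[x0 x1].
have [<-|xn0] := eqVneq 0 x; first by rewrite subrr normr0 expr0n mulr0 mul0r.
have xp : 0 < x by rewrite lt_neqAle xn0.
have pw (e : R) : let h := fun y : R => M * y ^+ m.+1 / m.+1%:R + e * g y in
    forall y : R, 0 <= y <= 1 -> is_derive y 1 h (M * y ^+ m + e * dg y).
  move=> h y hy; have gdy := gd y hy.
  have [p [cp p0 pE]] := is_derive_quot gdy.
  have /factor_theorem[q qE] : root ('X^(m.+1) - (y ^+ m.+1)%:P) y.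
    by rewrite /root !hornerE subrr.
  have qy : q.[y] = m.+1%:R * y ^+ m.
    have := congr1 (fun r => r^`().[y]) qE.
    by rewrite derivB derivC subr0 derivXn derivM derivXsubC mulr1 hornerD hornerM hornerXsubC subrr mulr0 add0r hornerMn hornerXn mulr_natl => <-.
  pose Phi (v : R) : R := (M / m.+1%:R) * q.[v] + e * p v.
  have -> : M * y ^+ m + e * dg y = Phi y.
    by rewrite /Phi /= p0 qy mulrA mulfVK// pnatr_eq0.
  apply: (is_derive_of_quot (phi := Phi)).
    split; apply: cvgD; last by apply: cvgM; [exact: cvg_cst|exact: (cts_atP cp)].
    by apply: cvgM; [exact: cvg_cst|exact: continuous_horner].
  apply: near_all => v; rewrite /h /Phi [RHS]mulrDl -[in RHS](mulrA e) -pE -[in RHS](mulrA (M / _)).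
  have -> : q.[v] * (v - y) = v ^+ m.+1 - y ^+ m.+1.
    by have := congr1 (fun r => r.[v]) qE; rewrite !hornerE => ->.
  ring.
have mon (e : R) : `|e| <= 1 -> 0 <= M * x ^+ m.+1 / m.+1%:R + e * (g x - g 0).
  move=> e1; pose h := fun y : R => M * y ^+ m.+1 / m.+1%:R + e * g y.
  have [||c /andP[]] := @MVT R h (fun y => M * y ^+ m + e * dg y) 0 x xp.
  - move=> y; rewrite in_itv /= => /andP[y0 yx]; apply: pw.
    by rewrite ltW//= ltW// (lt_le_trans yx).
  - apply/continuous_in_subspaceT => y; rewrite inE /= in_itv /= => /andP[y0 yx].
    apply: differentiable_continuous; apply/derivable1_diffP.
    by apply: ex_derive; apply: pw; rewrite y0 (le_trans yx).
  rewrite !bnd_simp => c0 cx.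
  rewrite /h expr0n /= mulr0 mul0r add0r subr0 => E.
  have -> : M * x ^+ m.+1 / m.+1%:R + e * (g x - g 0) = (M * c ^+ m + e * dg c) * x.
    by rewrite -E; ring.
  apply: mulr_ge0; last exact: ltW.
  have c01 : 0 <= c <= 1 by rewrite ltW//= ltW// (lt_le_trans cx).
  rewrite -lerBlDr sub0r (le_trans _ (dgb c c01))// (le_trans (ler_norm _))// normrN normrM.
  by rewrite ler_piMl.
rewrite ler_norml; apply/andP; split.
  have := mon 1; rewrite normr1 mul1r => /(_ (lexx _)); rewrite -lerBlDl sub0r => h.
  exact: h.
by have := mon (-1); rewrite normrN normr1 mulN1r subr_ge0; apply.
Qed.

(** Real and imaginary parts are estimated separately, at the cost of the factor 2. *)
Lemma cpath_pow (f df : R -> Cplx R) (M : R) (m : nat) : 0 <= M ->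
  (forall x : R, 0 <= x <= 1 -> rdiff f x (df x)) ->
  (forall x : R, 0 <= x <= 1 -> cabs (df x) <= M * x ^+ m) ->
  forall x : R, 0 <= x <= 1 -> cabs (f x - f 0) <= 2 * M * x ^+ m.+1 / m.+1%:R.
Proof.
move=> M0 fd b x hx; apply: le_trans (cabs_le_ReIm _) _; rewrite !raddfB /=.
have -> : 2 * M * x ^+ m.+1 / m.+1%:R = M * x ^+ m.+1 / m.+1%:R + M * x ^+ m.+1 / m.+1%:R by ring.
apply: lerD.
  apply: (@monoton_pow (fun x => complex.Re (f x)) (fun x => complex.Re (df x))) => // y hy.
    exact: rdiff_Re (fd y hy).
  exact: le_trans (cabs_Re _) (b y hy).
apply: (@monoton_pow (fun x => complex.Im (f x)) (fun x => complex.Im (df x))) => // y hy.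
  exact: rdiff_Im (fd y hy).
exact: le_trans (cabs_Im _) (b y hy).
Qed.

Lemma cdiff_eq0 (f : Cplx R -> Cplx R) (z d : Cplx R) :
  (\forall w \near z, f w = 0) -> cdiff f z d -> d = 0.
Proof.
move=> f0 [phi [cphi <- E]].
apply/eqP; rewrite -cabs_eq0; apply/negPn/negP => p0.
have pz : phi z != 0 by rewrite -cabs_eq0.
have [r r0 H] := (nbhs_cabs z _).1 (filterI (filterI f0 E) (cts_neq0 cphi pz)).
have hr : cabs (z - (z + rc (r / 2))) < r.
  by rewrite opprD addNKr cabsN cabs_real gtr0_norm ?divr_gt0// ltr_pdivrMr// ltr_pMr// ltr1n.
have [[h1 h2] h3] := H _ hr.
move: h2; rewrite h1 (nbhs_singleton f0) subrr addrAC subrr add0r => /esym/eqP.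
rewrite mulf_eq0 (negPf h3) /= -cabs_eq0 cabs_real normr_eq0 mulf_eq0 gt_eqF//=.
by rewrite invr_eq0 pnatr_eq0.
Qed.

End Rules.

(** * Integrals over intervals *)

Section Integrals.
Variable R : realType.
Local Notation mu := (@lebesgue_measure R).

Definition itgl (a b : R) (f : R -> R) : Prop := mu.-integrable `[a, b] (EFin \o f).

Lemma cts_within (a b : R) (f : R -> R) :
  (forall x, a <= x <= b -> cts_at f x) -> {within `[a, b], continuous f}.
Proof.
move=> cf; apply/continuous_in_subspaceT => y; rewrite inE /= in_itv /= => hy.
by case: (cf y hy).
Qed.

Lemma cts_itgl (a b : R) (f : R -> R) : (forall x, a <= x <= b -> cts_at f x) -> itgl a b f.
Proof.
move=> cf; apply: continuous_compact_integrable; first exact: segment_compact.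
exact: cts_within.
Qed.

Lemma itglM (a b : R) (g f : R -> R) : (forall x, a <= x <= b -> cts_at g x) ->
  itgl a b f -> itgl a b (fun x => g x * f x).
Proof.
move=> cg fi; have mI : measurable (`[a, b] : set R) by [].
have mg : measurable_fun `[a, b] g.
  by apply: subspace_continuous_measurable_fun => //; exact: cts_within.
have bg : [bounded g x | x in `[a, b]].
  have := compact_bounded (continuous_compact (cts_within cg) (@segment_compact _ a b)).
  move=> [M [Mr H]]; exists M; split => // N MN x hx; apply: (H N MN).
  by exists x.
by apply: eq_integrable (integrableMr (mu := mu) mI mg bg fi).
Qed.

Lemma eq_itgl (a b : R) (f g : R -> R) : (forall x, a <= x <= b -> f x = g x) ->
  itgl a b f -> itgl a b g.
Proof.
move=> fg; apply: eq_integrable => // x; rewrite inE /= in_itv /= => hx.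
by rewrite /= fg.
Qed.

(** At the break points of a piecewise smooth curve [cderive] may be junk; end points being
    negligible, identities on the open pieces suffice. *)
Lemma itgl_oo (a b : R) (f g : R -> R) : (forall x, a < x < b -> f x = g x) ->
  itgl a b f -> itgl a b g /\
  \int[mu]_(x in `[a, b]) f x = \int[mu]_(x in `[a, b]) g x.
Proof.
move=> fg fi.
have key (h : R -> R) : mu.-integrable `]a, b[ (EFin \o h) -> itgl a b h /\
    \int[mu]_(x in `]a, b[) h x = \int[mu]_(x in `[a, b]) h x.
  move=> hi; have [ab|ba] := leP b a.
    split.
      have [->|ab'] := eqVneq a b.
        rewrite /itgl set_itv1; apply/integrableP; split; first exact: measurable_fun_set1.
        by rewrite integral_set1.
      have -> : itgl a b h = mu.-integrable (set0 : set R) (EFin \o h).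
        rewrite /itgl set_itv_ge// bnd_simp -ltNge lt_neqAle ab andbT eq_sym //.
      exact: integrable_set0.
    rewrite set_itv_ge ?bnd_simp -?leNgt// Rintegral_set0.
    have [->|ab'] := eqVneq a b; first by rewrite set_itv1 Rintegral_set1.
    by rewrite set_itv_ge ?Rintegral_set0// bnd_simp -ltNge lt_neqAle ab andbT eq_sym.
  have mh := measurable_int _ hi.
  have mh' : measurable_fun `[a, b] h.
    by apply: (@measurable_fun_itv_cc _ _ _ false true); apply/measurable_EFinP.
  have mS (x : R) : measurable [set x] by [].
  have hi1 : itgl a b h.
    rewrite /itgl; apply/(@negligible_integrable _ _ _ mu _ ([set a] `|` [set b])) => //.
    - exact: measurableU.
    - exact/measurable_EFinP.
    - rewrite (measureU0 (mu := mu) (mS a) (mS b)); first exact: lebesgue_measure_set1.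
      exact: lebesgue_measure_set1.
    have -> : ([set` `[a, b]] : set R) `\` ([set a] `|` [set b]) = [set` `]a, b[]; last exact: hi.
    apply/seteqP; split => x /=; rewrite !in_itv /=.
      move=> [/andP[ax xb] /not_orP[xa xb']].
      by rewrite !lt_neqAle ax xb !andbT; apply/andP; split; apply/eqP; [move/esym|].
    move=> /andP[ax xb]; rewrite !ltW//; split => //.
    by case=> h'; [move: ax; rewrite h' ltxx|move: xb; rewrite h' ltxx].
  split => //.
  rewrite (Rintegral_itv_bndo_bndc (a := BRight a)) // Rintegral_itv_obnd_cbnd//.
  apply: integrableS hi1 => //; apply: subset_itvr; by rewrite bnd_simp.
have fo : mu.-integrable `]a, b[ (EFin \o f).
  apply: integrableS fi => //; exact: subset_itv_oo_cc.
have go : mu.-integrable `]a, b[ (EFin \o g).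
  apply: eq_integrable fo => // x; rewrite inE /= in_itv /= => hx; by rewrite /= fg.
have [_ <-] := key _ fo; have [gi <-] := key _ go; split => //.
by apply: eq_Rintegral => x; rewrite inE /= in_itv /= => hx; rewrite fg.
Qed.

Lemma Rint_ftc (F f : R -> R) (a b : R) : a < b ->
  (forall x : R, a < x < b -> is_derive x 1 F (f x)) ->
  (forall x, a <= x <= b -> cts_at F x) ->
  (forall x, a <= x <= b -> cts_at f x) ->
  \int[mu]_(x in `[a, b]) f x = F b - F a.
Proof.
move=> ab dF cF cf; rewrite /Rintegral (@continuous_FTC2 _ f F)//.
- exact: cts_within.
- split.
  + move=> x; rewrite in_itv /= => hx; have d := dF x hx; exact: (@ex_derive _ _ _ _ _ _ _ d).
  + by apply: cvg_at_right_filter; case: (cF a) => //; rewrite lexx ltW.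
  + by apply: cvg_at_left_filter; case: (cF b) => //; rewrite lexx ltW.
- move=> x; rewrite in_itv /= => hx; rewrite derive1E; have d := dF x hx.
  exact: derive_val.
Qed.

Lemma itgl_cat (a b c : R) (f : R -> R) : a <= b -> b <= c ->
  itgl a b f -> itgl b c f -> itgl a c f /\
  \int[mu]_(x in `[a, c]) f x =
  \int[mu]_(x in `[a, b]) f x + \int[mu]_(x in `[b, c]) f x.
Proof.
move=> ab bc fab fbc.
have fbc' : mu.-integrable `]b, c] (EFin \o f).
  by apply: integrableS fbc => //; apply: subset_itvr; rewrite bnd_simp.
have U : ([set` `[a, c]] : set R) = [set` `[a, b]] `|` [set` `]b, c]].
  by rewrite -itv_bndbnd_setU// bnd_simp.
have fac : itgl a c f.
  rewrite /itgl U; apply/integrable_mkcond; first exact: measurableU.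
  move/integrable_mkcond : fab => fab; move/integrable_mkcond : fbc' => fbc1.
  have := integrableD (@measurableT _ _) (fab _) (fbc1 _) => /(_ _ _) H.
  apply: eq_integrable (H _ _) => // x _ /=.
  rewrite /patch !mem_setE !in_itv /= in_setU !mem_setE !in_itv /=.
  case: (leP x b) => xb /=; rewrite ?andbF ?andbT ?orbF /= ?adde0 ?add0e//.
split => //; rewrite U Rintegral_setU//; last 2 first.
- by rewrite -U.
- apply/disj_setPS => x [] /=; rewrite !in_itv /= => /andP[_ xb] /andP[bx _].
  by move: (lt_le_trans bx xb); rewrite ltxx.
by congr (_ + _); rewrite Rintegral_itv_obnd_cbnd.
Qed.

Definition citgl (a b : R) (f : R -> Cplx R) : Prop :=
  itgl a b (fun x => complex.Re (f x)) /\ itgl a b (fun x => complex.Im (f x)).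

Definition cint (a b : R) (f : R -> Cplx R) : Cplx R :=
  (\int[mu]_(x in `[a, b]) complex.Re (f x)) +i* (\int[mu]_(x in `[a, b]) complex.Im (f x)).

Lemma cts_citgl (a b : R) (f : R -> Cplx R) :
  (forall x, a <= x <= b -> cts_at f x) -> citgl a b f.
Proof. by move=> cf; split; apply: cts_itgl => x hx; [apply: cts_Re|apply: cts_Im]; exact: cf. Qed.

Lemma eq_cint (a b : R) (f g : R -> Cplx R) : (forall x, a <= x <= b -> f x = g x) ->
  cint a b f = cint a b g.
Proof.
move=> fg; rewrite /cint; congr (_ +i* _); apply: eq_Rintegral => x;
  by rewrite inE /= in_itv /= => hx; rewrite fg.
Qed.

Lemma itglD (a b : R) (f g : R -> R) : itgl a b f -> itgl a b g -> itgl a b (fun x => f x + g x).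
Proof.
move=> fi gi; apply: eq_integrable (integrableD _ fi gi) => //.
Qed.

Lemma itglZ (a b k : R) (f : R -> R) : itgl a b f -> itgl a b (fun x => k * f x).
Proof. by move=> fi; apply: eq_integrable (integrableZl _ k fi). Qed.

Lemma citglD (a b : R) (f g : R -> Cplx R) : citgl a b f -> citgl a b g ->
  citgl a b (fun x => f x + g x).
Proof.
move=> [f1 f2] [g1 g2]; split.
  by apply: eq_itgl (itglD f1 g1) => x _; rewrite raddfD.
by apply: eq_itgl (itglD f2 g2) => x _; rewrite raddfD.
Qed.

Lemma citglM (a b : R) (g f : R -> Cplx R) : (forall x, a <= x <= b -> cts_at g x) ->
  citgl a b f -> citgl a b (fun x => g x * f x).
Proof.
move=> cg [f1 f2].
have cr x : a <= x <= b -> cts_at (fun x => complex.Re (g x)) x by move=> /cg; exact: cts_Re.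
have ci x : a <= x <= b -> cts_at (fun x => complex.Im (g x)) x by move=> /cg; exact: cts_Im.
split.
  apply: eq_itgl (itglD (itglM cr f1) (itglZ (-1) (itglM ci f2))) => x _.
  by case: (g x) => ? ?; case: (f x) => ? ? /=; ring.
apply: eq_itgl (itglD (itglM cr f2) (itglM ci f1)) => x _.
by case: (g x) => ? ?; case: (f x) => ? ? /=; ring.
Qed.

Lemma citglZ (a b : R) (k : Cplx R) (f : R -> Cplx R) : citgl a b f ->
  citgl a b (fun x => k * f x).
Proof. by apply: citglM => x _; exact: cts_cst. Qed.

Lemma cintD (a b : R) (f g : R -> Cplx R) : citgl a b f -> citgl a b g ->
  cint a b (fun x => f x + g x) = cint a b f + cint a b g.
Proof.
move=> [f1 f2] [g1 g2]; rewrite /cint; apply/eqP; rewrite eq_complex /=.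
by rewrite -!RintegralD//; apply/andP; split; apply/eqP; apply: eq_Rintegral => x _; rewrite raddfD.
Qed.

Lemma cintZ (a b : R) (k : Cplx R) (f : R -> Cplx R) : citgl a b f ->
  cint a b (fun x => k * f x) = k * cint a b f.
Proof.
move=> [f1 f2]; case: k => kr ki; rewrite /cint; apply/eqP; rewrite eq_complex /=.
rewrite -!RintegralZl//.
have mI : measurable ([set` `[a, b]] : set R) by [].
rewrite -(RintegralB (mu := mu) mI (itglZ kr f1) (itglZ ki f2)) -(RintegralD (mu := mu) mI (itglZ kr f2) (itglZ ki f1)).
apply/andP; split; apply/eqP; apply: eq_Rintegral => x _.
  by case: (f x) => ? ? /=.
by case: (f x) => ? ? /=; rewrite addrC.
Qed.

Lemma cint_le (a b : R) (f : R -> Cplx R) (B : R -> R) : citgl a b f -> itgl a b B ->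
  (forall x, a <= x <= b -> cabs (f x) <= B x) ->
  cabs (cint a b f) <= 2 * \int[mu]_(x in `[a, b]) B x.
Proof.
move=> [f1 f2] Bi fB; apply: le_trans (cabs_le_ReIm _) _ => /=.
rewrite mulrDl !mul1r; apply: lerD.
  apply: le_trans (le_normr_Rintegral _ f1) _ => //.
  apply: le_Rintegral => //; first exact: integrable_norm f1.
  by move=> x; rewrite /= in_itv /= => hx; exact: le_trans (cabs_Re _) (fB x hx).
apply: le_trans (le_normr_Rintegral _ f2) _ => //.
apply: le_Rintegral => //; first exact: integrable_norm f2.
by move=> x; rewrite /= in_itv /= => hx; exact: le_trans (cabs_Im _) (fB x hx).
Qed.

Lemma citgl_cabs (a b : R) (f : R -> Cplx R) : citgl a b f ->
  itgl a b (fun x => `|complex.Re (f x)| + `|complex.Im (f x)|).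
Proof. by move=> [f1 f2]; apply: itglD; [exact: integrable_norm f1|exact: integrable_norm f2]. Qed.

Lemma cint_ftc (F f : R -> Cplx R) (a b : R) : a < b ->
  (forall x : R, a < x < b -> rdiff F x (f x)) ->
  (forall x, a <= x <= b -> cts_at F x) ->
  (forall x, a <= x <= b -> cts_at f x) ->
  cint a b f = F b - F a.
Proof.
move=> ab dF cF cf; rewrite /cint.
have -> : \int[mu]_(x in `[a, b]) complex.Re (f x) = complex.Re (F b) - complex.Re (F a).
  apply: (@Rint_ftc (fun x => complex.Re (F x))) => //.
- by move=> x hx; apply: rdiff_Re; exact: dF.
- by move=> x hx; apply: cts_Re; exact: cF.
- by move=> x hx; apply: cts_Re; exact: cf.
have -> : \int[mu]_(x in `[a, b]) complex.Im (f x) = complex.Im (F b) - complex.Im (F a).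
  apply: (@Rint_ftc (fun x => complex.Im (F x))) => //.
- by move=> x hx; apply: rdiff_Im; exact: dF.
- by move=> x hx; apply: cts_Im; exact: cF.
- by move=> x hx; apply: cts_Im; exact: cf.
by case: (F b) => ? ?; case: (F a).
Qed.

Lemma citgl_oo (a b : R) (f g : R -> Cplx R) : (forall x, a < x < b -> f x = g x) ->
  citgl a b f -> citgl a b g /\ cint a b f = cint a b g.
Proof.
move=> fg [f1 f2].
have [|g1 E1] := @itgl_oo a b _ (fun x => complex.Re (g x)) _ f1.
  by move=> x /fg ->.
have [|g2 E2] := @itgl_oo a b _ (fun x => complex.Im (g x)) _ f2.
  by move=> x /fg ->.
by split => //; rewrite /cint E1 E2.
Qed.

Lemma citgl_cat (a b c : R) (f : R -> Cplx R) : a <= b -> b <= c ->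
  citgl a b f -> citgl b c f -> citgl a c f /\
  cint a c f = cint a b f + cint b c f.
Proof.
move=> ab bc [f1 f2] [g1 g2].
have [h1 E1] := itgl_cat ab bc f1 g1; have [h2 E2] := itgl_cat ab bc f2 g2.
by split => //; rewrite /cint E1 E2.
Qed.

End Integrals.

(** The set where a locally constant property holds is open and closed in A. *)
Lemma connected_ind (X : topologicalType) (A : set X) (Q : X -> Prop) : connected A ->
  (forall x, A x -> \forall y \near x, A y -> (Q x <-> Q y)) ->
  forall x y, A x -> A y -> Q x -> Q y.
Proof.
move=> cA loc x y Ax Ay Qx; suff : A `&` [set z | Q z] = A.
  by move=> E; have [] : (A `&` [set z | Q z]) y by rewrite E.
apply: cA; first by exists x.
- exists (interior [set z | A z -> Q z]); first exact: open_interior.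
  apply/seteqP; split => z [Az h]; split => //.
    by apply: filterS (loc z Az) => w hw Aw; apply/(hw Aw).
  exact: (interior_subset h).
- exists (~` interior [set z | A z -> ~ Q z]); first exact/open_closedC/open_interior.
  apply/seteqP; split => z [Az h]; split => //.
    by move=> /interior_subset/(_ Az).
  apply: contrapT => nQ; apply: h.
  by apply: filterS (loc z Az) => w hw Aw /(hw Aw).
Qed.

(** * Functionals and their Cauchy transforms *)

Section Functional.
Variables (R : realType) (I : Type) (p : I -> Cplx R).
Variable T : (Cplx R -> Cplx R) -> Cplx R.
Implicit Types (h k : Cplx R -> Cplx R) (t : Cplx R).

Definition cts_along h := forall i, cts_at h (p i).

(* [T] plays the role of a complex measure on the closure of the points [p i]. *)
Record bdd_functional : Prop := BddFunctional {
  bddD : forall h k, cts_along h -> cts_along k -> T (fun z => h z + k z) = T h + T k;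
  bddZ : forall (a : Cplx R) h, cts_along h -> T (fun z => a * h z) = a * T h;
  bddB : exists2 C : R, 0 <= C & forall h (M : R), cts_along h -> 0 <= M ->
           (forall i, cabs (h (p i)) <= M) -> cabs (T h) <= C * M }.

Hypothesis Tb : bdd_functional.

Lemma cts_alongD h k : cts_along h -> cts_along k -> cts_along (fun z => h z + k z).
Proof. by move=> ah ak i; apply: ctsD; [exact: ah|exact: ak]. Qed.

Lemma cts_alongM h k : cts_along h -> cts_along k -> cts_along (fun z => h z * k z).
Proof. by move=> ah ak i; apply: ctsM; [exact: ah|exact: ak]. Qed.

Lemma cts_along_cst (a : Cplx R) : cts_along (fun=> a).
Proof. by move=> i; exact: cts_cst. Qed.

Lemma cts_alongX h n : cts_along h -> cts_along (fun z => h z ^+ n).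
Proof. by move=> ah i; apply: ctsX; exact: ah. Qed.

Lemma cts_along_id : cts_along (fun z => z).
Proof. by move=> i; exact: cts_id. Qed.

Lemma cts_along_horner (q : {poly R[i]}) : cts_along (fun z => q.[z]).
Proof. by move=> i; apply: cts_horner; exact: cts_id. Qed.

Lemma cts_alongV h : cts_along h -> (forall i, h (p i) != 0) -> cts_along (fun z => (h z)^-1).
Proof. by move=> ah h0 i; apply: ctsV; [exact: h0|exact: ah]. Qed.

(** The difference vanishes at all points [p i], so the bound of the functional applies with M = 0.
    Hence identities that fail elsewhere, such as those dividing by z - t, may be used under [T]. *)
Lemma bdd_ext h k : cts_along h -> cts_along k -> (forall i, h (p i) = k (p i)) -> T h = T k.
Proof.
move=> ah ak hk; have [C C0 bC] := bddB Tb.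
have am : cts_along (fun z => h z + (-1) * k z).
  by apply: cts_alongD => //; apply: cts_alongM => //; exact: cts_along_cst.
have := bC _ 0 am (lexx _); rewrite mulr0 => H.
have : cabs (T (fun z => h z + (-1) * k z)) <= 0.
  by apply: H => i; rewrite hk mulN1r subrr cabs0.
rewrite bddD// ?bddZ//; last by apply: cts_alongM => //; exact: cts_along_cst.
by rewrite mulN1r le_eqVlt ltNge cabs_ge0 orbF cabs_eq0 subr_eq0 => /eqP.
Qed.

Lemma small_eq0 (a : Cplx R) (B : R) : (forall n, cabs a <= B / 2 ^+ n) -> a = 0.
Proof.
move=> h; apply/eqP; rewrite -cabs_eq0 eq_le cabs_ge0 andbT leNgt; apply/negP => a0.
have B0 : 0 < B by have := h 0%N; rewrite expr0 divr1; exact: lt_le_trans.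
have := archi_boundP (ltW (divr_gt0 B0 a0)); set n := Num.bound _ => hn.
have := h n; rewrite leNgt => /negP; apply.
rewrite ltr_pdivrMr ?exprn_gt0// mulrC -ltr_pdivrMr//; apply: lt_trans hn _.
have := ltn_expl n (isT : (1 < 2)%N).
by rewrite -(ltr_nat R) natrX.
Qed.

(** A geometric series without summation: by 1 / (1 - u) = 1 + u / (1 - u) and the induction
    hypothesis on m, the exponent of u can be raised without changing the value of [T], and |u| <=
    1/2 makes this value tend to 0. *)
Lemma neumann_vanishing h u : cts_along h -> cts_along u -> (forall i, cabs (u (p i)) <= 1 / 2) ->
  (exists2 B : R, 0 <= B & forall i, cabs (h (p i)) <= B) ->
  (forall j, T (fun z => h z * u z ^+ j) = 0) ->
  forall m j, T (fun z => h z * u z ^+ j * (1 - u z)^-1 ^+ m) = 0.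
Proof.
move=> ah au ub [B B0 hB] H0.
have hre i : 1 / 2 <= cabs (1 - u (p i)).
  apply: le_trans (cabs_distC _ _); rewrite cabs1.
  by have := ub i; lra.
have v0 i : 1 - u (p i) != 0.
  by rewrite -cabs_gt0 (lt_le_trans _ (hre i))// divr_gt0.
have av m : cts_along (fun z => (1 - u z)^-1 ^+ m).
  apply: cts_alongX; apply: cts_alongV => // i; apply: ctsB; [exact: cts_cst|exact: au].
have aF m j : cts_along (fun z => h z * u z ^+ j * (1 - u z)^-1 ^+ m).
  by apply: cts_alongM => //; apply: cts_alongM => //; exact: cts_alongX.
elim=> [|m IH] j.
  rewrite -(H0 j); apply: bdd_ext => //; first by apply: cts_alongM => //; exact: cts_alongX.
  by move=> i; rewrite expr0 mulr1.
have step l : T (fun z => h z * u z ^+ l * (1 - u z)^-1 ^+ m.+1) =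
              T (fun z => h z * u z ^+ l.+1 * (1 - u z)^-1 ^+ m.+1).
  have <- : 0 + T (fun z => h z * u z ^+ l.+1 * (1 - u z)^-1 ^+ m.+1) =
     T (fun z => h z * u z ^+ l * (1 - u z)^-1 ^+ m.+1).
    rewrite -(IH l) -bddD//; apply: bdd_ext => //; first exact: cts_alongD.
    move=> i; rewrite exprSr [in RHS]exprSr.
    by rewrite (exprSr _ m) -/(GRing.exp _ _); field; exact: v0.
  by rewrite add0r.
have {}step n : T (fun z => h z * u z ^+ j * (1 - u z)^-1 ^+ m.+1) =
              T (fun z => h z * u z ^+ (j + n) * (1 - u z)^-1 ^+ m.+1).
  by elim: n => [|n IHn]; rewrite ?addn0// IHn step addnS.
have [C C0 bC] := bddB Tb.
apply: (@small_eq0 _ (C * (B * 2 ^+ m.+1))) => n; rewrite (step n).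
rewrite -mulrA; apply: bC => //.
  by rewrite mulr_ge0 ?invr_ge0 ?mulr_ge0 ?exprn_ge0.
move=> i; rewrite !cabsM !cabsX cabsV.
have u1 : cabs (u (p i)) ^+ (j + n) <= (2 ^+ n)^-1.
  rewrite exprD -[leRHS]mul1r; apply: ler_pM; rewrite ?exprn_ge0 ?cabs_ge0//.
    by rewrite exprn_ile1 ?cabs_ge0// (le_trans (ub i))//; lra.
  by rewrite -exprVn lerXn2r ?nnegrE ?cabs_ge0 ?invr_ge0// -[_^-1]mul1r; exact: ub.
have w1 : (cabs (1 - u (p i)))^-1 ^+ m.+1 <= 2 ^+ m.+1.
  rewrite lerXn2r ?nnegrE ?invr_ge0 ?cabs_ge0// invf_ple ?posrE// ?cabs_gt0//.
  by rewrite -[_^-1]mul1r; exact: hre.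
rewrite [leRHS]mulrAC; apply: ler_pM => //; rewrite ?mulr_ge0 ?exprn_ge0 ?invr_ge0 ?cabs_ge0//.
by apply: ler_pM => //; rewrite ?exprn_ge0 ?cabs_ge0.
Qed.

(* The moments of [T] at infinity, transported to [t]; the set of such [t] is open and closed away
   from the points [p i]. *)
Definition moments_vanish_at t := forall a : nat, T (fun z => (z - t)^-1 ^+ a.+1) = 0.

(** Here u = z / t, since z - t = - t (1 - z / t). *)
Lemma moments_vanish_infty t : t != 0 -> (forall i, cabs (p i) <= cabs t / 2) ->
  (forall j, T (fun z => z ^+ j) = 0) -> moments_vanish_at t.
Proof.
move=> t0 pt H a.
have pt0 i : p i - t != 0.
  rewrite subr_eq0; apply/eqP => e; have := pt i; rewrite e.
  have := t0; rewrite -cabs_gt0; lra.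
have aV : cts_along (fun z => (z - t)^-1).
  by apply: cts_alongV => // i; apply: ctsB; [exact: cts_id|exact: cts_cst].
have au : cts_along (fun z => t^-1 * z) by apply: cts_alongM; [exact: cts_along_cst|exact: cts_along_id].
have := @neumann_vanishing (fun=> 1) (fun z => t^-1 * z) (cts_along_cst _) au.
move=> H1.
have ub i : cabs (t^-1 * p i) <= 1 / 2.
  by rewrite cabsM cabsV ler_pdivrMl ?cabs_gt0// mulrA mulr1.
have {}H1 := H1 ub.
have {}H1 : (forall j : nat, T (fun z => 1 * (t^-1 * z) ^+ j) = 0) -> forall m j : nat,
    T (fun z => 1 * (t^-1 * z) ^+ j * (1 - t^-1 * z)^-1 ^+ m) = 0.
  by apply: H1; exists 1 => // i; rewrite cabs1.
have H2 j : T (fun z => 1 * (t^-1 * z) ^+ j) = 0.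
  rewrite -[RHS](mulr0 (t^-1 ^+ j)) -(H j) -bddZ//; last exact/cts_alongX/cts_along_id.
  apply: bdd_ext.
  - by apply: cts_alongM; [exact: cts_along_cst|exact: cts_alongX].
  - by apply: cts_alongM; [exact: cts_along_cst|apply: cts_alongX; exact: cts_along_id].
  - by move=> i; rewrite mul1r exprMn.
have := H1 H2 a.+1 0%N => E.
rewrite -[RHS](mulr0 ((- t)^-1 ^+ a.+1)) -E -bddZ//; last first.
  apply: cts_alongM; first by apply: cts_alongM; [exact: cts_along_cst|exact: cts_alongX].
  apply: cts_alongX; apply: cts_alongV => [|i].
    by move=> i; apply: ctsB; [exact: cts_cst|exact: au].
  rewrite subr_eq0; apply/eqP => e; have := ub i; rewrite -e cabs1; lra.
apply: bdd_ext; first exact: cts_alongX.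
  apply: cts_alongM; first exact: cts_along_cst.
  apply: cts_alongM; first by apply: cts_alongM; [exact: cts_along_cst|exact: cts_alongX].
  apply: cts_alongX; apply: cts_alongV => [|i].
    by move=> i; apply: ctsB; [exact: cts_cst|exact: au].
  rewrite subr_eq0; apply/eqP => e; have := ub i; rewrite -e cabs1; lra.
move=> i; rewrite expr0 !mul1r -exprMn; congr (_ ^+ _).
rewrite -invfM; congr (_^-1); field; exact: t0.
Qed.

Definition far t := exists2 d : R, 0 < d & forall i, d <= cabs (p i - t).

(** Here u = (t' - t) / (z - t), since z - t' = (z - t) (1 - u). The expansion uses all powers of
    the resolvent at t, which is why [moments_vanish_at] quantifies over them. *)
Lemma moments_vanish_step t t' (d : R) : 0 < d -> (forall i, d <= cabs (p i - t)) ->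
  cabs (t' - t) <= d / 2 -> moments_vanish_at t -> moments_vanish_at t'.
Proof.
move=> d0 dt tt' Z a.
have pt0 i : p i - t != 0 by rewrite -cabs_gt0 (lt_le_trans d0).
have aV : cts_along (fun z => (z - t)^-1).
  by apply: cts_alongV => // i; apply: ctsB; [exact: cts_id|exact: cts_cst].
pose u z := (t' - t) * (z - t)^-1.
have au : cts_along u by apply: cts_alongM => //; exact: cts_along_cst.
have ub i : cabs (u (p i)) <= 1 / 2.
  rewrite /u cabsM cabsV ler_pdivrMr ?cabs_gt0//; apply: le_trans tt' _.
  by have := dt i; lra.
have u1 i : 1 - u (p i) != 0.
  rewrite subr_eq0; apply/eqP => e; have := ub i; rewrite -e cabs1; lra.
have hb : exists2 B : R, 0 <= B & forall i, cabs ((p i - t)^-1 ^+ a.+1) <= B.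
  exists (d^-1 ^+ a.+1); first by rewrite exprn_ge0// invr_ge0 ltW.
  move=> i; rewrite cabsX cabsV lerXn2r ?nnegrE ?invr_ge0 ?cabs_ge0// ?(ltW d0)//.
  by rewrite lef_pV2 ?posrE ?cabs_gt0.
have H2 j : T (fun z => (z - t)^-1 ^+ a.+1 * u z ^+ j) = 0.
  rewrite -[RHS](mulr0 ((t' - t) ^+ j)) -(Z (a + j)%N) -bddZ//; last exact: cts_alongX.
  apply: bdd_ext.
  - by apply: cts_alongM; exact: cts_alongX.
  - by apply: cts_alongM; [exact: cts_along_cst|exact: cts_alongX].
  - by move=> i; rewrite /u exprMn mulrCA -exprD addSn.
have E := neumann_vanishing (cts_alongX a.+1 aV) au ub hb H2 a.+1 0%N.
have pt0' i : p i - t' != 0.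
  rewrite (_ : p i - t' = (p i - t) * (1 - u (p i))) ?mulf_neq0//.
  by rewrite /u; field; exact: pt0.
rewrite -E; apply: bdd_ext.
- apply: cts_alongX; apply: cts_alongV => // i; apply: ctsB; [exact: cts_id|exact: cts_cst].
- apply: cts_alongM; first by apply: cts_alongM; exact: cts_alongX.
  by apply: cts_alongX; apply: cts_alongV => // i; apply: ctsB; [exact: cts_cst|exact: au].
- move=> i; rewrite expr0 mulr1 -exprMn -invfM; congr (_^-1 ^+ _).
  by rewrite /u; field; exact: pt0.
Qed.

Lemma moments_vanish_local t : far t -> \forall t' \near t, moments_vanish_at t <-> moments_vanish_at t'.
Proof.
move=> [d d0 dt]; apply/nbhs_cabs; exists (d / 4); first by rewrite divr_gt0.
move=> t' tt'; split.
  by apply: (moments_vanish_step d0 dt); rewrite cabsB (le_trans (ltW tt'))//; lra.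
(* From t' the points are still at distance 3/4 d, and d / 4 is less than half of that. *)
apply: (@moments_vanish_step _ _ (3 / 4 * d)); first by lra.
  move=> i; have := dt i; have := cabsD (p i - t') (t' - t).
  rewrite (cabsB t' t) (_ : p i - t' + (t' - t) = p i - t); last by ring.
  lra.
by lra.
Qed.

Lemma moments_vanish_connected (A : set (Cplx R)) t t' : connected A ->
  (forall s, A s -> far s) -> A t -> A t' -> moments_vanish_at t -> moments_vanish_at t'.
Proof.
move=> cA fA; apply: connected_ind => // s As.
by apply: filterS (moments_vanish_local (fA s As)).
Qed.

(** (A(z) - A(t)) / (z - t) is a polynomial in z and t, and applying [T] in z leaves a polynomial in
    t. The induction is Horner's scheme, with z / (z - t) = 1 + t / (z - t). *)
Lemma resolvent_poly (A : {poly R[i]}) : exists G : {poly R[i]}, forall t,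
  (forall i, p i - t != 0) ->
  T (fun z => A.[z] * (z - t)^-1) = A.[t] * T (fun z => (z - t)^-1) + G.[t].
Proof.
elim/poly_ind: A => [|A c [G GE]].
  exists 0 => t pt; rewrite !horner0 mul0r addr0.
  have aV : cts_along (fun z => (z - t)^-1).
    by apply: cts_alongV => // i; apply: ctsB; [exact: cts_id|exact: cts_cst].
  rewrite -[RHS](mul0r (T (fun z => (z - t)^-1))) -bddZ//.
  apply: bdd_ext.
  - by apply: cts_alongM => //; exact: cts_along_horner.
  - by apply: cts_alongM => //; exact: cts_along_cst.
  - by move=> i; rewrite horner0.
exists ((T (fun z => A.[z]))%:P + 'X * G) => t pt.
have aV : cts_along (fun z => (z - t)^-1).
  by apply: cts_alongV => // i; apply: ctsB; [exact: cts_id|exact: cts_cst].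
have aA : cts_along (fun z => A.[z] * (z - t)^-1) by apply: cts_alongM => //; exact: cts_along_horner.
have a1 : cts_along (fun z => t * (A.[z] * (z - t)^-1)) by apply: cts_alongM => //; exact: cts_along_cst.
have a2 : cts_along (fun z => c * (z - t)^-1) by apply: cts_alongM => //; exact: cts_along_cst.
have -> : T (fun z => (A * 'X + c%:P).[z] * (z - t)^-1) =
    T (fun z => A.[z] + (t * (A.[z] * (z - t)^-1) + c * (z - t)^-1)).
  apply: bdd_ext.
  - by apply: cts_alongM => //; exact: cts_along_horner.
  - by apply: cts_alongD; [exact: cts_along_horner|exact: cts_alongD].
  - move=> i; rewrite hornerMXaddC.
    have id (x y s e : Cplx R) : y - s != 0 ->
      (x * y + e) * (y - s)^-1 = x + (s * (x * (y - s)^-1) + e * (y - s)^-1).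
      by move=> ys; field.
    exact: id.
rewrite bddD//; [|exact: cts_along_horner|exact: cts_alongD].
rewrite (bddD Tb a1 a2) (bddZ Tb t aA) (bddZ Tb c aV) GE// hornerMXaddC hornerD hornerC hornerM hornerX.
have id (x y s e u g : Cplx R) : x + (s * (y * u + g) + e * u) = (y * s + e) * u + (x + s * g).
  by ring.
exact: id.
Qed.

(** Since z^(j+1) / (z - t) = z^j + t z^j / (z - t), the vanishing of T (z^j / (z - t)) for large t
    makes T (z^j) equal to T (z^(j+1) / (z - t)), which tends to 0 as t goes to infinity. The same
    identity then passes from j to j + 1. *)
Lemma moments_of_resolvent (M0 : R) : (exists2 B : R, 0 <= B & forall i, cabs (p i) <= B) ->
  (forall t : Cplx R, M0 <= cabs t -> T (fun z => (z - t)^-1) = 0) ->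
  forall j, T (fun z => z ^+ j) = 0.
Proof.
move=> [B B0 pB] H; pose M1 := Num.max M0 (2 * B + 1).
have pt t : M1 <= cabs t -> forall i, p i - t != 0.
  rewrite ge_max => /andP[_ tB] i; rewrite subr_eq0; apply/eqP => e.
  by have := pB i; rewrite e; lra.
have aV t : M1 <= cabs t -> cts_along (fun z => (z - t)^-1).
  by move=> /pt h; apply: cts_alongV => // i; apply: ctsB; [exact: cts_id|exact: cts_cst].
have aF j t : M1 <= cabs t -> cts_along (fun z => z ^+ j * (z - t)^-1).
  by move=> ht; apply: cts_alongM; [exact/cts_alongX/cts_along_id|exact: aV].
suff K j : (forall t, M1 <= cabs t -> T (fun z => z ^+ j * (z - t)^-1) = 0) -> T (fun z => z ^+ j) = 0.
  suff L : forall j t, M1 <= cabs t -> T (fun z => z ^+ j * (z - t)^-1) = 0 by move=> j; apply: K; exact: L.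
  elim=> [|j IH] t ht.
    rewrite -(H t); last by move: ht; rewrite ge_max => /andP[].
    by apply: bdd_ext; [exact: aF|exact: aV|move=> i; rewrite expr0 mul1r].
  have := K j IH; have -> : T (fun z => z ^+ j) =
      T (fun z => z ^+ j.+1 * (z - t)^-1 + (- t) * (z ^+ j * (z - t)^-1)).
    apply: bdd_ext; first exact/cts_alongX/cts_along_id.
      by apply: cts_alongD; [exact: aF|apply: cts_alongM; [exact: cts_along_cst|exact: aF]].
    by move=> i; rewrite exprSr; field; exact: pt.
  rewrite bddD; [|exact: Tb|exact: aF|by apply: cts_alongM; [exact: cts_along_cst|exact: aF]].
  by rewrite bddZ; [rewrite IH// mulr0 addr0|exact: Tb|exact: aF].
move=> Hj; have [C C0 bC] := bddB Tb.
apply: (@small_eq0 _ (C * B ^+ j.+1)) => n.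
(* So large that every [p i] is at distance at least 2^n from it. *)
pose s : R := M1 + B + 2 ^+ n; have M1p : 0 < M1 by rewrite lt_max; apply/orP; right; lra.
have n0 : 0 < 2 ^+ n :> R by rewrite exprn_gt0.
have cs : cabs (s%:C : Cplx R) = s.
  by rewrite cabs_real ger0_norm// /s; lra.
have ht : M1 <= cabs (s%:C : Cplx R) by rewrite cs /s; lra.
have -> : T (fun z => z ^+ j) =
      T (fun z => z ^+ j.+1 * (z - s%:C)^-1 + (- s%:C) * (z ^+ j * (z - s%:C)^-1)).
  apply: bdd_ext; first exact/cts_alongX/cts_along_id.
    by apply: cts_alongD; [exact: aF|apply: cts_alongM; [exact: cts_along_cst|exact: aF]].
  by move=> i; rewrite exprSr; field; exact: pt.
rewrite bddD; [|exact: Tb|exact: aF|by apply: cts_alongM; [exact: cts_along_cst|exact: aF]].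
rewrite bddZ; [rewrite Hj// mulr0 addr0|exact: Tb|exact: aF].
rewrite -mulrA; apply: bC; [exact: aF|by rewrite mulr_ge0 ?exprn_ge0 ?invr_ge0|move=> i].
rewrite cabsM cabsX cabsV ler_pM ?exprn_ge0 ?invr_ge0 ?cabs_ge0//.
  by rewrite lerXn2r ?nnegrE ?cabs_ge0.
rewrite lef_pV2 ?posrE// ?cabs_gt0; last exact: pt.
by have := cabs_distC (s%:C) (p i); rewrite cs (cabsB (s%:C)) /s; have := pB i; lra.
Qed.

End Functional.

Lemma bdd_mulpoly (R : realType) (I : Type) (p : I -> Cplx R)
    (T : (Cplx R -> Cplx R) -> Cplx R) (A : {poly R[i]}) :
  (exists2 B : R, 0 <= B & forall i, cabs (p i) <= B) ->
  bdd_functional p T -> bdd_functional p (fun h => T (fun z => A.[z] * h z)).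
Proof.
move=> [B B0 pB] Tb.
have aA h : cts_along p h -> cts_along p (fun z => A.[z] * h z).
  by move=> ah; apply: cts_alongM => //; exact: cts_along_horner.
split.
- move=> h k ah ak; rewrite -(bddD Tb); [|exact: aA|exact: aA].
  apply: (bdd_ext Tb); first by apply: aA; exact: cts_alongD.
    by apply: cts_alongD; exact: aA.
  by move=> i; rewrite mulrDr.
- move=> a h ah; rewrite -(bddZ Tb); last exact: aA.
  apply: (bdd_ext Tb).
  + by apply: aA; apply: cts_alongM => //; exact: cts_along_cst.
  + by apply: cts_alongM; [exact: cts_along_cst|exact: aA].
  + by move=> i; rewrite mulrCA.
have [C C0 bC] := bddB Tb.
pose K := \sum_(j < size A) cabs (A`_j) * B ^+ j.
have K0 : 0 <= K by apply: sumr_ge0 => j _; rewrite mulr_ge0 ?cabs_ge0 ?exprn_ge0.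
exists (C * K); first exact: mulr_ge0.
move=> h M ah M0 hM; rewrite -mulrA; apply: bC; [exact: aA|exact: mulr_ge0|move=> i].
rewrite cabsM ler_pM ?cabs_ge0// horner_coef (le_trans (cabs_sum _ _))//.
apply: ler_sum => j _; rewrite cabsM cabsX ler_wpM2l ?cabs_ge0//.
by rewrite lerXn2r ?nnegrE ?cabs_ge0.
Qed.

(** * Multivalued primitives along paths *)

Section Homogenization.
Variable R : realType.
Implicit Types (p q : {poly R[i]}) (a x : R[i]).

(** This is x^d p (a + 1/x): p in the coordinate x = 1 / (z - a), freed of denominators. With a
    common d, quotients of such polynomials keep their values. *)
Definition homog a (d : nat) p : {poly R[i]} :=
  \sum_(j < d.+1) p`_j *: ((a *: 'X + 1) ^+ j * 'X^(d - j)).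

Lemma homogE a d p x : (size p <= d.+1)%N -> x != 0 ->
  (homog a d p).[x] = x ^+ d * p.[a + x^-1].
Proof.
move=> sp x0; rewrite /homog horner_sum (horner_coef_wide _ sp) mulr_sumr.
apply: eq_bigr => j _; rewrite hornerZ hornerM horner_exp hornerXn !hornerE.
have jd : (j <= d)%N by rewrite -ltnS.
have -> : a * x + 1 = (a + x^-1) * x by rewrite mulrDl mulVf.
have -> : x ^+ d = x ^+ j * x ^+ (d - j) by rewrite -exprD subnKC.
rewrite exprMn /=; ring.
Qed.

Lemma homog0 a d p : (homog a d p).[0] = p`_d.
Proof.
rewrite /homog horner_sum (bigD1 ord_max)//= big1 ?addr0.
  by rewrite hornerZ hornerM horner_exp hornerD hornerZ hornerX hornerC mulr0 add0r expr1n subnn expr0 hornerC !mulr1.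
move=> j jd; rewrite hornerZ hornerM hornerXn expr0n.
have -> : (d - j == 0)%N = false.
  apply/negbTE; rewrite subn_eq0 -ltnNge; move: jd; rewrite -val_eqE /=.
  by have := ltn_ord j; rewrite ltnS leq_eqVlt => /orP[->|].
by rewrite !mulr0.
Qed.

(** With d the degree, x^d p (1/x) takes the leading coefficient as its value at 0, whereas for |x|
    <= 1 it is at most |p (1/x)|. *)
Lemma poly_infty0 p : (forall e : R, 0 < e -> exists M : R, forall x, M <= cabs x -> cabs (p.[x] : Cplx R) <= e) ->
  p = 0.
Proof.
move=> H; apply/eqP/negPn/negP => p0.
pose d := (size p).-1; have sp : (size p <= d.+1)%N by rewrite leqSpred.
have l0 : 0 < cabs (lead_coef p : Cplx R) by rewrite cabs_gt0 lead_coef_eq0.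
have e0 : 0 < cabs (lead_coef p : Cplx R) / 2 by rewrite divr_gt0.
have [M MH] := H _ e0.
have c : cts_at (fun x : Cplx R => (homog 0 d p).[x] : Cplx R) 0 by apply: cts_horner; exact: cts_id.
have [r r0 rH] := (nbhs_cabs (0 : Cplx R) _).1 (cts_cabs c e0).
pose x : R := Num.min (r / 2) (Num.min 1 (1 + `|M|)^-1).
have x0 : 0 < x by rewrite !lt_min divr_gt0//= ltr01 invr_gt0 ltr_pwDl.
have xr : x < r by rewrite gt_min; apply/orP; left; rewrite ltr_pdivrMr// ltr_pMr// ltr1n.
have x1 : x <= 1 by rewrite !ge_min lexx orbT.
have xM : M <= x^-1.
  apply: le_trans (ler_norm _) _.
  have : x <= (1 + `|M|)^-1 by rewrite !ge_min lexx !orbT.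
  rewrite -[leLHS]invrK lef_pV2 ?posrE ?invr_gt0 ?ltr_pwDl//.
  by move=> h; apply: le_trans h; rewrite lerDr.
have cx : cabs (x%:C : Cplx R) = x by rewrite cabs_real gtr0_norm.
have := rH (x%:C); rewrite sub0r cabsN cx => /(_ xr); rewrite homog0 homogE//; last first.
  by rewrite -cabs_gt0 cx.
have := MH (0 + (x%:C)^-1); rewrite add0r cabsV cx => /(_ xM) h1.
rewrite -/d -lead_coefE; set y := p.[_] in h1 *; move=> h2.
have := le_lt_trans (cabs_distC _ _) h2; rewrite cabsM cabsX cx.
have : x ^+ d * cabs (y : Cplx R) <= cabs (y : Cplx R).
  by rewrite ler_piMl ?cabs_ge0// exprn_ile1// ltW.
lra.
Qed.

End Homogenization.

(** * Primitives of rational functions by partial fractions *)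

Section Primitives.
Variables (R : realType) (D : {poly R[i]}).
Implicit Types (f g r : Cplx R -> Cplx R) (x e : Cplx R).

(* [S + sum_(y <- l) y.1 log (x - y.2)] is a multivalued primitive of [r]. *)
Definition has_prim r (S : Cplx R -> Cplx R) (l : seq (Cplx R * Cplx R)) : Prop :=
  (forall y, y \in l -> root D y.2) /\
  (forall x, D.[x] != 0 -> cdiff S x (r x - \sum_(y <- l) y.1 * (x - y.2)^-1)).

(** Partial fractions as a closure: what matters is stability under division by x - e and the
    existence of primitives, so no explicit decomposition is ever written down. *)
Inductive simple_fracs : (Cplx R -> Cplx R) -> Prop :=
| sf_poly p : simple_fracs (fun x => p.[x])
| sf_pole e m : root D e -> simple_fracs (fun x => (x - e)^-1 ^+ m.+1)
| sf_add f g : simple_fracs f -> simple_fracs g -> simple_fracs (fun x => f x + g x)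
| sf_scale c f : simple_fracs f -> simple_fracs (fun x => c * f x)
| sf_ext f g : simple_fracs f -> (forall x, D.[x] != 0 -> f x = g x) -> simple_fracs g.

Lemma nroot_sub x e : D.[x] != 0 -> root D e -> x - e != 0.
Proof.
move=> x0 /eqP De; rewrite subr_eq0; apply: contraNneq x0 => ->.
by rewrite De.
Qed.

(** Division of p by x - e leaves p(e) / (x - e). For distinct roots 1 / ((x - e') (x - e)) is a
    combination of simple fractions, and induction on the order of the pole at e' reduces to this
    case. *)
Lemma sf_div f e : simple_fracs f -> root D e -> simple_fracs (fun x => f x * (x - e)^-1).
Proof.
move=> sf De; elim: sf => {f}.
- move=> p; have /factor_theorem[q qE] : root (p - p.[e]%:P) e.
    by rewrite /root hornerD hornerN hornerC subrr.
  apply: (sf_ext (sf_add (sf_poly q) (sf_scale p.[e] (sf_pole 0 De)))) => x x0.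
  have xe := nroot_sub x0 De.
  have pE : p.[x] = q.[x] * (x - e) + p.[e].
    by have := congr1 (fun p => p.[x]) qE; rewrite hornerM hornerXsubC hornerD hornerN hornerC => <-; rewrite subrK.
  by rewrite pE expr1 mulrDl mulfK.
- move=> e' m De'; have [->|ee'] := eqVneq e' e.
    by apply: (sf_ext (sf_pole m.+1 De)) => x x0; rewrite -exprSr.
  have ne : e' - e != 0 by rewrite subr_eq0.
  elim: m => [|m IH].
    apply: (sf_ext (sf_scale (e' - e)^-1 (sf_add (sf_pole 0 De') (sf_scale (-1) (sf_pole 0 De))))) => x x0.
    have xe := nroot_sub x0 De; have xe' := nroot_sub x0 De'.
    by rewrite !expr1; field; rewrite xe xe' ne.
  apply: (sf_ext (sf_scale (e' - e)^-1 (sf_add (sf_pole m.+1 De') (sf_scale (-1) IH)))) => x x0.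
  have xe := nroot_sub x0 De; have xe' := nroot_sub x0 De'.
  rewrite (exprSr _ m.+1); set y := _ ^+ m.+1.
  by field; rewrite xe xe' ne.
- move=> f g _ h1 _ h2; apply: (sf_ext (sf_add h1 h2)) => x _.
  by rewrite mulrDl.
- move=> c f _ h; apply: (sf_ext (sf_scale c h)) => x _.
  by rewrite mulrA.
- move=> f g _ h fg; apply: (sf_ext h) => x x0.
  by rewrite fg.
Qed.

Lemma sf_prod (p : {poly R[i]}) (s : seq (Cplx R)) : (forall e, e \in s -> root D e) ->
  simple_fracs (fun x => p.[x] * (\prod_(e <- s) (x - e))^-1).
Proof.
elim: s => [|e s IH] h.
  by apply: (sf_ext (sf_poly p)) => x _; rewrite big_nil invr1 mulr1.
have h' e' : e' \in s -> root D e' by move=> es; apply: h; rewrite inE es orbT.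
have De : root D e by apply: h; rewrite inE eqxx.
apply: (sf_ext (sf_div (IH h') De)) => x _.
by rewrite big_cons invfM mulrA mulrAC.
Qed.

Lemma sf_prim f : simple_fracs f -> exists S l, has_prim f S l.
Proof.
elim=> {f}.
- move=> p; pose q := \poly_(j < (size p).+1) (if j is j'.+1 then p`_j' / j'.+1%:R else 0).
  exists (fun x => q.[x]), [::]; split => // x _; rewrite big_nil subr0.
  have -> : p = q^`(); last exact: cdiff_horner.
  apply/polyP => j; rewrite coef_deriv coef_poly ltnS.
  case: ltnP => jp; last by rewrite mul0rn nth_default.
  by rewrite -[RHS]mulr_natr mulfVK// pnatr_eq0.
- move=> e [|m] De.
    exists (fun=> 0), [:: (1, e)]; split => [y|x x0]; first by rewrite inE => /eqP ->.
    rewrite big_seq1 /= mul1r expr1 subrr; exact: cder_cst.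
  exists (fun x => - (m.+1%:R)^-1 * (x - e)^-1 ^+ m.+1), [::]; split => // x x0.
  rewrite big_nil subr0; have xe := nroot_sub x0 De.
  have c : cts_at (fun w : Cplx R => w - e) x by apply: ctsB; [exact: cts_id|exact: cts_cst].
  have d1 : cdiff (fun w : Cplx R => w - e) x 1.
    by rewrite -[X in cder _ _ _ X]subr0; apply: cderB; [exact: cder_id|exact: cder_cst].
  have d2 := cderV c xe d1.
  have d3 := cder_comp (ctsV (f := fun w : Cplx R => w - e) xe c) d2 (cdiff_horner 'X^(m.+1) _).
  have := cderZ (- (m.+1%:R)^-1) d3.
  rewrite derivXn hornerMn hornerXn => d4.
  apply: (cder_near (f := fun y : Cplx R => - (m.+1%:R)^-1 * 'X^(m.+1).[(y - e)^-1])).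
    by apply: near_all => y; rewrite hornerXn.
  move: d4; congr (cder _ _ _ _).
  rewrite -(mulr_natr ((x - e)^-1 ^+ m.+1.-1) m.+1) (exprSr _ m.+1) (exprSr _ m) /=.
  have n0 : m.+1%:R != 0 :> Cplx R by rewrite pnatr_eq0.
  move: n0; set k := m.+1%:R; set y := _ ^+ m; clearbody k y => k0.
  by field; rewrite xe k0.
- move=> f g _ [S1 [l1 [r1 h1]]] _ [S2 [l2 [r2 h2]]].
  exists (fun x => S1 x + S2 x), (l1 ++ l2); split.
    by move=> y; rewrite mem_cat => /orP[/r1|/r2].
  move=> x x0; have := cderD (h1 x x0) (h2 x x0); congr (cder _ _ _ _).
  by rewrite big_cat /=; ring.
- move=> c f _ [S1 [l1 [r1 h1]]].
  exists (fun x => c * S1 x), [seq (c * y.1, y.2) | y <- l1]; split.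
    by move=> y /mapP[z /r1 h ->].
  move=> x x0; have := cderZ c (h1 x x0); congr (cder _ _ _ _).
  rewrite big_map mulrBr mulr_sumr; congr (_ - _).
  by apply: eq_bigr => y _; rewrite mulrA.
- move=> f g _ [S1 [l1 [r1 h1]]] fg; exists S1, l1; split => // x x0.
  by rewrite -fg//; exact: h1.
Qed.

Lemma prim_exists (K : {poly R[i]}) (a : nat) : D != 0 ->
  exists S l, has_prim (fun x => K.[x] * (D.[x] ^+ a)^-1) S l.
Proof.
move=> D0; apply: sf_prim.
have [s sE] := closed_field_poly_normal D.
have rs e : e \in s -> root D e.
  by move=> es; rewrite sE rootZ ?lead_coef_eq0// root_prod_XsubC.
have rs' e : e \in flatten (nseq a s) -> root D e.
  by move=> /flattenP[t]; rewrite mem_nseq => /andP[_ /eqP ->] /rs.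
apply: (sf_ext (sf_scale (lead_coef D ^+ a)^-1 (sf_prod K rs'))) => x x0.
have -> : \prod_(e <- flatten (nseq a s)) (x - e) = (\prod_(e <- s) (x - e)) ^+ a.
  clear rs'; elim: a => [|a IH] /=; first by rewrite big_nil expr0.
  by rewrite big_cat /= IH exprS.
have -> : D.[x] = lead_coef D * \prod_(e <- s) (x - e).
  rewrite [in LHS]sE hornerZ horner_prod; congr (_ * _).
  by apply: eq_bigr => e _; rewrite hornerXsubC.
by rewrite exprMn invfM mulrCA.
Qed.

End Primitives.

(** * Increments of continuous logarithms *)

Section LogIncrement.
Variable R : realType.
Implicit Types (f g l : R -> Cplx R).

Definition log_of f l : Prop := continuous l /\ forall u, 0 <= u <= 1 -> cexp (l u) = f u.

(* The increment of a continuous logarithm; junk value [0] when there is none. *)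
Definition dlog f : Cplx R := xget 0 [set d | exists2 l, log_of f l & d = l 1 - l 0].

Lemma dlogE f l : log_of f l -> dlog f = l 1 - l 0.
Proof.
move=> [cl lE]; rewrite /dlog; case: xgetP => [d _ [m [cm mE] ->]|/(_ (l 1 - l 0))]; last first.
  by case; exists l.
apply: cexp_eq_path => // u hu; try exact: cl; try exact: cm.
by rewrite lE// mE.
Qed.

Lemma eq_dlog f g : (forall u, 0 <= u <= 1 -> f u = g u) -> dlog f = dlog g.
Proof.
move=> fg; rewrite /dlog; congr (xget _ _); apply/seteqP; split => d [l [cl lE] ->];
  by exists l => //; split => // u hu; rewrite lE// fg.
Qed.

Definition c01 (u : R) : R := Num.max 0 (Num.min 1 u).

Lemma c01P u : 0 <= c01 u <= 1.
Proof. by rewrite /c01 le_max lexx /= ge_max ler01 ge_min lexx. Qed.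

Lemma c01_id u : 0 <= u <= 1 -> c01 u = u.
Proof. by move=> /andP[u0 u1]; rewrite /c01 min_r// max_r. Qed.

Lemma c01_continuous : continuous c01.
Proof.
move=> x; have : {for x, continuous ((cst 0 : R -> R^o) \max (((cst 1) : R -> R^o) \min id))}.
  apply: continuous_max; first exact: cvg_cst.
  by apply: continuous_min; [exact: cvg_cst|exact: cvg_id].
exact.
Qed.

Lemma within_retract (T V W : topologicalType) (A : set T) (f : T -> V) (r : W -> T) :
  {within A, continuous f} -> continuous r -> (forall w, A (r w)) -> continuous (fun w => f (r w)).
Proof.
move=> /subspace_continuousP cf cr rA w B wB.
have h : nbhs w (fun v => A (r v) -> B (f (r v))) := cr w _ (cf _ (rA w) _ wB).
change (nbhs w (fun v => B (f (r v)))).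
by apply: filterS h => v; apply; exact: rA.
Qed.

Lemma log_ofP f : {within `[0, 1], continuous f} -> (forall u, 0 <= u <= 1 -> f u != 0) ->
  exists l, log_of f l.
Proof.
move=> cf f0; have c := @within_retract _ _ _ _ _ c01 cf c01_continuous.
have [||l [cl lE]] := @log_path _ (fun u => f (c01 u)).
- by apply: c => u; rewrite /= in_itv /= c01P.
- by move=> u; apply: f0; exact: c01P.
by exists l; split => // u hu; rewrite lE// c01_id.
Qed.

End LogIncrement.

(** * Evaluation of functions of paths on singular chains *)

Section Chains.
Variables (R : realType) (T : topologicalType).
Variable Phi : (R -> T) -> Cplx R.
Hypothesis Phi_ext : forall f g, {in `[0, 1], f =1 g} -> Phi f = Phi g.

Definition agree (f g : R -> T) : Prop := {in `[0, 1], f =1 g}.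

Lemma chain_sumE (s : seq (int * (R -> T))) h :
  (\sum_(x <- s) simplex_chain x.2 *~ x.1) h = \sum_(x <- s) x.1 *~ `[< agree x.2 h >]%:Z.
Proof.
elim: s => [|x s IH]; first by rewrite !big_nil.
rewrite !big_cons [LHS]/= -IH; congr (_ + _).
have -> : forall (c : chain R T) (n : int), (c *~ n) h = (c h) *~ n.
  move=> c [n|n]; rewrite /intmul /=; last congr (- _).
    by elim: n => // n IHn; rewrite !mulrS -IHn.
  by elim: n.+1 => // m IHn; rewrite !mulrS -IHn.
by rewrite /simplex_chain /agree !mulrzz mulrC.
Qed.

(** Makes the additive extension of [Phi] to chains well defined. All terms whose path agrees with
    the first one on [0, 1] are removed together: they share one value of [Phi], and their
    coefficients have sum 0. *)
Lemma chain_eval (s : seq (int * (R -> T))) :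
  \sum_(x <- s) simplex_chain x.2 *~ x.1 = 0 -> \sum_(x <- s) x.1%:~R * Phi x.2 = 0.
Proof.
move: {2}(size s) (leqnn (size s)) => n; elim: n s => [|n IH] [|[k f] s]//= sn H; try by rewrite big_nil.
pose P (x : int * (R -> T)) := `[< agree x.2 f >].
have asym g h : agree g h -> agree h g by move=> a u hu; rewrite a.
have atr g h j : agree g h -> agree h j -> agree g j by move=> a b u hu; rewrite a// b.
rewrite (bigID P) /= -[X in _ + X]big_filter.
have -> : \sum_(x <- (k, f) :: s | P x) x.1%:~R * Phi x.2 = 0.
  have := congr1 (fun c => c f) H; rewrite chain_sumE => E.
  have {}E : \sum_(x <- (k, f) :: s | P x) x.1 = 0.
    rewrite -[RHS]E big_mkcond /=; apply: eq_bigr => x _; rewrite /P.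
    by case: ifP => _; rewrite ?mulr1z ?mulr0z.
  rewrite -[RHS](mul0r (Phi f)) -[X in X * _](_ : (\sum_(x <- (k, f) :: s | P x) x.1)%:~R = 0); last by rewrite E.
  rewrite raddf_sum /= mulr_suml; apply: eq_bigr => x /asboolP h.
  by rewrite (Phi_ext h).
rewrite add0r; apply: IH.
  rewrite /= /P /=; have -> : `[< agree f f >] by apply/asboolP.
  by rewrite /= size_filter (leq_trans (count_size _ _)).
apply/funext => h; rewrite chain_sumE big_filter.
have [fh|fh] := pselect (agree h f).
  rewrite big1// => x nP; have -> : `[< agree x.2 h >] = false; last by rewrite mulr0z.
  by apply/asboolPn => a; move/asboolP: nP; apply; exact: atr fh.
have := congr1 (fun c => c h) H; rewrite chain_sumE (bigID P) /= big1 ?add0r// => x /asboolP a.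
have -> : `[< agree x.2 h >] = false; last by rewrite mulr0z.
apply/asboolPn => b; apply: fh; apply: atr a.
exact: asym.
Qed.

Lemma homologous_eval (X : set T) (g0 : R -> T) (I : Type) (w : seq I) (e : I -> R -> T) (c : I -> int) :
  (forall sigma : R * R -> T, {within @std_triangle R, continuous sigma} ->
     sigma @` @std_triangle R `<=` X ->
     Phi (fun u : R => sigma (1 - u, u)) - Phi (fun u : R => sigma (0, u)) + Phi (fun u : R => sigma (u, 0)) = 0) ->
  homologous_to_zero X (simplex_chain g0 - \sum_(i <- w) simplex_chain (e i) *~ c i) ->
  Phi g0 = \sum_(i <- w) (c i)%:~R * Phi (e i).
Proof.
move=> Hs [m [a [sigma [hs E]]]].
(* Minus the boundary of [sigma j] taken [a j] times, so that [s] lists a formal sum equal to 0. *)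
pose F (j : 'I_m) : seq (int * (R -> T)) :=
  [:: (- a j, fun u : R => sigma j (1 - u, u)); (a j, fun u : R => sigma j (0, u)); (- a j, fun u : R => sigma j (u, 0))].
pose s := (1, g0) :: [seq (- c i, e i) | i <- w] ++ flatten [seq F j | j <- index_enum 'I_m].
have := @chain_eval s; rewrite /s !big_cons !big_cat !big_map !big_flatten !big_map mul1r => H; apply/eqP; rewrite -subr_eq0; apply/eqP.
rewrite -[RHS]H.
  congr (_ + _); rewrite [X in _ = _ + X]big1 ?addr0.
    by rewrite -sumrN; apply: eq_bigr => i _; rewrite mulrNz mulNr.
  move=> j _; rewrite /F !big_cons big_nil /= addr0 !mulrNz !mulNr.
  have [h1 h2] := hs j; have := Hs _ h1 h2 => {}Hs.
  rewrite -[RHS](mulr0 (- (a j)%:~R)) -Hs; ring.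
rewrite mulr1z; have -> : \sum_(j <- w) simplex_chain (e j) *~ - c j = - \sum_(i <- w) simplex_chain (e i) *~ c i.
  by rewrite -sumrN; apply: eq_bigr => i _; rewrite mulrNz.
rewrite addrA E -big_split big1//= => j _.
rewrite /F !big_cons big_nil /= addr0 /simplex_boundary !mulrNz.
rewrite mulrzDl mulrzBl; set x := simplex_chain _; set y := simplex_chain _; set z := simplex_chain _.
by rewrite addrACA -addrA addrC; apply/funext => h /=; rewrite /GRing.add /GRing.opp /GRing.zero /=; ring.
Qed.

End Chains.

Lemma within_c01 (R : realType) (V : topologicalType) (f : R -> V) :
  {within `[0, 1], continuous f} -> continuous (fun u : R => f (c01 u)).
Proof.
move=> cf; apply: (within_retract cf (@c01_continuous R)) => u.
by rewrite /= in_itv /= c01P.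
Qed.

Lemma cts_Clog (R : realType) (T : topologicalType) (f : T -> Cplx R) (x : T) :
  0 < complex.Re (f x) -> cts_at f x -> cts_at (fun y => Clog (f y)) x.
Proof. by move=> f0 [cf]; split; exact: (cvg_Clog f0 cf). Qed.

(** * Increments of a multivalued primitive along a path *)

Section PathPrimitive.
Variables (R : realType) (D : {poly R[i]}) (r S : Cplx R -> Cplx R).
Variable l : seq (Cplx R * Cplx R).
Hypothesis rS : has_prim D r S l.
Implicit Types (f F : R -> Cplx R) (x e : Cplx R).

(** Plays the role of the integral of r dx over a path that is merely continuous. *)
Definition pathint f : Cplx R :=
  S (f 1) - S (f 0) + \sum_(y <- l) y.1 * dlog (fun u => f u - y.2).

Lemma eq_pathint f g : (forall u, 0 <= u <= 1 -> f u = g u) -> pathint f = pathint g.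
Proof.
move=> fg; rewrite /pathint !fg ?lexx ?ler01//; congr (_ + _).
by apply: eq_bigr => y _; congr (_ * _); apply: eq_dlog => u hu; rewrite fg.
Qed.

Lemma prim_neq0 x y : D.[x] != 0 -> y \in l -> x - y.2 != 0.
Proof. by move=> x0 /rS.1; exact: nroot_sub. Qed.

(* [F] is a primitive of [r] along the path [f]: its increments can be computed with any
   continuous logarithms [lam e] of [f - e] on a subinterval. *)
Definition along f F : Prop := forall a b (lam : Cplx R -> R -> Cplx R),
  0 <= a -> a <= b -> b <= 1 ->
  (forall y u, y \in l -> a <= u <= b -> cts_at (lam y.2) u /\ cexp (lam y.2 u) = f u - y.2) ->
  F b - F a = S (f b) - S (f a) + \sum_(y <- l) y.1 * (lam y.2 b - lam y.2 a).

Lemma along_exists f : {within `[0, 1], continuous f} ->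
  (forall u, 0 <= u <= 1 -> D.[f u] != 0) ->
  exists F, [/\ continuous F, pathint f = F 1 - F 0 & along f F].
Proof.
move=> cf f0; have cfc := within_c01 cf.
have fc0 u : D.[f (c01 u)] != 0 by apply: f0; exact: c01P.
(* One logarithm per pole and not per entry of [l], since [along] indexes logarithms by poles;
   points that are not poles receive a dummy. *)
pose P e m := forall y, y \in l -> y.2 = e -> log_of (fun u => f (c01 u) - e) m.
have hm e : exists m : R -> Cplx R, P e m.
  have [[y yl ye]|h] := pselect (exists2 y, y \in l & y.2 = e); last first.
    by exists (fun=> 0) => y yl ye; case: h; exists y.
  have [||m [cm mE]] := @log_path _ (fun u => f (c01 u) - e).
  - by apply: cts_continuous => u; apply: ctsB; [exact: ctsT|exact: cts_cst].
  - by move=> u; rewrite -ye; exact: prim_neq0.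
  by exists m => y' _ _; split.
pose m e := projT1 (cid (hm e)); have mP e : P e (m e) := projT2 (cid (hm e)).
exists (fun u => S (f (c01 u)) + \sum_(y <- l) y.1 * m y.2 u); split.
- apply: cts_continuous => u; apply: ctsD.
    apply: (cts_comp (f := fun u => f (c01 u))); first exact: ctsT.
    exact: cdiff_cts (rS.2 _ (fc0 u)).
  rewrite (_ : (fun u => _) = fun u => \sum_(y <- l) (if y \in l then y.1 * m y.2 u else 0)); last first.
    by apply/funext => v; apply: eq_big_seq => y ->.
  apply: (@cts_sum _ _ _ l (fun (y : Cplx R * Cplx R) v => if y \in l then y.1 * m y.2 v else 0)) => y.
  have [yl|yl] := boolP (y \in l); last exact: cts_cst.
  apply: ctsM; first exact: cts_cst.
  by apply: ctsT; case: (mP y.2 y yl erefl).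
- rewrite /pathint !c01_id ?lexx ?ler01//.
  rewrite opprD addrACA -sumrB; congr (_ + _); apply: eq_big_seq => y yl.
  rewrite -mulrBr; congr (_ * _); apply: dlogE.
  have [cm mE] := mP y.2 y yl erefl; split => // u hu.
  by rewrite mE// c01_id.
- move=> a b lam a0 ab b1 H.
  have ca : c01 a = a by rewrite c01_id// a0 (le_trans ab).
  have cb : c01 b = b by rewrite c01_id// b1 (le_trans a0).
  rewrite ca cb opprD addrACA -sumrB; congr (_ + _); apply: eq_big_seq => y yl.
  rewrite -mulrBr; congr (_ * _); have [cm mE] := mP y.2 y yl erefl.
  apply: cexp_eq_path => //.
  + by move=> u _; exact: cm.
  + by move=> u hu; case: (H y u yl hu) => [[]].
  + move=> u /andP[au ub]; have [_ ->] := H y u yl (introT andP (conj au ub)).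
    have hu : 0 <= u <= 1 by rewrite (le_trans a0 au) (le_trans ub b1).
    by rewrite mE// c01_id.
Qed.

(** A continuous logarithm of tau - e on the whole triangle turns the increments along the sides
    into differences of values at the vertices, which cancel. *)
Lemma pathint_boundary (tau : R * R -> Cplx R) : {within @std_triangle R, continuous tau} ->
  (forall q, std_triangle q -> D.[tau q] != 0) ->
  pathint (fun u : R => tau (1 - u, u)) - pathint (fun u : R => tau (0, u))
    + pathint (fun u : R => tau (u, 0)) = 0.
Proof.
move=> ct t0.
(* A retraction of the plane onto the triangle: positive parts, then division by their sum when it
   exceeds 1. Composition with it gives the everywhere continuous function that [log_lift]
   expects. *)
pose rho (q : R * R) : R * R :=
  let a := Num.max 0 q.1 in let b := Num.max 0 q.2 in let s := Num.max 1 (a + b) in (a / s, b / s).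
have rhoT q : std_triangle (rho q).
  rewrite /std_triangle /rho /=; set a := Num.max 0 q.1; set b := Num.max 0 q.2.
  have a0 : 0 <= a by rewrite le_max lexx.
  have b0 : 0 <= b by rewrite le_max lexx.
  have s0 : 0 < Num.max 1 (a + b) by rewrite lt_max ltr01.
  split; [exact: divr_ge0 a0 (ltW s0)|exact: divr_ge0 b0 (ltW s0)|].
  by rewrite -mulrDl ler_pdivrMr// mul1r le_max lexx orbT.
have rho_id q : std_triangle q -> rho q = q.
  case: q => x y [/= x0 y0 xy]; rewrite /rho /=.
  by rewrite (max_r x0) (max_r y0) (max_l xy) !divr1.
have cmax0 (g : R * R -> R) : continuous g -> continuous (fun q => Num.max 0 (g q)).
  move=> cg q; have : {for q, continuous ((cst 0 : R * R -> R^o) \max (g : R * R -> R^o))}.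
    by apply: continuous_max; [exact: cvg_cst|exact: cg].
  exact.
have crho : continuous rho.
  have c1 := cmax0 _ (fun q => @cvg_fst _ _ (nbhs q.1) (nbhs q.2) _).
  have c2 := cmax0 _ (fun q => @cvg_snd _ _ (nbhs q.1) (nbhs q.2) _).
  have cs : continuous (fun q : R * R => Num.max 1 (Num.max 0 q.1 + Num.max 0 q.2)).
    move=> q; have : {for q, continuous ((cst 1 : R * R -> R^o) \max ((fun q => Num.max 0 q.1 + Num.max 0 q.2) : R * R -> R^o))}.
      by apply: continuous_max; [exact: cvg_cst|apply: cvgD; [exact: c1|exact: c2]].
    exact.
  move=> q; have sq : Num.max 1 (Num.max 0 q.1 + Num.max 0 q.2) != 0.
    by rewrite gt_eqF// lt_max ltr01.
  apply: cvg_pt_pair; apply: cvgM; [exact: c1|apply: cvgV => //; exact: cs|exact: c2|apply: cvgV => //; exact: cs].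
have ctr : continuous (fun q => tau (rho q)) by exact: within_retract ct crho rhoT.
pose P e (m : R * R -> Cplx R) := forall y, y \in l -> y.2 = e -> continuous m /\
  forall a b, -1 <= a <= 1 -> -1 <= b <= 1 -> cexp (m (a, b)) = tau (rho (a, b)) - e.
have hm e : exists m : R * R -> Cplx R, P e m.
  have [[y yl ye]|h] := pselect (exists2 y, y \in l & y.2 = e); last first.
    by exists (fun=> 0) => y yl ye; case: h; exists y.
  have [||m [cm mE]] := @log_lift _ (fun q => tau (rho q) - e).
  - by apply: cts_continuous => q; apply: ctsB; [exact: ctsT|exact: cts_cst].
  - by move=> q; rewrite -ye; apply: prim_neq0 => //; exact: t0.
  by exists m => y' _ _; split.
pose m e := projT1 (cid (hm e)); have mP e : P e (m e) := projT2 (cid (hm e)).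
have itv (u : R) : 0 <= u <= 1 -> -1 <= u <= 1.
  by move=> /andP[u0 ->]; rewrite (le_trans _ u0)// lerN10.
have side (sg : R -> R * R) : continuous sg -> (forall u, 0 <= u <= 1 -> std_triangle (sg u)) ->
    pathint (fun u => tau (sg u)) = S (tau (sg 1)) - S (tau (sg 0)) +
      \sum_(y <- l) y.1 * (m y.2 (sg 1) - m y.2 (sg 0)).
  move=> csg sT; rewrite /pathint; congr (_ + _); apply: eq_big_seq => y yl; congr (_ * _).
  have [cm mE] := mP y.2 y yl erefl; apply: (dlogE (l := fun u => m y.2 (sg u))); split.
    by move=> u; apply: (cvg_map (h := m y.2)); [exact: cm|exact: csg].
  move=> u hu; have := sT u hu; rewrite -{3}(rho_id _ (sT u hu)).
  case: (sg u) => a b [/= a0 b0 ab]; apply: mE; apply: itv.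
    by rewrite a0 /= (le_trans _ ab)// lerDl.
  by rewrite b0 /= (le_trans _ ab)// lerDr.
have cid1 (u : R) : (id : R -> R) v @[v --> u] --> u by exact: cvg_id.
rewrite (side (fun u => (1 - u, u))); last 2 first.
- move=> u; apply: cvg_pt_pair; last exact: cvg_id.
  by apply: cvgB; [exact: cvg_cst|exact: cvg_id].
- by move=> u /andP[u0 u1]; split => //=; rewrite ?subr_ge0// subrK.
rewrite (side (fun u => (0, u))); last 2 first.
- by move=> u; apply: cvg_pt_pair; [exact: cvg_cst|exact: cvg_id].
- by move=> u /andP[u0 u1]; split => //=; rewrite add0r.
rewrite (side (fun u => (u, 0))); last 2 first.
- by move=> u; apply: cvg_pt_pair; [exact: cvg_id|exact: cvg_cst].
- by move=> u /andP[u0 u1]; split => //=; rewrite addr0.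
rewrite subrr subr0.
have -> : \sum_(y <- l) y.1 * (m y.2 (0, 1) - m y.2 (1, 0)) =
   \sum_(y <- l) y.1 * (m y.2 (0, 1) - m y.2 (0, 0)) - \sum_(y <- l) y.1 * (m y.2 (1, 0) - m y.2 (0, 0)).
  by rewrite -sumrB; apply: eq_bigr => y _; ring.
ring.
Qed.

(** A single-valued primitive on a disc around x0 without roots of D: there each quotient (x - e) /
    (x0 - e) is at distance less than 1 from 1, where [Clog] is a logarithm. *)
Definition loc_prim x0 x : Cplx R :=
  S x + \sum_(y <- l) y.1 * Clog ((x - y.2) / (x0 - y.2)).

Section Local.
Variables (x0 : Cplx R) (eta : R).
Hypothesis D0 : forall x, cabs (x0 - x) < eta -> D.[x] != 0.

Lemma loc_Re x y : cabs (x0 - x) < eta -> y \in l -> 0 < complex.Re ((x - y.2) / (x0 - y.2)).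
Proof.
move=> hx yl; have eta0 : 0 < eta by apply: le_lt_trans hx; exact: cabs_ge0.
have x00 : x0 - y.2 != 0 by apply: prim_neq0 => //; apply: D0; rewrite subrr cabs0.
apply: Re_near1; have -> : 1 - (x - y.2) / (x0 - y.2) = (x0 - x) / (x0 - y.2) by field.
rewrite cabsM cabsV ltr_pdivrMr ?cabs_gt0// mul1r (lt_le_trans hx)// leNgt.
apply/negP => /D0; have /eqP -> := rS.1 y yl; by rewrite eqxx.
Qed.

Lemma loc_prim_diff x : cabs (x0 - x) < eta -> cdiff (loc_prim x0) x (r x).
Proof.
move=> hx; have eta0 : 0 < eta by apply: le_lt_trans hx; exact: cabs_ge0.
have -> : r x = (r x - \sum_(y <- l) y.1 * (x - y.2)^-1) + \sum_(y <- l) y.1 * (x - y.2)^-1.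
  by rewrite subrK.
apply: cderD; first by apply: rS.2; exact: D0.
pose g (y : Cplx R * Cplx R) (w : Cplx R) : Cplx R :=
  if y \in l then y.1 * Clog ((w - y.2) / (x0 - y.2)) else 0.
have -> : (fun w => \sum_(y <- l) y.1 * Clog ((w - y.2) / (x0 - y.2))) = fun w => \sum_(y <- l) g y w.
  by apply/funext => w; apply: eq_big_seq => y yl; rewrite /g yl.
have -> : \sum_(y <- l) y.1 * (x - y.2)^-1 = \sum_(y <- l) (if y \in l then y.1 * (x - y.2)^-1 else 0).
  by apply: eq_big_seq => y ->.
apply: cder_sum => y; rewrite /g; case: ifP => yl; last exact: cder_cst.
apply: cderZ.
have x00 : x0 - y.2 != 0 by apply: prim_neq0 => //; apply: D0; rewrite subrr cabs0.
have xy : x - y.2 != 0 by apply: prim_neq0 => //; exact: D0.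
pose q (w : Cplx R) := (x0 - y.2)^-1 * (w - y.2).
have dq : cdiff q x ((x0 - y.2)^-1 * (1 - 0)).
  by apply: cderZ; apply: cderB; [exact: cder_id|exact: cder_cst].
have qE w : (w - y.2) / (x0 - y.2) = q w by rewrite mulrC.
apply: (cder_near (f := fun w => Clog (q w))); first by apply: near_all => w; rewrite -qE.
have -> : (x - y.2)^-1 = (x0 - y.2)^-1 * (1 - 0) / q x.
  by rewrite /q; field; rewrite xy x00.
have cq := cdiff_cts dq.
have near_x : \forall w \near x, cabs (x0 - w) < eta.
  apply/nbhs_cabs; exists (eta - cabs (x0 - x)); first by rewrite subr_gt0.
  move=> w hw; have := cabsD (x0 - x) (x - w); rewrite addrA subrK => h.
  by apply: le_lt_trans h _; rewrite -ltrBrDl.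
apply: (cder_log (g := q)) => //.
  by apply: cts_Clog => //; rewrite -qE; exact: loc_Re.
by apply: filterS near_x => w hw; rewrite cexp_Clog// -qE; exact: loc_Re.
Qed.

Lemma along_local f F a b : {within `[0, 1], continuous f} -> along f F ->
  0 <= a -> a <= b -> b <= 1 -> (forall u, a <= u <= b -> cabs (x0 - f u) < eta) ->
  F b - F a = loc_prim x0 (f b) - loc_prim x0 (f a).
Proof.
move=> cf aF a0 ab b1 H.
have cfc := within_c01 cf.
(* The logarithm of the quotient becomes one of f - e after adding a constant logarithm of x0 -
   e. *)
have := aF a b (fun e u => Clog ((f (c01 u) - e) / (x0 - e)) + xget 0 [set v | cexp v = x0 - e]) a0 ab b1.
move=> ->.
  have ca : c01 a = a by rewrite c01_id// a0 (le_trans ab).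
  have cb : c01 b = b by rewrite c01_id// b1 (le_trans a0).
  rewrite /loc_prim ca cb opprD addrACA -sumrB; congr (_ + _).
  by apply: eq_bigr => y _; ring.
move=> y u yl hu.
have u01 : c01 u = u.
  by case/andP: hu => au ub; rewrite c01_id// (le_trans a0 au) (le_trans ub b1).
have hx := H u hu.
have eta0 : 0 < eta by apply: le_lt_trans hx; exact: cabs_ge0.
have x00 : x0 - y.2 != 0 by apply: prim_neq0 => //; apply: D0; rewrite subrr cabs0.
have re := loc_Re hx yl.
split.
  apply: ctsD; last exact: cts_cst.
  apply: cts_Clog; first by rewrite u01.
  by apply: ctsM; [apply: ctsB; [exact: ctsT|exact: cts_cst]|exact: cts_cst].
rewrite cexpD cexp_Clog ?u01//; case: xgetP => [v _ ->|/= h].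
  by rewrite mulfVK.
by have [v vE] := cexp_surj x00; case: (h v).
Qed.

End Local.

(** Near u the primitive F differs from [loc_prim] along f by a constant only. *)
Lemma along_rdiff f F (u : R) (d : Cplx R) : {within `[0, 1], continuous f} -> along f F ->
  D.[f u] != 0 -> 0 < u < 1 -> rdiff f u d -> rdiff F u (r (f u) * d).
Proof.
move=> cf aF f0 /andP[u0 u1] df; have cfu := rdiff_cts df.
have cD : cts_at (fun w : Cplx R => D.[w] : Cplx R) (f u) by apply: cts_horner; exact: cts_id.
have [eta eta0 etaP] := (nbhs_cabs _ _).1 (cts_neq0 cD f0).
have dG := cder_comp cfu df (loc_prim_diff etaP (x := f u) _).
have {}dG := dG ltac:(by rewrite subrr cabs0).
have [e /= e0 eP] := (nbhs_ballP _ _).1 (cts_cabs cfu eta0).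
pose e1 := Num.min e (Num.min u (1 - u)).
have e10 : 0 < e1 by rewrite !lt_min e0 u0 subr_gt0.
have {}dG : rdiff (fun v => loc_prim (f u) (f v) + (F u - loc_prim (f u) (f u))) u (r (f u) * d + 0).
  by apply: cderD => //; exact: cder_cst.
rewrite addr0 in dG; apply: cder_near dG; apply/nbhs_ballP; exists e1 => // v.
rewrite /ball /= !lt_min => /andP[ve /andP[vu v1]].
have bd w : `|u - w| <= `|u - v| -> cabs (f u - f w) < eta.
  by move=> h; apply: eP; rewrite /ball /=; exact: le_lt_trans h ve.
have v01 : 0 <= v <= 1.
  move: vu v1; rewrite !ltr_norml => /andP[_ h1] /andP[h2 _]; lra.
case/andP: v01 => v0' v1'; have [uv|vu'] := leP u v.
  have h w : u <= w <= v -> cabs (f u - f w) < eta.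
    by move=> /andP[uw wv]; apply: bd; rewrite !ler0_norm ?subr_le0//; lra.
  have := along_local etaP cf aF (ltW u0) uv v1' h; move=> E.
  by rewrite addrCA -E addrC subrK.
have h w : v <= w <= u -> cabs (f u - f w) < eta.
  by move=> /andP[vw wu]; apply: bd; rewrite !ger0_norm ?subr_ge0//; lra.
have := along_local etaP cf aF v0' (ltW vu') (ltW u1) h; move=> E.
apply/eqP; rewrite -subr_eq0; apply/eqP.
have -> : loc_prim (f u) (f v) + (F u - loc_prim (f u) (f u)) - F v =
  (F u - F v) - (loc_prim (f u) (f u) - loc_prim (f u) (f v)) by ring.
by rewrite E subrr.
Qed.

End PathPrimitive.

Notation bdd_on X := (bdd_functional (fun i : {z | X z} => sval i)).

(** * The complement of a star *)

Section BddOps.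
Variables (R : realType) (I : Type) (p : I -> Cplx R).
Implicit Types T : (Cplx R -> Cplx R) -> Cplx R.

Lemma bdd_zero : bdd_functional p (fun=> 0).
Proof.
split; [by move=> h k _ _; rewrite addr0|by move=> a h _; rewrite mulr0|].
by exists 0 => // h M _ _ _; rewrite cabs0 mul0r.
Qed.

Lemma bdd_add T1 T2 : bdd_functional p T1 -> bdd_functional p T2 ->
  bdd_functional p (fun h => T1 h + T2 h).
Proof.
move=> b1 b2; split.
- by move=> h k ah ak; rewrite (bddD b1)// (bddD b2)// addrACA.
- by move=> a h ah; rewrite (bddZ b1)// (bddZ b2)// mulrDr.
have [C1 C10 H1] := bddB b1; have [C2 C20 H2] := bddB b2.
exists (C1 + C2); first exact: addr_ge0.
move=> h M ah M0 hM; apply: le_trans (cabsD _ _) _.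
by rewrite mulrDl lerD ?H1 ?H2.
Qed.

Lemma bdd_scale (a : Cplx R) T : bdd_functional p T -> bdd_functional p (fun h => a * T h).
Proof.
move=> b; split.
- by move=> h k ah ak; rewrite (bddD b)// mulrDr.
- by move=> c h ah; rewrite (bddZ b)// mulrCA.
have [C C0 H] := bddB b; exists (cabs a * C); first by rewrite mulr_ge0 ?cabs_ge0.
by move=> h M ah M0 hM; rewrite cabsM -mulrA ler_wpM2l ?cabs_ge0 ?H.
Qed.

Lemma bdd_sum (J : Type) (s : seq J) (T : J -> (Cplx R -> Cplx R) -> Cplx R) :
  (forall j, bdd_functional p (T j)) -> bdd_functional p (fun h => \sum_(j <- s) T j h).
Proof.
move=> H; elim: s => [|j s IH].
  have -> : (fun h => \sum_(j <- [::]) T j h) = fun=> 0 by apply/funext => h; rewrite big_nil.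
  exact: bdd_zero.
have -> : (fun h => \sum_(j <- j :: s) T j h) = fun h => T j h + \sum_(j <- s) T j h.
  by apply/funext => h; rewrite big_cons.
exact: bdd_add.
Qed.

End BddOps.

Lemma bdd_sub (R : realType) (X Y : set (Cplx R)) T : X `<=` Y -> bdd_on X T -> bdd_on Y T.
Proof.
move=> XY b.
have ad h : cts_along (fun i : {z | Y z} => sval i) h -> cts_along (fun i : {z | X z} => sval i) h.
  by move=> ah [z Xz] /=; exact: (ah (exist _ z (XY z Xz))).
split.
- by move=> h k ah ak; rewrite (bddD b)//; exact: ad.
- by move=> a h ah; rewrite (bddZ b)//; exact: ad.
have [C C0 H] := bddB b; exists C => // h M ah M0 hM; apply: H => //; first exact: ad.
by move=> [z Xz] /=; exact: (hM (exist _ z (XY z Xz))).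
Qed.

Definition fnl (R : realType) (p g : R -> Cplx R) (h : Cplx R -> Cplx R) : Cplx R :=
  cint 0 1 (fun u => h (p u) * g u).

Lemma bdd_fnl (R : realType) (X : set (Cplx R)) (p g : R -> Cplx R) :
  (forall u, 0 <= u <= 1 -> cts_at p u) -> (forall u, 0 <= u <= 1 -> X (p u)) ->
  citgl 0 1 g -> bdd_on X (fnl p g).
Proof.
move=> cp Xp ig.
have chp h : cts_along (fun i : {z | X z} => sval i) h -> forall u, 0 <= u <= 1 -> cts_at (fun u => h (p u)) u.
  move=> ah u hu; apply: (cts_comp (f := p) (g := h)); first exact: cp.
  exact: (ah (exist _ (p u) (Xp u hu))).
have ih h ah := citglM (chp h ah) ig.
split.
- move=> h k ah ak; rewrite /fnl -cintD; [|exact: ih|exact: ih].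
  by apply: eq_cint => u _; rewrite mulrDl.
- move=> a h ah; rewrite /fnl -cintZ; last exact: ih.
  by apply: eq_cint => u _; rewrite mulrA.
pose G (u : R) := `|complex.Re (g u)| + `|complex.Im (g u)|.
have iG := citgl_cabs ig.
exists (2 * \int[lebesgue_measure]_(x in `[0, 1]) G x).
  by rewrite mulr_ge0// Rintegral_ge0// => u _; rewrite addr_ge0.
move=> h M ah M0 hM; rewrite -mulrA (mulrC _ M) -RintegralZl//.
apply: cint_le; [exact: ih|exact: itglZ|move=> u hu].
rewrite cabsM ler_pM ?cabs_ge0 ?cabs_le_ReIm//.
exact: (hM (exist _ (p u) (Xp u hu))).
Qed.

(** * Escape to infinity off a compact set that carries logarithms *)

Section Escape.
Variable R : realType.
Implicit Types (S K : set (Cplx R)) (t z w : Cplx R).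

Lemma cts_cabsf (T : topologicalType) (f : T -> Cplx R) x : cts_at f x -> cts_at (fun y => cabs (f y)) x.
Proof. by move=> [cf]; split; exact: (cvg_cabs_comp cf). Qed.

Lemma compact_cabs_bounded S : compact S -> exists2 B : R, 0 < B & forall z, S z -> cabs z <= B.
Proof.
move=> cS; have [S0|S0] := pselect (S !=set0); last first.
  by exists 1 => // z Sz; case: S0; exists z.
have [|] := @compact_EVT_max _ R (fun z : Cplx R => cabs z) S S0 cS.
  apply: continuous_subspaceT; apply: cts_continuous => z.
  exact: cts_cabsf (cts_id z).
move=> c _ cP; exists (cabs c + 1); first by rewrite ltr_wpDl ?cabs_ge0.
by move=> z Sz; rewrite (le_trans (cP z _)) ?inE// lerDl.
Qed.

(** Compactness is asked besides connectedness, so that K keeps a positive distance from S. *)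
Definition linked S t z := exists K, [/\ connected K, compact K, K `<=` ~` S, K t & K z].

Lemma seg_connected z w : connected [set z + rc u * (w - z) | u in `[0, 1]].
Proof.
apply: connected_continuous_connected; first exact: segment_connected.
by apply: continuous_subspaceT; apply: cts_continuous => u; exact: seg_cts.
Qed.

Lemma seg_compact z w : compact [set z + rc u * (w - z) | u in `[0, 1]].
Proof.
apply: continuous_compact; last exact: segment_compact.
by apply: continuous_subspaceT; apply: cts_continuous => u; exact: seg_cts.
Qed.

Lemma linked_refl S t : ~ S t -> linked S t t.
Proof.
move=> St; exists [set t]; split => //; [exact: connected1|exact: compact_set1|by move=> z ->].
Qed.

Lemma linked_seg S t z w : linked S t z ->
  (forall u, 0 <= u <= 1 -> ~ S (z + rc u * (w - z))) -> linked S t w.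
Proof.
move=> [C0 [cC kC CS Ct Cz]] H; exists (C0 `|` [set z + rc u * (w - z) | u in `[0, 1]]); split.
- apply: connectedU => //; last exact: seg_connected.
  exists z; split => //; exists 0; first by rewrite /= in_itv /= lexx ler01.
  by rewrite /rc mul0r addr0.
- by apply: compactU => //; exact: seg_compact.
- by move=> y [/CS//|[u hu <-]]; apply: H; move: hu; rewrite /= in_itv.
- by left.
right; exists 1; first by rewrite /= in_itv /= lexx ler01.
by rewrite /rc mul1r addrC subrK.
Qed.

Lemma linked_ball S t z w (e : R) : (forall y, cabs (z - y) < e -> ~ S y) ->
  cabs (z - w) < e -> linked S t z -> linked S t w.
Proof.
move=> H hw /linked_seg; apply => u /andP[u0 u1]; apply: H.
rewrite opprD addrA subrr add0r cabsN cabsM cabsB cabs_real ger0_norm//.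
by apply: le_lt_trans hw; rewrite ler_piMl ?cabs_ge0.
Qed.

Definition cts_on S (f : Cplx R -> Cplx R) := forall z (e : R), S z -> 0 < e ->
  \forall w \near z, S w -> cabs (f z - f w) < e.

Lemma tietze S (f : Cplx R -> Cplx R) : compact S -> cts_on S f ->
  exists g : Cplx R -> Cplx R, continuous g /\ forall z, S z -> g z = f z.
Proof.
move=> cS cf.
pose j (q : R * R) : Cplx R := q.1 +i* q.2.
have cj : continuous j.
  by apply: continuous_ReIm => q; [exact: cvg_fst|exact: cvg_snd].
have clS : closed (j @^-1` S).
  apply: preimage_closed; first by move=> q _; exact: cj.
  by apply: compact_closed => //; exact: Cplx_hausdorff.
have cfS : {within S, continuous f}.
  apply/subspace_continuousP => z Sz; apply/cvg_cabs => e e0.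
  by rewrite near_withinE; exact: cf.
have [B B0 hB] := compact_cabs_bounded (continuous_compact cfS cS).
have ext (pr : Cplx R -> R) : (forall z w, `|pr z - pr w| <= cabs (z - w)) -> pr 0 = 0 ->
    exists g : R * R -> R, continuous g /\ forall q, S (j q) -> g q = pr (f (j q)).
  move=> prl pr0.
  have [|||g [gE cg _]] := @continuous_bounded_extension (R * R)%type R _ _ clS (fun q => pr (f (j q))) B B0.
  - exact: pseudometric_normal.
  - apply/subspace_continuousP => q Sq; apply/cvgrPdist_lt => e e0.
    rewrite near_withinE.
    have h : nbhs q (fun q' => S (j q') -> cabs (f (j q) - f (j q')) < e) := cj q _ (cf _ e Sq e0).
    by apply: filterS h => q' /= h Sq'; exact: le_lt_trans (prl _ _) (h Sq').
  - move=> q Sq; rewrite -[pr _]subr0 -pr0; apply: le_trans (prl _ _) _.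
    by rewrite subr0; apply: hB; exists (j q).
  by exists g; split => // q Sq; rewrite -gE ?inE.
have [g1 [cg1 g1E]] := ext (fun z => complex.Re z) (fun z w => ltac:(by rewrite -raddfB; exact: cabs_Re)) erefl.
have [g2 [cg2 g2E]] := ext (fun z => complex.Im z) (fun z w => ltac:(by rewrite -raddfB; exact: cabs_Im)) erefl.
have cRI : continuous (fun z : Cplx R => (complex.Re z, complex.Im z) : R * R).
  move=> z; have h1 := cts_atP (cts_Re (cts_id z)); have h2 := cts_atP (cts_Im (cts_id z)).
  exact: (cvg_pt_pair h1 h2).
have jE z : j (complex.Re z, complex.Im z) = z by case: z.
exists (fun z => g1 (complex.Re z, complex.Im z) +i* g2 (complex.Re z, complex.Im z)); split.
  apply: continuous_ReIm => z.
    exact: (cvg_map (cg1 _) (cRI z)).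
  exact: (cvg_map (cg2 _) (cRI z)).
by move=> z Sz; rewrite g1E ?g2E ?jE//; case: (f z).
Qed.

Lemma cts_cexp (T : topologicalType) (f : T -> Cplx R) x : cts_at f x -> cts_at (fun y => cexp (f y)) x.
Proof. by move=> [cf]; split; exact: (cvg_cexp cf). Qed.

Lemma compact_complement_ball S z : compact S -> ~ S z -> exists2 e : R, 0 < e & forall y, cabs (z - y) < e -> ~ S y.
Proof.
move=> cS Sz; have oS : open (~` S).
  by apply: closed_openC; apply: compact_closed => //; exact: Cplx_hausdorff.
exact: ((nbhs_cabs z (~` S)).1 (open_nbhs_nbhs (conj oS Sz))).
Qed.

(* Winding number: a nowhere zero function on a disc has a logarithm, whereas z - t
   has none on a circle around t. *)
Lemma no_extension (h : Cplx R -> Cplx R) t (r : R) : continuous h -> (forall z, h z != 0) ->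
  cabs t < r -> (forall z, cabs z = r -> h z = z - t) -> False.
Proof.
move=> ch h0 tr hr; have r0 : 0 < r by apply: le_lt_trans tr; exact: cabs_ge0.
pose e (x : R) : Cplx R := cexp (0 +i* (pi * x)).
have ce (x : R) : cts_at e x.
  apply: cts_cexp; apply: cts_ReIm; split; first exact: cvg_cst.
  by apply: cvgM; [exact: cvg_cst|exact: cvg_id].
have e1 : e 1 = e (-1).
  by rewrite /e /cexp /= mulrN !mulr1 cosN sinN sinpi oppr0.
have ae x : cabs (e x) = 1 by rewrite cabs_cexp /= expR0.
(* Polar coordinates: r q.1 is the radius and pi q.2 the angle. At radius 0 the function does not
   depend on the angle, and the rays q.2 = 1 and q.2 = -1 coincide, so the increment of the
   logarithm around the boundary circle is 0. *)
pose G (q : R * R) := h (rc (r * q.1) * e q.2).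
have cG : continuous G.
  move=> q; apply: (cvg_map (h := h)); first exact: ch.
  apply: cvgC_M.
    apply: cvg_real; apply: cvgM; [exact: cvg_cst|exact: cvg_fst].
  by apply: (cvg_map (h := e)); [exact: (cts_atP (ce _))|exact: cvg_snd].
have [l [cl lE]] := log_lift cG (fun q => h0 _).
have cl1 (y u : R) : {for u, continuous (fun x : R => l (x, y))}.
  by apply: (cvg_map (h := l)); [exact: cl|apply: cvg_pt_pair; [exact: cvg_id|exact: cvg_cst]].
have cl2 (x u : R) : {for u, continuous (fun y : R => l (x, y))}.
  by apply: (cvg_map (h := l)); [exact: cl|apply: cvg_pt_pair; [exact: cvg_cst|exact: cvg_id]].
have I1 : -1 <= (1 : R) <= 1 by lra.
have I0 : -1 <= (0 : R) <= 1 by lra.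
have In : -1 <= (-1 : R) <= 1 by lra.
have E0 : l (0, 1) - l (0, -1) = l (0, -1) - l (0, -1).
  apply: (cexp_eq_path (l := fun y => l (0, y)) (m := fun=> l (0, -1))).
  - by lra.
  - by move=> u _; exact: cl2.
  - by move=> u _; exact: cvg_cst.
  by move=> u hu; rewrite !lE// /G /= mulr0 /rc !mul0r.
have E1 : l (1, 1) - l (0, 1) = l (1, -1) - l (0, -1).
  apply: (cexp_eq_path (l := fun x => l (x, 1)) (m := fun x => l (x, -1))) => //.
  move=> u /andP[u0 u1]; have hu : -1 <= u <= 1 by rewrite u1 andbT; lra.
  by rewrite !lE// /G /= e1.
have r0' : rc r != 0 :> Cplx R by rewrite -cabs_eq0 cabs_real gt_eqF// normr_gt0 gt_eqF.
have [w0 w0E] := cexp_surj r0'.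
(* A logarithm of z - t on the circle, written log (1 - t / z) + log z with |t / z| < 1; it
   increases by 2 pi i around the circle. *)
pose m (x : R) : Cplx R := Clog (1 - t / (rc r * e x)) + (0 +i* (pi * x)) + w0.
have n1 (x : R) : 0 < complex.Re (1 - t / (rc r * e x)).
  apply: Re_near1; rewrite opprB addrCA subrr addr0 cabsM cabsV cabsM ae mulr1 cabs_real.
  by rewrite ger0_norm ?ltW// ltr_pdivrMr// mul1r.
have E2 : l (1, 1) - l (1, -1) = m 1 - m (-1).
  apply: (cexp_eq_path (l := fun y => l (1, y)) (m := m)).
  - by lra.
  - by move=> u _; exact: cl2.
  - move=> u _; apply: (cts_atP (f := m)); apply: ctsD; last exact: cts_cst.
    apply: ctsD.
      apply: cts_Clog => //; apply: ctsB; first exact: cts_cst.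
      apply: ctsM; first exact: cts_cst.
      apply: ctsV; first by rewrite mulf_neq0 ?cexp_neq0.
      by apply: ctsM; [exact: cts_cst|exact: ce].
    apply: cts_ReIm; split; first exact: cvg_cst.
    by apply: cvgM; [exact: cvg_cst|exact: cvg_id].
  move=> u hu; rewrite lE// /G /= mulr1 hr; last first.
    by rewrite cabsM ae mulr1 cabs_real ger0_norm ?ltW.
  rewrite !cexpD w0E cexp_Clog// -/(e u).
  have eu : e u != 0 := cexp_neq0 _.
  have id (x y z : Cplx R) : x != 0 -> y != 0 -> x * y - z = (1 - z / (x * y)) * y * x.
    by move=> x0 y0; field; rewrite x0 y0.
  exact: id.
have : m 1 - m (-1) = 0.
  rewrite -E2; have id (a b c d : Cplx R) : a - b = b - b -> c - a = d - b -> c - d = 0.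
    by rewrite subrr => /subr0_eq -> /addIr ->; rewrite subrr.
  exact: id E0 E1.
have sub4 (a x y w : Cplx R) : a + x + w - (a + y + w) = x - y by ring.
rewrite /m e1 sub4 => /(congr1 (@complex.Im R)) /= H.
have : (pi : R) = 0 by move: H; lra.
by move/eqP; rewrite gt_eqF// pi_gt0.
Qed.

(** Eilenberg's criterion. Were the part linked to t bounded, one could extend the logarithm by
    Tietze, use its exponential on this part and keep z - t elsewhere. The two agree on S, so the
    result is continuous; it has no zero because t is linked to itself. This contradicts
    [no_extension]. *)
Lemma log_escape S t lam (rho : R) : compact S -> ~ S t -> cts_on S lam ->
  (forall z, S z -> cexp (lam z) = z - t) -> exists z, linked S t z /\ rho < cabs z.
Proof.
move=> cS St cl lE; apply: contrapT => H.
have bd z : linked S t z -> cabs z <= rho.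
  by move=> L; rewrite leNgt; apply/negP => h; apply: H; exists z.
have [g [cg gE]] := tietze cS cl.
pose h z : Cplx R := if `[< linked S t z >] then cexp (g z) else z - t.
have hL z : linked S t z -> h z = cexp (g z) by move=> L; rewrite /h asboolT.
have hN z : ~ linked S t z -> h z = z - t by move=> L; rewrite /h asboolF.
have ccg z : cts_at (fun z => cexp (g z)) z by apply: cts_cexp; exact: ctsT.
have ct z : cts_at (fun z => z - t) z by apply: ctsB; [exact: cts_id|exact: cts_cst].
(* The circle has to surround t and to lie outside everything linked to t, which has modulus at most
   rho. *)
apply: (@no_extension h t (Num.max (rho + 1) (cabs t + 1))).
- apply: cts_continuous => z; have [Sz|Sz] := pselect (S z).
    have nL : ~ linked S t z by move=> [K [_ _ KS _ Kz]]; exact: (KS z Kz).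
    apply: cts_atE => e e0; have h1 := cts_cabs (ccg z) e0; have h2 := cts_cabs (ct z) e0.
    apply: filterS2 h1 h2 => w; rewrite (hN z)// gE// lE// => h1 h2.
    by have [L|L] := pselect (linked S t w); [rewrite hL|rewrite hN].
  have [e e0 eP] := compact_complement_ball cS Sz.
  have near2 : \forall w \near z, cabs (z - w) < e / 2.
    by apply/nbhs_cabs; exists (e / 2) => //; rewrite divr_gt0.
  have [L|L] := pselect (linked S t z).
    apply: cts_near (ccg z); apply: filterS near2 => w hw; rewrite hL//.
    by apply: linked_ball eP _ L; lra.
  apply: cts_near (ct z); apply: filterS near2 => w hw; rewrite hN// => Lw; apply: L.
  apply: (@linked_ball _ _ w _ (e / 2)) => //; last by rewrite cabsB.
  move=> y hy; apply: eP; have := cabsD (z - w) (w - y).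
  by rewrite addrA subrK; lra.
- move=> z; have [L|L] := pselect (linked S t z); first by rewrite hL// cexp_neq0.
  by rewrite hN// subr_eq0; apply/eqP => zt; apply: L; rewrite zt; exact: linked_refl.
- by rewrite lt_max ltrDl ltr01 orbT.
move=> z zE; apply: hN => /bd; rewrite zE leNgt; apply/negP; rewrite negbK.
by rewrite lt_max ltrDl ltr01.
Qed.

Section Star.
Variables (k : nat) (c : Cplx R) (beta : 'I_k -> R -> Cplx R).
Hypotheses (cb : forall s, continuous (beta s)) (b0 : forall s, beta s 0 = c).
Hypothesis inj : forall s u v, 0 <= u <= 1 -> 0 <= v <= 1 -> beta s u = beta s v -> u = v.
Hypothesis meet : forall s s' u v, s != s' -> 0 <= u <= 1 -> 0 <= v <= 1 ->
  beta s u = beta s' v -> u = 0 /\ v = 0.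

Definition arcs : set (Cplx R) := [set z | exists s u, 0 <= u <= 1 /\ beta s u = z].

Lemma arcs_compact : compact arcs.
Proof.
have -> : arcs = \big[setU/set0]_(s < k) [set beta s u | u in `[0, 1]].
  rewrite -bigcup_seq; apply/seteqP; split => [z [s [u [hu <-]]]|z [s _ [u hu <-]]].
    exists s; first by rewrite /= mem_index_enum.
    by exists u => //; rewrite /= in_itv.
  by exists s, u; split => //; move: hu; rewrite /= in_itv.
apply: bigsetU_compact => s _; apply: continuous_compact; last exact: segment_compact.
by apply: continuous_subspaceT; exact: cb.
Qed.

(** The logarithms along the arcs are normalized to one value at c, the only point that two arcs
    share. *)
Lemma star_log t : ~ arcs t -> exists lam, cts_on arcs lam /\ forall z, arcs z -> cexp (lam z) = z - t.
Proof.
move=> St.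
have nz s u : 0 <= u <= 1 -> beta s u - t != 0.
  by move=> hu; rewrite subr_eq0; apply/eqP => E; apply: St; exists s, u.
have [k0|s0] := pselect (forall s : 'I_k, False).
  by exists id; split; [move=> z e [s]; case: (k0 s)|move=> z [s]; case: (k0 s)].
have {s0}[s0 _] : exists s : 'I_k, True.
  by apply: contrapT => h; apply: s0 => s; apply: h; exists s.
have ct : c - t != 0.
  by rewrite -(b0 s0) nz// lexx ler01.
have [w0 w0E] := cexp_surj ct.
have hl s : exists l : R -> Cplx R, continuous l /\ l 0 = w0 /\
    forall u, 0 <= u <= 1 -> cexp (l u) = beta s u - t.
  have [|l [cl lE]] := @log_ofP _ (fun u => beta s u - t) _ (nz s).
    apply: continuous_subspaceT; apply: cts_continuous => u.
    by apply: ctsB; [apply: ctsT; exact: cb|exact: cts_cst].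
  exists (fun u => l u + (w0 - l 0)); split.
    by apply: cts_continuous => u; apply: ctsD; [exact: ctsT|exact: cts_cst].
  split; first by rewrite addrC subrK.
  move=> u hu; rewrite cexpD lE// cexpB w0E lE ?lexx ?ler01// b0 divff// mulr1//.
pose l s := projT1 (cid (hl s)).
have lP s : continuous (l s) /\ l s 0 = w0 /\ forall u, 0 <= u <= 1 -> cexp (l s u) = beta s u - t.
  exact: projT2 (cid (hl s)).
pose lam z := xget 0 [set w | exists s u, [/\ 0 <= u <= 1, beta s u = z & w = l s u]].
have lamE s u : 0 <= u <= 1 -> lam (beta s u) = l s u.
  move=> hu; rewrite /lam; case: xgetP => [w _ [s' [v [hv E ->]]]|/(_ (l s u))[]]; last by exists s, u.
  have [ss|ss] := eqVneq s' s; first by rewrite ss in E *; rewrite (inj hv hu E).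
  by have [-> ->] := meet ss hv hu E; rewrite (lP s').2.1 (lP s).2.1.
exists lam; split; last by move=> z [s [u [hu <-]]]; rewrite lamE// (lP s).2.2.
move=> z e Sz e0.
(* The points of the s-th arc whose logarithm is at least e away from that of z form a compact set
   without z, hence keep away from z. There are finitely many arcs. *)
have H s : \forall w \near z, forall u, 0 <= u <= 1 -> beta s u = w -> cabs (lam z - l s u) < e.
  pose K := [set beta s u | u in `[0, 1] `&` [set u | e <= cabs (lam z - l s u)]].
  have cK : compact K.
    apply: continuous_compact; first by apply: continuous_subspaceT; exact: cb.
    apply: compact_closedI; first exact: segment_compact.
    have : closed ((fun u : R => cabs (lam z - l s u)) @^-1` [set x : R | e <= x]).
      apply: preimage_closed; last exact: closed_ge.
      move=> u _; apply: (cts_atP (f := fun u : R => cabs (lam z - l s u))).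
      by apply: cts_cabsf; apply: ctsB; [exact: cts_cst|apply: ctsT; exact: (lP s).1].
    exact.
  have Kz : ~ K z.
    move=> [u [hu /= he] E]; move: he; rewrite -E lamE ?subrr ?cabs0; first by rewrite leNgt e0.
    by move: hu; rewrite /= in_itv.
  have [d d0 dP] := compact_complement_ball cK Kz.
  apply/nbhs_cabs; exists d => // w /dP Kw u hu E; rewrite ltNge; apply/negP => h.
  by apply: Kw; exists u => //; split => //; rewrite /= in_itv.
apply: (filterS _ (filter_forall _ H)) => w hw [s [u [hu E]]].
by rewrite -E lamE//; exact: hw.
Qed.

Lemma star_escape t (rho : R) : ~ arcs t -> exists z, linked arcs t z /\ rho < cabs z.
Proof.
move=> St; have [lam [cl lE]] := star_log St.
exact: log_escape arcs_compact St cl lE.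
Qed.

End Star.

End Escape.

(** * Modification of the star and the jump across a chord *)

Section Jump.
Variable R : realType.

(** The imaginary part of 1 / (x - t - i y), that is the difference of the Cauchy kernels at t + i y
    and t - i y divided by 2i. *)
Definition pker (t y x : R) : R := y / ((x - t) ^+ 2 + y ^+ 2).

Lemma pker_den (t y x : R) : 0 < y -> 0 < (x - t) ^+ 2 + y ^+ 2.
Proof. by move=> y0; rewrite ltr_wpDl ?sqr_ge0// exprn_gt0. Qed.

Lemma pker_ge0 (t y x : R) : 0 < y -> 0 <= pker t y x.
Proof. by move=> y0; rewrite divr_ge0 ?ltW// pker_den. Qed.

Lemma pker_atan (t y x : R) : 0 < y ->
  is_derive x 1 (fun x : R => atan ((x - t) / y)) (pker t y x).
Proof.
move=> y0; have d1 : is_derive x 1 (fun x : R => (x - t) * y^-1) (1 * y^-1).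
  have d0 : is_derive x 1 (fun x : R => x - t) (1 - 0).
    exact: is_deriveB.
  have -> : (fun x : R => (x - t) * y^-1) = y^-1 \*: (fun x : R => x - t).
    by apply/funext => v; rewrite /GRing.scale /= mulrC.
  by apply: is_derive_eq (is_deriveZ y^-1 d0) _; rewrite /GRing.scale /= subr0 mulr1 mul1r.
apply: is_derive_eq (@is_derive1_comp _ _ (fun x : R => (x - t) / y) x _ _ (is_derive1_atan ((x - t) / y)) d1) _.
rewrite /pker; have := pker_den t x y0; move=> /lt0r_neq0 h.
by field; rewrite h gt_eqF.
Qed.

Lemma cts_pker (t y x : R) : 0 < y -> cts_at (pker t y) x.
Proof.
move=> y0; split; apply: cvgM; first exact: cvg_cst.
apply: cvgV; first by rewrite gt_eqF// pker_den.
apply: cvgD; last exact: cvg_cst.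
by apply: cvgM; apply: cvgB; [exact: cvg_id|exact: cvg_cst|exact: cvg_id|exact: cvg_cst].
Qed.

(* The Poisson kernel [pker t y] has mass bounded below on [0, 1] and concentrates at [t]
   when [y] tends to 0. *)
Lemma poisson_jump (psi : R -> Cplx R) (t C y1 : R) : 0 < t < 1 ->
  (forall x, 0 <= x <= 1 -> cts_at psi x) -> 0 < y1 ->
  (forall y, 0 < y <= y1 -> cabs (cint 0 1 (fun x => psi x * rc (pker t y x))) <= C * y) ->
  psi t = 0.
Proof.
move=> /andP[t0 t1] cpsi y10 H; apply/eqP; apply: contraT => pt0.
pose m := cabs (psi t); have m0 : 0 < m by rewrite cabs_gt0.
have e0 : 0 < m / 4 by rewrite divr_gt0.
have ct : cts_at psi t by apply: cpsi; rewrite !ltW.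
have [rho /= rho0 rhoP] := (nbhs_ballP _ _).1 (cts_cabs ct e0).
have kI : compact [set psi x | x in `[0, 1]].
  apply: continuous_compact; last exact: segment_compact.
  apply/subspace_continuousP => x; rewrite /= in_itv /= => hx.
  apply: cvg_within_filter; exact: (cts_atP (cpsi x hx)).
have [B B0 hB] := compact_cabs_bounded kI.
have bB x : 0 <= x <= 1 -> cabs (psi x) <= B.
  by move=> hx; apply: hB; exists x => //; rewrite /= in_itv.
(* The quadratic term in [bd] replaces a splitting of the integral at distance rho from t, because
   (x - t)^2 times the kernel is at most y. *)
pose Ce := 2 * B / rho ^+ 2.
have Ce0 : 0 <= Ce by rewrite divr_ge0 ?sqr_ge0// mulr_ge0 ?ltW.
have bd x : 0 <= x <= 1 -> cabs (psi t - psi x) <= m / 4 + Ce * (x - t) ^+ 2.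
  move=> hx; have [xr|xr] := ltP `|t - x| rho.
    apply: (@le_trans _ _ (m / 4)); first exact/ltW/rhoP.
    by rewrite lerDl mulr_ge0 ?sqr_ge0.
  apply: (@le_trans _ _ (2 * B)).
    have := cabsD (psi t) (- psi x); rewrite cabsN => /le_trans; apply.
    rewrite mulrDl !mul1r; apply: lerD; first by apply: bB; rewrite !ltW.
    exact: bB.
  apply: (@le_trans _ _ (Ce * (x - t) ^+ 2)); last by rewrite lerDr ltW.
  rewrite /Ce -mulrA ler_peMr ?mulr_ge0 ?(ltW B0)// mulrC ler_pdivlMr ?exprn_gt0// mul1r.
  by rewrite -[leRHS]real_normK ?num_real// [`|x - t|]distrC lerXn2r ?nnegrE ?(ltW rho0).
(* y <= 1 - t makes the mass I at least pi / 4; the last bound contradicts m I <= C y + 2 (m I / 4 +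
   Ce y). *)
pose y := Num.min (Num.min y1 (1 - t)) (m * pi / 16 / (`|C| + 2 * Ce + 1)).
have den0 : 0 < `|C| + 2 * Ce + 1 by rewrite ltr_wpDl// addr_ge0// mulr_ge0.
have y0 : 0 < y by rewrite !lt_min y10 subr_gt0 t1 !divr_gt0 ?mulr_gt0 ?pi_gt0.
have yy1 : y <= y1 by rewrite !ge_min lexx.
have yt : y <= 1 - t by rewrite !ge_min lexx orbT.
have yC : (`|C| + 2 * Ce + 1) * y <= m * pi / 16.
  by rewrite mulrC -ler_pdivlMr// !ge_min lexx !orbT.
pose G (x : R) := atan ((x - t) / y); pose I := G 1 - G 0.
have cG (x : R) : cts_at G x.
  split; apply: (cvg_map (h := atan)); first exact: continuous_atan.
  by apply: cvgM; [apply: cvgB; [exact: cvg_id|exact: cvg_cst]|exact: cvg_cst].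
have cP x : cts_at (fun x => rc (pker t y x)) x.
  by apply: cts_realf; exact: cts_pker.
have I0 : pi / 4 <= I.
  rewrite /I; have g1 : pi / 4 <= G 1.
    by rewrite -atan1; apply: le_atan; rewrite ler_pdivlMr// mul1r.
  have g0 : G 0 <= 0 by rewrite -[leRHS]atan0; apply: le_atan; rewrite sub0r mulNr oppr_le0 divr_ge0 ?ltW.
  lra.
have icst : citgl 0 1 (fun x => psi t * rc (pker t y x)).
  by apply: cts_citgl => x _; apply: ctsM; [exact: cts_cst|exact: cP].
have ipsi : citgl 0 1 (fun x => psi x * rc (pker t y x)).
  by apply: cts_citgl => x hx; apply: ctsM; [exact: cpsi|exact: cP].
have idif : citgl 0 1 (fun x => (psi t - psi x) * rc (pker t y x)).
  by apply: cts_citgl => x hx; apply: ctsM; [apply: ctsB; [exact: cts_cst|exact: cpsi]|exact: cP].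
have E1 : cint 0 1 (fun x => psi t * rc (pker t y x)) = psi t * rc I.
  rewrite (cint_ftc (F := fun x => psi t * rc (G x))) ?ltr01//.
  - by rewrite /I /rc rmorphB mulrBr.
  - move=> x _; apply: cderZ; apply: rdiff_ReIm; first exact: pker_atan.
  - by move=> x _; apply: ctsM; [exact: cts_cst|apply: cts_realf; exact: cG].
  by move=> x _; apply: ctsM; [exact: cts_cst|exact: cP].
have E2 : cint 0 1 (fun x => psi t * rc (pker t y x)) =
    cint 0 1 (fun x => psi x * rc (pker t y x)) + cint 0 1 (fun x => (psi t - psi x) * rc (pker t y x)).
  by rewrite -cintD//; apply: eq_cint => x _; rewrite -mulrDl addrC subrK.
have cB (x : R) : cts_at (fun x : R => m / 4 * pker t y x + Ce * y) x.
  split; apply: cvgD; last exact: cvg_cst.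
  by apply: cvgM; [exact: cvg_cst|exact: (cts_atP (cts_pker t x y0))].
have B1 : cabs (cint 0 1 (fun x => (psi t - psi x) * rc (pker t y x))) <= 2 * (m / 4 * I + Ce * y).
  have -> : m / 4 * I + Ce * y = \int[lebesgue_measure]_(x in `[0, 1]) (m / 4 * pker t y x + Ce * y).
    have -> : m / 4 * I + Ce * y = (m / 4 * G 1 + Ce * y * 1) - (m / 4 * G 0 + Ce * y * 0).
      by rewrite /I; ring.
    apply/esym; apply: (@Rint_ftc _ (fun x => m / 4 * G x + Ce * y * x)); [exact: ltr01| | |by move=> x _].
      have dZ (k : R) (f : R -> R) (x d : R) : is_derive x 1 f d -> is_derive x 1 (fun u => k * f u) (k * d).
        by move=> h; exact: (is_deriveZ k h).
      move=> x _; have h1 := dZ (m / 4) _ _ _ (pker_atan t x y0).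
      have h2 := dZ (Ce * y) id x 1 (is_derive_id x 1); rewrite mulr1 in h2.
      exact: (is_deriveD h1 h2).
    move=> x _; split; apply: cvgD.
      by apply: cvgM; [exact: cvg_cst|exact: (cts_atP (cG x))].
    by apply: cvgM; [exact: cvg_cst|exact: cvg_id].
  apply: cint_le => //; first by apply: cts_itgl => x _; exact: cB.
  move=> x hx; rewrite cabsM cabs_real ger0_norm ?pker_ge0//.
  apply: (@le_trans _ _ ((m / 4 + Ce * (x - t) ^+ 2) * pker t y x)).
    by rewrite ler_wpM2r ?pker_ge0// bd.
  rewrite mulrDl lerD2l -mulrA ler_wpM2l// /pker mulrA ler_pdivrMr ?pker_den// mulrC.
  by rewrite ler_wpM2l ?(ltW y0)// lerDl sqr_ge0.
have := H y; rewrite y0 yy1 => /(_ isT) h1.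
have : m * I <= C * y + 2 * (m / 4 * I + Ce * y).
  have -> : m * I = cabs (psi t * rc I).
    by rewrite cabsM cabs_real ger0_norm// (le_trans _ I0)// divr_ge0 ?pi_ge0.
  rewrite -E1 E2; apply: le_trans (cabsD _ _) _; exact: lerD.
have hC : C * y <= `|C| * y by rewrite ler_wpM2r ?(ltW y0)// ler_norm.
have hI : m / 2 * (pi / 4) <= m / 2 * I by rewrite ler_wpM2l// divr_ge0 ?ltW.
have mp : 0 < m * pi by rewrite mulr_gt0 ?pi_gt0.
by move=> h2; suff: False by []; lra.
Qed.

End Jump.

Lemma seg_dist (R : realType) (x0 z w : Cplx R) (eta t : R) : cabs (x0 - z) < eta -> cabs (x0 - w) < eta ->
  0 <= t <= 1 -> cabs (x0 - (z + rc t * (w - z))) < eta.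
Proof.
move=> hz hw /andP[t0 t1].
have id (a b c s : Cplx R) : a - (b + s * (c - b)) = (1 - s) * (a - b) + s * (a - c) by ring.
rewrite id; apply: le_lt_trans (cabsD _ _) _; rewrite !cabsM.
have -> : cabs (1 - rc t) = 1 - t.
  have -> : 1 - rc t = rc (1 - t) by rewrite /rc rmorphB.
  by rewrite cabs_real ger0_norm// subr_ge0.
rewrite cabs_real ger0_norm//.
have h1 : (1 - t) * cabs (x0 - z) <= (1 - t) * Num.max (cabs (x0 - z)) (cabs (x0 - w)).
  by rewrite ler_wpM2l ?subr_ge0// le_max lexx.
have h2 : t * cabs (x0 - w) <= t * Num.max (cabs (x0 - z)) (cabs (x0 - w)).
  by rewrite ler_wpM2l// le_max lexx orbT.
have h3 : Num.max (cabs (x0 - z)) (cabs (x0 - w)) < eta by rewrite gt_max hz hw.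
apply: le_lt_trans (lerD h1 h2) _; rewrite -mulrDl subrK mul1r //.
Qed.

(** * The form in the coordinate z = N / D and its chord integrals *)

Section QuotientForm.
Variables (R : realType) (N D K : {poly R[i]}) (a : nat).
Definition wron : {poly R[i]} := N^`() * D - N * D^`().
Definition quo (x : Cplx R) : Cplx R := N.[x] / D.[x].
(** The coefficient of the form A(P) P^m q dz, where A(P) q dz = K / D^a dx. *)
Definition rmom (m : nat) (x : Cplx R) : Cplx R := (N ^+ m * K).[x] * (D.[x] ^+ (m + a))^-1.
(* The coefficient of the form [rmom 0 x dx] in the coordinate [z = quo x]. *)
Definition qform (x : Cplx R) : Cplx R := rmom 0 x * (D.[x] ^+ 2 / wron.[x]).

Lemma rmomE m x : D.[x] != 0 -> rmom m x = quo x ^+ m * rmom 0 x.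
Proof.
move=> x0; rewrite /rmom /quo !hornerM !horner_exp expr0 mul1r add0n exprD.
have id (n d k e : Cplx R) : d != 0 -> e != 0 -> n * k * (d * e)^-1 = n * d^-1 * (k * e^-1).
  by move=> d0 e0; field; rewrite d0 e0.
by rewrite expr_div_n; apply: id; rewrite expf_neq0.
Qed.

Lemma cts_polyR (p : {poly R[i]}) (x : Cplx R) : cts_at (fun w : Cplx R => p.[w] : Cplx R) x.
Proof. by apply: cts_horner; exact: cts_id. Qed.

Lemma cts_quo x : D.[x] != 0 -> cts_at quo x.
Proof.
by move=> x0; apply: ctsM; [exact: cts_polyR|apply: ctsV; [exact: x0|exact: cts_polyR]].
Qed.

Lemma cts_rmom m x : D.[x] != 0 -> cts_at (rmom m) x.
Proof.
move=> x0; apply: ctsM; first exact: cts_polyR.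
by apply: ctsV; [rewrite expf_neq0|apply: ctsX; exact: cts_polyR].
Qed.

Lemma cts_qform x : D.[x] != 0 -> wron.[x] != 0 -> cts_at qform x.
Proof.
move=> x0 w0; apply: ctsM; first exact: cts_rmom.
apply: ctsM; first by apply: ctsX; exact: cts_polyR.
by apply: ctsV; [exact: w0|exact: cts_polyR].
Qed.

Lemma cdiff_quo x : D.[x] != 0 -> cdiff quo x (wron.[x] / D.[x] ^+ 2).
Proof.
move=> x0; have cD := cts_polyR D x.
have h := cderM (cts_polyR N x) (cdiff_horner N x) (cderV cD x0 (cdiff_horner D x)).
have -> : wron.[x] / D.[x] ^+ 2 = N^`().[x] * (D.[x])^-1 + N.[x] * (- D^`().[x] / D.[x] ^+ 2).
  rewrite /wron hornerD hornerN !hornerM.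
  have id (n' n d d' : Cplx R) : d != 0 -> (n' * d - n * d') / d ^+ 2 = n' * d^-1 + n * (- d' / d ^+ 2).
    by move=> d0; field.
  exact: (id _ _ _ _ x0).
exact: h.
Qed.

Variables (S : nat -> Cplx R -> Cplx R) (l : nat -> seq (Cplx R * Cplx R)).
Hypothesis SP : forall m, has_prim D (rmom m) (S m) (l m).

(* On a short subinterval the path can be replaced by its chord, over which the increment is an
   integral; the arc itself is only continuous. *)
Lemma primitive_increment_functional (e : R -> Cplx R) (F : nat -> R -> Cplx R) (u v delta : R) :
  {within `[0, 1], continuous e} -> (forall t, 0 <= t <= 1 -> D.[e t] != 0) ->
  (forall m, along (S m) (l m) e (F m)) -> 0 <= u -> u <= v -> v <= 1 -> 0 < delta ->
  exists T, bdd_on [set z | exists t, u <= t <= v /\ cabs (z - quo (e t)) < delta] T /\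
    forall m, T (fun z => z ^+ m) = F m v - F m u.
Proof.
move=> ce eD aF u0 uv v1 d0; have cec := within_c01 ce; set X := [set z | _].
apply: (interval_ind (Rel := fun u' v' => exists T, bdd_on X T /\
    forall m, T (fun z => z ^+ m) = F m v' - F m u')) => //.
  move=> p q r _ _ _ _ [T1 [b1 E1]] [T2 [b2 E2]]; exists (fun h => T1 h + T2 h).
  by split; [exact: bdd_add|move=> m; rewrite E1 E2 addrC addrA subrK].
move=> t0 ht0; have h01 : 0 <= t0 <= 1.
  by case/andP: ht0 => h1 h2; rewrite (le_trans u0 h1) (le_trans h2 v1).
pose x0 := e t0; have Dx0 : D.[x0] != 0 := eD _ h01.
have [eta1 eta10 H1] := (nbhs_cabs _ _).1 (cts_neq0 (cts_polyR D x0) Dx0).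
have [eta2 eta20 H2] := (nbhs_cabs _ _).1 (cts_cabs (cts_quo Dx0) d0).
pose eta := Num.min eta1 eta2; have eta0 : 0 < eta by rewrite lt_min eta10.
have Deta x : cabs (x0 - x) < eta -> D.[x] != 0.
  by rewrite lt_min => /andP[h _]; exact: H1.
have Qeta x : cabs (x0 - x) < eta -> cabs (quo x0 - quo x) < delta.
  by rewrite lt_min => /andP[_ h]; exact: H2.
have [eps /= eps0 epsP] := (nbhs_ballP _ _).1 (cts_cabs (ctsT t0 cec) eta0).
have eP t : u <= t <= v -> `|t - t0| < eps -> cabs (x0 - e t) < eta.
  move=> /andP[ut tv] h; have := epsP t; rewrite /ball /= distrC => /(_ h).
  by rewrite !c01_id// (le_trans u0 ut) (le_trans tv v1).
exists eps => // p q up pq qv hp hq.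
have ep := eP p; have eq := eP q.
have {}ep : cabs (x0 - e p) < eta by apply: ep => //; rewrite up (le_trans pq qv).
have {}eq : cabs (x0 - e q) < eta by apply: eq => //; rewrite qv (le_trans up pq).
pose seg (t : R) := e p + rc t * (e q - e p).
have sP t : 0 <= t <= 1 -> cabs (x0 - seg t) < eta by move=> ht; exact: seg_dist.
have cseg t : cts_at seg t by exact: seg_cts.
have crm m t : 0 <= t <= 1 -> cts_at (fun t => rmom m (seg t)) t.
  move=> ht; apply: (cts_comp (f := seg)); first exact: cseg.
  by apply: cts_rmom; apply: Deta; exact: sP.
exists (fnl (fun t => quo (seg t)) (fun t => rmom 0 (seg t) * (e q - e p))); split.
  apply: bdd_fnl.
  - move=> t ht; apply: (cts_comp (f := seg)); first exact: cseg.
    by apply: cts_quo; apply: Deta; exact: sP.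
  - by move=> t ht; exists t0; split => //; rewrite cabsB; apply: Qeta; exact: sP.
  - by apply: cts_citgl => t ht; apply: ctsM; [exact: crm|exact: cts_cst].
move=> m; rewrite /fnl (eq_cint (g := fun t => rmom m (seg t) * (e q - e p))); last first.
  by move=> t ht; rewrite mulrA -rmomE//; apply: Deta; exact: sP.
have dL t : 0 <= t <= 1 -> rdiff (fun t => loc_prim (S m) (l m) x0 (seg t)) t (rmom m (seg t) * (e q - e p)).
  move=> ht; apply: (cder_comp (f := seg)); [exact: cseg|exact: seg_rdiff|].
  by apply: (loc_prim_diff (SP m) Deta); exact: sP.
rewrite (cint_ftc (F := fun t => loc_prim (S m) (l m) x0 (seg t))) ?ltr01//; last 3 first.
- by move=> t /andP[t1 t2]; apply: dL; rewrite !ltW.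
- by move=> t ht; exact: rdiff_cts (dL t ht).
- by move=> t ht; apply: ctsM; [exact: crm|exact: cts_cst].
have -> : seg 0 = e p by rewrite /seg /rc mul0r addr0.
have -> : seg 1 = e q by rewrite /seg /rc mul1r addrC subrK.
apply/esym.
apply: (along_local (SP m) Deta ce (aF m)) => //.
- exact: le_trans u0 up.
- exact: le_trans qv v1.
move=> t /andP[pt tq]; apply: eP; first by rewrite (le_trans up pt) (le_trans tq qv).
by move: hp hq; rewrite !ltr_norml => /andP[h1 h2] /andP[h3 h4]; apply/andP; split; lra.
Qed.

Variables (n : nat) (U : set (Cplx R)) (b : 'I_n -> Cplx R -> Cplx R).
Hypotheses (oU : open U) (cb : forall i z, U z -> cts_at (b i) z).
Hypotheses (bD : forall i z, U z -> D.[b i z] != 0) (bN : forall i z, U z -> quo (b i z) = z).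
Hypothesis bW : forall i z, U z -> wron.[b i z] != 0.

Lemma branch_cdiff i z : U z -> cdiff (b i) z (D.[b i z] ^+ 2 / wron.[b i z]).
Proof.
move=> Uz; have E : \forall w \near z, quo (b i w) = w.
  by apply: filterS (open_nbhs_nbhs (conj oU Uz)) => w; exact: bN.
have W0 : wron.[b i z] / D.[b i z] ^+ 2 != 0 :> Cplx R.
  by rewrite mulf_neq0 ?invr_neq0 ?expf_neq0 ?bD ?bW.
have := cder_implicit (cb i Uz) (cdiff_quo (bD i Uz)) W0 E (cder_id _ z).
by rewrite div1r invf_div.
Qed.

(** In the coordinate z a local primitive composed with a branch has derivative z^m times [qform] at
    the branch, so its increment over a chord is an integral against a density independent of m. *)
Lemma chord_int (i : 'I_n) (x0 z w : Cplx R) (eta : R) m :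
  (forall x, cabs (x0 - x) < eta -> D.[x] != 0) ->
  (forall t : R, 0 <= t <= 1 -> U (z + rc t * (w - z)) /\ cabs (x0 - b i (z + rc t * (w - z))) < eta) ->
  loc_prim (S m) (l m) x0 (b i w) - loc_prim (S m) (l m) x0 (b i z) =
  cint 0 1 (fun t => (z + rc t * (w - z)) ^+ m * (qform (b i (z + rc t * (w - z))) * (w - z))).
Proof.
move=> Deta H; pose seg (t : R) := z + rc t * (w - z).
have cseg t : cts_at seg t by exact: seg_cts.
have dL t : 0 <= t <= 1 -> rdiff (fun t => loc_prim (S m) (l m) x0 (b i (seg t))) t
    (seg t ^+ m * (qform (b i (seg t)) * (w - z))).
  move=> ht; have [Ut et] := H t ht.
  have db := cder_comp (cseg t) (seg_rdiff z w t) (branch_cdiff i Ut).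
  have cbs : cts_at (fun t => b i (seg t)) t by apply: (cts_comp (f := seg)); [exact: cseg|exact: cb].
  have := cder_comp cbs db (loc_prim_diff (SP m) Deta et).
  rewrite rmomE ?bN//; last exact: bD.
  by rewrite /qform !mulrA.
have E := cint_ftc (ltr01 : (0 : R) < 1) (F := fun t => loc_prim (S m) (l m) x0 (b i (seg t)))
  (f := fun t => seg t ^+ m * (qform (b i (seg t)) * (w - z))).
have s0 : seg 0 = z by rewrite /seg /rc mul0r addr0.
have s1 : seg 1 = w by rewrite /seg /rc mul1r addrC subrK.
rewrite s0 s1 in E; rewrite -E//.
- by move=> t /andP[t1 t2]; apply: dL; rewrite !ltW.
- by move=> t ht; exact: rdiff_cts (dL t ht).
move=> t ht; have [Ut et] := H t ht.
apply: ctsM; first by apply: ctsX; exact: cseg.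
apply: ctsM; last exact: cts_cst.
apply: (cts_comp (f := fun t => b i (seg t))); last by apply: cts_qform; [exact: bD|exact: bW].
by apply: (cts_comp (f := seg)); [exact: cseg|exact: cb].
Qed.

End QuotientForm.

(** The set of differences is compact and omits 0. *)
Lemma compact_dist (R : realType) (A B : set (Cplx R)) : compact A -> compact B -> A `<=` ~` B ->
  exists2 d : R, 0 < d & forall x y, A x -> B y -> d <= cabs (x - y).
Proof.
move=> cA cB AB.
have cK : compact [set p.1 - p.2 | p in A `*` B].
  apply: continuous_compact; last exact: compact_setX.
  apply: continuous_subspaceT => p; apply: cvgC_B; [exact: cvg_fst|exact: cvg_snd].
have [|d d0 dP] := @compact_complement_ball _ _ 0 cK.
  by move=> [[x y] [/= Ax By]] /subr0_eq xy; apply: (AB x Ax); rewrite xy.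
exists d => // x y Ax By; rewrite leNgt; apply/negP => h; apply: (dP (x - y)); last by exists (x, y).
by rewrite sub0r cabsN.
Qed.

Section RealArithmetic.
Variable R : realType.
Implicit Types a c e u v : R.

Lemma dist_half_itv u e : `|1 / 2 - u| < e -> e <= 1 / 2 -> 0 < u < 1.
Proof. by rewrite ltr_norml; lra. Qed.

Lemma dist_itv_lt c e u v a : `|c - u| < e -> `|c - v| < e -> u <= a <= v -> `|c - a| < e.
Proof. by rewrite !ltr_norml; lra. Qed.

Lemma dist_between u a v : (u <= a <= v) || (v <= a <= u) -> `|u - a| <= `|u - v|.
Proof.
by case/orP => h; [rewrite !ler0_norm|rewrite !ger0_norm]; lra.
Qed.

Lemma dist_lt_itv u v a c : `|u - v| < u - a -> `|u - v| < c - u -> a <= v <= c.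
Proof. by rewrite !ltr_norml; lra. Qed.

End RealArithmetic.

(** * Replacing a piece of one arc by a chord *)

Section StarModification.
Variables (R : realType) (k : nat) (c : Cplx R) (gam : 'I_k -> R -> Cplx R).
Hypotheses (cg : forall s, continuous (gam s)) (g0 : forall s, gam s 0 = c).
Hypothesis inj : forall s u v, 0 <= u <= 1 -> 0 <= v <= 1 -> gam s u = gam s v -> u = v.
Hypothesis meet : forall s s' u v, s != s' -> 0 <= u <= 1 -> 0 <= v <= 1 ->
  gam s u = gam s' v -> u = 0 /\ v = 0.
Variables (s : 'I_k) (rho : R).
Hypothesis rho0 : 0 < rho.

Definition chord (z w : Cplx R) (u1 u2 u : R) : Cplx R := z + rc ((u - u1) / (u2 - u1)) * (w - z).

Definition detour (u1 u2 : R) (s' : 'I_k) (u : R) : Cplx R :=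
  if (s' == s) && (u1 <= u <= u2) then chord (gam s u1) (gam s u2) u1 u2 u else gam s' u.

(* [u1] and [u2] are the first entrance and the last exit of a small closed disc around
   [gam s (1/2)], so that the chord meets the rest of the star at its ends only. *)
Lemma detourP : exists u1 u2, [/\ 0 < u1, u1 < u2, u2 < 1,
  forall u, 0 <= u <= 1 -> cabs (gam s (1 / 2) - chord (gam s u1) (gam s u2) 0 1 u) < rho &
  (forall u, u1 <= u <= u2 -> cabs (gam s (1 / 2) - gam s u) < rho) /\
  [/\ forall s', continuous (detour u1 u2 s'), forall s', detour u1 u2 s' 0 = c,
   forall s' u v, 0 <= u <= 1 -> 0 <= v <= 1 -> detour u1 u2 s' u = detour u1 u2 s' v -> u = v &
   forall s' s'' u v, s' != s'' -> 0 <= u <= 1 -> 0 <= v <= 1 ->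
     detour u1 u2 s' u = detour u1 u2 s'' v -> u = 0 /\ v = 0]].
Proof.
pose z0 := gam s (1 / 2).
have h12 : 0 <= (1 / 2 : R) <= 1 by lra.
have cgs : cts_at (gam s) (1 / 2) by apply: ctsT; exact: cg.
have [ep /= ep0 epP] := (nbhs_ballP _ _).1 (cts_cabs cgs rho0).
pose eps := Num.min ep (1 / 2).
have eps0 : 0 < eps by rewrite lt_min ep0; lra.
have eps12 : eps <= 1 / 2 by rewrite ge_min lexx orbT.
have epsP u : `|1 / 2 - u| < eps -> cabs (z0 - gam s u) < rho.
  by rewrite lt_min => /andP[h _]; apply: epP.
(* What the small disc must avoid: the other arcs, and the part of the s-th arc whose parameter is
   at least eps away from 1/2. This set is compact and misses [z0]. *)
pose Rest := [set z | (exists s' u, [/\ s' != s, 0 <= u <= 1 & gam s' u = z]) \/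
                      (exists u, [/\ 0 <= u <= 1, eps <= `|1 / 2 - u| & gam s u = z])].
have cRest : compact Rest.
  have -> : Rest = \big[setU/set0]_(s' < k | s' != s) [set gam s' u | u in `[0, 1]] `|`
     [set gam s u | u in `[0, 1] `&` [set u | eps <= `|1 / 2 - u|]].
    apply/seteqP; split => z.
      move=> [[s' [u [ss hu <-]]]|[u [hu he <-]]]; [left|right].
        rewrite -bigcup_seq_cond; exists s'; first by rewrite /= mem_index_enum.
        by exists u => //; rewrite /= in_itv.
      by exists u => //; split => //; rewrite /= in_itv.
    move=> [|[u [hu /= he] <-]].
      rewrite -bigcup_seq_cond => -[s' /= /andP[_ ss] [u hu <-]]; left.
      by exists s', u; split => //; move: hu; rewrite /= in_itv.
    by right; exists u; split => //; move: hu; rewrite /= in_itv.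
  apply: compactU.
    apply: bigsetU_compact => s' _; apply: continuous_compact; last exact: segment_compact.
    by apply: continuous_subspaceT; exact: cg.
  apply: continuous_compact; first by apply: continuous_subspaceT; exact: cg.
  apply: compact_closedI; first exact: segment_compact.
  have : closed ((fun u : R => `|1 / 2 - u|) @^-1` [set x : R | eps <= x]).
    apply: preimage_closed; last exact: closed_ge.
    by move=> u _; apply: cvg_norm; apply: cvgB; [exact: cvg_cst|exact: cvg_id].
  exact.
have Rz0 : ~ Rest z0.
  move=> [[s' [u [ss hu E]]]|[u [hu he E]]].
    by have [_] := meet ss hu h12 E; lra.
  have := inj hu h12 E => uE; move: he; rewrite uE subrr normr0; lra.
have [e1 e10 e1P] := compact_complement_ball cRest Rz0.
pose r := Num.min e1 rho / 2.
have m0 : 0 < Num.min e1 rho by rewrite lt_min e10.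
have r0 : 0 < r by rewrite divr_gt0.
have rr : r < Num.min e1 rho by rewrite /r; lra.
have rR z : Rest z -> r < cabs (z0 - z).
  move=> Rz; rewrite ltNge; apply/negP => h; apply: (e1P z) Rz; apply: le_lt_trans h _.
  by apply: lt_le_trans rr _; rewrite ge_min lexx.
have rrho : r < rho by apply: lt_le_trans rr _; rewrite ge_min lexx orbT.
pose A := `[0, 1] `&` [set u : R | cabs (z0 - gam s u) <= r].
have cA : compact A.
  apply: compact_closedI; first exact: segment_compact.
  have : closed ((fun u : R => cabs (z0 - gam s u)) @^-1` [set x : R | x <= r]).
    apply: preimage_closed; last exact: closed_le.
    move=> u _; apply: (cts_atP (f := fun u : R => cabs (z0 - gam s u))).
    by apply: cts_cabsf; apply: ctsB; [exact: cts_cst|apply: ctsT; exact: cg].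
  exact.
have [d /= d0 dP] := (nbhs_ballP _ _).1 (cts_cabs cgs r0).
pose d1 := Num.min d (1 / 2) / 2.
have dm0 : 0 < Num.min d (1 / 2) by rewrite lt_min d0; lra.
have dd : Num.min d (1 / 2) <= d by rewrite ge_min lexx.
have dh : Num.min d (1 / 2) <= 1 / 2 by rewrite ge_min lexx orbT.
(* [A] contains an interval around 1/2, whence u1 < u2 below. *)
have Ad (u : R) : `|1 / 2 - u| <= d1 -> A u.
  move=> h; split; first by rewrite /= in_itv /=; move: h; rewrite ler_norml /d1; lra.
  by apply/ltW/dP; rewrite /ball /=; apply: le_lt_trans h _; rewrite /d1; lra.
have d10 : 0 < d1 by rewrite divr_gt0.
have A12 : A !=set0 by exists (1 / 2); apply: Ad; rewrite subrr normr0 ltW.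
have cid' : {within A, continuous (id : R -> R)} by apply: continuous_subspaceT => u; exact: cvg_id.
have [u1 /set_mem Au1 u1P] := compact_EVT_min A12 cA cid'.
have [u2 /set_mem Au2 u2P] := compact_EVT_max A12 cA cid'.
have Aout u : 0 <= u <= 1 -> ~~ (u1 <= u <= u2) -> r < cabs (z0 - gam s u).
  move=> hu hn; rewrite ltNge; apply: contra hn => h.
  have Au : A u by split => //; rewrite /= in_itv.
  by rewrite u1P ?u2P ?inE.
have lo : u1 <= 1 / 2 - d1.
  by apply: u1P; rewrite inE; apply: (Ad (1 / 2 - d1)); rewrite opprB addrCA subrr addr0 ger0_norm ?lexx ?(ltW d10).
have hi : 1 / 2 + d1 <= u2.
  by apply: u2P; rewrite inE; apply: (Ad (1 / 2 + d1)); rewrite opprD addrA subrr add0r normrN ger0_norm ?lexx ?(ltW d10).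
have Ain u : A u -> `|1 / 2 - u| < eps.
  move=> [hu /= ur]; rewrite ltNge; apply/negP => h.
  have : Rest (gam s u) by right; exists u; split => //; move: hu; rewrite /= in_itv.
  by move/rR; rewrite ltNge ur.
have in1 := Ain _ Au1; have in2 := Ain _ Au2.
have /andP[u10 u11] := dist_half_itv in1 eps12; have /andP[u20 u21] := dist_half_itv in2 eps12.
have u12 : u1 < u2 by apply: le_lt_trans lo _; apply: lt_le_trans hi; rewrite ltrD2l gtrN.
have hu1 : 0 <= u1 <= 1 by rewrite !ltW.
have hu2 : 0 <= u2 <= 1 by rewrite !ltW.
pose z := gam s u1; pose w := gam s u2.
have zw : w - z != 0.
  by rewrite subr_eq0; apply/eqP => /(inj hu2 hu1)/eqP; rewrite gt_eqF.
(* The closed disc is convex; [seg_dist] treats open discs, hence the intermediate radius [e]. *)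
have inch (t : R) : 0 <= t <= 1 -> cabs (z0 - (z + rc t * (w - z))) <= r.
  move=> ht; rewrite leNgt; apply/negP => h.
  pose e := (r + cabs (z0 - (z + rc t * (w - z)))) / 2.
  have re : r < e by rewrite /e (midf_lt h).
  have hz : cabs (z0 - z) < e by apply: le_lt_trans re; exact: Au1.2.
  have hw : cabs (z0 - w) < e by apply: le_lt_trans re; exact: Au2.2.
  by have := seg_dist hz hw ht; rewrite ltNge /e ltW// (midf_lt h).
have frac u : u1 <= u <= u2 -> 0 <= (u - u1) / (u2 - u1) <= 1.
  move=> /andP[h1 h2]; rewrite divr_ge0 ?subr_ge0 ?(ltW u12)//=.
  by rewrite ler_pdivrMr ?subr_gt0// mul1r lerD2r.
have chE u : u1 <= u <= u2 -> cabs (z0 - chord z w u1 u2 u) <= r.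
  by move=> hu; apply: inch; exact: frac.
have ch1 : chord z w u1 u2 u1 = z by rewrite /chord subrr mul0r /rc mul0r addr0.
have ch2 : chord z w u1 u2 u2 = w.
  by rewrite /chord divff ?subr_eq0 ?gt_eqF// /rc mul1r addrC subrK.
have chinj u v : chord z w u1 u2 u = chord z w u1 u2 v -> u = v.
  move=> /addrI /(mulIf zw) /(congr1 (@complex.Re R)) /=.
  have dn : (u2 - u1)^-1 != 0 by rewrite invr_neq0// subr_eq0 gt_eqF.
  by move=> /(mulIf dn) /addIr.
have dou s' u : ~~ ((s' == s) && (u1 <= u <= u2)) -> detour u1 u2 s' u = gam s' u.
  by rewrite /detour => /negbTE ->.
have din u : u1 <= u <= u2 -> detour u1 u2 s u = chord z w u1 u2 u.
  by rewrite /detour eqxx => ->.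
(* The chord lies in the closed disc and every other point of the new star outside it, so the two
   cannot meet. *)
have dout s' u : 0 <= u <= 1 -> ~~ ((s' == s) && (u1 <= u <= u2)) -> r < cabs (z0 - gam s' u).
  move=> hu; have [->|ss] := eqVneq s' s; first exact: Aout.
  by move=> _; apply: rR; left; exists s', u.
exists u1, u2; split; [exact: u10|exact: u12|exact: u21| |].
  move=> t ht; apply: le_lt_trans rrho; rewrite /chord !subr0 divr1; exact: inch.
split.
  by move=> u hu; apply: epsP; exact: dist_itv_lt in1 in2 hu.
split.
- move=> s'; have [->|ss] := eqVneq s' s; last first.
    have -> : detour u1 u2 s' = gam s'.
      by apply/funext => v; rewrite dou// (negbTE ss).
    exact: cg.
  apply: cts_continuous => u.
  have cch (v : R) : cts_at (chord z w u1 u2) v.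
    apply: ctsD; first exact: cts_cst.
    apply: ctsM; last exact: cts_cst.
    apply: cts_realf; split; apply: cvgM; last exact: cvg_cst.
    by apply: cvgB; [exact: cvg_id|exact: cvg_cst].
  have cgm (v : R) : cts_at (gam s) v by apply: ctsT; exact: cg.
  have cE v : detour u1 u2 s v = if u1 <= v <= u2 then chord z w u1 u2 v else gam s v.
    by rewrite /detour eqxx.
  (* Where both formulas agree, in particular at u1 and u2, each of them bounds the variation;
     elsewhere a single one is in force near u. *)
  have [E|E] := eqVneq (chord z w u1 u2 u) (gam s u).
    apply: cts_atE => e e0; apply: filterS2 (cts_cabs (cch u) e0) (cts_cabs (cgm u) e0) => v h1 h2.
    rewrite !cE [in X in cabs (X - _)]E if_same; case: ifP => _; [by rewrite -E|exact: h2].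
  have un1 : u != u1 by apply: contra E => /eqP ->; rewrite ch1.
  have un2 : u != u2 by apply: contra E => /eqP ->; rewrite ch2.
  pose dl := Num.min `|u - u1| `|u - u2|.
  have dl0 : 0 < dl by rewrite lt_min !normr_gt0 !subr_eq0 un1.
  have [ui|ui] := boolP (u1 <= u <= u2).
    apply: cts_near (cch u); apply/nbhs_ballP; exists dl => //= v.
    case/andP: ui => h1 h2; rewrite /ball /= lt_min (ger0_norm (_ : 0 <= u - u1)) ?subr_ge0// (ler0_norm (_ : u - u2 <= 0)) ?subr_le0//.
    by rewrite opprB cE => /andP[k1 k2]; rewrite ifT//; exact: dist_lt_itv k1 k2.
  apply: cts_near (cgm u); apply/nbhs_ballP; exists dl => //= v.
  rewrite /ball /= lt_min => /andP[h1 h2]; rewrite cE ifF//; apply: contraNF ui => /andP[k1 k2].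
  apply/andP; split; rewrite leNgt; apply/negP => h.
    by move: h1; rewrite ltNge dist_between// (ltW h) k1.
  by move: h2; rewrite ltNge dist_between// (ltW h) k2 orbT.
- by move=> s'; rewrite dou// negb_and orbC leNgt u10.
- move=> s' u v hu hv; have [ku|ku] := boolP ((s' == s) && (u1 <= u <= u2));
    have [kv|kv] := boolP ((s' == s) && (u1 <= v <= u2)).
  + case/andP: ku kv => /eqP -> ku /andP[_ kv]; rewrite !din//; exact: chinj.
  + case/andP: ku => /eqP ss ku'; subst s'; rewrite (din u ku') (dou s v kv) => E.
    by have := dout s v hv kv; rewrite -E ltNge chE.
  + case/andP: kv => /eqP ss kv'; subst s'; rewrite (din v kv') (dou s u ku) => E.
    by have := dout s u hu ku; rewrite E ltNge chE.
  by rewrite !dou//; exact: inj.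
- move=> s' s'' u v ss hu hv; have [ku|ku] := boolP ((s' == s) && (u1 <= u <= u2));
    have [kv|kv] := boolP ((s'' == s) && (u1 <= v <= u2)).
  + by case/andP: ku kv ss => /eqP -> _ /andP[/eqP -> _]; rewrite eqxx.
  + case/andP: ku => /eqP s'E ku'; subst s'; rewrite (din u ku') (dou s'' v kv) => E.
    by have := dout s'' v hv kv; rewrite -E ltNge chE.
  + case/andP: kv => /eqP s'E kv'; subst s''; rewrite (din v kv') (dou s' u ku) => E.
    by have := dout s' u hu ku; rewrite E ltNge chE.
  by rewrite !dou//; exact: meet.
Qed.

End StarModification.

Lemma cint_sum (R : realType) (J : Type) (s : seq J) (c : J -> Cplx R) (g : J -> R -> Cplx R) (u v : R) :
  (forall j, citgl u v (g j)) ->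
  citgl u v (fun x => \sum_(j <- s) c j * g j x) /\
  cint u v (fun x => \sum_(j <- s) c j * g j x) = \sum_(j <- s) c j * cint u v (g j).
Proof.
move=> ig; elim: s => [|j s [IH1 IH2]].
  have E : (fun x => \sum_(j <- [::]) c j * g j x) = fun=> 0 by apply/funext => x; rewrite big_nil.
  have i0 : citgl u v (fun=> 0 : Cplx R) by apply: cts_citgl => x _; exact: cts_cst.
  rewrite E big_nil; split => //.
  rewrite -[RHS](mul0r (cint u v (fun=> 0))) -(cintZ 0 i0).
  by apply: eq_cint => x _; rewrite mul0r.
have E : (fun x => \sum_(j <- j :: s) c j * g j x) = fun x => c j * g j x + \sum_(j <- s) c j * g j x.
  by apply/funext => x; rewrite big_cons.
have i1 : citgl u v (fun x => c j * g j x) by exact: citglZ.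
rewrite E big_cons -IH2 -cintZ//; split; first exact: citglD.
exact: cintD.
Qed.

Lemma far_arith1 (R : realType) (d0 del x y z s t : R) : d0 <= x -> x <= y + s -> s <= z + t ->
  y <= d0 / 3 -> t < del -> del <= d0 / 3 -> d0 / 3 <= z.
Proof. by lra. Qed.

Lemma far_arith2 (R : realType) (d del x y z : R) : d <= x -> x <= y + z -> z < del -> del <= d / 2 ->
  d / 2 <= y.
Proof. by lra. Qed.

(** * Vanishing of the branch sums on a chord *)

Section CoreChord.
Variables (R : realType) (N D K : {poly R[i]}) (a : nat).
Variables (S : nat -> Cplx R -> Cplx R) (l : nat -> seq (Cplx R * Cplx R)).
Hypothesis SP : forall m, has_prim D (rmom N D K a m) (S m) (l m).
Variables (n : nat) (U : set (Cplx R)) (b : 'I_n -> Cplx R -> Cplx R).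
Hypotheses (oU : open U) (cb : forall i z, U z -> cts_at (b i) z).
Hypotheses (bD : forall i z, U z -> D.[b i z] != 0) (bN : forall i z, U z -> quo N D (b i z) = z).
Hypothesis bW : forall i z, U z -> (wron N D).[b i z] != 0.
Variables (k : nat) (c : Cplx R) (gam : 'I_k -> R -> Cplx R).
Hypotheses (cg : forall s, continuous (gam s)) (g0 : forall s, gam s 0 = c).
Hypothesis inj : forall s u v, 0 <= u <= 1 -> 0 <= v <= 1 -> gam s u = gam s v -> u = v.
Hypothesis meet : forall s s' u v, s != s' -> 0 <= u <= 1 -> 0 <= v <= 1 ->
  gam s u = gam s' v -> u = 0 /\ v = 0.
Hypothesis gU : forall s u, 0 <= u < 1 -> U (gam s u).
Variable e : 'I_k -> 'I_n -> R -> Cplx R.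
Hypothesis ce : forall s i, {within `[0, 1], continuous (e s i)}.
Hypothesis eD : forall s i u, 0 <= u <= 1 -> D.[e s i u] != 0.
Hypothesis eQ : forall s i u, 0 <= u <= 1 -> quo N D (e s i u) = gam s u.
Hypothesis eb : forall s i u, 0 <= u < 1 -> e s i u = b i (gam s u).
Variable f : 'I_k -> 'I_n -> Cplx R.

Local Notation gt := (qform N D K a).

Lemma branch_sums_vanish_on_chord s : (forall m, \sum_s \sum_i f s i * pathint (S m) (l m) (e s i) = 0) ->
  exists z w, w - z != 0 /\ forall t : R, 0 < t < 1 -> U (z + rc t * (w - z)) /\
    \sum_i f s i * gt (b i (z + rc t * (w - z))) = 0.
Proof.
move=> hL.
have hF s' i m := along_exists (SP m) (@ce s' i) (fun u hu => eD s' i hu).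
pose F s' i m := projT1 (cid (hF s' i m)).
have FP s' i m : [/\ continuous (F s' i m), pathint (S m) (l m) (e s' i) = F s' i m 1 - F s' i m 0 &
  along (S m) (l m) (e s' i) (F s' i m)] := projT2 (cid (hF s' i m)).
pose z0 := gam s (1 / 2).
have Uz0 : U z0 by apply: gU; lra.
have hEta i : exists eta : R, 0 < eta /\ forall x, cabs (b i z0 - x) < eta -> D.[x] != 0.
  have [eta h1 h2] := (nbhs_cabs _ _).1 (cts_neq0 (cts_polyR D (b i z0)) (bD i Uz0)).
  by exists eta.
pose eta i := projT1 (cid (hEta i)); have etaP i : 0 < eta i /\ forall x, cabs (b i z0 - x) < eta i -> D.[x] != 0
  := projT2 (cid (hEta i)).
(* Over this disc the branches stay where local primitives are defined, so that the increment over
   the removed piece of an edge equals an integral over the chord. *)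
have [rho rho0 rhoP] : exists2 rho : R, 0 < rho & forall x, cabs (z0 - x) < rho ->
    U x /\ forall i, cabs (b i z0 - b i x) < eta i.
  have nU : \forall x \near z0, U x by exact: open_nbhs_nbhs.
  have nb : \forall x \near z0, forall i, cabs (b i z0 - b i x) < eta i.
    have H i : \forall x \near z0, cabs (b i z0 - b i x) < eta i by exact: (cts_cabs (cb i Uz0) (etaP i).1).
    exact: (filter_forall _ H).
  apply: (nbhs_cabs z0 (fun x => U x /\ forall i, cabs (b i z0 - b i x) < eta i)).1.
  exact: filterI nU nb.
have [u1 [u2 [u10 u12 u21 inch [inarc [cbe be0 binj bmeet]]]]] := detourP cg g0 inj meet s rho0.
pose beta := detour gam s u1 u2; pose z := gam s u1; pose w := gam s u2.
have u20 := lt_trans u10 u12; have u11 := lt_trans u12 u21.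
have hu1 : 0 <= u1 <= 1 by rewrite !ltW.
have hu2 : 0 <= u2 <= 1 by rewrite !ltW.
have u1le := ltW u11.
have hu1' : 0 <= u1 < 1 by rewrite ltW.
have hu2' : 0 <= u2 < 1 by rewrite ltW.
have u1_0 := ltW u10; have u2_1 := ltW u21; have u12' := ltW u12.
have hinarc u : u1 <= u <= u2 -> 0 <= u < 1.
  by move=> /andP[h1 h2]; rewrite (le_trans (ltW u10) h1) (le_lt_trans h2 u21).
have u2ge := ltW u20.
have zw : w - z != 0 by rewrite subr_eq0; apply/eqP => /(inj hu2 hu1)/eqP; rewrite gt_eqF.
pose seg (t : R) := z + rc t * (w - z).
have cseg t : cts_at seg t by exact: seg_cts.
have segP t : 0 <= t <= 1 -> U (seg t) /\ forall i, cabs (b i z0 - b i (seg t)) < eta i.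
  by move=> ht; apply: rhoP; have := inch t ht; rewrite /chord !subr0 divr1.
exists z, w; split => // t0 /andP[t00 t01].
have ht0 : 0 <= t0 <= 1 by lra.
split; first exact: (segP t0 ht0).1.
pose psi (t : R) := \sum_i f s i * gt (b i (seg t)).
pose x0 := seg t0.
have cgb i t : 0 <= t <= 1 -> cts_at (fun t => gt (b i (seg t))) t.
  move=> ht; have [Ut _] := segP t ht.
  apply: (cts_comp (f := fun t => b i (seg t))); last by apply: cts_qform; [exact: bD|exact: bW].
  by apply: (cts_comp (f := seg)); [exact: cseg|exact: cb].
have cpsi t : 0 <= t <= 1 -> cts_at psi t.
  by move=> ht; apply: cts_sum => i; apply: ctsM; [exact: cts_cst|exact: cgb].
(* Parameters of the part of the star that is kept; [So] is that part. *)
pose Kp s' : set R := if s' == s then [set` `[0, u1]] `|` [set` `[u2, 1]] else [set` `[0, 1]].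
have kKp s' : compact (Kp s').
  by rewrite /Kp; case: ifP => _; [apply: compactU|]; exact: segment_compact.
have Kp01 s' u : Kp s' u -> 0 <= u <= 1.
  rewrite /Kp; case: ifP => _ /=; rewrite !in_itv //= => -[/andP[h1 h2]|/andP[h1 h2]].
    by rewrite h1 (le_trans h2 u1le).
  by rewrite (le_trans u2ge h1) h2.
pose So := \big[setU/set0]_(s' < k) [set gam s' u | u in Kp s'].
have kSo : compact So.
  apply: bigsetU_compact => s' _; apply: continuous_compact => //.
  by apply: continuous_subspaceT; exact: cg.
have SoP y : So y <-> exists s' u, Kp s' u /\ gam s' u = y.
  rewrite /So -bigcup_seq; split => [[s' _ [u Ku <-]]|[s' [u [Ku <-]]]]; first by exists s', u.
  by exists s'; [rewrite /= mem_index_enum|exists u].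
have bg s' u : Kp s' u -> beta s' u = gam s' u.
  rewrite /Kp /beta /detour; have [->|ss] := eqVneq s' s; last by [].
  rewrite /=; case: ifP => // /andP[h1 h2] [] /=; rewrite in_itv /= => h.
    have -> : u = u1 by apply/eqP; rewrite eq_le h1; case/andP: h => _ ->.
    by rewrite /chord subrr mul0r /rc mul0r addr0.
  have -> : u = u2 by apply/eqP; rewrite eq_le h2; case/andP: h => ->.
  by rewrite /chord divff ?subr_eq0 ?gt_eqF// /rc mul1r addrC subrK.
pose us t := u1 + t * (u2 - u1).
have usP t : 0 <= t <= 1 -> u1 <= us t <= u2.
  move=> /andP[h1 h2]; rewrite /us lerDl mulr_ge0 ?subr_ge0 ?(ltW u12)//=.
  by rewrite -lerBrDl ler_piMl ?subr_ge0 ?(ltW u12).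
have us01 t : 0 <= t <= 1 -> 0 <= us t <= 1.
  by move=> /usP /andP[h1 h2]; rewrite (le_trans u1_0 h1) (le_trans h2 u2_1).
have bseg t : 0 <= t <= 1 -> beta s (us t) = seg t.
  move=> ht; have E : (us t - u1) / (u2 - u1) = t.
    by rewrite /us addrAC subrr add0r mulfK// subr_eq0 gt_eqF.
  by rewrite /beta /detour eqxx usP//= /chord E.
have ust0 : u1 < us t0 < u2.
  rewrite /us ltrDl mulr_gt0 ?subr_gt0//=.
  by rewrite -ltrBrDl gtr_pMl ?subr_gt0.
(* Injectivity of the modified star keeps an inner point of the chord off the kept part; [d0]
   measures the gap. *)
have Sox0 : ~ So x0.
  move=> /SoP [s' [u [Ku]]]; rewrite -bg// /x0 -bseg// => E.
  have hu := Kp01 _ _ Ku; have hus := us01 _ ht0.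
  have [ss|ss] := eqVneq s' s.
    rewrite ss in E Ku; have := binj _ _ _ hu hus E => uE.
    case/andP: ust0 => k1 k2; move: Ku.
    by rewrite /Kp eqxx uE => -[] /=; rewrite in_itv /= ?(leNgt _ u1) ?(leNgt u2) ?k1 ?k2 ?andbF.
  have [_ E0] := bmeet _ _ _ _ ss hu hus E; case/andP: ust0 => k1 _.
  by move: (lt_trans u10 k1); rewrite E0 ltxx.
have [d0 d00 d0P] := compact_complement_ball kSo Sox0.
pose AB := arcs beta.
have kAB : compact AB by exact: arcs_compact.
have ABP y : AB y -> So y \/ exists2 t : R, 0 <= t <= 1 & y = seg t.
  move=> [s' [u [hu <-]]]; have [/andP[/eqP -> hu12]|h] := boolP ((s' == s) && (u1 <= u <= u2)).
    right; exists ((u - u1) / (u2 - u1)); last by rewrite /beta /detour eqxx hu12.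
    case/andP: hu12 => h1 h2; rewrite divr_ge0 ?subr_ge0 ?(ltW u12)//=.
    by rewrite ler_pdivrMr ?subr_gt0// mul1r lerD2r.
  left; apply/SoP; exists s', u; split; last by rewrite /beta /detour (negbTE h).
  move: h; rewrite /Kp; have [_|_] := eqVneq s' s; last by rewrite /= in_itv.
  by rewrite /= negb_and -!ltNge => /orP[h|h]; [left|right]; rewrite /= in_itv /= (ltW h) ?andbT; case/andP: hu.
have SoAB : So `<=` AB.
  by move=> y /SoP [s' [u [Ku <-]]]; exists s', u; split; [exact: Kp01 Ku|exact: bg].
have segAB t : 0 <= t <= 1 -> AB (seg t).
  by move=> ht; exists s, (us t); split; [exact: us01|exact: bseg].
pose dd := cabs (w - z); have dd0 : 0 < dd by rewrite cabs_gt0.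
(* Keeps the points [tp sg y] of the normal to the chord at x0, on its two sides sg = 1 and sg = -1,
   within d0 / 3 of x0. *)
pose y1 := d0 / (3 * dd).
have y10 : 0 < y1 by rewrite divr_gt0 ?mulr_gt0.
have y1dd : y1 * dd = d0 / 3 by rewrite /y1; field; rewrite gt_eqF.
pose tp (sg y : R) : Cplx R := x0 + (0 +i* (sg * y)) * (w - z).
have ctp sg (y : R) : cts_at (tp sg) y.
  apply: ctsD; first exact: cts_cst.
  apply: ctsM; last exact: cts_cst.
  apply: cts_ReIm; split; first exact: cvg_cst.
  by apply: cvgM; [exact: cvg_cst|exact: cvg_id].
have cabsI (y : R) : cabs (0 +i* y) = `|y|.
  by rewrite cabs_sqrt /= expr0n /= add0r sqrtr_sqr.
have tpx sg y : `|sg| = 1 -> 0 < y -> cabs (x0 - tp sg y) = y * dd.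
  move=> sg1 y0; rewrite /tp opprD addrA subrr add0r cabsN cabsM cabsI normrM sg1 mul1r.
  by rewrite ger0_norm// ltW.
have segt sg y t : seg t - tp sg y = ((t - t0) +i* (- (sg * y))) * (w - z).
  rewrite /tp /x0 /seg.
  have id (pp tt tt0 ii qq : Cplx R) : pp + tt * qq - (pp + tt0 * qq + ii * qq) = (tt - tt0 - ii) * qq by ring.
  by rewrite id; congr (_ * _); apply/eqP; rewrite eq_complex /= !subr0 sub0r !eqxx.
have segtp sg y t : `|sg| = 1 -> 0 < y -> y * dd <= cabs (seg t - tp sg y).
  move=> sg1 y0; rewrite segt cabsM ler_wpM2r ?cabs_ge0//; apply: le_trans (cabs_Im _) => /=.
  by rewrite normrN normrM sg1 mul1r ger0_norm// ltW.
have tpAB sg y : `|sg| = 1 -> 0 < y -> y <= y1 -> ~ AB (tp sg y).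
  move=> sg1 y0 yy1 /ABP[]; last first.
    move=> [t ht E]; have := segtp sg y t sg1 y0; rewrite E subrr cabs0 leNgt mulr_gt0//.
  apply: d0P; rewrite tpx//; apply: (@le_lt_trans _ _ (y1 * dd)); first by rewrite ler_pM2r.
  by rewrite y1dd ltr_pdivrMr// ltr_pMr// ltr1n.
have [B B0 hB] := compact_cabs_bounded kAB.
(* From either side of the chord a connected set leads far away without touching the modified star.
   The functional will live in the disc of radius B + 1, and [moments_vanish_infty] wants a point at
   least twice as far out. *)
have hK sg : `|sg| = 1 -> exists K' w' d', [/\ connected K', K' (tp sg y1), K' w', 2 * (B + 1) < cabs w' &
    0 < d' /\ forall x y, K' x -> AB y -> d' <= cabs (x - y)].
  move=> sg1; have nA : ~ AB (tp sg y1) by exact: tpAB.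
  have [w' [[K' [cK kK KA Kt Kw]] hw]] := star_escape cbe be0 binj bmeet (2 * (B + 1)) nA.
  have [d' d'0 d'P] := compact_dist kK kAB KA.
  by exists K', w', d'; split => //; split.
have n1 : `|1 : R| = 1 by rewrite normr1.
have nm1 : `|-1 : R| = 1 by rewrite normrN1.
have [Kp' [wp [dp [cKp Kpt Kpw hwp [dp0 dpP]]]]] := hK 1 n1.
have [Km' [wm [dm [cKm Kmt Kmw hwm [dm0 dmP]]]]] := hK (-1) nm1.
(* Thickness of the neighbourhood of the kept part that carries the functionals of the edges: it
   leaves half of the distance to the escape sets, and d0 / 3 to the points [tp]. *)
pose del := Num.min (Num.min dp dm / 2) (Num.min (d0 / 3) 1).
have mm0 : 0 < Num.min dp dm by rewrite lt_min dp0.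
have del0 : 0 < del by rewrite !lt_min ltr01 !divr_gt0.
have delp : del <= dp / 2.
  by rewrite /del ge_min ler_pM2r// ge_min lexx.
have delm : del <= dm / 2.
  by rewrite /del ge_min ler_pM2r// ge_min lexx orbT.
have deld : del <= d0 / 3 by rewrite /del !ge_min lexx !orbT.
have del1 : del <= 1 by rewrite /del !ge_min lexx !orbT.
pose Xo := [set y | exists2 x, So x & cabs (y - x) < del].
(* For s' = s the pieces [0, u1] and [u2, 1] are treated separately, which leaves out the increment
   over [u1, u2]. *)
have hT s' i : exists T, bdd_on Xo T /\ forall m, T (fun z => z ^+ m) =
    pathint (S m) (l m) (e s' i) - (if s' == s then F s' i m u2 - F s' i m u1 else 0).
  have pc (u v : R) : 0 <= u -> u <= v -> v <= 1 -> (forall t, u <= t <= v -> Kp s' t) ->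
      exists T, bdd_on Xo T /\ forall m, T (fun z => z ^+ m) = F s' i m v - F s' i m u.
    move=> hu huv hv hK'; have [T [bT ET]] := primitive_increment_functional SP (@ce s' i) (fun t ht => eD s' i ht)
      (fun m => let: And3 _ _ h := FP s' i m in h) hu huv hv del0.
    exists T; split => //; apply: bdd_sub bT => y [t [ht yt]]; exists (gam s' t).
      by apply/SoP; exists s', t; split => //; exact: hK'.
    by rewrite -(eQ s' i)//; exact/Kp01/hK'.
  have [ss|ss] := eqVneq s' s.
    have [t ht|T1 [b1 E1]] := pc 0 u1 (lexx _) (ltW u10) u1le.
      by rewrite /Kp ss eqxx; left; rewrite /= in_itv.
    have [t ht|T2 [b2 E2]] := pc u2 1 u2ge (ltW u21) (lexx _).
      by rewrite /Kp ss eqxx; right; rewrite /= in_itv.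
    exists (fun h => T1 h + T2 h); split; first exact: bdd_add.
    by move=> m; rewrite E1 E2; have [_ -> _] := FP s' i m; ring.
  have [t ht|T1 [b1 E1]] := pc 0 1 (lexx _) ler01 (lexx _).
    by rewrite /Kp (negbTE ss) /= in_itv.
  by exists T1; split => // m; rewrite E1 subr0; have [_ -> _] := FP s' i m.
pose To' s' i := projT1 (cid (hT s' i)).
have ToP s' i : bdd_on Xo (To' s' i) /\ forall m, To' s' i (fun z => z ^+ m) =
    pathint (S m) (l m) (e s' i) - (if s' == s then F s' i m u2 - F s' i m u1 else 0) := projT2 (cid (hT s' i)).
pose To h := \sum_s' \sum_i f s' i * To' s' i h.
have bTo : bdd_on Xo To.
  by apply: bdd_sum => s'; apply: bdd_sum => i; apply: bdd_scale; exact: (ToP s' i).1.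
pose X := Xo `|` [set seg t | t in `[0, 1]].
(* The removed piece of the edges, seen through the branches, has become the density psi (w - z) on
   the chord. The moments of the whole are therefore the sums in [hL]. *)
pose T h := fnl seg (fun t => psi t * (w - z)) h + To h.
have bT : bdd_on X T.
  apply: bdd_add; last by apply: bdd_sub bTo => y; left.
  apply: bdd_fnl => //.
    by move=> t ht; right; exists t => //; rewrite /= in_itv.
  by apply: cts_citgl => t ht; apply: ctsM; [exact: cpsi|exact: cts_cst].
have mom m : T (fun z => z ^+ m) = 0.
  rewrite /T /To /fnl.
  have -> : cint 0 1 (fun t => seg t ^+ m * (psi t * (w - z))) =
      \sum_i f s i * (F s i m u2 - F s i m u1).
    have ci i : citgl 0 1 (fun t => seg t ^+ m * (gt (b i (seg t)) * (w - z))).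
      apply: cts_citgl => t ht; apply: ctsM; first by apply: ctsX; exact: cseg.
      by apply: ctsM; [exact: cgb|exact: cts_cst].
    have [_ E] := cint_sum (index_enum _) (f s) ci.
    rewrite (eq_cint (g := fun t => \sum_i f s i * (seg t ^+ m * (gt (b i (seg t)) * (w - z))))); last first.
      by move=> t _; rewrite /psi mulr_suml mulr_sumr; apply: eq_bigr => i _; ring.
    rewrite E; apply: eq_bigr => i _; congr (_ * _).
    have [_ _ aF] := FP s i m.
    have h1 : forall t, 0 <= t <= 1 -> U (seg t) /\ cabs (b i z0 - b i (seg t)) < eta i.
      by move=> t ht; have [h1 h2] := segP t ht.
    have e1 : e s i u1 = b i z by exact: eb.
    have e2 : e s i u2 = b i w by exact: eb.
    have ch := chord_int SP oU cb bD bN bW m (etaP i).2 h1.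
    have al := along_local (SP m) (etaP i).2 (@ce s i) aF u1_0 u12' u2_1.
    rewrite e1 e2 in al; rewrite -/seg in ch; rewrite -ch al// => u hu.
    rewrite eb; last exact: hinarc.
    by have [_] := rhoP _ (inarc u hu); apply.
  have -> : \sum_s' \sum_i f s' i * To' s' i (fun z => z ^+ m) =
      \sum_s' \sum_i f s' i * pathint (S m) (l m) (e s' i) - \sum_i f s i * (F s i m u2 - F s i m u1).
    have -> : \sum_i f s i * (F s i m u2 - F s i m u1) =
       \sum_s' \sum_i f s' i * (if s' == s then F s' i m u2 - F s' i m u1 else 0).
      rewrite (bigD1 s)//= [X in _ = _ + X]big1 ?addr0.
        by apply: eq_bigr => i _; rewrite eqxx.
      by move=> s' /negbTE ->; apply: big1 => i _; rewrite mulr0.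
    rewrite -sumrB; apply: eq_bigr => s' _; rewrite -sumrB; apply: eq_bigr => i _.
    by rewrite (ToP s' i).2 mulrBr.
  by rewrite hL sub0r subrr.
have Xb y : X y -> cabs y <= B + 1.
  move=> [[oo Soo yo]|[t]]; last first.
    by rewrite /= in_itv /= => ht <-; apply: (le_trans (hB _ (segAB t ht))); rewrite lerDl.
  have -> : y = oo + (y - oo) by rewrite addrC subrK.
  apply: le_trans (cabsD _ _) _; apply: lerD; first exact/hB/SoAB.
  exact: le_trans (ltW yo) del1.
have SoX0 x : So x -> d0 <= cabs (x0 - x).
  by move=> h; rewrite leNgt; apply/negP => /d0P.
have farXo sg y q : `|sg| = 1 -> 0 < y -> y <= y1 -> Xo q -> d0 / 3 <= cabs (q - tp sg y).
  move=> sg1 y0 yy1 [oo /SoX0 h1 h2].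
  have h3 : cabs (x0 - tp sg y) <= d0 / 3 by rewrite tpx// -y1dd ler_pM2r.
  have id (xx tt qq pp : Cplx R) : xx - pp = (xx - tt) + (- (qq - tt) + (qq - pp)) by ring.
  have := cabsD (x0 - tp sg y) (- (q - tp sg y) + (q - oo)); rewrite -id.
  move=> k1; have k2 := cabsD (- (q - tp sg y)) (q - oo); rewrite cabsN in k2.
  exact: far_arith1 h1 k1 k2 h3 h2 deld.
(* Vanishing is carried from the far point along the escape set to [tp sg y1], then down the normal
   to [tp sg y]. *)
have Z sg (K' : set (Cplx R)) w' d' : `|sg| = 1 -> connected K' -> K' (tp sg y1) -> K' w' -> 2 * (B + 1) < cabs w' ->
    (forall x y, K' x -> AB y -> d' <= cabs (x - y)) -> 0 < d' -> del <= d' / 2 ->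
    forall y, 0 < y -> y <= y1 -> T (fun z => (z - tp sg y)^-1) = 0.
  move=> sg1 cK Kt Kw hw dP d'0 deld' y y0 yy1.
  have w'0 : w' != 0 by rewrite -cabs_gt0; apply: lt_trans hw; rewrite mulr_gt0// addr_gt0.
  have Zw : moments_vanish_at T w'.
    apply: (moments_vanish_infty bT w'0 _ mom) => -[q Xq] /=.
    by rewrite ler_pdivlMr// mulrC; apply: ltW; apply: le_lt_trans hw; rewrite ler_pM2l// Xb.
  have Z1 : moments_vanish_at T (tp sg y1).
    apply: (moments_vanish_connected bT cK _ Kw Kt Zw) => t Kt'; exists (d' / 2); first by rewrite divr_gt0.
    move=> [q [[oo Soo qo]|[v hv E]]] /=.
      have := dP t oo Kt' (SoAB _ Soo) => h1.
      have id (tt qq pp : Cplx R) : tt - pp = - (qq - tt) + (qq - pp) by ring.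
      have k2 := cabsD (- (q - t)) (q - oo); rewrite -id cabsN in k2.
      exact: far_arith2 h1 k2 qo deld'.
    rewrite -E cabsB; apply: le_trans (dP t _ Kt' (segAB v _)); last by move: hv; rewrite /= in_itv.
    by rewrite ler_pdivrMr// ler_peMr ?(ltW d'0)// ler1n.
  have cI : connected [set tp sg y' | y' in `[y, y1]].
    apply: connected_continuous_connected; first exact: segment_connected.
    by apply: continuous_subspaceT; apply: cts_continuous => y'; exact: ctp.
  have Z2 : moments_vanish_at T (tp sg y).
    apply: (moments_vanish_connected bT cI _ _ _ Z1); last 2 first.
    - by exists y1 => //; rewrite /= in_itv /= yy1 lexx.
    - by exists y => //; rewrite /= in_itv /= yy1 lexx.
    move=> _ [y' + <-]; rewrite /= in_itv /= => /andP[yy' y'1].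
    have y'0 : 0 < y' by exact: lt_le_trans yy'.
    exists (Num.min (d0 / 3) (y' * dd)); first by rewrite lt_min divr_gt0//= mulr_gt0.
    move=> [q [Xq|[v hv E]]] /=; rewrite ge_min; first by rewrite farXo.
    by rewrite -E segtp// orbT.
  by have := Z2 0; rewrite (_ : (fun z => (z - tp sg y)^-1 ^+ 1) = fun z => (z - tp sg y)^-1)//; apply/funext => v; rewrite expr1.
have [C C0 hC] := bddB bTo.
pose M := C * (2 * dd / (d0 / 3 * (d0 / 3))).
apply: (poisson_jump (psi := psi) (C := M) (y1 := y1)) => //; first by rewrite t00.
move=> y /andP[y0 yy1].
have Zp := Z 1 Kp' wp dp n1 cKp Kpt Kpw hwp dpP dp0 delp y y0 yy1.
have Zm := Z (-1) Km' wm dm nm1 cKm Kmt Kmw hwm dmP dm0 delm y y0 yy1.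
pose hp (q : Cplx R) := (q - tp 1 y)^-1; pose hm (q : Cplx R) := (q - tp (-1) y)^-1.
pose hd (q : Cplx R) := hp q + (-1) * hm q.
have ne sg q : `|sg| = 1 -> X q -> q - tp sg y != 0.
  move=> sg1 [Xq|[v hv <-]]; rewrite -cabs_gt0; first by apply: lt_le_trans (farXo sg y q sg1 y0 yy1 Xq); rewrite divr_gt0.
  by apply: lt_le_trans (segtp sg y v sg1 y0); rewrite mulr_gt0.
have ctsh sg q : `|sg| = 1 -> X q -> cts_at (fun q => (q - tp sg y)^-1) q.
  by move=> sg1 Xq; apply: ctsV; [exact: ne|apply: ctsB; [exact: cts_id|exact: cts_cst]].
have ap : cts_along (fun i : {q | X q} => sval i) hp by move=> [q Xq] /=; exact: ctsh.
have am : cts_along (fun i : {q | X q} => sval i) hm by move=> [q Xq] /=; exact: ctsh.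
have amm : cts_along (fun i : {q | X q} => sval i) (fun q => (-1) * hm q).
  by move=> [q Xq] /=; apply: ctsM; [exact: cts_cst|exact: ctsh].
have T0 : T hd = 0 by rewrite (bddD bT)// (bddZ bT)// Zp Zm mulr0 addr0.
have hdE q : X q -> hd q = (tp 1 y - tp (-1) y) / ((q - tp 1 y) * (q - tp (-1) y)).
  move=> Xq; have id (qq ss tt : Cplx R) : qq - ss != 0 -> qq - tt != 0 ->
    (qq - ss)^-1 + (-1) * (qq - tt)^-1 = (ss - tt) / ((qq - ss) * (qq - tt)) by move=> h1 h2; field; rewrite h1 h2.
  by apply: id; exact: ne.
have tptp : tp 1 y - tp (-1) y = (0 +i* (2 * y)) * (w - z).
  rewrite /tp; have id (x p q v : Cplx R) : x + p * v - (x + q * v) = (p - q) * v by ring.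
  rewrite id; congr (_ * _); apply/eqP; rewrite eq_complex /= subrr eqxx /=; apply/eqP; ring.
(* Points near the kept part are at distance at least d0 / 3 from both poles of [hd], which are 2 y
   |w - z| apart: their share of the jump is O(y). *)
have bTo' : cabs (To hd) <= C * (2 * y * dd / (d0 / 3 * (d0 / 3))).
  apply: hC.
  - by move=> [q Xq] /=; apply: ctsD; [exact: (ap (exist _ q (or_introl Xq)))|exact: (amm (exist _ q (or_introl Xq)))].
  - by rewrite divr_ge0 ?mulr_ge0 ?divr_ge0 ?(ltW y0) ?(ltW dd0) ?(ltW d00).
  move=> [q Xq] /=; rewrite hdE; last by left.
  have f1 := farXo 1 y q n1 y0 yy1 Xq; have f2 := farXo (-1) y q nm1 y0 yy1 Xq.
  have d3 : 0 < d0 / 3 by rewrite divr_gt0.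
  rewrite tptp !cabsM cabsV !cabsM cabsI ger0_norm ?mulr_ge0 ?(ltW y0)//.
  rewrite ler_wpM2l ?mulr_ge0 ?(ltW y0) ?(ltW dd0)//.
  have p1 := lt_le_trans d3 f1; have p2 := lt_le_trans d3 f2.
  by rewrite lef_pV2 ?posrE ?mulr_gt0// ler_pM ?(ltW d3).
(* On the chord the difference of the Cauchy kernels is 2i times the Poisson kernel in the parameter
   of the chord. *)
have fE : fnl seg (fun t => psi t * (w - z)) hd = (0 +i* 2) * cint 0 1 (fun x => psi x * rc (pker t0 y x)).
  rewrite -cintZ; last first.
    apply: cts_citgl => t ht; apply: ctsM; first exact: cpsi.
    by apply: cts_realf; exact: cts_pker.
  apply: eq_cint => t ht; rewrite hdE; last by right; exists t => //; rewrite /= in_itv.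
  rewrite tptp !segt mul1r mulN1r opprK /pker.
  have -> : rc (y / ((t - t0) ^+ 2 + y ^+ 2)) = rc y / (((t - t0) +i* (- y)) * ((t - t0) +i* y)) :> Cplx R.
    have -> : ((t - t0) +i* (- y)) * ((t - t0) +i* y) = rc ((t - t0) ^+ 2 + y ^+ 2) :> Cplx R.
      by apply/eqP; rewrite eq_complex /=; apply/andP; split; apply/eqP; ring.
    by rewrite /rc rmorphM fmorphV.
  have -> : (0 +i* (2 * y)) = (0 +i* 2) * rc y :> Cplx R.
    by apply/eqP; rewrite eq_complex /= !mulr0 !mul0r subrr add0r !eqxx.
  have nn : ((t - t0) +i* (- y)) != 0 :> Cplx R by rewrite eq_complex /= oppr_eq0 negb_and (gt_eqF y0) orbT.
  have np : ((t - t0) +i* y) != 0 :> Cplx R by rewrite eq_complex /= negb_and (gt_eqF y0) orbT.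
  have id (i2 yy v p q ps : Cplx R) : v != 0 -> p != 0 -> q != 0 ->
    i2 * yy * v / (p * v * (q * v)) * (ps * v) = i2 * (ps * (yy / (p * q))) by move=> h1 h2 h3; field; rewrite h1 h2 h3.
  exact: id.
have h2 : 2 * cabs (cint 0 1 (fun x => psi x * rc (pker t0 y x))) = cabs (To hd).
  have : fnl seg (fun t => psi t * (w - z)) hd = - To hd by apply/eqP; rewrite -addr_eq0; apply/eqP; exact: T0.
  rewrite fE => /(congr1 (@cabs R)); rewrite cabsN cabsM cabsI ger0_norm//.
have h3 : C * (2 * y * dd / (d0 / 3 * (d0 / 3))) = M * y by rewrite /M; ring.
by rewrite -h3; apply: le_trans bTo'; rewrite -h2 ler_peMl ?cabs_ge0// ler1n.
Qed.

End CoreChord.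

(** * The identity theorem for sums of branches *)

Section PolyNorm.
Variables (R : realType) (rho : R).
Hypothesis rho1 : 1 <= rho.
Implicit Types p q : {poly R[i]}.

Definition absp p : {poly R} := \poly_(i < size p) cabs (p`_i : Cplx R).
(** The weighted l1 norm of the coefficients. It bounds p on the disc of radius rho, and derivation
    costs at most a factor [size p], as rho >= 1. *)
Definition pnorm p : R := (absp p).[rho].

Lemma coef_absp p i : (absp p)`_i = cabs (p`_i : Cplx R).
Proof. by rewrite coef_poly; case: ltnP => // h; rewrite nth_default// cabs0. Qed.

Lemma pnormE p n : (size p <= n)%N -> pnorm p = \sum_(i < n) cabs (p`_i : Cplx R) * rho ^+ i.
Proof.
move=> h; rewrite /pnorm (horner_coef_wide _ (leq_trans (size_poly _ _) h)).
by apply: eq_bigr => i _; rewrite coef_absp.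
Qed.

Lemma rho_ge0 : 0 <= rho. Proof. exact: le_trans ler01 rho1. Qed.

Lemma pnorm_ge0 p : 0 <= pnorm p.
Proof.
by rewrite (pnormE (leqnn _)) sumr_ge0// => i _; rewrite mulr_ge0 ?cabs_ge0 ?exprn_ge0 ?rho_ge0.
Qed.

Lemma pnorm_maj p (P : {poly R}) : (forall i, cabs (p`_i : Cplx R) <= P`_i) -> pnorm p <= P.[rho].
Proof.
move=> h; rewrite (pnormE (leq_maxl (size p) (size P))).
rewrite (horner_coef_wide _ (leq_maxr (size p) (size P))).
by apply: ler_sum => i _; rewrite ler_wpM2r ?exprn_ge0 ?rho_ge0.
Qed.

Lemma pnormM p q : pnorm (p * q) <= pnorm p * pnorm q.
Proof.
rewrite /pnorm -hornerM; apply: pnorm_maj => i; rewrite !coefM.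
apply: le_trans (cabs_sum _ _) _; apply: ler_sum => j _.
by rewrite !coef_absp cabsM.
Qed.

Lemma pnormD p q : pnorm (p + q) <= pnorm p + pnorm q.
Proof.
by rewrite /pnorm -hornerD; apply: pnorm_maj => i; rewrite !coefD !coef_absp cabsD.
Qed.

Lemma pnormN p : pnorm (- p) = pnorm p.
Proof.
rewrite (pnormE (leqnn _)) size_polyN (pnormE (leqnn (size p))).
by apply: eq_bigr => i _; rewrite coefN cabsN.
Qed.

Lemma pnormMn p n : pnorm (p *+ n) <= n%:R * pnorm p.
Proof.
elim: n => [|n IH]; first by rewrite mulr0n mul0r (@pnormE 0 0) ?size_poly0// big_ord0.
by rewrite mulrS -natr1 mulrDl mul1r addrC; apply: le_trans (pnormD _ _) _; exact: lerD.
Qed.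

Lemma pnorm_deriv p : pnorm p^`() <= (size p)%:R * pnorm p.
Proof.
have [->|p0] := eqVneq p 0; first by rewrite deriv0 size_poly0 mul0r (pnormE (leqnn _)) size_poly0 big_ord0.
have sp : (size p).-1.+1 = size p by rewrite prednK// lt0n size_poly_eq0.
rewrite (@pnormE p^`() (size p).-1); last by rewrite -ltnS sp lt_size_deriv.
rewrite [X in _ <= _ * X](pnormE (leqnn _)) -[in leRHS]sp big_ord_recl mulrDr ler_wpDl//.
  by rewrite mulr_ge0// mulr_ge0 ?cabs_ge0.
rewrite mulr_sumr; apply: ler_sum => i _; rewrite coef_deriv lift0.
have -> : cabs (p`_i.+1 *+ i.+1 : Cplx R) = i.+1%:R * cabs (p`_i.+1 : Cplx R).
  rewrite -[p`_i.+1 *+ i.+1]mulr_natl cabsM; congr (_ * _).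
  have -> : (i.+1%:R : Cplx R) = (i.+1%:R)%:C by rewrite rmorph_nat.
  by rewrite cabs_real ger0_norm.
rewrite -mulrA ler_pM ?mulr_ge0 ?cabs_ge0 ?exprn_ge0 ?rho_ge0//.
  by rewrite ler_nat ltnS ltnW.
by rewrite ler_wpM2l ?cabs_ge0// exprS ler_peMl// exprn_ge0 ?rho_ge0.
Qed.

Lemma pnorm_horner p (x : Cplx R) : cabs x <= rho -> cabs p.[x] <= pnorm p.
Proof.
move=> hx; rewrite (pnormE (leqnn _)) horner_coef; apply: le_trans (cabs_sum _ _) _.
apply: ler_sum => i _; rewrite cabsM cabsX ler_wpM2l ?cabs_ge0//.
by rewrite lerXn2r ?nnegrE ?cabs_ge0 ?rho_ge0.
Qed.

End PolyNorm.

Lemma rdiff_eq0 (R : realType) (f : R -> Cplx R) (x : R) (d : Cplx R) :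
  (\forall u \near x, f u = 0) -> rdiff f x d -> d = 0.
Proof.
move=> f0 [phi [cphi <- E]].
apply/eqP; rewrite -cabs_eq0; apply/negPn/negP => p0.
have pz : phi x != 0 by rewrite -cabs_eq0.
have [r /= r0 H] := (nbhs_ballP x _).1 (filterI (filterI f0 E) (cts_neq0 cphi pz)).
have hr : ball x r (x + r / 2).
  by rewrite /ball /= opprD addNKr normrN gtr0_norm ?divr_gt0// ltr_pdivrMr// ltr_pMr// ltr1n.
have [[h1 h2] h3] := H _ hr.
move: h2; rewrite h1 (nbhs_singleton f0) subrr /rc -rmorphB addrAC subrr add0r => /esym/eqP.
rewrite mulf_eq0 (negPf h3) /= -cabs_eq0 cabs_real normr_eq0 mulf_eq0 gt_eqF//=.
by rewrite invr_eq0 pnatr_eq0.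
Qed.

(** * Identity theorem from factorial bounds on derivatives *)

Section Taylor.
Variables (R : realType) (phi : nat -> Cplx R -> Cplx R) (U : set (Cplx R)).
Hypothesis oU : open U.
Hypothesis dphi : forall j z, U z -> cdiff (phi j) z (phi j.+1 z).
Hypothesis bphi : forall z, U z -> exists C B : R, [/\ 0 <= C, 0 < B &
  \forall w \near z, forall j, cabs (phi j w) <= C * B ^+ j * j`!%:R].

(** As all derivatives vanish at z, the bound on the J-th one is integrated J times along the
    segment. The factorials cancel and leave C (2 B |w - z|)^J <= C / 2^J, the 2 coming from
    [cpath_pow]. *)
Lemma taylor_vanishing (C B : R) (z w : Cplx R) : 0 <= C -> 0 < B -> cabs (w - z) <= 1 / (4 * B) ->
  (forall t : R, 0 <= t <= 1 -> U (z + rc t * (w - z)) /\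
     forall j, cabs (phi j (z + rc t * (w - z))) <= C * B ^+ j * j`!%:R) ->
  (forall j, phi j z = 0) -> phi 0 w = 0.
Proof.
move=> C0 B0 hw H Z; pose h := cabs (w - z); have h0 : 0 <= h := cabs_ge0 _.
pose g j (t : R) := phi j (z + rc t * (w - z)).
have s0 : z + rc 0 * (w - z) = z by rewrite /rc mul0r addr0.
have s1 : z + rc 1 * (w - z) = w by rewrite /rc mul1r addrC subrK.
have dg j (t : R) : 0 <= t <= 1 -> rdiff (g j) t (g j.+1 t * (w - z)).
  move=> ht; apply: (cder_comp (f := fun t => z + rc t * (w - z))); [exact: seg_cts|exact: seg_rdiff|].
  by apply: dphi; exact: (H t ht).1.
have claim J i : (i <= J)%N -> forall t : R, 0 <= t <= 1 ->
    cabs (g (J - i)%N t) <= C * B ^+ J * J`!%:R * (2 * h) ^+ i / i`!%:R * t ^+ i.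
  elim: i => [|i IH] iJ t ht.
    by rewrite subn0 !expr0 fact0 divr1 !mulr1; exact: (H t ht).2.
  have dG u : 0 <= u <= 1 -> rdiff (g (J - i.+1)%N) u (g (J - i)%N u * (w - z)).
    by move=> hu; have := dg (J - i.+1)%N u hu; rewrite subnSK.
  pose M := C * B ^+ J * J`!%:R * (2 * h) ^+ i / i`!%:R * h.
  have M0 : 0 <= M.
    by rewrite !mulr_ge0 ?invr_ge0 ?exprn_ge0 ?mulr_ge0 ?(ltW B0).
  have bM u : 0 <= u <= 1 -> cabs (g (J - i)%N u * (w - z)) <= M * u ^+ i.
    move=> hu; rewrite cabsM /M mulrAC; rewrite ler_wpM2r//.
    exact: (IH (ltnW iJ) u hu).
  have := cpath_pow M0 dG bM ht; rewrite {2}/g s0 Z subr0 => /le_trans; apply.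
  have i0 : i.+1%:R != 0 :> R by rewrite pnatr_eq0.
  have f0 : i`!%:R != 0 :> R by rewrite pnatr_eq0 -lt0n fact_gt0.
  rewrite /M factS natrM [(2 * h) ^+ i.+1]exprS.
  have id (x p q y u v : R) : u != 0 -> v != 0 -> 2 * (x * p / u * y) * q / v = x * (2 * y * p) / (v * u) * q.
    by move=> u0 v0; field; rewrite u0 v0.
  by rewrite id.
apply: (small_eq0 (B := C)) => J.
have := claim J J (leqnn _) 1; rewrite subnn /g s1 expr1n mulr1 => /(_ _)/le_trans; apply.
  by rewrite ler01 lexx.
have f0 : J`!%:R != 0 :> R by rewrite pnatr_eq0 -lt0n fact_gt0.
have -> : C * B ^+ J * J`!%:R * (2 * h) ^+ J / J`!%:R = C * (B * (2 * h)) ^+ J.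
  have id (x p q u : R) : u != 0 -> x * p * u * q / u = x * (p * q) by move=> u0; field.
  by rewrite [(B * _) ^+ J]exprMn id.
rewrite ler_wpM2l// -exprVn lerXn2r ?nnegrE ?mulr_ge0 ?(ltW B0)//.
move: hw; rewrite -/h ler_pdivlMr ?mulr_gt0// => hw; rewrite -[leRHS]mul1r ler_pdivlMr//; lra.
Qed.

Lemma identity_from_derivatives z w : connected U -> U z -> U w -> (forall j, phi j z = 0) -> phi 0 w = 0.
Proof.
move=> cU Uz Uw Z; suff : forall j, phi j w = 0 by exact.
apply: (connected_ind (Q := fun x => forall j, phi j x = 0) cU _ Uz Uw Z) => z0 Uz0.
 have [C [B [C0 B0 nb]]] := bphi Uz0.
have nU : \forall x \near z0, U x by exact: open_nbhs_nbhs.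
have [r r0 rP] := (nbhs_cabs z0 _).1 (filterI nU nb).
(* Two points within 1 / (8 B) of z0 are within 1 / (4 B) of each other. *)
pose r1 := Num.min r (1 / (8 * B)).
have r10 : 0 < r1 by rewrite lt_min r0 divr_gt0 ?mulr_gt0.
have key x y : cabs (z0 - x) < r1 -> cabs (z0 - y) < r1 -> (forall j, phi j x = 0) -> phi 0 y = 0.
  move=> hx hy; apply: (taylor_vanishing C0 B0).
    have id (p q s : Cplx R) : q - p = - (s - q) + (s - p) by ring.
    rewrite (id _ _ z0); apply: le_trans (cabsD _ _) _; rewrite cabsN.
    have h8 : 1 / (4 * B) = 1 / (8 * B) + 1 / (8 * B) by field; rewrite gt_eqF.
    rewrite h8; apply: lerD; apply: ltW.
      by apply: lt_le_trans hy _; rewrite ge_min lexx orbT.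
    by apply: lt_le_trans hx _; rewrite ge_min lexx orbT.
  move=> t ht; apply: rP; have := seg_dist hx hy ht => /lt_le_trans; apply.
  by rewrite ge_min lexx.
(* Vanishing of [phi j] on the whole disc passes to [phi j.+1] by differentiation. *)
have key2 x y : cabs (z0 - x) < r1 -> cabs (z0 - y) < r1 -> (forall j, phi j x = 0) -> forall j, phi j y = 0.
  move=> hx hy Zx j; elim: j y hy => [|j IH] y hy; first exact: key hx hy Zx.
  have Uy : U y by case: (rP y (lt_le_trans hy _)) => //; rewrite ge_min lexx.
  apply: (cdiff_eq0 (f := phi j) (z := y)) (dphi j Uy).
  apply/nbhs_cabs; exists (r1 - cabs (z0 - y)); first by rewrite subr_gt0.
  move=> v hv; apply: IH; have := cabsD (z0 - y) (y - v); rewrite addrA subrK => h.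
  by apply: le_lt_trans h _; rewrite -ltrBrDl.
have z00 : cabs (z0 - z0) < r1 by rewrite subrr cabs0.
apply/nbhs_cabs; exists r1 => // y hy _; split; exact: key2.
Qed.

(** Differentiating along the chord, whose direction is nonzero, kills all derivatives at its
    midpoint. *)
Lemma identity_chord z w : connected U -> w - z != 0 ->
  (forall t : R, 0 < t < 1 -> U (z + rc t * (w - z)) /\ phi 0 (z + rc t * (w - z)) = 0) ->
  forall x, U x -> phi 0 x = 0.
Proof.
move=> cU zw H x Ux.
have Z j (t : R) : 0 < t < 1 -> phi j (z + rc t * (w - z)) = 0.
  elim: j t => [|j IH] t ht; first exact: (H t ht).2.
  have dg : rdiff (fun t => phi j (z + rc t * (w - z))) t (phi j.+1 (z + rc t * (w - z)) * (w - z)).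
    apply: (cder_comp (f := fun t => z + rc t * (w - z))); [exact: seg_cts|exact: seg_rdiff|].
    by apply: dphi; exact: (H t ht).1.
  have : phi j.+1 (z + rc t * (w - z)) * (w - z) = 0.
    apply: rdiff_eq0 dg; case/andP: ht => t0 t1.
    apply/nbhs_ballP; exists (Num.min t (1 - t)); first by rewrite /= lt_min t0 subr_gt0.
    by move=> v; rewrite /ball /= lt_min => /andP[]; rewrite !ltr_norml => h1 h2; apply: IH; lra.
  by move/eqP; rewrite mulf_eq0 (negPf zw) orbF => /eqP.
have h2 : 0 < (1 / 2 : R) < 1 by lra.
exact: (identity_from_derivatives cU (H _ h2).1 Ux (fun j => Z j _ h2)).
Qed.

End Taylor.

(** * Iterated derivatives of the branch sums *)

Section IdentityBranches.
Variables (R : realType) (N D K : {poly R[i]}) (a : nat).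
Variables (n : nat) (U : set (Cplx R)) (b : 'I_n -> Cplx R -> Cplx R).
Hypotheses (oU : open U) (cb : forall i z, U z -> cts_at (b i) z).
Hypotheses (bD : forall i z, U z -> D.[b i z] != 0) (bN : forall i z, U z -> quo N D (b i z) = z).
Hypothesis bW : forall i z, U z -> (wron N D).[b i z] != 0.
Variable f : 'I_n -> Cplx R.

Local Notation W := (wron N D).
Local Notation Y := (D * W).

(* Numerators, over [Y ^+ (a + j.*2).+1], of the successive derivatives of [qform] with respect to
   [z = N / D]: the derivation is [D^2 / W = D^3 / Y] times that in the coordinate. *)
Fixpoint numer j : {poly R[i]} :=
  if j is j'.+1 then ((numer j')^`() * Y - numer j' * Y^`() *+ (a + j'.*2).+1) * D ^+ 3
  else K * D ^+ 3 * W ^+ a.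

Definition psi j (z : Cplx R) : Cplx R :=
  \sum_i f i * ((numer j).[b i z] / (Y ^+ (a + j.*2).+1).[b i z]).

Lemma psi0E z : U z -> psi 0 z = \sum_i f i * qform N D K a (b i z).
Proof.
move=> Uz; apply: eq_bigr => i _; congr (_ * _).
have d0 := bD i Uz; have w0 := bW i Uz.
rewrite /qform /rmom /= double0 addn0 add0n expr0 mul1r !hornerM !horner_exp hornerM exprS exprMn.
have id (k d w da wa : Cplx R) : d != 0 -> w != 0 -> da != 0 -> wa != 0 ->
  k * d ^+ 3 * wa / (d * w * (da * wa)) = k * da^-1 * (d ^+ 2 / w).
  by move=> h1 h2 h3 h4; field; rewrite h1 h2 h3 h4.
by apply: id => //; rewrite expf_neq0.
Qed.

Lemma psi_diff j z : U z -> cdiff (psi j) z (psi j.+1 z).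
Proof.
move=> Uz; apply: cder_sum => i; apply: cderZ.
set m := (a + j.*2)%N.
have d0 := bD i Uz; have w0 := bW i Uz.
have y0 : Y.[b i z] != 0 by rewrite hornerM mulf_neq0.
have ym0 : (Y ^+ m.+1).[b i z] != 0 by rewrite horner_exp expf_neq0.
have cp (p : {poly R[i]}) : cts_at (fun x : Cplx R => p.[x] : Cplx R) (b i z) by exact: cts_polyR.
have dq := cderM (cp (numer j)) (cdiff_horner (numer j) (b i z))
  (cderV (cp (Y ^+ m.+1)) ym0 (cdiff_horner (Y ^+ m.+1) (b i z))).
have := cder_comp (cb i Uz) (branch_cdiff oU cb bD bN bW i Uz) dq.
congr (cdiff _ _ _).
rewrite [numer j.+1]/= doubleS -/m !addnS -/m.
have hMn (p : {poly R[i]}) e x : (p *+ e).[x] = e%:R * p.[x] by rewrite hornerMn mulr_natl.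
have q0 : (D.[b i z] * W.[b i z]) ^+ m != 0 by rewrite expf_neq0 ?mulf_neq0.
move: w0 q0; generalize W => V w0 q0.
rewrite deriv_exp succnK !horner_exp !(hMn, hornerM, hornerD, hornerN, horner_exp) !exprS !expr0 !mulr1.
have id (n0 n1 y1 d w q e : Cplx R) : d != 0 -> w != 0 -> q != 0 ->
  (n1 / (d * w * q) + n0 * (- (e * (y1 * q)) / (d * w * q * (d * w * q)))) * (d * d / w) =
  (n1 * (d * w) - e * (n0 * y1)) * (d * (d * d)) / (d * w * (d * w * (d * w * q))).
  by move=> h1 h2 h3; field; rewrite h1 h2 h3.
exact: id.
Qed.

(** With degrees growing linearly in j, [pnorm_deriv] costs a factor linear in j at each step,
    whence norms of order B^j j! in [pnorm_numer]. *)
Lemma size_numer : exists s : nat, forall j, (size (numer j) <= s * j.+1)%N.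
Proof.
exists (size (numer 0) + size Y%R + 3 * size D)%N; elim=> [|j IH]; first by rewrite muln1 -!addnA leq_addr.
have sM (p r : {poly R[i]}) : (size (p * r)%R <= size p + size r)%N.
  by apply: leq_trans (size_polyMleq _ _) _; exact: leq_pred.
have s3 : (size (D ^+ 3)%R <= 3 * size D)%N.
  by rewrite !exprS expr0 mulr1; apply: leq_trans (sM _ _) _; have := sM D D; lia.
have sd (p : {poly R[i]}) : (size p^`() <= size p)%N.
  have [->|p0] := eqVneq p 0; first by rewrite deriv0.
  exact/ltnW/lt_size_deriv.
have s1 : (size ((numer j)^`() * Y - numer j * Y^`() *+ (a + j.*2).+1)%R <= size (numer j) + size Y%R)%N.
  apply: leq_trans (size_polyD _ _) _; rewrite geq_max size_polyN; apply/andP; split.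
    by apply: leq_trans (sM _ _) _; rewrite leq_add2r sd.
  rewrite -mulr_natr -polyC_natr mulrC mul_polyC; apply: leq_trans (size_scale_leq _ _) _.
  by apply: leq_trans (sM _ _) _; rewrite leq_add2l sd.
rewrite [numer j.+1]/=; apply: leq_trans (sM _ _) _.
have ar (t q v v0 y d x : nat) : (v <= (v0 + y + 3 * d) * x -> t <= v + y -> q <= 3 * d ->
    t + q <= (v0 + y + 3 * d) * x.+1)%N by rewrite mulnS; lia.
exact: ar IH s1 s3.
Qed.

Lemma pnorm_numer (rho : R) : 1 <= rho -> exists2 B : R, 0 < B &
  forall j, pnorm rho (numer j) <= pnorm rho (numer 0) * B ^+ j * j`!%:R.
Proof.
move=> r1; have [s sP] := size_numer.
pose c := (pnorm rho Y + pnorm rho Y^`()) * pnorm rho (D ^+ 3).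
have c0 : 0 <= c by rewrite mulr_ge0 ?addr_ge0 ?pnorm_ge0.
(* The factors s (j + 1), from the derivative of the numerator, and a + 2 j + 1, from that of the
   power of Y, are both at most (s + a + 3) (j + 1). Adding 1 makes the constant positive. *)
exists ((s + a + 3)%:R * c + 1); first by rewrite ltr_wpDl// mulr_ge0.
set B := _ + 1; have B0 : 0 <= B by rewrite addr_ge0// mulr_ge0.
elim=> [|j IH]; first by rewrite expr0 fact0 !mulr1.
rewrite [numer j.+1]/=; apply: le_trans (pnormM r1 _ _) _.
apply: (@le_trans _ _ ((s + a + 3)%:R * j.+1%:R * c * pnorm rho (numer j))); last first.
  rewrite exprS factS natrM.
  have -> : pnorm rho (numer 0) * (B * B ^+ j) * (j.+1%:R * j`!%:R) =
    B * j.+1%:R * (pnorm rho (numer 0) * B ^+ j * j`!%:R) by ring.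
  apply: ler_pM; [by apply: mulr_ge0 c0; apply: mulr_ge0; exact: ler0n|exact: pnorm_ge0| |exact: IH].
  by rewrite mulrAC ler_wpM2r// lerDl.
have e1 : pnorm rho ((numer j)^`() * Y) <= (s * j.+1)%:R * (pnorm rho (numer j) * pnorm rho Y).
  apply: le_trans (pnormM r1 _ _) _; rewrite mulrA ler_wpM2r ?pnorm_ge0//.
  apply: le_trans (pnorm_deriv r1 _) _; rewrite ler_wpM2r ?pnorm_ge0// ler_nat; exact: sP.
have e2 : pnorm rho (numer j * Y^`() *+ (a + j.*2).+1) <= (a + j.*2).+1%:R * (pnorm rho (numer j) * pnorm rho Y^`()).
  by apply: le_trans (pnormMn r1 _ _) _; rewrite ler_wpM2l// pnormM.
have n1 : ((s * j.+1)%:R : R) <= (s + a + 3)%:R * j.+1%:R.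
  by rewrite -natrM ler_nat leq_mul2r -addnA leq_addr orbT.
have n2 : ((a + j.*2).+1%:R : R) <= (s + a + 3)%:R * j.+1%:R.
  by rewrite -natrM ler_nat; nia.
have pj := pnorm_ge0 r1 (numer j); have pY := pnorm_ge0 r1 Y; have pY' := pnorm_ge0 r1 Y^`().
have e3 := le_trans e1 (ler_wpM2r (mulr_ge0 pj pY) n1).
have e4 := le_trans e2 (ler_wpM2r (mulr_ge0 pj pY') n2).
have e5 : pnorm rho ((numer j)^`() * Y - numer j * Y^`() *+ (a + j.*2).+1) <=
    (s + a + 3)%:R * j.+1%:R * (pnorm rho Y + pnorm rho Y^`()) * pnorm rho (numer j).
  apply: le_trans (pnormD r1 _ _) _; rewrite pnormN//; apply: le_trans (lerD e3 e4) _.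
  by rewrite le_eqVlt; apply/orP; left; apply/eqP; ring.
apply: le_trans (ler_wpM2r (pnorm_ge0 r1 _) e5) _.
by rewrite le_eqVlt /c; apply/orP; left; apply/eqP; ring.
Qed.

Lemma psi_bound z : U z -> exists C B : R, [/\ 0 <= C, 0 < B &
  \forall w \near z, forall j, cabs (psi j w) <= C * B ^+ j * j`!%:R].
Proof.
move=> Uz.
(* Near z the branches are bounded by [rho] and 1 / Y along them by [kap]. The exponent a + 2 j + 1
   of Y accounts for kap^2 in the constant B. *)
pose rho := 1 + \sum_i cabs (b i z); pose kap := 1 + \sum_i cabs (Y.[b i z] : Cplx R)^-1.
have rho1 : 1 <= rho by rewrite lerDl sumr_ge0// => i _; exact: cabs_ge0.
have kap1 : 1 <= kap by rewrite lerDl sumr_ge0// => i _; exact: cabs_ge0.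
have kap0 : 0 < kap by exact: lt_le_trans ltr01 kap1.
have [B B0 HB] := pnorm_numer rho1.
exists ((\sum_i cabs (f i)) * (pnorm rho (numer 0) * kap ^+ a.+1)), (B * kap ^+ 2); split.
- by rewrite !mulr_ge0 ?exprn_ge0 ?pnorm_ge0 ?(ltW kap0)// sumr_ge0// => i _; exact: cabs_ge0.
- by rewrite mulr_gt0// exprn_gt0.
have H i : \forall w \near z, cabs (b i w) <= rho /\ cabs (Y.[b i w] : Cplx R)^-1 <= kap.
  have y0 : Y.[b i z] != 0 by rewrite hornerM mulf_neq0 ?bD ?bW.
  have cY : cts_at (fun w => (Y.[b i w] : Cplx R)^-1) z.
    by apply: ctsV => //; apply: (cts_comp (f := b i)); [exact: cb|exact: cts_polyR].
  apply: filterS2 (cts_cabs (cb i Uz) ltr01) (cts_cabs cY ltr01) => w h1 h2.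
  have tri (x y : Cplx R) : cabs (x - y) < 1 -> cabs y <= 1 + cabs x.
    by move=> h; have := cabs_distC y x; rewrite cabsB; lra.
  split; [apply: le_trans (tri _ _ h1) _|apply: le_trans (tri _ _ h2) _]; rewrite lerD2l (bigD1 i)//= lerDl sumr_ge0// => i' _; exact: cabs_ge0.
apply: filterS (filter_forall _ H) => w hw j.
apply: le_trans (cabs_sum _ _) _; rewrite -!mulrA mulr_suml; apply: ler_sum => i _.
have [h1 h2] := hw i; rewrite cabsM ler_wpM2l ?cabs_ge0// cabsM cabsV horner_exp cabsX.
rewrite -exprVn -cabsV.
apply: (@le_trans _ _ (pnorm rho (numer j) * kap ^+ (a + j.*2).+1)).
  by rewrite ler_pM ?cabs_ge0 ?exprn_ge0 ?cabs_ge0 ?pnorm_horner// lerXn2r ?nnegrE ?cabs_ge0 ?(ltW kap0).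
apply: le_trans (ler_wpM2r _ (HB j)) _; first by rewrite exprn_ge0 ?(ltW kap0).
rewrite le_eqVlt; apply/orP; left; apply/eqP.
by rewrite exprMn -addSn exprD -mul2n exprM; ring.
Qed.

Lemma identity_branches z w : connected U -> w - z != 0 ->
  (forall t : R, 0 < t < 1 -> U (z + rc t * (w - z)) /\ \sum_i f i * qform N D K a (b i (z + rc t * (w - z))) = 0) ->
  forall x, U x -> \sum_i f i * qform N D K a (b i x) = 0.
Proof.
move=> cU zw H x Ux; rewrite -psi0E//.
apply: (identity_chord oU psi_diff psi_bound cU zw) => // t ht.
by have [Ut E] := H t ht; rewrite psi0E.
Qed.

End IdentityBranches.

(** * Sums over edges and sums of branches *)

Section CoreEquiv.
Variables (R : realType) (N D K : {poly R[i]}) (a : nat).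
Variables (S : nat -> Cplx R -> Cplx R) (l : nat -> seq (Cplx R * Cplx R)).
Hypothesis SP : forall m, has_prim D (rmom N D K a m) (S m) (l m).
Variables (n : nat) (U : set (Cplx R)) (b : 'I_n -> Cplx R -> Cplx R).
Hypotheses (oU : open U) (cb : forall i z, U z -> cts_at (b i) z).
Hypotheses (bD : forall i z, U z -> D.[b i z] != 0) (bN : forall i z, U z -> quo N D (b i z) = z).
Hypothesis bW : forall i z, U z -> (wron N D).[b i z] != 0.
Variables (k : nat) (c : Cplx R) (gam : 'I_k -> R -> Cplx R).
Hypotheses (cg : forall s, continuous (gam s)) (g0 : forall s, gam s 0 = c).
Hypothesis inj : forall s u v, 0 <= u <= 1 -> 0 <= v <= 1 -> gam s u = gam s v -> u = v.
Hypothesis meet : forall s s' u v, s != s' -> 0 <= u <= 1 -> 0 <= v <= 1 ->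
  gam s u = gam s' v -> u = 0 /\ v = 0.
Hypothesis gU : forall s u, 0 <= u < 1 -> U (gam s u).
Variable e : 'I_k -> 'I_n -> R -> Cplx R.
Hypothesis ce : forall s i, {within `[0, 1], continuous (e s i)}.
Hypothesis eD : forall s i u, 0 <= u <= 1 -> D.[e s i u] != 0.
Hypothesis eQ : forall s i u, 0 <= u <= 1 -> quo N D (e s i u) = gam s u.
Hypothesis eb : forall s i u, 0 <= u < 1 -> e s i u = b i (gam s u).
Variable f : 'I_k -> 'I_n -> Cplx R.

Local Notation gt := (qform N D K a).

Hypothesis cU : connected U.

(** Over a short piece of the arc the sum of the increments is a chord integral of a density that
    vanishes. This reaches every v < 1; continuity then gives v = 1, whose image may be a branch
    point outside U. *)
Lemma edge_sums_of_branch_sums : (forall s z, U z -> \sum_i f s i * gt (b i z) = 0) ->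
  forall s m, \sum_i f s i * pathint (S m) (l m) (e s i) = 0.
Proof.
move=> hz s m.
have hF i := along_exists (SP m) (@ce s i) (fun u hu => eD s i hu).
pose F i := projT1 (cid (hF i)).
have FP i : [/\ continuous (F i), pathint (S m) (l m) (e s i) = F i 1 - F i 0 &
  along (S m) (l m) (e s i) (F i)] := projT2 (cid (hF i)).
pose G (u : R) := \sum_i f s i * F i u.
have cG (u : R) : cts_at G u.
  by apply: cts_sum => i; apply: ctsM; [exact: cts_cst|apply: ctsT; case: (FP i)].
suff : G 1 = G 0.
  move=> E; rewrite -[RHS](subrr (G 0)) -{1}E -sumrB; apply: eq_bigr => i _.
  by have [_ -> _] := FP i; rewrite mulrBr.
have G0 v : 0 <= v < 1 -> G v = G 0.
  move=> /andP[v0 v1].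
  apply: (interval_ind (Rel := fun p q => G q = G p) v0); first by move=> p q r _ _ _ _ -> ->.
  move=> u0 /andP[u00 u0v]; have hu0 : 0 <= u0 < 1 by rewrite u00 (le_lt_trans u0v).
  pose z0 := gam s u0; have Uz0 : U z0 by exact: gU.
  have hEta i : exists eta : R, 0 < eta /\ forall x, cabs (b i z0 - x) < eta -> D.[x] != 0.
    have [eta h1 h2] := (nbhs_cabs _ _).1 (cts_neq0 (cts_polyR D (b i z0)) (bD i Uz0)).
    by exists eta.
  pose eta i := projT1 (cid (hEta i)); have etaP i : 0 < eta i /\ forall x, cabs (b i z0 - x) < eta i -> D.[x] != 0
    := projT2 (cid (hEta i)).
  have [rho rho0 rhoP] : exists2 rho : R, 0 < rho & forall x, cabs (z0 - x) < rho ->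
      U x /\ forall i, cabs (b i z0 - b i x) < eta i.
    have nU : \forall x \near z0, U x by exact: open_nbhs_nbhs.
    have H i : \forall x \near z0, cabs (b i z0 - b i x) < eta i by exact: (cts_cabs (cb i Uz0) (etaP i).1).
    apply: (nbhs_cabs z0 (fun x => U x /\ forall i, cabs (b i z0 - b i x) < eta i)).1.
    exact: filterI nU (filter_forall _ H).
  have [ep /= ep0 epP] := (nbhs_ballP _ _).1 (cts_cabs (ctsT u0 (@cg s)) rho0).
  exists ep => // p q p0 pq qv hp hq.
  have gP u : p <= u <= q -> cabs (z0 - gam s u) < rho.
    move=> /andP[pu uq]; apply: epP; rewrite /ball /= distrC.
    by move: hp hq; rewrite !ltr_norml => /andP[h1 h2] /andP[h3 h4]; apply/andP; split; lra.
  have gz : cabs (z0 - gam s p) < rho by apply: gP; rewrite lexx.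
  have gw : cabs (z0 - gam s q) < rho by apply: gP; rewrite lexx andbT.
  have hs i t : 0 <= t <= 1 -> U (gam s p + rc t * (gam s q - gam s p)) /\
      cabs (b i z0 - b i (gam s p + rc t * (gam s q - gam s p))) < eta i.
    by move=> ht; have [h1 h2] := rhoP _ (seg_dist gz gw ht).
  apply/eqP; rewrite -subr_eq0 -sumrB; apply/eqP.
  have q1 : q < 1 by exact: le_lt_trans v1.
  have e1 i : e s i p = b i (gam s p) by apply: eb; rewrite p0 (le_lt_trans pq).
  have e2 i : e s i q = b i (gam s q) by apply: eb; rewrite q1 (le_trans p0).
  pose seg (t : R) := gam s p + rc t * (gam s q - gam s p).
  have ci i : citgl 0 1 (fun t => seg t ^+ m * (gt (b i (seg t)) * (gam s q - gam s p))).
    apply: cts_citgl => t ht; have [Ut _] := hs i t ht.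
    apply: ctsM; first by apply: ctsX; exact: seg_cts.
    apply: ctsM; last exact: cts_cst.
    apply: (cts_comp (f := fun t => b i (seg t))); last by apply: cts_qform; [exact: bD|exact: bW].
    by apply: (cts_comp (f := seg)); [exact: seg_cts|exact: cb].
  transitivity (\sum_i f s i * cint 0 1 (fun t => seg t ^+ m * (gt (b i (seg t)) * (gam s q - gam s p)))).
    apply: eq_bigr => i _; rewrite -mulrBr; congr (_ * _).
    have [_ _ aF] := FP i.
    have al := along_local (SP m) (etaP i).2 (@ce s i) aF p0 pq (ltW q1).
    rewrite e1 e2 in al; rewrite -(chord_int SP oU cb bD bN bW m (etaP i).2 (hs i)) al// => u hu.
    have hu' : 0 <= u < 1 by case/andP: hu => h1 h2; rewrite (le_trans p0 h1) (le_lt_trans h2 q1).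
    rewrite eb//; have [_] := rhoP _ (gP u hu); exact.
  rewrite -(cint_sum (index_enum _) (f s) ci).2.
  rewrite (eq_cint (g := fun t => 0 * seg t)); last first.
    move=> t ht; rewrite mul0r.
    transitivity ((\sum_i f s i * gt (b i (seg t))) * (seg t ^+ m * (gam s q - gam s p))).
      by rewrite mulr_suml; apply: eq_bigr => i _; ring.
    rewrite hz ?mul0r//; have [i0|i0] := pselect (exists i : 'I_n, True).
      by case: i0 => i _; exact: (hs i t ht).1.
    by have [h1 h2] := rhoP _ (seg_dist gz gw ht).
  by rewrite cintZ ?mul0r//; apply: cts_citgl => t _; exact: seg_cts.
apply/eqP; rewrite -subr_eq0; apply: contraT => n0.
have cG' : cts_at (fun u => G u - G 0) (1 : R) by apply: ctsB; [exact: cG|exact: cts_cst].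
have [r /= r0 rP] := (nbhs_ballP _ _).1 (cts_neq0 cG' n0).
pose v := 1 - Num.min r 1 / 2.
have m0 : 0 < Num.min r 1 by rewrite lt_min r0 ltr01.
have m1 : Num.min r 1 <= 1 by rewrite ge_min lexx orbT.
have mr : Num.min r 1 <= r by rewrite ge_min lexx.
have := rP v; rewrite /ball /= G0 ?subrr ?eqxx; last by rewrite /v; lra.
have v1 : `|1 - v| < r by rewrite /v opprB addrCA subrr addr0 ger0_norm ?divr_ge0 ?(ltW m0)//; lra.
by move=> /(_ v1).
Qed.

Lemma edge_sums_iff_branch_sums :
  (forall m, \sum_s \sum_i f s i * pathint (S m) (l m) (e s i) = 0) <->
  (forall s z, U z -> \sum_i f s i * gt (b i z) = 0).
Proof.
split=> [H s z Uz|H m]; last by apply: big1 => s _; exact: edge_sums_of_branch_sums.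
have [p [q [pq hpq]]] := branch_sums_vanish_on_chord SP oU cb bD bN bW cg g0 inj meet gU (@ce) eD eQ eb s H.
exact: (identity_branches oU cb bD bN bW cU pq hpq).
Qed.

End CoreEquiv.

(** * Rational functions and curves on the sphere *)

Section RiemannSphere.
Variable R : realType.
Implicit Types (z p : Cplx R) (B : R).

Lemma cball_compact B : compact [set z : Cplx R | cabs z <= B].
Proof.
pose j (q : R * R) : Cplx R := q.1 +i* q.2.
have cj : continuous j.
  by apply: continuous_ReIm => q; [exact: cvg_fst|exact: cvg_snd].
have kI : compact (j @` (`[- B, B] `*` `[- B, B])).
  apply: continuous_compact; first exact: continuous_subspaceT.
  by apply: compact_setX; exact: segment_compact.
apply: (subclosed_compact _ kI).
  have : closed ((fun z : Cplx R => cabs z) @^-1` [set x : R | x <= B]).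
    apply: preimage_closed; last exact: closed_le.
    by move=> z _; exact: (cts_atP (cts_cabsf (cts_id z))).
  exact.
move=> z /= zB; exists (complex.Re z, complex.Im z); last by case: z {zB}.
have h1 := le_trans (cabs_Re z) zB; have h2 := le_trans (cabs_Im z) zB.
by split; rewrite /= in_itv /= -ler_norml.
Qed.

Lemma nbhs_None (A : set (CP1 R)) :
  nbhs (None : CP1 R) A <-> A None /\ exists B : R, forall z, B < cabs z -> A (Some z).
Proof.
split=> [[C [kC _] CA]|[A0 [B HB]]].
  have [B B0 hB] := compact_cabs_bounded kC; split; first by apply: CA; right.
  exists B => z zB; apply: CA; left; exists z => // Cz.
  by have := hB z Cz; rewrite leNgt zB.
exists [set z : Cplx R | cabs z <= B].
  split; first exact: cball_compact.
  by apply: compact_closed; [exact: Cplx_hausdorff|exact: cball_compact].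
move=> x [[z /= /negP zB <-]|->]; last exact: A0.
by apply: HB; rewrite ltNge.
Qed.

Lemma CP1_hausdorff : hausdorff_space (CP1 R).
Proof.
apply: one_point_compactification_hausdorff; last exact: Cplx_hausdorff.
move=> z _; exists [set w : Cplx R | cabs w <= cabs z + 1].
  have : nbhs z [set w : Cplx R | cabs w <= cabs z + 1].
    apply/nbhs_cabs; exists 1 => // w zw /=.
    by have := cabs_distC w z; rewrite cabsB; lra.
  by move=> h; apply: filterS h => w hw _.
split; first exact: cball_compact.
by apply: compact_closed; [exact: Cplx_hausdorff|exact: cball_compact].
Qed.

(** The inverse of the coordinate x = 1 / (z - p) of the sphere. *)
Definition minv p (x : Cplx R) : CP1 R := if x == 0 then None else Some (p + x^-1).

Lemma cts_minv p x : cts_at (minv p) x.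
Proof.
split; have [->|x0] := eqVneq x 0.
  rewrite /minv eqxx => A /nbhs_None [A0 [B HB]].
  have d0 : 0 < `|B| + cabs p + 1 by rewrite ltr_wpDl// addr_ge0 ?cabs_ge0.
  apply/nbhs_cabs; exists (`|B| + cabs p + 1)^-1; first by rewrite invr_gt0.
  move=> w; rewrite sub0r cabsN => hw /=; case: eqVneq => [//|w0]; apply: HB.
  have w0' : 0 < cabs w by rewrite cabs_gt0.
  have : `|B| + cabs p + 1 < cabs w^-1 by rewrite cabsV -ltf_pV2 ?posrE ?invr_gt0// invrK.
  have := cabs_distC w^-1 (- p); rewrite cabsN opprK addrC [w^-1 + p]addrC.
  have := ler_norm B; lra.
have c1 : cts_at (fun w : Cplx R => p + w^-1) x.
  by apply: ctsD; [exact: cts_cst|apply: ctsV => //; exact: cts_id].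
have c2 : cts_at (fun w : Cplx R => Some (p + w^-1) : CP1 R) x.
  apply: (cts_comp (f := fun w : Cplx R => p + w^-1) (g := fun v => Some v : CP1 R)) => //.
have := cts_near _ c2 (g := minv p); move=> h; apply: (cts_atP (h _)).
by apply: filterS (cts_neq0 (cts_id x) x0) => w w0; rewrite /minv (negPf w0).
Qed.

End RiemannSphere.

(** * Integration along piecewise smooth curves *)

Section Piecewise.
Variables (R : realType).
Implicit Types (g h : R -> Cplx R) (a b u : R).

Lemma C1_rdiff h u : continuously_differentiable (fun u => complex.Re (h u)) ->
  continuously_differentiable (fun u => complex.Im (h u)) -> rdiff h u (cderive h u).
Proof.
move=> [d1 _] [d2 _].
have i1 : is_derive u 1 (fun u => complex.Re (h u)) (derive1 (fun u => complex.Re (h u)) u).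
  by rewrite derive1E; exact: DeriveDef.
have i2 : is_derive u 1 (fun u => complex.Im (h u)) (derive1 (fun u => complex.Im (h u)) u).
  by rewrite derive1E; exact: DeriveDef.
apply: (cder_near _ (rdiff_ReIm i1 i2)); apply: near_all => v; by case: (h v).
Qed.

Lemma rdiff_cderive g u (d : Cplx R) : rdiff g u d -> cderive g u = d.
Proof.
move=> dg; have i1 := rdiff_Re dg; have i2 := rdiff_Im dg.
by rewrite /cderive !derive1E (@derive_val _ _ _ _ _ _ _ i1) (@derive_val _ _ _ _ _ _ _ i2); case: d {dg i1 i2}.
Qed.

(** On the open interval [cderive g] agrees with the derivative of the C^1 extension. F is only
    required to inherit a derivative from g, because it will be a primitive along the curve read in
    another coordinate. *)
Lemma pw_piece g a b : a < b -> smooth_on g a b ->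
  {within `[a, b], continuous g} /\
  forall q : R -> Cplx R, (forall u, a <= u <= b -> cts_at q u) ->
    citgl a b (fun u => q u * cderive g u) /\
    forall F : R -> Cplx R, (forall u, a <= u <= b -> cts_at F u) ->
      (forall u d, a < u < b -> rdiff g u d -> rdiff F u (q u * d)) ->
      cint a b (fun u => q u * cderive g u) = F b - F a.
Proof.
move=> ab [h [dR dI gh _]].
have dh u : rdiff h u (cderive h u) by exact: C1_rdiff.
have gE u : a <= u <= b -> g u = h u by move=> hu; apply: gh; rewrite in_itv.
have cdh u : cts_at (cderive h) u.
  by apply: cts_ReIm; [apply: ctsT; exact: dR.2|apply: ctsT; exact: dI.2].
split.
  have ch : {within `[a, b], continuous h}.
    by apply: continuous_subspaceT; apply: cts_continuous => u; exact: rdiff_cts (dh u).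
  apply/subspace_continuousP => u hu; apply/cvg_cabs => e e0.
  move/subspace_continuousP: ch => /(_ u hu)/cvg_cabs/(_ e e0).
  rewrite !near_withinE; apply: filterS => v hv Av.
  have {}hv : cabs (h u - h v) < e := hv Av.
  suff : cabs (g u - g v) < e by [].
  by rewrite !gE.
have dg u : a < u < b -> rdiff g u (cderive h u).
  move=> /andP[au ub]; apply: cder_near (dh u); apply/nbhs_ballP.
  exists (Num.min (u - a) (b - u)); first by rewrite /= lt_min !subr_gt0 au.
  by move=> v; rewrite /ball /= lt_min => /andP[]; rewrite !ltr_norml => h1 h2; rewrite gE//; lra.
have gd u : a < u < b -> cderive g u = cderive h u by move=> hu; exact/rdiff_cderive/dg.
move=> q cq.
have ch : citgl a b (fun u => q u * cderive h u).
  by apply: cts_citgl => u hu; apply: ctsM; [exact: cq|exact: cdh].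
have qE u : a < u < b -> q u * cderive h u = q u * cderive g u by move=> hu; rewrite gd.
have [ig iE] := citgl_oo qE ch; split; first exact: ig.
move=> F cF dF; rewrite -iE.
apply: cint_ftc; [exact: ab| |exact: cF|].
  move=> u hu; exact: dF hu (dg u hu).
by move=> u hu; apply: ctsM; [exact: cq|exact: cdh].
Qed.

Lemma pw_chain g (s : seq R) a : path <%R a s ->
  (forall j, (j < size s)%N -> smooth_on g (nth 0 (a :: s) j) (nth 0 s j)) ->
  [/\ a <= last a s, {within `[a, last a s], continuous g} &
  forall q : R -> Cplx R, (forall u, a <= u <= last a s -> cts_at q u) ->
    citgl a (last a s) (fun u => q u * cderive g u) /\
    forall F : R -> Cplx R, (forall u, a <= u <= last a s -> cts_at F u) ->
      (forall u d, a < u < last a s -> rdiff g u d -> rdiff F u (q u * d)) ->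
      cint a (last a s) (fun u => q u * cderive g u) = F (last a s) - F a].
Proof.
elim: s a => [|c s IH] a /=.
  move=> _ _; split; rewrite ?set_itv1//; first exact: continuous_subspace1.
  move=> q _.
  have c0 : citgl a a (fun=> 0 : Cplx R) by apply: cts_citgl => u _; exact: cts_cst.
  have [|i0 _] := citgl_oo (g := fun u => q u * cderive g u) _ c0; first by move=> u /andP[h1 h2]; have := lt_trans h1 h2; rewrite ltxx.
  by split => // F _ _; rewrite /cint set_itv1 !Rintegral_set1 subrr.
move=> /andP[ac pc] H.
have [cb wc ic] := IH c pc (fun j => H j.+1).
have [wa ia] := pw_piece ac (H 0 (ltn0Sn _)).
have acl := ltW ac.
split; first exact: le_trans cb.
  have -> : `[a, last c s]%classic = `[a, c] `|` `[c, last c s].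
    by apply/seteqP; split => u; rewrite /= !in_itv /=; lra.
  by apply: withinU_continuous => //; exact: interval_closed.
move=> q cq.
have cqa u : a <= u <= c -> cts_at q u by move=> /andP[h1 h2]; apply: cq; rewrite h1 (le_trans h2).
have cqc u : c <= u <= last c s -> cts_at q u by move=> /andP[h1 h2]; apply: cq; rewrite h2 (le_trans acl).
have [ia1 ia2] := ia q cqa; have [ic1 ic2] := ic q cqc.
have [i1 E] := citgl_cat acl cb ia1 ic1; split => // F cF dF.
rewrite E (ia2 F); first rewrite (ic2 F); first by rewrite addrC addrA subrK.
- by move=> u /andP[h1 h2]; apply: cF; rewrite h2 (le_trans acl).
- by move=> u d /andP[h1 h2]; apply: dF; rewrite h2 (lt_trans ac).
- by move=> u /andP[h1 h2]; apply: cF; rewrite h1 (le_trans h2).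
by move=> u d /andP[h1 h2]; apply: dF; rewrite h1 (lt_le_trans h2).
Qed.

Lemma pw_curve g : piecewise_smooth g -> {within `[0, 1], continuous g} /\
  forall q : R -> Cplx R, (forall u, 0 <= u <= 1 -> cts_at q u) ->
    citgl 0 1 (fun u => q u * cderive g u) /\
    forall F : R -> Cplx R, (forall u, 0 <= u <= 1 -> cts_at F u) ->
      (forall u d, 0 < u < 1 -> rdiff g u d -> rdiff F u (q u * d)) ->
      cint 0 1 (fun u => q u * cderive g u) = F 1 - F 0.
Proof.
move=> [s [ps ls H]]; have [_] := pw_chain ps H; by rewrite ls.
Qed.

End Piecewise.

(** * Values of rational functions in lowest terms *)

Section RationalFunctionValues.
Variable R : realType.
Implicit Types (r s : ratfun R) (A B p : {poly R[i]}) (z : Cplx R).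
Local Notation "p %:F" := (@FracField.tofrac _ p).
Local Open Scope quotient_scope.

Lemma frac_repr r : r * (frac (repr r)).2%:F = (frac (repr r)).1%:F.
Proof.
rewrite -{1}[r]reprK; move: (repr r) => x; have := denom_ratioP x => x2.
unlock FracField.tofrac; rewrite -[LHS]FracField.pi_mul.
apply/eqmodP; rewrite /= FracField.equivfE /FracField.mulf /=.
by rewrite !numden_Ratio ?oner_eq0 ?mulf_neq0 ?oner_eq0// !mulr1 mulrC.
Qed.

Lemma rden_neq0 r : rden r != 0.
Proof. by rewrite /rden dvdp_div_eq0 ?dvdp_gcdr// denom_ratioP. Qed.

Lemma rat_coprime r : coprimep (rnum r) (rden r).
Proof. by apply: coprimep_div_gcd; rewrite denom_ratioP orbT. Qed.

Lemma rat_split r : r = (rnum r)%:F / (rden r)%:F.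
Proof.
have d0 : (rden r)%:F != 0 :> ratfun R by rewrite tofrac_eq0 rden_neq0.
apply: (mulIf d0); rewrite divfK//; set x := frac (repr r).
have g0 : gcdp x.1 x.2 != 0 by rewrite gcdp_eq0 negb_and denom_ratioP orbT.
have g0' : (gcdp x.1 x.2)%:F != 0 :> ratfun R by rewrite tofrac_eq0.
apply: (mulIf g0'); rewrite -mulrA -!tofracM /rnum /rden.
by rewrite !divpK ?dvdp_gcdl ?dvdp_gcdr// frac_repr.
Qed.

Lemma rat_mul r : r * (rden r)%:F = (rnum r)%:F.
Proof.
have d0 : (rden r)%:F != 0 :> ratfun R by rewrite tofrac_eq0 rden_neq0.
by rewrite {1}[r]rat_split divfK.
Qed.

Lemma rat_cross r A B : B != 0 -> r = A%:F / B%:F -> rnum r * B = A * rden r.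
Proof.
move=> B0 rE; apply/eqP; rewrite -(tofrac_eq _ _) !tofracM.
have B0' : B%:F != 0 :> ratfun R by rewrite tofrac_eq0.
have e1 : r * B%:F = A%:F by rewrite {1}rE divfK.
by rewrite -e1 -rat_mul mulrAC.
Qed.

Lemma rat_no_common r z : (rden r).[z] = 0 -> (rnum r).[z] != 0.
Proof.
move=> d0; apply/negP => n0.
by have := coprimep_root (rat_coprime r) n0; rewrite d0 eqxx.
Qed.

Lemma reval_some r z : (rden r).[z] != 0 -> reval r (Some z) = Some (rval r z).
Proof. by rewrite /reval => /negbTE ->. Qed.

(** If the reduced denominator vanished at z, so would the reduced numerator, which coprimality
    forbids. *)
Lemma reval_cross r A B z : rnum r * B = A * rden r -> B.[z] != 0 ->
  (rden r).[z] != 0 /\ rval r z = A.[z] / B.[z].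
Proof.
move=> E B0; have Ez : (rnum r).[z] * B.[z] = A.[z] * (rden r).[z] by rewrite -!hornerM E.
have d0 : (rden r).[z] != 0.
  apply/eqP => d0; have := rat_no_common d0; move: Ez; rewrite d0 mulr0 => /eqP.
  by rewrite mulf_eq0 (negPf B0) orbF => ->.
by split => //; rewrite /rval; apply/eqP; rewrite eqr_div// Ez.
Qed.

Lemma rat_cts r z : (rden r).[z] != 0 -> cts_at (rval r) z.
Proof.
by move=> d0; apply: ctsM; [exact: cts_polyR|apply: ctsV => //; exact: cts_polyR].
Qed.

End RationalFunctionValues.

Lemma poly_near0 (R : realType) (A : {poly R[i]}) (t : Cplx R) : (\forall s \near t, A.[s] = 0) -> A = 0.
Proof.
move=> /nbhs_cabs [e e0 H]; apply/eqP; apply: contraT => A0.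
pose pt (j : nat) : R[i] := t + rc (e / j.+2%:R).
have pinj : injective pt.
  move=> i j /addrI /(congr1 (@complex.Re R)) /= /mulfI; rewrite gt_eqF// => /(_ isT) /invr_inj /eqP.
  by rewrite eqr_nat => /eqP [].
pose s := [seq pt j | j <- iota 0 (size A)].
have us : uniq s by rewrite map_inj_uniq ?iota_uniq.
have rs : all (root A) s.
  apply/allP => x /mapP [j _ ->]; apply/eqP; apply: H.
  rewrite /pt opprD addNKr cabsN cabs_real ger0_norm ?divr_ge0 ?ltW//.
  by rewrite ltr_pdivrMr// ltr_pMr// ltr1n.
by have := max_poly_roots A0 rs us; rewrite size_map size_iota ltnn.
Qed.

(** Removes finitely many exceptional points, the zeros of A, from an identity between continuous
    functions. *)
Lemma poly_density (R : realType) (A : {poly R[i]}) (h : Cplx R -> Cplx R) (t : Cplx R) : A != 0 -> cts_at h t ->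
  (\forall s \near t, A.[s] * h s = 0) -> h t = 0.
Proof.
move=> A0 ch H; apply/eqP; apply: contraT => ht.
have /poly_near0 E : \forall s \near t, A.[s] = 0.
  apply: filterS2 H (cts_neq0 ch ht) => s /eqP; rewrite mulf_eq0 => + hs.
  by rewrite (negPf hs) orbF => /eqP.
by rewrite E eqxx in A0.
Qed.

(** The resolvent identity bounds the increment by a multiple of |t - s|. *)
Lemma resolvent_cts (R : realType) (I : Type) (p : I -> Cplx R) T t : bdd_functional p T -> far p t ->
  cts_at (fun s => T (fun z => (z - s)^-1)) t.
Proof.
move=> bT [d d0 dP]; have [C C0 hC] := bddB bT.
apply: cts_atE => e e0.
have ne s i : cabs (t - s) <= d / 2 -> d / 2 <= cabs (p i - s).
  move=> hs; have := cabsD (p i - s) (s - t); rewrite addrA subrK [cabs (s - t)]cabsB.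
  by have := dP i; lra.
have ne0 s i : cabs (t - s) <= d / 2 -> p i - s != 0.
  by move=> hs; rewrite -cabs_gt0; apply: lt_le_trans (ne s i hs); rewrite divr_gt0.
have ad s : cabs (t - s) <= d / 2 -> cts_along p (fun z => (z - s)^-1).
  by move=> hs i; apply: ctsV; [exact: ne0|apply: ctsB; [exact: cts_id|exact: cts_cst]].
have tt : cabs (t - t) <= d / 2 by rewrite subrr cabs0 divr_ge0 ?ltW.
pose L := C * (4 / d ^+ 2) + 1.
have L0 : 0 < L by rewrite ltr_wpDl// mulr_ge0// divr_ge0// exprn_ge0// ltW.
apply/nbhs_cabs; exists (Num.min (d / 2) (e / L)); first by rewrite lt_min !divr_gt0.
move=> s; rewrite lt_min => /andP[s1 s2]; have hs := ltW s1.
have -> : T (fun z => (z - t)^-1) - T (fun z => (z - s)^-1) =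
    T (fun z => (z - t)^-1 + (-1) * (z - s)^-1).
  have am : cts_along p (fun z => (-1) * (z - s)^-1).
    by move=> i; apply: ctsM; [exact: cts_cst|exact: ad].
  rewrite (bddD bT (ad _ tt) am) (bddZ bT _ (ad _ hs)); congr (_ + _).
  by rewrite mulN1r.
apply: (@le_lt_trans _ _ (C * (cabs (t - s) * (4 / d ^+ 2)))).
  apply: hC.
  - by move=> i; apply: ctsD; [exact: ad|apply: ctsM; [exact: cts_cst|exact: ad]].
  - by rewrite mulr_ge0 ?cabs_ge0// divr_ge0// exprn_ge0// ltW.
  move=> i; have id (x y z : Cplx R) : x - y != 0 -> x - z != 0 ->
    (x - y)^-1 + (-1) * (x - z)^-1 = (y - z) * ((x - y)^-1 * (x - z)^-1) by move=> h1 h2; field; rewrite h1 h2.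
  rewrite id ?ne0// cabsM ler_wpM2l ?cabs_ge0// cabsM !cabsV.
  have -> : 4 / d ^+ 2 = (d / 2)^-1 * (d / 2)^-1 by field; rewrite gt_eqF.
  have d20 : 0 < d / 2 by rewrite divr_gt0.
  have h1 := ne t i tt; have h2 := ne s i hs.
  by rewrite ler_pM ?invr_ge0 ?cabs_ge0// lef_pV2// posrE; exact: lt_le_trans d20 _.
rewrite mulrCA; apply: le_lt_trans (_ : cabs (t - s) * L < e); last by rewrite -ltr_pdivlMr.
by rewrite ler_wpM2l ?cabs_ge0// /L lerDl.
Qed.

(** * Rationality of I_infty and vanishing moments *)

Section IInftyMoments.
Variables (R : realType) (P q : ratfun R) (g : R -> Cplx R).
Hypothesis pw : piecewise_smooth g.
Hypothesis np : forall u, 0 <= u <= 1 -> (rden P).[g u] != 0 /\ (rden q).[g u] != 0.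

Let gc u := g (c01 u).
Let wq u := rval q (gc u) * cderive g u.
Let pP u := rval P (gc u).

Definition moment h := fnl pP wq h.
Definition image_P : set (Cplx R) := [set rval P (g u) | u in `[0, 1]].

Lemma cts_gc u : cts_at gc u.
Proof. by apply: ctsT; exact: within_c01 (pw_curve pw).1. Qed.

Lemma cts_P_path u : cts_at pP u.
Proof.
apply: (cts_comp (f := gc)); first exact: cts_gc.
by apply: rat_cts; have [] := np (c01P u).
Qed.

Lemma citgl_wq : citgl 0 1 wq.
Proof.
have := ((pw_curve pw).2 (fun u => rval q (gc u)) _).1; apply => u _.
apply: (cts_comp (f := gc)); first exact: cts_gc.
by apply: rat_cts; have [] := np (c01P u).
Qed.

Lemma bdd_moment : bdd_on image_P moment.
Proof.
apply: bdd_fnl; [by move=> u _; exact: cts_P_path| |exact: citgl_wq].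
by move=> u hu; exists (c01 u) => //; rewrite /= in_itv /= c01P.
Qed.

Lemma contour_moment h : contour_integral g (fun z => h (rval P z) * rval q z) = moment h.
Proof.
rewrite /moment /fnl /contour_integral -/(cint 0 1 _).
apply: (eq_cint (f := fun u => h (rval P (g u)) * rval q (g u) * cderive g u)) => u hu.
by rewrite /pP /wq /gc c01_id// mulrA.
Qed.

Lemma I_inftyE t : I_infty P q g t = (0 +i* (2 * pi))^-1 * moment (fun z => (z - t)^-1).
Proof.
rewrite /I_infty -contour_moment; congr (_ * _).
by congr (contour_integral g); apply/funext => z; rewrite mulrC.
Qed.

Lemma image_P_compact : compact image_P.
Proof.
have -> : image_P = [set pP u | u in `[0, 1]].
  by apply/seteqP; split => _ [u hu <-]; exists u => //; rewrite /pP /gc c01_id//; move: hu; rewrite /= in_itv.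
apply: continuous_compact; last exact: segment_compact.
by apply: continuous_subspaceT; apply: cts_continuous => u; exact: cts_P_path.
Qed.

Lemma image_P_far t : ~ image_P t -> far (fun i : {z | image_P z} => sval i) t.
Proof.
move=> /(compact_complement_ball image_P_compact) [d d0 dP]; exists d => // -[z Xz] /=.
by rewrite leNgt; apply/negP => h; apply: (dP z) => //; rewrite cabsB.
Qed.

Lemma Uinf_notin t : U_infty P g (Some t) -> ~ image_P t.
Proof.
move=> /connected_component_sub /= H [u hu tE]; apply: H; exists u => //.
by rewrite ifN ?tE//; move: hu; rewrite /= in_itv => /np [].
Qed.

(** The ray t / x, for x from 1 down to 0, joins t to infinity; its modulus never falls below |t|,
    so it misses the image of the curve. *)
Lemma Uinf_far (B : R) t : (forall z, image_P z -> cabs z <= B) -> B < cabs t -> 0 <= B ->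
  U_infty P g (Some t).
Proof.
move=> hB Bt B0; have t0 : t != 0 by rewrite -cabs_gt0; exact: le_lt_trans Bt.
pose ray (x : R) : CP1 R := minv 0 (rc x / t).
have c1 : connected [set ray x | x in `[0, 1]].
  apply: connected_continuous_connected; first exact: segment_connected.
  apply: continuous_subspaceT; apply: cts_continuous => x.
  apply: (cts_comp (f := fun x => rc x / t)); last exact: cts_minv.
  by apply: ctsM; [exact: rc_cts|exact: cts_cst].
apply: (connected_component_max (B := [set ray x | x in `[0, 1]])) => //.
- by exists 0; [rewrite /= in_itv /= lexx ler01|rewrite /ray /rc mul0r /minv eqxx].
- move=> _ [x + <-] [u hu]; rewrite /= in_itv /= => /andP[x0 x1].
  have hu' : 0 <= u <= 1 by move: hu; rewrite /= in_itv.
  rewrite ifN; last by case: (np hu').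
  rewrite /ray /minv; case: eqVneq => // n0 [E].
  have : cabs (rval P (g u)) <= B by apply: hB; exists u.
  rewrite E add0r cabsV cabsM cabsV cabs_real ger0_norm// invf_div leNgt => /negP; apply.
  have xp : 0 < x.
    by rewrite lt_neqAle x0 andbT eq_sym; apply: contra n0 => /eqP ->; rewrite /rc mul0r.
  by rewrite ltr_pdivlMr//; apply: le_lt_trans Bt; rewrite ler_piMr.
exists 1; first by rewrite /= in_itv /= lexx ler01.
by rewrite /ray /minv /rc mul1r invr_eq0 (negPf t0) add0r invrK.
Qed.


Lemma res_ne t : ~ image_P t -> forall i : {z | image_P z}, sval i - t != 0.
Proof. by move=> Xt [z Xz] /=; rewrite subr_eq0; apply/eqP => E; apply: Xt; rewrite -E. Qed.

Let c2 : Cplx R := 0 +i* (2 * pi).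

Lemma c2_neq0 : c2 != 0.
Proof. by rewrite eq_complex /= negb_and mulf_neq0 ?orbT// gt_eqF ?pi_gt0. Qed.

Lemma image_P_bounded : exists2 B : R, 0 <= B & forall i : {z | image_P z}, cabs (sval i) <= B.
Proof.
have [B B0 hB] := compact_cabs_bounded image_P_compact; exists B; first exact: ltW.
by move=> [z Xz] /=; exact: hB.
Qed.

Lemma moments_rational (A : {poly R[i]}) : A != 0 ->
  (forall m, moment (fun z => A.[z] * z ^+ m) = 0) -> I_infty_rational P q g.
Proof.
move=> A0 mom; have bT := bdd_moment; have [B B0 hB] := image_P_bounded.
have bTA := bdd_mulpoly A image_P_bounded bT.
pose TA h := moment (fun z => A.[z] * h z).
have Zfar t : 2 * B < cabs t -> moments_vanish_at TA t.
  move=> ht; have t0 : t != 0 by rewrite -cabs_gt0; apply: le_lt_trans ht; rewrite mulr_ge0.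
  apply: (moments_vanish_infty bTA t0 _ mom) => i; rewrite ler_pdivlMr// mulrC.
  by apply: ltW; apply: le_lt_trans ht; rewrite ler_wpM2l.
have ZU t : U_infty P g (Some t) -> moments_vanish_at TA t.
  (* The predicate is true at infinity by decree, so that the clopen argument can start there and
     run over the connected set U_infty of the sphere. *)
  move=> Ut; pose Q (x : CP1 R) := if x is Some t then moments_vanish_at TA t else True.
  have U0 : U_infty P g None.
    by apply: connected_component_refl => -[u]; rewrite /= in_itv /= => /np [h _]; rewrite ifN.
  apply: (connected_ind (Q := Q) _ _ U0 Ut) => //; first exact: component_connected.
  move=> [x|] Ux.
    have h := moments_vanish_local bTA (image_P_far (Uinf_notin Ux)).
    suff : nbhs x (fun y => U_infty P g (Some y) -> (Q (Some x) <-> Q (Some y))) by [].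
    by apply: filterS h => y h _.
  apply/nbhs_None; split; first by [].
  by exists (2 * B) => z hz _; split => // _; exact: Zfar.
have [G GE] := resolvent_poly bT A.
have key t : U_infty P g (Some t) -> \forall s \near t, ~ image_P s /\ A.[s] * moment (fun z => (z - s)^-1) = - G.[s].
  move=> Ut; have Xt := Uinf_notin Ut; have [d d0 dP] := compact_complement_ball image_P_compact Xt.
  have nX : \forall s \near t, ~ image_P s by apply/nbhs_cabs; exists d.
  apply: filterS2 nX (moments_vanish_local bTA (image_P_far Xt)) => s Xs [Zs _]; split => //.
  have := Zs (ZU t Ut) 0%N; rewrite /TA.
  have -> : (fun z => A.[z] * (z - s)^-1 ^+ 1) = fun z => A.[z] * (z - s)^-1.
    by apply/funext => z; rewrite expr1.
  rewrite (GE s (res_ne Xs)) => E; apply/eqP; rewrite -subr_eq0 opprK; exact/eqP.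
have cA0 : c2%:P * A != 0 by rewrite mulf_neq0// polyC_eq0 c2_neq0.
pose r : ratfun R := FracField.tofrac (- G) / FracField.tofrac (c2%:P * A).
have cr : rnum r * (c2%:P * A) = - G * rden r by exact: rat_cross.
exists r => t Ut; have kt := key t Ut; rewrite I_inftyE -/c2.
pose J s := c2^-1 * moment (fun z => (z - s)^-1).
have cJ : cts_at J t.
  by apply: ctsM; [exact: cts_cst|exact: resolvent_cts bT (image_P_far (Uinf_notin Ut))].
(* Immediate off the zeros of A and extended to them by continuity. It also shows that t is no pole
   of r: a zero of the denominator would be one of the numerator. *)
have E : (rnum r).[t] - J t * (rden r).[t] = 0.
  apply: (poly_density (h := fun s => (rnum r).[s] - J s * (rden r).[s]) A0).
    by apply: ctsB; [exact: cts_polyR|apply: ctsM; [exact: cJ|exact: cts_polyR]].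
  apply: filterS kt => s [Xs Es].
  have := congr1 (fun p : {poly R[i]} => p.[s]) cr; rewrite /= !hornerM hornerC hornerN -Es /J => H.
  have c0 := c2_neq0; move: H; set T1 := moment _; set a := A.[s]; set x := _.[s]; set y := (rden r).[s] => H.
  have id (a1 x1 y1 t1 : Cplx R) : x1 * (c2 * a1) = a1 * t1 * y1 -> a1 * (x1 - c2^-1 * t1 * y1) = 0.
    move=> h; have -> : a1 * (x1 - c2^-1 * t1 * y1) = c2^-1 * (x1 * (c2 * a1) - a1 * t1 * y1) by field.
    by rewrite h subrr mulr0.
  exact: id.
have d0 : (rden r).[t] != 0.
  apply/eqP => d0; have := rat_no_common d0; move: E; rewrite d0 mulr0 subr0 => ->.
  by rewrite eqxx.
have {}E : (rnum r).[t] = J t * (rden r).[t] by apply/eqP; rewrite -subr_eq0 E.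
by rewrite reval_some// /rval E mulfK.
Qed.

Lemma rational_moments : I_infty_rational P q g ->
  exists2 A : {poly R[i]}, A != 0 & forall m, moment (fun z => A.[z] * z ^+ m) = 0.
Proof.
move=> [r rE]; exists (rden r); first exact: rden_neq0.
set A := rden r; have bT := bdd_moment; have [B B0 hB] := image_P_bounded.
have hBX z : image_P z -> cabs z <= B by move=> Xz; exact: (hB (exist _ z Xz)).
have bTA := bdd_mulpoly A image_P_bounded bT.
have [G GE] := resolvent_poly bT A.
(* As A is the denominator of I_infty, the Cauchy transform of A times the functional equals the
   polynomial [H] near infinity. It tends to 0 there, hence is 0. *)
pose H : {poly R[i]} := (c2 : R[i])%:P * rnum r + G.
have HE t : B < cabs t -> moment (fun z => A.[z] * (z - t)^-1) = H.[t].
  move=> Bt; have Ut := Uinf_far hBX Bt B0; have Xt := Uinf_notin Ut.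
  rewrite (GE t (res_ne Xt)) /H hornerD hornerM hornerC; congr (_ + _).
  have := rE t Ut; rewrite /reval; case: ifPn => // d0 [].
  rewrite I_inftyE -/c2 /rval => E; have c0 := c2_neq0.
  have -> : moment (fun z => (z - t)^-1) = c2 * (c2^-1 * moment (fun z => (z - t)^-1)) by rewrite mulVKf.
  by rewrite -E mulrCA [A.[t] * _]mulrC divfK.
have H0 : H = 0.
  apply: poly_infty0 => e e0; have [C C0 hC] := bddB bTA.
  exists (B + 1 + C / e) => t ht.
  have Ce : 0 <= C / e by rewrite divr_ge0// ltW.
  have Bt : B < cabs t by lra.
  have Xt := Uinf_notin (Uinf_far hBX Bt B0).
  rewrite -HE//; apply: (@le_trans _ _ (C * (1 + C / e)^-1)).
    have s0 : 0 < 1 + C / e by lra.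
    apply: hC.
    - by move=> i; apply: ctsV; [exact: res_ne|apply: ctsB; [exact: cts_id|exact: cts_cst]].
    - by rewrite invr_ge0 ltW.
    move=> i; rewrite cabsV lef_pV2 ?posrE ?cabs_gt0 ?res_ne//.
    by have := cabs_distC t (sval i); rewrite cabsB; have := hB i; lra.
  rewrite ler_pdivrMr; last by lra.
  by rewrite mulrDr mulr1 mulrC mulfVK ?gt_eqF// lerDr ltW.
move=> m; apply: (moments_of_resolvent bTA (M0 := B + 1) image_P_bounded) => t ht.
by rewrite HE ?H0 ?horner0//; lra.
Qed.

End IInftyMoments.

(** * Change of coordinate on the sphere *)

Section HomCoef.
Variable R : realType.
Implicit Types (p q : {poly R[i]}) (a x t : R[i]).

Lemma size_linX a j : (size ((a *: 'X + 1) ^+ j : {poly R[i]}) <= j.+1)%N /\ ((a *: 'X + 1) ^+ j : {poly R[i]})`_j = a ^+ j.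
Proof.
elim: j => [|j [s c]]; first by rewrite !expr0 size_poly1 coef1.
split.
  rewrite exprS; apply: leq_trans (size_polyMleq _ _) _.
  have s2 : (size (a *: 'X + 1 : {poly R[i]})%R <= 2)%N.
    apply: leq_trans (size_polyD _ _) _; rewrite geq_max size_poly1 andbT.
    by apply: leq_trans (size_scale_leq _ _) _; rewrite size_polyX.
  by move: s s2; lia.
rewrite exprS mulrDl mul1r -scalerAl coefD coefZ coefXM /= c.
by rewrite [X in _ + X](leq_sizeP _ _ s) // addr0 exprS.
Qed.

Lemma size_homog a d p : (size (homog a d p) <= d.+1)%N.
Proof.
apply/leq_sizeP => j dj; rewrite /homog coef_sum big1// => i _.
rewrite coefZ coefMXn; case: ltnP => [_|ij]; first by rewrite mulr0.
have := (size_linX a i).1 => /leq_sizeP ->; first by rewrite mulr0.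
by have := ltn_ord i; lia.
Qed.

Lemma coef_homog a d p : (size p <= d.+1)%N -> (homog a d p)`_d = p.[a].
Proof.
move=> sp; rewrite /homog coef_sum (horner_coef_wide _ sp); apply: eq_bigr => j _.
have jd : (j <= d)%N by rewrite -ltnS.
by rewrite coefZ coefMXn ltnNge leq_subr /= subKn// (size_linX a j).2.
Qed.

Lemma homogB a d p q t : homog a d (p - t *: q) = homog a d p - t *: homog a d q.
Proof.
rewrite /homog scaler_sumr -sumrB; apply: eq_bigr => j _.
by rewrite coefB coefZ scalerBl scalerA.
Qed.

Lemma homogS a d p : (size p <= d.+1)%N -> homog a d.+1 p = 'X * homog a d p.
Proof.
move=> sp; rewrite /homog big_ord_recr /= nth_default// scale0r addr0 mulr_sumr.
apply: eq_bigr => j _; have jd : (j <= d)%N by rewrite -ltnS.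
by rewrite subSn// exprS -scalerAr; congr (_ *: _); rewrite mulrCA.
Qed.

End HomCoef.

Lemma cdiff_unique (R : realType) (f : Cplx R -> Cplx R) z d e : cdiff f z d -> cdiff f z e -> d = e.
Proof.
move=> h1 h2; have := cderB h1 h2 => h; apply/eqP; rewrite -subr_eq0; apply/eqP.
by apply: cdiff_eq0 h; apply: near_all => w; rewrite subrr.
Qed.

Section RatMult.
Variables (R : realType) (P : ratfun R).
Hypothesis P0 : (0 < rdeg P)%N.
Local Notation n := (rnum P).
Local Notation d := (rden P).

Lemma num_sub_scale_den_neq0 t : n - t *: d != 0.
Proof.
apply/eqP => /subr0_eq E.
have [/eqP s1|/closed_rootP [x /rootP dx]] := boolP (size d == 1%N); last first.
  by have := rat_no_common dx; rewrite E hornerZ dx mulr0 eqxx.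
move: P0; rewrite /rdeg s1 maxn0 E.
by have := size_scale_leq t d; rewrite s1; case: (size _) => [|[]].
Qed.

(** The derivative of num - t den at z, multiplied by den (z), is the Wronskian at z. *)
Lemma rmult_gt1 z : d.[z] != 0 -> (wron n d).[z] = 0 -> (1 < rmult P (rval P z) (Some z))%N.
Proof.
move=> d0 W0; rewrite /rmult; set t := rval P z; set p := n - t *: d.
have p0 : p != 0 := num_sub_scale_den_neq0 t.
have nt : n.[z] = t * d.[z] by rewrite /t /rval divfK.
have pz : p.[z] = 0 by rewrite /p hornerD hornerN hornerZ nt subrr.
have pz' : p^`().[z] = 0.
  apply: (mulIf d0); rewrite mul0r /p derivB derivZ hornerD hornerN hornerZ -W0 /wron.
  by rewrite hornerD hornerN !hornerM mulrBl nt; congr (_ - _); rewrite mulrAC.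
rewrite mup_geq//; move/eqP: pz; rewrite -/(root p z) => /factor_theorem [q pE].
move: pz'; rewrite pE derivM derivXsubC mulr1 hornerD hornerM hornerXsubC subrr mulr0 add0r.
move=> /rootP/factor_theorem [q' ->].
by rewrite -mulrA -expr2 dvdp_mulIr.
Qed.

End RatMult.

(* A coordinate [M] on the sphere, with inverse [Mi], sending some pole of [P] to infinity:
   [P = N / D] and [q dz = K0 / D0 dx] in this coordinate. *)
Record coords (R : realType) (P q : ratfun R) (N D K0 D0 : {poly R[i]})
    (M : CP1 R -> Cplx R) (Mi : Cplx R -> CP1 R) : Prop := Coords {
  co_size : (size D < size N)%N;
  co_cop : forall x, D.[x] = 0 -> N.[x] != 0;
  co_D0 : D0 != 0;
  co_M : forall x, reval P x <> None ->
    [/\ D.[M x] != 0, Mi (M x) = x, reval P x = Some (quo N D (M x)) & cts_at M x];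
  co_Mi : forall x, D.[x] != 0 ->
    [/\ M (Mi x) = x, cts_at Mi x & reval P (Mi x) = Some (quo N D x)];
  co_W : forall x t, reval P x = Some t -> (rmult P t x <= 1)%N -> (wron N D).[M x] != 0;
  co_fin : forall z, (rden P).[z] != 0 -> (rden q).[z] != 0 ->
    exists dM : Cplx R, [/\ dM != 0, cdiff (fun w : Cplx R => M (Some w)) z dM, D0.[M (Some z)] != 0 &
      rval q z = K0.[M (Some z)] / D0.[M (Some z)] * dM] }.

Section CoordsExist.
Variables (R : realType) (P q : ratfun R).
Hypothesis P0 : (0 < rdeg P)%N.

Lemma reval_someN z : reval P (Some z) <> None -> (rden P).[z] != 0.
Proof. by rewrite /reval; case: ifPn. Qed.

Lemma coords_id : (size (rden P) < size (rnum P))%N ->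
  coords P q (rnum P) (rden P) (rnum q) (rden q) (fun x => if x is Some z then z else 0) (fun z => Some z).
Proof.
move=> sP; split => //.
- by move=> x; exact: rat_no_common.
- exact: rden_neq0.
- move=> [z|]; last by rewrite /= sP.
  by move=> /reval_someN d0; split => //; rewrite reval_some.
- by move=> z d0; split => //; rewrite reval_some.
- move=> [z|] t; last by rewrite /= sP.
  move=> E; have d0 : (rden P).[z] != 0 by apply: reval_someN; rewrite E.
  move: E; rewrite reval_some// => -[<-]; rewrite leqNgt; apply: contra => /eqP.
  exact: rmult_gt1.
move=> z d0 q0; exists 1; split; [exact: oner_neq0|exact: cder_id|exact: q0|by rewrite mulr1].
Qed.

(** The coordinate is x = 1 / (z - p), with p a finite pole. Then dz = - dx / x^2, which accounts
    for the sign and for the factor X^2; numerators and denominators are homogenized in a common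
    degree. *)
Lemma coords_inv p : (size (rnum P) <= size (rden P))%N -> root (rden P) p ->
  exists N D K0 D0 M Mi, coords P q N D K0 D0 M Mi.
Proof.
move=> sP rp; set n := rnum P; set d := rden P.
have d_neq0 : d != 0 := rden_neq0 P.
have sd : (1 < size d)%N by exact: root_size_gt1 rp.
pose m := (size d).-1.
have sm : size d = m.+1 by rewrite /m prednK// ltnW.
have m0 : (0 < m)%N by move: sd; rewrite sm.
have sn : (size n <= m.+1)%N by rewrite -sm.
have sd' : (size d <= m.+1)%N by rewrite sm.
have lead0 : d`_m != 0 by rewrite -lead_coef_eq0 /lead_coef in d_neq0.
pose e := maxn (size (rnum q)) (size (rden q)).
have se1 : (size (rnum q) <= e.+1)%N by rewrite leqW// leq_maxl.
have se2 : (size (rden q) <= e.+1)%N by rewrite leqW// leq_maxr.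
pose N := homog p m n; pose D := homog p m d.
pose M (x : CP1 R) : Cplx R := if x is Some z then (z - p)^-1 else 0.
exists N, D, (- homog p e (rnum q)), ('X^2 * homog p e (rden q)), M, (minv p).
have N0 : N.[0] = n`_m by exact: homog0.
have D0 : D.[0] = d`_m by exact: homog0.
have nz z : d.[z] != 0 -> z - p != 0.
  by move=> dz; rewrite subr_eq0; apply: contra dz => /eqP ->.
have pzE z : p + ((z - p)^-1)^-1 = z by rewrite invrK addrC subrK.
have NE z : d.[z] != 0 -> N.[(z - p)^-1] = (z - p)^-1 ^+ m * n.[z].
  by move=> dz; rewrite homogE ?invr_neq0 ?nz// pzE.
have DE z : d.[z] != 0 -> D.[(z - p)^-1] = (z - p)^-1 ^+ m * d.[z].
  by move=> dz; rewrite homogE ?invr_neq0 ?nz// pzE.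
have Dne z : d.[z] != 0 -> D.[(z - p)^-1] != 0.
  by move=> dz; rewrite DE// mulf_neq0// expf_neq0// invr_neq0// nz.
have quoE z : d.[z] != 0 -> quo N D (z - p)^-1 = rval P z.
  move=> dz; rewrite /quo NE// DE// /rval -mulf_div divff ?mul1r//.
  by rewrite expf_neq0// invr_neq0// nz.
have dM z : z - p != 0 -> cdiff (fun w : Cplx R => M (Some w)) z (- (1 - 0) / (z - p) ^+ 2).
  move=> z0; apply: (cderV (g := fun w : Cplx R => w - p)) => //.
    by apply: ctsB; [exact: cts_id|exact: cts_cst].
  by apply: cderB; [exact: cder_id|exact: cder_cst].
have revN : reval P None = Some (quo N D 0).
  by rewrite /= ltnNge sP /= /quo N0 D0.
split.
(* The coefficient of degree m of a homogenization is the value at p, which is zero for D and not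
   for N. *)
- have : (size D <= m)%N.
    apply/leq_sizeP => j; rewrite leq_eqVlt => /orP[/eqP <-|jm].
      by rewrite coef_homog//; exact/rootP.
    by have := size_homog p m d => /leq_sizeP; apply.
  move=> /leq_ltn_trans; apply; rewrite ltnNge; apply/negP => /leq_sizeP /(_ m (leqnn _)).
  by rewrite coef_homog//; apply/eqP; apply: rat_no_common; exact/rootP.
- move=> x Dx; have [x0|x0] := eqVneq x 0; first by move: Dx lead0; rewrite x0 D0 => ->; rewrite eqxx.
  move: Dx; rewrite !homogE// => /eqP; rewrite mulf_eq0 expf_eq0 (negPf x0) andbF /= => /eqP dx.
  by rewrite mulf_neq0 ?expf_neq0// rat_no_common.
- rewrite mulf_neq0 ?expf_neq0 ?polyX_eq0//; apply/eqP => h0.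
  suff : rden q = 0 by apply/eqP; exact: rden_neq0.
  apply: (@poly_near0 _ _ (p + 1)).
  have : \forall s \near (p + 1 : Cplx R), s - p != 0.
    apply: (cts_neq0 (f := fun s : Cplx R => s - p)); last by rewrite addrAC subrr add0r oner_neq0.
    by apply: ctsB; [exact: cts_id|exact: cts_cst].
  apply: filterS => s sp; have := @homogE _ p e (rden q) (s - p)^-1 se2 (invr_neq0 sp).
  rewrite h0 horner0 pzE => /esym/eqP.
  by rewrite mulf_eq0 expf_eq0 invr_eq0 (negPf sp) andbF /= => /eqP.
- move=> [z|] hz.
    have dz := reval_someN hz; split; first exact: Dne.
    + by rewrite /minv invr_eq0 (negPf (nz z dz)) invrK addrC subrK.
    + by rewrite reval_some// quoE.
    have := cdiff_cts (dM z (nz z dz)) => -[c1]; split => A nA; exact: (c1 A nA).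
  split; [by rewrite D0|by rewrite /minv eqxx|exact: revN|].
  split => A /nbhs_cabs [r r0 rA]; apply/nbhs_None; split; first by apply: rA; rewrite subrr cabs0.
  exists (cabs p + r^-1) => z zr; apply: rA; rewrite sub0r cabsN cabsV.
  have h : r^-1 < cabs (z - p) by have := cabs_distC z p; lra.
  by rewrite -[ltRHS]invrK ltf_pV2 ?posrE ?invr_gt0//; apply: lt_trans h; rewrite invr_gt0.
- move=> x Dx; have [x0|x0] := eqVneq x 0.
    rewrite x0; split; [by rewrite /minv eqxx|exact: cts_minv|by rewrite /minv eqxx].
  have dx : d.[p + x^-1] != 0.
    by move: Dx; rewrite homogE// mulf_eq0 negb_or => /andP[].
  have xE : (p + x^-1 - p)^-1 = x by rewrite addrAC subrr add0r invrK.
  have mE : minv p x = Some (p + x^-1) by rewrite /minv (negPf x0).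
  split; [by rewrite mE /M xE|exact: cts_minv|].
  by rewrite mE reval_some// -quoE// xE.
- move=> [z|] t E hm.
    have dz : d.[z] != 0 by apply: reval_someN; rewrite E.
    move: E; rewrite reval_some// => -[tE]; rewrite -tE in hm.
    have W0 : (wron n d).[z] != 0.
      by apply: contraTneq hm => W0; rewrite -ltnNge; exact: rmult_gt1.
    have c1 := cdiff_quo n dz.
    have zp := nz z dz.
    have c2 := cder_comp (cdiff_cts (dM z zp)) (dM z zp) (cdiff_quo N (Dne z dz)).
    have nd : \forall w \near z, d.[w] != 0 by exact: (cts_neq0 (cts_polyR d z) dz).
    have c3 : cdiff (fun w : Cplx R => quo N D (M (Some w))) z ((wron n d).[z] / d.[z] ^+ 2).
      by apply: cder_near c1; apply: filterS nd => w dw; rewrite /M quoE.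
    have := cdiff_unique c2 c3; apply: contra_eqN => /eqP ->.
    by rewrite mul0r mul0r eq_sym mulf_neq0// invr_neq0// expf_neq0.
  (* The point at infinity, x = 0. There num - t den has degree at most m - 1, and exactly m - 1 in
     case of multiplicity 1; then N - t D is X times a polynomial that does not vanish at 0. *)
  move: E hm; rewrite revN => -[tE]; rewrite /rmult -/n -/d; set pp := n - t *: d => hm.
  have pp0 : pp != 0 := num_sub_scale_den_neq0 P0 t.
  have n0 : n`_m = t * d`_m by rewrite -N0 -D0 -tE /quo divfK// D0.
  have ppm : pp`_m = 0 by rewrite /pp coefB coefZ n0 subrr.
  have spp : (size pp <= m)%N.
    apply/leq_sizeP => j; rewrite leq_eqVlt => /orP[/eqP <- //|jm].
    by rewrite /pp coefB coefZ !nth_default ?mulr0 ?subrr//; [exact: leq_trans sd' jm|exact: leq_trans sn jm].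
  have rdE : rdeg P = m.
    rewrite /rdeg -/n -/d sm /=; apply/maxn_idPr; by move: sn; case: (size n).
  rewrite rdE in hm.
  have spp' : size pp = m.
    have s1 : (0 < size pp)%N by rewrite lt0n size_poly_eq0.
    by move: hm spp s1; lia.
  have ppl : pp`_m.-1 != 0 by rewrite -spp' -/(lead_coef pp) lead_coef_eq0.
  have hE : N - t *: D = 'X * homog p m.-1 pp.
    by rewrite /N /D -homogB -/pp -{1}(prednK m0) homogS// prednK.
  have W0E : (wron N D).[0] = D.[0] * (homog p m.-1 pp).[0].
    have h1 : (N - t *: D)^`().[0] = (homog p m.-1 pp).[0].
      by rewrite hE derivM derivX mul1r hornerD hornerM hornerX mul0r addr0.
    rewrite -h1 derivB derivZ /wron !hornerE /=.
    by rewrite N0 n0 -D0; ring.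
  by rewrite /= W0E homog0 mulf_neq0// D0.
move=> z dz qz; have zp := nz z dz; exists (- (1 - 0) / (z - p) ^+ 2); split.
- by rewrite subr0 mulNr mul1r oppr_eq0 invr_neq0// expf_neq0.
- exact: dM.
- by rewrite hornerM hornerXn mulf_neq0 ?expf_neq0 ?invr_neq0// homogE ?invr_neq0// pzE mulf_neq0// expf_neq0// invr_neq0.
rewrite hornerN hornerM hornerXn !homogE ?invr_neq0// pzE /rval.
set a := (rnum q).[z]; set b := (rden q).[z]; have y0 : (z - p)^-1 ^+ e != 0 by rewrite expf_neq0// invr_neq0.
have id (x y a' b' : Cplx R) : x != 0 -> y != 0 -> b' != 0 ->
  a' / b' = - (y * a') / (x^-1 ^+ 2 * (y * b')) * (- (1 - 0) / x ^+ 2) by move=> h1 h2 h3; field; rewrite h1 h2 h3.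
exact: id.
Qed.

Lemma coords_exist : exists N D K0 D0 M Mi, coords P q N D K0 D0 M Mi.
Proof.
have [sP|sP] := ltnP (size (rden P)) (size (rnum P)).
  by do 6 eexists; exact: coords_id.
have [/eqP s1|/closed_rootP [p rp]] := boolP (size (rden P) == 1%N); last exact: coords_inv rp.
by move: P0; rewrite /rdeg s1 maxn0; move: sP; rewrite s1; case: (size _) => [|[]].
Qed.

End CoordsExist.

(** * Clearing denominators by a polynomial in P *)

Section Clearing.
Variables (R : realType) (N D : {poly R[i]}).
Local Notation Q := (quo N D).

Lemma poly_quo (A : {poly R[i]}) : exists (K : {poly R[i]}) a, forall x, D.[x] != 0 ->
  A.[Q x] = K.[x] * (D.[x] ^+ a)^-1.
Proof.
elim/poly_ind: A => [|A c [K [a E]]].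
  by exists 0, 0%N => x _; rewrite !horner0 mul0r.
exists (K * N + c *: D ^+ a.+1), a.+1 => x x0.
rewrite hornerMXaddC E// hornerD hornerM hornerZ horner_exp /quo exprS.
have id (k n d e s : Cplx R) : d != 0 -> e != 0 ->
  k * e^-1 * (n / d) + s = (k * n + s * (d * e)) * (d * e)^-1 by move=> h1 h2; field; rewrite h1 h2.
by apply: id; rewrite ?expf_neq0.
Qed.

(** A root e that is also a root of D is absorbed into the power of D. Otherwise A receives the
    factor X - Q(e), because the numerator of Q(x) - Q(e) is divisible by x - e. *)
Lemma clear_roots (r : seq R[i]) : exists (A K : {poly R[i]}) a, A != 0 /\ forall x, D.[x] != 0 ->
  A.[Q x] = (\prod_(e <- r) ('X - e%:P)).[x] * (K.[x] * (D.[x] ^+ a)^-1).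
Proof.
elim: r => [|e r [A [K [a [A0 E]]]]].
  by exists 1, 1, 0%N; split; [exact: oner_neq0|move=> x _; rewrite big_nil !hornerC invr1 !mulr1].
have [De|De] := eqVneq D.[e] 0.
  move/rootP/factor_theorem: De => [D1 D1E].
  exists A, (K * D1), a.+1; split=> // x x0; rewrite E// big_cons !hornerM hornerXsubC exprS.
  have DxE : D.[x] = D1.[x] * (x - e) by rewrite {1}D1E hornerM hornerXsubC.
  have xe : x - e != 0 by move: x0; rewrite DxE mulf_eq0 negb_or => /andP[].
  have d1 : D1.[x] != 0 by move: x0; rewrite DxE mulf_eq0 negb_or => /andP[].
  have da : D.[x] ^+ a != 0 by rewrite expf_neq0.
  have id (p k d v w : Cplx R) : d != 0 -> v != 0 -> w != 0 ->
    p * (k * w^-1) = v * p * (k * d * (d * v * w)^-1) by move=> h1 h2 h3; field; rewrite h1 h2 h3.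
  by rewrite {2}DxE; exact: id.
have : root (N * D.[e]%:P - N.[e]%:P * D) e.
  by rewrite /root hornerD hornerN !hornerM !hornerC subrr.
move=> /factor_theorem [G GE].
exists (A * ('X - (Q e)%:P)), (K * (G * (D.[e])^-1%:P)), a.+1; split.
  by rewrite mulf_neq0// polyXsubC_eq0.
move=> x x0; rewrite hornerM E// hornerXsubC big_cons !hornerM hornerXsubC hornerC exprS.
have GxE : N.[x] * D.[e] - N.[e] * D.[x] = G.[x] * (x - e).
  by have := congr1 (fun p : {poly R[i]} => p.[x]) GE; rewrite /= hornerD hornerN !hornerM !hornerC hornerXsubC.
have QE : Q x - Q e = G.[x] * (x - e) / (D.[x] * D.[e]).
  rewrite -GxE /quo; have id (n d n' d' : Cplx R) : d != 0 -> d' != 0 ->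
    n / d - n' / d' = (n * d' - n' * d) / (d * d') by move=> h1 h2; field; rewrite h1 h2.
  exact: id.
rewrite QE; have da : D.[x] ^+ a != 0 by rewrite expf_neq0.
have id (p k w g v d d' : Cplx R) : d != 0 -> d' != 0 -> w != 0 ->
  p * (k * w^-1) * (g * v / (d * d')) = v * p * (k * (g * d'^-1) * (d * w)^-1).
  by move=> h1 h2 h3; field; rewrite h1 h2 h3.
exact: id.
Qed.

Lemma clear_denoms (A1 K0 D0 : {poly R[i]}) : A1 != 0 -> D0 != 0 ->
  exists (A2 K : {poly R[i]}) a, A2 != 0 /\ forall x, D.[x] != 0 -> D0.[x] != 0 ->
  (A2 * A1).[Q x] * (K0.[x] / D0.[x]) = K.[x] * (D.[x] ^+ a)^-1.
Proof.
move=> A10 D00; have [r rE] := closed_field_poly_normal D0.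
have [A [K [a [A0 E]]]] := clear_roots r; have [K1 [a1 E1]] := poly_quo A1.
have l0 : lead_coef D0 != 0 by rewrite lead_coef_eq0.
exists A, (K * K1 * K0 * (lead_coef D0)^-1%:P), (a + a1)%N; split=> // x x0 y0.
have D0x : D0.[x] = lead_coef D0 * (\prod_(e <- r) ('X - e%:P)).[x] by rewrite {1}rE hornerZ.
rewrite hornerM E// E1// D0x !hornerM hornerC exprD.
have p0 : (\prod_(e <- r) ('X - e%:P)).[x] != 0.
  by move: y0; rewrite rE hornerZ mulf_eq0 negb_or => /andP[].
have id (p k v k1 w k0 s : Cplx R) : p != 0 -> v != 0 -> w != 0 -> s != 0 ->
  p * (k * v^-1) * (k1 * w^-1) * (k0 / (s * p)) = k * k1 * k0 * s^-1 * (v * w)^-1.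
  by move=> h1 h2 h3 h4; field; rewrite h1 h2 h3 h4.
by apply: id; rewrite ?expf_neq0.
Qed.

End Clearing.

(** * Lifts of the star *)

Section RootLimit.
Variable R : realType.
Implicit Types (N D : {poly R[i]}) (x : Cplx R).

Lemma seq_separated (s : seq (Cplx R)) : exists2 e : R, 0 < e &
  forall x y, x \in s -> y \in s -> cabs (x - y) < e -> x = y.
Proof.
have one x (s' : seq (Cplx R)) : exists2 e : R, 0 < e & forall y, y \in s' -> cabs (x - y) < e -> x = y.
  elim: s' => [|z s' [e e0 H]]; first by exists 1.
  have [xz|xz] := eqVneq x z.
    by exists e => // y; rewrite inE => /orP[/eqP -> //|ys]; exact: H.
  exists (Num.min e (cabs (x - z))); first by rewrite lt_min e0 cabs_gt0 subr_eq0.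
  move=> y; rewrite inE lt_min => /orP[/eqP ->|ys] /andP[h1 h2]; last exact: H.
  by rewrite ltxx in h2.
elim: s => [|x s [e e0 H]]; first by exists 1.
have [e' e'0 H'] := one x s; exists (Num.min e e'); first by rewrite lt_min e0.
move=> y z; rewrite !inE lt_min => /orP[/eqP ->|ys] /orP[/eqP ->|zs] /andP[h1 h2] //.
- exact: H'.
- by apply/esym; apply: H' => //; rewrite cabsB.
exact: H.
Qed.

(** Cauchy's bound for the roots of N - t D: as deg D < deg N, the leading coefficient does not
    depend on t. *)
Lemma root_bounded N D (T : R) : (size D < size N)%N -> 0 <= T -> exists2 B : R, 0 <= B &
  forall t x : Cplx R, cabs t <= T -> N.[x] = t * D.[x] -> cabs x <= B.
Proof.
move=> sDN T0; pose m := (size N).-1.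
have sN : size N = m.+1 by rewrite /m prednK// (leq_ltn_trans _ sDN).
have sD : (size D <= m)%N by rewrite -ltnS -sN.
pose L := cabs (N`_m : Cplx R); have L0 : 0 < L.
  by rewrite cabs_gt0 -[m]/(size N).-1 -/(lead_coef N) lead_coef_eq0 -size_poly_eq0 sN.
pose S := \sum_(i < m) (T * cabs (D`_i : Cplx R) + cabs (N`_i : Cplx R)).
have S0 : 0 <= S by apply: sumr_ge0 => i _; rewrite addr_ge0 ?mulr_ge0 ?cabs_ge0.
exists (1 + S / L); first by rewrite addr_ge0// divr_ge0// ltW.
move=> t x tT E; have [x1|x1] := leP (cabs x) 1.
  by apply: le_trans x1 _; rewrite lerDl divr_ge0// ltW.
have x0 : 0 <= cabs x := cabs_ge0 x.
have key : L * cabs x ^+ m = cabs (\sum_(i < m) (t * D`_i - N`_i) * x ^+ i).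
  rewrite /L -cabsX -cabsM; congr cabs.
  have : N.[x] = \sum_(i < m) N`_i * x ^+ i + N`_m * x ^+ m by rewrite horner_coef sN big_ord_recr.
  rewrite E (horner_coef_wide _ sD) => E2.
  apply/eqP; rewrite eq_sym -subr_eq0; apply/eqP.
  under eq_bigr do rewrite mulrBl -mulrA.
  by rewrite sumrB -mulr_sumr E2 addrAC addrK subrr.
have : L * cabs x ^+ m * cabs x <= S * cabs x ^+ m.
  rewrite key; apply: le_trans (ler_wpM2r x0 (cabs_sum _ _)) _.
  rewrite !mulr_suml; apply: ler_sum => i _; rewrite cabsM cabsX -mulrA -exprSr.
  apply: ler_pM; rewrite ?cabs_ge0 ?exprn_ge0//.
    apply: le_trans (cabsD _ _) _; rewrite cabsN lerD2r cabsM ler_wpM2r ?cabs_ge0//.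
  by rewrite ler_weXn2l// ltW.
have xm : 0 < cabs x ^+ m by rewrite exprn_gt0// (lt_trans ltr01).
rewrite mulrAC ler_pM2r// mulrC -ler_pdivlMr// => h; apply: le_trans h _.
by rewrite lerDr.
Qed.

(** The lift is bounded and N - t(1) D becomes small along it, so it comes close to one of finitely
    many roots; being continuous, it cannot jump from one root to another. *)
Lemma root_limit N D (t xi : R -> Cplx R) : (size D < size N)%N -> continuous t ->
  (forall v, 0 <= v < 1 -> cts_at xi v) ->
  (forall v, 0 <= v < 1 -> N.[xi v] = t v * D.[xi v]) ->
  exists x1, N.[x1] = t 1 * D.[x1] /\
    forall e : R, 0 < e -> exists2 d : R, 0 < d & forall v, 1 - d < v < 1 -> cabs (x1 - xi v) < e.
Proof.
move=> sDN ct cxi E.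
have kI : compact [set t v | v in `[0, 1]].
  apply: continuous_compact; last exact: segment_compact.
  exact: continuous_subspaceT.
have [T T0 hT] := compact_cabs_bounded kI.
have [B B0 hB] := root_bounded sDN (ltW T0).
have xiB v : 0 <= v < 1 -> cabs (xi v) <= B.
  move=> hv; apply: hB (E v hv); apply: hT; exists v => //; rewrite /= in_itv /=; lra.
pose p := N - t 1 *: D.
have p0 : p != 0.
  apply/eqP => /subr0_eq NE; move: sDN; rewrite NE ltnNge => /negP; apply; exact: size_scale_leq.
have [rs rsE] := closed_field_poly_normal p.
have l0 : lead_coef p != 0 by rewrite lead_coef_eq0.
pose l := cabs (lead_coef p : Cplx R); have l0' : 0 < l by rewrite cabs_gt0.
have rho1 : 1 <= 1 + B by rewrite lerDl.
pose Dm := pnorm (1 + B) D; have Dm0 : 0 <= Dm by exact: pnorm_ge0.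
have near1 e : 0 < e -> exists2 d : R, 0 < d <= 1 & forall v, 1 - d < v < 1 -> exists2 r, r \in rs & cabs (xi v - r) < e.
  (* If all roots were at distance at least e, the polynomial would be at least l e^(number of
     roots) in modulus. *)
  move=> e0; pose eta := l * e ^+ size rs / (Dm + 1).
  have eta0 : 0 < eta by rewrite divr_gt0 ?mulr_gt0 ?exprn_gt0// ltr_wpDl.
  have [d /= d0 dP] := (nbhs_ballP _ _).1 (cts_cabs (ctsT (1 : R) ct) eta0).
  exists (Num.min d 1); first by rewrite lt_min d0 ltr01 ge_min lexx orbT.
  move=> v /andP[v1 v2]; have d1 : Num.min d 1 <= 1 by rewrite ge_min lexx orbT.
  have dd : Num.min d 1 <= d by rewrite ge_min lexx.
  have hv : 0 <= v < 1 by lra.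
  have tv : cabs (t 1 - t v) < eta by apply: dP; rewrite /ball /= gtr0_norm ?subr_gt0//; lra.
  apply: contrapT => H.
  have far r : r \in rs -> e <= cabs (xi v - r).
    by move=> rrs; rewrite leNgt; apply/negP => h; apply: H; exists r.
  have pE : cabs (p.[xi v] : Cplx R) = cabs (t 1 - t v) * cabs (D.[xi v] : Cplx R).
    by rewrite /p hornerD hornerN hornerZ E// -mulrBl cabsM cabsB.
  have : l * e ^+ size rs <= cabs (p.[xi v] : Cplx R).
    rewrite rsE hornerZ cabsM ler_wpM2l ?cabs_ge0// horner_prod.
    elim: (rs) far => [|r rs' IH] far; first by rewrite big_nil expr0 cabs1.
    rewrite big_cons cabsM /= exprS hornerXsubC ler_pM ?exprn_ge0 ?(ltW e0)//.
      by apply: far; rewrite mem_head.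
    by apply: IH => r' hr'; apply: far; rewrite inE hr' orbT.
  rewrite leNgt pE => /negP; apply.
  apply: (@le_lt_trans _ _ (cabs (t 1 - t v) * Dm)).
    rewrite ler_wpM2l ?cabs_ge0// pnorm_horner//; apply: le_trans (xiB v hv) _.
    by rewrite lerDr.
  apply: (@le_lt_trans _ _ (cabs (t 1 - t v) * (Dm + 1))); first by rewrite ler_wpM2l ?cabs_ge0// lerDl.
  by rewrite -ltr_pdivlMr// ltr_wpDl.
have [e0 e00 sep] := seq_separated rs.
have e02 : 0 < e0 / 2 by rewrite divr_gt0.
have [d0 /andP[d00 d01] H0] := near1 _ e02.
pose v0 := 1 - d0 / 2.
have hv0 : 1 - d0 < v0 < 1 by rewrite /v0; lra.
have [r1 r1s hr1] := H0 v0 hv0.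
(* Two roots closer than [e0] coincide, so the root within e0 / 2 of [xi v] is unique, and it is
   locally constant in v. *)
have Q v : 1 - d0 < v < 1 -> cabs (xi v - r1) < e0 / 2.
  move=> hv; apply: (connected_ind (A := [set v : R | 1 - d0 < v < 1])
    (Q := fun v => cabs (xi v - r1) < e0 / 2) _ _ hv0 hv hr1).
    apply/connected_intervalP => x y /= hx hy z /andP[xz zy]; lra.
  move=> u /= hu; have hu' : 0 <= u < 1 by lra.
  have [r rs' hr] := H0 u hu.
  have c0 : 0 < e0 / 2 - cabs (xi u - r) by rewrite subr_gt0.
  apply: filterS (cts_cabs (cxi u hu') c0) => w hw hw'.
  have hwr : cabs (xi w - r) < e0 / 2.
    have := cabsD (xi w - xi u) (xi u - r); rewrite addrA subrK [cabs (xi w - xi u)]cabsB; lra.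
  have same (y : R) : cabs (xi y - r) < e0 / 2 -> cabs (xi y - r1) < e0 / 2 -> r1 = r.
    move=> h1 h2; apply: sep => //; have id (a b c : Cplx R) : a - b = - (c - a) + (c - b) by ring.
    rewrite (id _ _ (xi y)); apply: le_lt_trans (cabsD _ _) _; rewrite cabsN; lra.
  by split => h; [rewrite (same u hr h)|rewrite (same w hwr h)].
exists r1; split.
  have : root p r1 by rewrite rsE rootZ// root_prod_XsubC.
  by rewrite /root /p hornerD hornerN hornerZ subr_eq0 => /eqP.
move=> e ep; have m0 : 0 < Num.min e (e0 / 2) by rewrite lt_min ep.
have [d /andP[d_0 d_1] H] := near1 _ m0.
exists (Num.min d d0); first by rewrite lt_min d_0.
move=> v /andP[v1 v2].
have k1 : Num.min d d0 <= d by rewrite ge_min lexx.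
have k2 : Num.min d d0 <= d0 by rewrite ge_min lexx orbT.
have hv1 : 1 - d < v < 1 by clear -v1 v2 k1; lra.
have hv2 : 1 - d0 < v < 1 by clear -v1 v2 k2; lra.
have [r rs' hr] := H v hv1.
move: hr; rewrite lt_min => /andP[h1 h2].
have -> : r1 = r.
  apply: sep => //; have id (a b c : Cplx R) : a - b = - (c - a) + (c - b) by ring.
  rewrite (id _ _ (xi v)); apply: le_lt_trans (cabsD _ _) _; rewrite cabsN.
  by have := Q v hv2; clear -h1 h2; lra.
by rewrite cabsB.
Qed.

End RootLimit.

Lemma within_open_cts (T V : topologicalType) (U : set T) (f : T -> V) z :
  open U -> {within U, continuous f} -> U z -> cts_at f z.
Proof.
move=> oU /subspace_continuousP cf Uz; split => A nA.
have nU : \forall x \near z, U x by exact: open_nbhs_nbhs.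
have h : \forall x \near z, U x -> A (f x) := cf z Uz A nA.
by apply: filterS2 nU h => x Ux; exact.
Qed.

Lemma cts_reval (R : realType) (r : ratfun R) (x : CP1 R) : reval r x <> None ->
  cts_at (fun y => finite_part (reval r y)) x.
Proof.
case: x => [z|] hx.
  have d0 := reval_someN hx.
  have h : cts_at (rval r) z := rat_cts d0.
  split => A; rewrite {1}/finite_part reval_some// => nA.
  suff : \forall y \near (z : Cplx R), A (finite_part (reval r (Some y))) by [].
  have h1 : \forall y \near z, (rden r).[y] != 0 := cts_neq0 (cts_polyR (rden r) z) d0.
  have h2 : \forall y \near z, A (rval r y) := cts_atP h nA.
  suff H : (fun y : Cplx R => (rden r).[y] != 0) `&` (fun y : Cplx R => A (rval r y)) `<=` (fun y => A (finite_part (reval r (Some y)))).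
    exact: (filterS H (filterI h1 h2)).
  by move=> y [dy hy]; rewrite /= (negPf dy).
have sr : (size (rnum r) <= size (rden r))%N by rewrite leqNgt; apply/negP => h; apply: hx; rewrite /= h.
have d_neq0 := rden_neq0 r.
pose m := (size (rden r)).-1.
have sm : size (rden r) = m.+1 by rewrite /m prednK// lt0n size_poly_eq0.
have s1 : (size (rnum r) <= m.+1)%N by rewrite -sm.
have s2 : (size (rden r) <= m.+1)%N by rewrite sm.
(* At infinity the function is read in the coordinate 1 / z. *)
pose N := homog 0 m (rnum r); pose D := homog 0 m (rden r).
have D0 : D.[0] != 0 by rewrite /D homog0 -lead_coef_eq0 /lead_coef in d_neq0 *.
have cg : cts_at (quo N D) 0 := cts_quo N D0.
split => A.
have -> : finite_part (reval r None) = quo N D 0.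
  by rewrite /= ltnNge sr /= /quo /N /D !homog0 /lead_coef.
move=> nA.
have hA : \forall s \near (0 : Cplx R), A (quo N D s) := cts_atP cg nA.
have hD : \forall s \near (0 : Cplx R), D.[s] != 0 := cts_neq0 (cts_polyR D 0) D0.
have [e e0 eP] := (nbhs_cabs _ _).1 (filterI hA hD).
apply/nbhs_None; split.
  by have [h _] := eP 0 ltac:(by rewrite subrr cabs0); rewrite /= ltnNge sr /= /lead_coef -/m; move: h; rewrite /quo /N /D !homog0.
exists e^-1 => z hz; have z0 : z != 0 by rewrite -cabs_gt0; apply: lt_trans hz; rewrite invr_gt0.
have ez : cabs (0 - z^-1) < e.
  by rewrite sub0r cabsN cabsV invf_plt// posrE cabs_gt0.
have [h1 h2] := eP _ ez.
have zi : z^-1 != 0 by rewrite invr_eq0.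
have dz : (rden r).[z] != 0.
  by move: h2; rewrite /D homogE// invrK add0r mulf_eq0 negb_or => /andP[].
rewrite /= (negPf dz) /=; suff -> : rval r z = quo N D z^-1 by [].
rewrite /quo /N /D !homogE// invrK add0r /rval -mulf_div divff ?mul1r//.
by rewrite expf_neq0.
Qed.

Lemma moments_mulpoly (R : realType) (P q : ratfun R) (g : R -> Cplx R) (A B : {poly R[i]}) :
  piecewise_smooth g ->
  (forall u, 0 <= u <= 1 -> (rden P).[g u] != 0 /\ (rden q).[g u] != 0) ->
  (forall m, moment P q g (fun z => A.[z] * z ^+ m) = 0) ->
  forall m, moment P q g (fun z => (B * A).[z] * z ^+ m) = 0.
Proof.
move=> pw np H; have bT := bdd_moment pw np.
have ap (C : {poly R[i]}) j : cts_along (fun i : {z | image_P P g z} => sval i) (fun z => C.[z] * z ^+ j).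
  by move=> i; apply: ctsM; [exact: cts_polyR|apply: ctsX; exact: cts_id].
elim/poly_ind: B => [|B c IH] m.
  transitivity (moment P q g (fun z => 0 * (A.[z] * z ^+ m))); last by rewrite (bddZ bT) ?mul0r//; exact: ap.
  apply: (bdd_ext bT); [exact: ap|by move=> i; apply: ctsM; [exact: cts_cst|exact: ap]|].
  by move=> i; rewrite !mul0r horner0 mul0r.
transitivity (moment P q g (fun z => (B * A).[z] * z ^+ m.+1 + c * (A.[z] * z ^+ m))).
  apply: (bdd_ext bT); [exact: ap| |].
    by move=> i; apply: ctsD; [exact: ap|apply: ctsM; [exact: cts_cst|exact: ap]].
  move=> i; rewrite !hornerM hornerMXaddC exprS; ring.
rewrite (bddD bT); [|exact: ap|by move=> i; apply: ctsM; [exact: cts_cst|exact: ap]].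
rewrite (bddZ bT); last exact: ap.
by rewrite IH H mulr0 addr0.
Qed.

(** * From moments along the curve to the sums of branches *)

Section StarLifts.
Variables (R : realType) (n k : nat) (P q : ratfun R) (gamma : R -> Cplx R).
Variables (cs : 'I_k -> Cplx R) (c : Cplx R) (arc : 'I_k -> R -> Cplx R).
Variables (U : set (Cplx R)) (br : 'I_n -> Cplx R -> CP1 R) (w : seq (oedge n k)).
Hypothesis pw : piecewise_smooth gamma.
Hypothesis np : forall u, 0 <= u <= 1 -> (rden P).[gamma u] != 0 /\ (rden q).[gamma u] != 0.
Hypothesis star0 : is_star cs c arc.
Hypotheses (oU : open U) (cU : connected U).
Hypothesis nbr : forall t, U t -> ~ branch_point P t.
Hypothesis sU : star c arc `\` range cs `<=` U.
Hypothesis brs : forall i, is_branch P U (br i).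
Hypothesis hgw : homologous_to_zero (~` poles P)
  (simplex_chain (fun u => Some (gamma u) : CP1 R) - graph_path_chain arc br w).
Variables (N D K0 D0 : {poly R[i]}) (M : CP1 R -> Cplx R) (Mi : Cplx R -> CP1 R).
Hypothesis co : coords P q N D K0 D0 M Mi.

(** Constant beyond both ends, so that the arcs are continuous on the whole line. *)
Let gam s u := arc s (c01 u).

Lemma gam_cts s : continuous (gam s).
Proof. by case: star0 => _ /(_ s) [h _] _ _; exact: within_c01. Qed.

Lemma gam0 s : gam s 0 = c.
Proof. by case: star0 => _ _ /(_ s) [h _] _; rewrite /gam c01_id// lexx ler01. Qed.

Lemma arc_inj s u v : 0 <= u <= 1 -> 0 <= v <= 1 -> arc s u = arc s v -> u = v.
Proof.
by move=> hu hv; case: star0 => _ /(_ s) [_ h] _ _; apply: h; rewrite in_itv.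
Qed.

Lemma gam_inj s u v : 0 <= u <= 1 -> 0 <= v <= 1 -> gam s u = gam s v -> u = v.
Proof. by move=> hu hv; rewrite /gam !c01_id//; exact: arc_inj. Qed.

Lemma arc_meet s s' u v : s != s' -> 0 <= u <= 1 -> 0 <= v <= 1 -> arc s u = arc s' v -> u = 0 /\ v = 0.
Proof.
move=> ss hu hv E; case: star0 => _ _ a01 /(_ s s' ss) h.
have h0 : 0 <= (0 : R) <= 1 by rewrite lexx ler01.
have uc : arc s u = c.
  have : (arc s @` `[0, 1] `&` arc s' @` `[0, 1]) (arc s u).
    by split; [exists u => //; rewrite /= in_itv|exists v => //; rewrite /= in_itv].
  by rewrite h.
split; [apply: (arc_inj (s := s)) => //|apply: (arc_inj (s := s')) => //].
  by rewrite uc (a01 s).1.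
by rewrite -E uc (a01 s').1.
Qed.

Lemma gam_meet s s' u v : s != s' -> 0 <= u <= 1 -> 0 <= v <= 1 -> gam s u = gam s' v -> u = 0 /\ v = 0.
Proof. by move=> ss hu hv; rewrite /gam !c01_id//; exact: arc_meet. Qed.

Lemma gamU s u : 0 <= u < 1 -> U (gam s u).
Proof.
move=> /andP[u0 u1]; have hu : 0 <= u <= 1 by rewrite u0 ltW.
have h1 : 0 <= (1 : R) <= 1 by rewrite ler01 lexx.
rewrite /gam c01_id//; apply: sU; split; first by right; exists s => //; exists u => //; rewrite /= in_itv.
move=> [s' _ E]; case: star0 => _ _ /(_ s') [_ a1] _; rewrite -a1 in E.
have [ss|ss] := eqVneq s' s.
  by rewrite ss in E; have := arc_inj h1 hu E => uE; move: u1; rewrite -uE ltxx.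
by have [/eqP] := arc_meet ss h1 hu E; rewrite oner_eq0.
Qed.

Let b i z := M (br i z).

Lemma br_some i z : U z -> reval P (br i z) = Some z.
Proof. by move=> Uz; case: (brs i) => _; exact. Qed.

Lemma br_nonpole i z : U z -> reval P (br i z) <> None.
Proof. by move=> Uz; rewrite br_some. Qed.

Lemma br_cts i z : U z -> cts_at (br i) z.
Proof. by move=> Uz; have [cbr _] := brs i; exact: within_open_cts oU cbr Uz. Qed.

Lemma b_cts i z : U z -> cts_at (b i) z.
Proof.
move=> Uz; apply: (cts_comp (f := br i)); first exact: br_cts.
by have [] := co_M co (@br_nonpole i z Uz).
Qed.

Lemma b_D i z : U z -> D.[b i z] != 0.
Proof. by move=> Uz; have [] := co_M co (@br_nonpole i z Uz). Qed.

Lemma b_quo i z : U z -> quo N D (b i z) = z.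
Proof.
by move=> Uz; have [_ _] := co_M co (@br_nonpole i z Uz); rewrite br_some// => -[].
Qed.

Lemma b_W i z : U z -> (wron N D).[b i z] != 0.
Proof.
move=> Uz; apply: (co_W co (@br_some i z Uz)); rewrite leqNgt; apply/negP => h.
by apply: (nbr Uz); exists (br i z).
Qed.

Lemma b_Mi i z : U z -> Mi (b i z) = br i z.
Proof. by move=> Uz; have [] := co_M co (@br_nonpole i z Uz). Qed.

Lemma edge_lt s i u : u < 1 -> edge arc br s i u = br i (arc s u).
Proof. by rewrite /edge => ->. Qed.

(** The limit that defines the end of an edge does exist: [root_limit] finds it in the coordinate x,
    [co_cop] shows that it is not a root of D, and continuity of [Mi] carries it to the sphere. *)
Lemma edge_limit s i : exists x1, [/\ D.[x1] != 0, edge arc br s i 1 = Mi x1, quo N D x1 = gam s 1 &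
  forall e : R, 0 < e -> exists2 d : R, 0 < d & forall v, 1 - d < v < 1 -> cabs (x1 - b i (gam s v)) < e].
Proof.
have cxi v : 0 <= v < 1 -> cts_at (fun v => b i (gam s v)) v.
  move=> hv; apply: (cts_comp (f := gam s)); first by apply: ctsT; exact: gam_cts.
  by apply: b_cts; exact: gamU.
have E v : 0 <= v < 1 -> N.[b i (gam s v)] = gam s v * D.[b i (gam s v)].
  by move=> hv; have Uv := gamU s hv; rewrite -{2}(b_quo i Uv) /quo divfK// b_D.
have [x1 [x1E lim1]] := root_limit (co_size co) (@gam_cts s) cxi E.
have Dx1 : D.[x1] != 0.
  by apply/eqP => Dx; have := co_cop co Dx; rewrite x1E Dx mulr0 eqxx.
exists x1; split => //; last by rewrite /quo x1E mulfK.
rewrite /edge ltxx; apply: cvg_lim; first exact: CP1_hausdorff.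
have [_ [cMi] _] := co_Mi co Dx1.
move=> A /cMi /nbhs_cabs [e e0 eA].
have [d d0 dP] := lim1 e e0.
apply/nbhs_ballP; exists (Num.min d 1); first by rewrite /= lt_min d0 ltr01.
move=> v; rewrite /ball /= => h v1; move: h; rewrite gtr0_norm ?subr_gt0// lt_min => /andP[h1 h2].
have hv : 0 <= v < 1 by rewrite v1 andbT; lra.
have hv' : 0 <= v <= 1 by lra.
have -> : arc s v = gam s v by rewrite /gam c01_id.
by rewrite -b_Mi; [apply: eA; apply: dP; lra|exact: gamU].
Qed.

Let e s i u := M (edge arc br s i u).

Lemma e_lt s i u : 0 <= u < 1 -> e s i u = b i (gam s u).
Proof.
move=> /andP[u0 u1]; rewrite /e edge_lt// /b /gam c01_id// u0 ltW//.
Qed.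

Lemma e_one s i : [/\ D.[e s i 1] != 0, quo N D (e s i 1) = gam s 1 &
  forall r : R, 0 < r -> exists2 d : R, 0 < d & forall v, 1 - d < v < 1 -> cabs (e s i 1 - b i (gam s v)) < r].
Proof.
have [x1 [Dx1 E Q L]] := edge_limit s i.
by have [M1 _ _] := co_Mi co Dx1; rewrite /e E M1.
Qed.

Lemma e_D s i u : 0 <= u <= 1 -> D.[e s i u] != 0.
Proof.
move=> /andP[u0]; rewrite le_eqVlt => /orP[/eqP ->|u1]; first by have [] := e_one s i.
by rewrite e_lt ?u0//; apply: b_D; apply: gamU; rewrite u0.
Qed.

Lemma e_quo s i u : 0 <= u <= 1 -> quo N D (e s i u) = gam s u.
Proof.
move=> /andP[u0]; rewrite le_eqVlt => /orP[/eqP ->|u1]; first by have [] := e_one s i.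
by rewrite e_lt ?u0//; apply: b_quo; apply: gamU; rewrite u0.
Qed.

Lemma e_cts s i : {within `[0, 1], continuous (e s i)}.
Proof.
apply/subspace_continuousP => u; rewrite /= in_itv /= => /andP[u0 u1].
apply/cvg_cabs => r r0; rewrite near_withinE.
suff : \forall v \near u, 0 <= v <= 1 -> cabs (e s i u - e s i v) < r.
  by move=> H; apply: (filterS _ H) => v h /= hv; apply: h; move: hv; rewrite in_itv.
move: u1; rewrite le_eqVlt => /orP[/eqP ->|u1].
  have [_ _ L] := e_one s i; have [d d0 dP] := L r r0.
  apply/nbhs_ballP; exists d => // v; rewrite /ball /= ltr_norml => /andP[h1 h2] /andP[v0].
  rewrite le_eqVlt => /orP[/eqP ->|v1]; first by rewrite subrr cabs0.
  by rewrite (@e_lt s i v) ?v0//; apply: dP; lra.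
have hu : 0 <= u < 1 by rewrite u0.
have cb : cts_at (fun v => b i (gam s v)) u.
  apply: (cts_comp (f := gam s)); first by apply: ctsT; exact: gam_cts.
  by apply: b_cts; exact: gamU.
have n1 : \forall v \near u, v < 1 by exact: lt_nbhsl.
apply: filterS2 n1 (cts_cabs cb r0) => v v1 hv /andP[v0 _].
by rewrite !e_lt ?v0.
Qed.

Section Form.
Variables (A K : {poly R[i]}) (a : nat).
Hypothesis rel : forall x, D.[x] != 0 -> D0.[x] != 0 ->
  A.[quo N D x] * (K0.[x] / D0.[x]) = K.[x] * (D.[x] ^+ a)^-1.

Section Primitive.
Variables (S : nat -> Cplx R -> Cplx R) (l : nat -> seq (Cplx R * Cplx R)).
Hypothesis SP : forall m, has_prim D (rmom N D K a m) (S m) (l m).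

(** The primitive along the curve read in the coordinate is differentiable wherever the curve is,
    and its derivative is the integrand of the moment, so the fundamental theorem applies on each
    smooth piece. *)
Lemma moment_pathint m : moment P q gamma (fun z => A.[z] * z ^+ m) =
  pathint (S m) (l m) (fun u => M (Some (gamma u))).
Proof.
have [_ H] := pw_curve pw.
pose gc u := gamma (c01 u); pose f u := M (Some (gc u)).
have npc u : (rden P).[gc u] != 0 /\ (rden q).[gc u] != 0 by apply: np; exact: c01P.
have cgc u : cts_at gc u := cts_gc pw u.
have cf u : cts_at f u.
  apply: (cts_comp (f := gc) (g := fun z : Cplx R => M (Some z))); first exact: cgc.
  by have [p1 p2] := npc u; have [dM [_ h _ _]] := co_fin co p1 p2; exact: cdiff_cts h.
have wf : {within `[0, 1], continuous f} by apply: continuous_subspaceT; exact: cts_continuous.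
have cM u : [/\ D.[f u] != 0 & quo N D (f u) = rval P (gc u)].
  have [p1 _] := npc u.
  have r1 : reval P (Some (gc u)) <> None by rewrite reval_some.
  by have [d0 _ E _] := co_M co r1; split => //; move: E; rewrite reval_some// => -[].
have fD u : 0 <= u <= 1 -> D.[f u] != 0 by have [] := cM u.
have [F [cF E aF]] := along_exists (SP m) wf fD.
have -> : pathint (S m) (l m) (fun u => M (Some (gamma u))) = F 1 - F 0.
  by rewrite -E; apply: eq_pathint => u hu; rewrite /f /gc c01_id.
pose h (u : R) : Cplx R := A.[rval P (gc u)] * rval P (gc u) ^+ m * rval q (gc u).
have crP u : cts_at (fun u => rval P (gc u)) u.
  by apply: (cts_comp (f := gc)); [exact: cgc|apply: rat_cts; have [] := npc u].
have ch u : 0 <= u <= 1 -> cts_at h u.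
  move=> _; apply: ctsM; last by apply: (cts_comp (f := gc)); [exact: cgc|apply: rat_cts; have [] := npc u].
  by apply: ctsM; [apply: cts_horner; exact: crP|apply: ctsX; exact: crP].
have [_ FTC] := H h ch.
rewrite -(FTC F); first by apply: eq_cint => u hu; rewrite /h mulrA.
  by move=> u _; exact: ctsT.
move=> u d hu hd.
have hu' : 0 <= u <= 1 by move: hu => /andP[u0 u1]; rewrite !ltW.
have gcu : gc u = gamma u by rewrite /gc c01_id.
have [p1 p2] := npc u; have [dM [dM0 hM D0M qE]] := co_fin co p1 p2.
have dgc : rdiff gc u d.
  apply: cder_near hd.
  have n01 : \forall v \near u, 0 < v < 1 
    by have := @near_in_itvoo R 0 1 u; rewrite in_itv => /(_ hu).
  suff H2 : (fun v : R => 0 < v < 1) `<=` (fun v => gamma v = gc v) by exact: (filterS H2 n01).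
  by move=> v /andP[v0 v1]; rewrite /gc c01_id// !ltW.
have df : rdiff f u (dM * d).
  exact: (cder_comp (f := gc) (g := fun z : Cplx R => M (Some z)) (rdiff_cts dgc) dgc hM).
have [Du Qu] := cM u.
have := along_rdiff (SP m) wf aF Du hu df.
suff -> : rmom N D K a m (f u) * (dM * d) = h u * d by [].
rewrite rmomE// Qu mulrA; congr (_ * _).
rewrite /h qE -/(f u) {1}/rmom expr0 mul1r add0n -rel// Qu; ring.
Qed.

(** Off the poles of P the coordinate [M] is continuous and avoids the roots of D, so
    [pathint_boundary] applies to the 2-simplices of the homology. The terms of the edge path are
    then grouped by edge. *)
Lemma pathint_decomp m : pathint (S m) (l m) (fun u => M (Some (gamma u))) =
  \sum_s \sum_i (edge_number w s i)%:~R * pathint (S m) (l m) (e s i).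
Proof.
pose Phi (g : R -> CP1 R) := pathint (S m) (l m) (fun u => M (g u)).
have Phi_ext f g : {in `[0, 1], f =1 g} -> Phi f = Phi g.
  by move=> fg; apply: eq_pathint => u hu; rewrite fg// in_itv.
have bd (sigma : R * R -> CP1 R) : {within @std_triangle R, continuous sigma} ->
    sigma @` @std_triangle R `<=` ~` poles P ->
    Phi (fun u : R => sigma (1 - u, u)) - Phi (fun u : R => sigma (0, u)) + Phi (fun u : R => sigma (u, 0)) = 0.
  move=> cs1 sP; have cM p : std_triangle p -> D.[M (sigma p)] != 0 /\ cts_at M (sigma p).
    by move=> hp; have /(co_M co)[d0 _ _ c0] : reval P (sigma p) <> None by apply: sP; exists p.
  apply: (pathint_boundary (SP m) (tau := fun p => M (sigma p))); last by move=> p /cM[].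
  apply/subspace_continuousP => p hp; move/subspace_continuousP: cs1 => /(_ p hp) c1.
  by apply: (cvg_comp _ _ c1); have [_ [c2]] := cM p hp.
etransitivity; first exact: (homologous_eval Phi_ext bd hgw).
rewrite pair_bigA /= (partition_big (fun x : oedge n k => x.1) xpredT)//=.
apply: eq_bigr => -[s i] _; rewrite /edge_number rmorph_sum mulr_suml.
by apply: eq_bigr => x /eqP ->.
Qed.

Lemma moments_qform_prim : (forall m, moment P q gamma (fun z => A.[z] * z ^+ m) = 0) <->
  (forall s z, U z -> \sum_i (edge_number w s i)%:~R * qform N D K a (b i z) = 0).
Proof.
rewrite -(edge_sums_iff_branch_sums SP oU b_cts b_D b_quo b_W gam_cts gam0 gam_inj gam_meet gamU e_cts e_D e_quo e_lt _ cU).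
by split => H m; have := H m; rewrite moment_pathint pathint_decomp.
Qed.

End Primitive.

Lemma moments_qform : (forall m, moment P q gamma (fun z => A.[z] * z ^+ m) = 0) <->
  (forall s z, U z -> \sum_i (edge_number w s i)%:~R * qform N D K a (b i z) = 0).
Proof.
have Dn0 : D != 0.
  have h0 : 0 <= (0 : R) <= 1 by rewrite lexx ler01.
  have [p1 _] := np h0; apply/eqP => E.
  have /(co_M co)[] : reval P (Some (gamma 0)) <> None by rewrite reval_some.
  by rewrite E horner0 eqxx.
have prim m : {Sl | has_prim D (rmom N D K a m) Sl.1 Sl.2}.
  apply: cid; have [S [l H]] := prim_exists (N ^+ m * K) (m + a) Dn0.
  by exists (S, l).
exact: (moments_qform_prim (fun m => svalP (prim m))).
Qed.

End Form.

Hypothesis P0 : (0 < rdeg P)%N.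
Local Notation qP := (q / rderiv P).

(** H excludes the value of P at infinity and its values at the poles of q. For any other z every
    branch is a finite point at which q is regular, and uniqueness of the derivative of P relates
    both forms of q / P'. *)
Lemma qform_generic : exists2 H : {poly R[i]}, H != 0 &
  forall i z, U z -> H.[z] != 0 -> reval qP (br i z) <> None /\
  forall A K a, (forall x, D.[x] != 0 -> D0.[x] != 0 ->
      A.[quo N D x] * (K0.[x] / D0.[x]) = K.[x] * (D.[x] ^+ a)^-1) ->
    qform N D K a (b i z) = A.[z] * finite_part (reval qP (br i z)).
Proof.
have [rs rsE] := closed_field_poly_normal (rden q).
(* At poles of P both values default to 0, so that at worst z = 0 is excluded in addition. *)
exists (('X - (finite_part (reval P None))%:P) * \prod_(y <- rs) ('X - (rval P y)%:P)).
  rewrite mulf_neq0 ?polyXsubC_eq0//.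
  by rewrite prodf_seq_neq0; apply/allP => y _; rewrite polyXsubC_eq0.
move=> i z Uz; rewrite hornerM hornerXsubC mulf_eq0 negb_or => /andP[z1 z2].
have E := @br_some i z Uz; have Wz := @b_W i z Uz; have Dz := @b_D i z Uz; have Qz := @b_quo i z Uz.
rewrite /b in Wz Dz Qz *; case: (br i z) E Wz Dz Qz => [y|] E Wz Dz Qz; last first.
  by move: z1; rewrite E subrr eqxx.
have dy : (rden P).[y] != 0 by apply: reval_someN; rewrite E.
have Py : rval P y = z by move: E; rewrite reval_some// => -[].
have qy : (rden q).[y] != 0.
  apply: contra z2 => /eqP y0; rewrite horner_prod.
  have yrs : y \in rs.
    have : root (rden q) y by apply/rootP.
    by rewrite rsE rootZ ?lead_coef_eq0 ?rden_neq0// root_prod_XsubC.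
  by rewrite (big_rem _ yrs) /= hornerXsubC Py subrr mul0r.
pose WP := wron (rnum P) (rden P).
have Wy : WP.[y] != 0.
  apply/eqP => Wy0; have := rmult_gt1 P0 dy Wy0; rewrite Py => h.
  by apply: (nbr Uz); exists (Some y).
have [dM [dM0 hM D0y qE]] := co_fin co dy qy.
pose B := rden q * WP.
have By : B.[y] != 0 by rewrite hornerM mulf_neq0.
have B0 : B != 0 by apply: contra By => /eqP ->; rewrite horner0.
have qPE : qP = FracField.tofrac (rnum q * rden P ^+ 2) / FracField.tofrac B.
  by rewrite {1}(rat_split q) /rderiv invf_div mulf_div -!rmorphM.
have [r1 r2] := reval_cross (rat_cross B0 qPE) By.
split; first by rewrite reval_some.
move=> A K a rel; rewrite reval_some//= r2.
have dE : (wron N D).[M (Some y)] / D.[M (Some y)] ^+ 2 * dM = WP.[y] / (rden P).[y] ^+ 2.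
  apply: (cdiff_unique (f := rval P) (z := y)); last exact: (cdiff_quo (rnum P) dy).
  have h : cdiff (fun x : Cplx R => quo N D (M (Some x))) y ((wron N D).[M (Some y)] / D.[M (Some y)] ^+ 2 * dM).
    by apply: (cder_comp (f := fun x : Cplx R => M (Some x))); [exact: cdiff_cts hM|exact: hM|exact: cdiff_quo].
  apply: cder_near h.
  have nd : \forall x \near (y : Cplx R), (rden P).[x] != 0 := cts_neq0 (cts_polyR (rden P) y) dy.
  apply: (filterS _ nd) => x dx.
  have /(co_M co)[_ _ + _] : reval P (Some x) <> None by rewrite reval_some.
  by rewrite reval_some// => -[].
rewrite /qform {1}/rmom expr0 mul1r add0n -rel// Qz (hornerM (rnum q)) horner_exp (hornerM (rden q)).
have -> : (rnum q).[y] = K0.[M (Some y)] / D0.[M (Some y)] * dM * (rden q).[y] by rewrite -qE /rval divfK.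
have id (A1 v d w0 dm dq dp wp : Cplx R) : w0 != 0 -> d != 0 -> dq != 0 -> dp != 0 -> wp != 0 ->
    w0 / d ^+ 2 * dm = wp / dp ^+ 2 ->
    A1 * v * (d ^+ 2 / w0) = A1 * (v * dm * dq * dp ^+ 2 / (dq * wp)).
  move=> h1 h2 h3 h4 h5 h6.
  have -> : dm = wp / dp ^+ 2 * (d ^+ 2 / w0) by rewrite -h6; field; rewrite h1 h2.
  by field; rewrite h1 h3 h4 h5.
exact: id.
Qed.

(** Off the zeros of H the two sums differ by the factor A(z). The remaining points, zeros of A
    included, follow by density, [phi] being continuous wherever none of its terms has a pole. *)
Lemma qform_phi (A K : {poly R[i]}) a : A != 0 ->
  (forall x, D.[x] != 0 -> D0.[x] != 0 ->
    A.[quo N D x] * (K0.[x] / D0.[x]) = K.[x] * (D.[x] ^+ a)^-1) ->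
  (forall s z, U z -> \sum_i (edge_number w s i)%:~R * qform N D K a (b i z) = 0) <->
  (forall s, phi_identically_zero P q br U (edge_number w) s).
Proof.
move=> A0 rel; have [H H0 HP] := qform_generic.
have nU z : U z -> \forall x \near z, U x by move=> Uz; exact: open_nbhs_nbhs.
have gE s z : U z -> H.[z] != 0 -> \sum_i (edge_number w s i)%:~R * qform N D K a (b i z) =
    A.[z] * phi P q br (edge_number w) s z.
  move=> Uz Hz; rewrite /phi mulr_sumr; apply: eq_bigr => i _.
  by have [_ /(_ A K a rel) ->] := HP i z Uz Hz; rewrite mulrCA.
split => E s z Uz.
  move=> nz; apply: (poly_density (A := A * H) (h := phi P q br (edge_number w) s)); first by rewrite mulf_neq0.
    apply: cts_sum => i; apply: ctsM; first exact: cts_cst.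
    apply: (cts_comp (f := br i) (g := fun y => finite_part (reval qP y))); first exact: br_cts.
    exact: cts_reval.
  apply: (filterS _ (nU z Uz)) => x Ux.
  have [Hx|Hx] := eqVneq H.[x] 0; first by rewrite hornerM Hx mulr0 mul0r.
  by rewrite hornerM mulrAC -gE// E// mul0r.
apply: (poly_density (A := H) (h := fun z => \sum_i (edge_number w s i)%:~R * qform N D K a (b i z))) => //.
  apply: cts_sum => i; apply: ctsM; first exact: cts_cst.
  by apply: (cts_comp (f := b i)); [exact: b_cts|apply: cts_qform; [exact: b_D|exact: b_W]].
apply: (filterS _ (nU z Uz)) => x Ux.
have [Hx|Hx] := eqVneq H.[x] 0; first by rewrite Hx mul0r.
by rewrite gE// E ?mulr0// => i; have [] := HP i x Ux Hx.
Qed.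

End StarLifts.

Theorem theorem3p2 (R : realType) (n k : nat) (P q : ratfun R)
    (gamma : R -> Cplx R) (cs : 'I_k -> Cplx R) (c : Cplx R)
    (arc : 'I_k -> R -> Cplx R) (U : set (Cplx R))
    (br : 'I_n -> Cplx R -> CP1 R) (w : seq (oedge n k)) :
  rdeg P = n -> (0 < n)%N -> q != 0 ->
  is_curve gamma ->
  (forall u, u \in `[0, 1] ->
     (rden P).[gamma u] != 0 /\ (rden q).[gamma u] != 0) ->
  marked_points P gamma cs ->
  is_star cs c arc ->
  simply_connected_domain U ->
  (forall t, U t -> ~ branch_point P t) ->
  boundary (Some @` U : set (CP1 R)) None ->
  star c arc `\` range cs `<=` U ->
  branches P U br ->
  represents P c arc br gamma w ->
  (I_infty_rational P q gamma <->
   forall s : 'I_k, phi_identically_zero P q br U (edge_number w) s).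
Proof.
move=> dP n0 _ [pw _] np' _ st [oU _ cU _] nbr _ sU [brs _] [_ _ hgw].
have P0 : (0 < rdeg P)%N by rewrite dP.
have np u : 0 <= u <= 1 -> (rden P).[gamma u] != 0 /\ (rden q).[gamma u] != 0.
  by move=> hu; apply: np'; rewrite in_itv.
have [N [D [K0 [D0 [M [Mi co]]]]]] := coords_exist q P0.
split=> H.
  have [A1 A10 mA1] := rational_moments pw np H.
  (* The polynomial that makes the moments vanish need not clear the denominators of q dz. A
     multiple of it does, and its moments vanish as well. *)
  have [A2 [K [a [A20 rel]]]] := clear_denoms N D K0 A10 (co_D0 co).
  have A0 : A2 * A1 != 0 by rewrite mulf_neq0.
  apply: (qform_phi w oU nbr brs co P0 A0 rel).1.
  apply: (moments_qform pw np st oU cU nbr sU brs hgw co rel).1.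
  exact: moments_mulpoly.
have [A [K [a [A20 rel]]]] := clear_denoms N D K0 (oner_neq0 _) (co_D0 co).
have A0 : A * 1 != 0 by rewrite mulr1.
apply: (moments_rational pw np A0).
apply: (moments_qform pw np st oU cU nbr sU brs hgw co rel).2.
exact: (qform_phi w oU nbr brs co P0 A0 rel).2.
Qed.
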